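(* Let $D$ and $f$ be odd positive integers, mutually coprime, and let $\chi$ be an even primitive Dirichlet character modulo $f$. Let $m,n$ be nonzero integers and let $\varepsilon>0$. (a) If $\chi\neq\chi_f$, or if $m<0$, or if $n<0$, then for $X\ge 1$ $$\sum_{\substack{0<c\le X,\ c\ \mathrm{odd}\\ c\equiv 0\ (\mathrm{mod}\ D)}}\frac{K_2(m,n;c)}{\sqrt c}\,\overline{\epsilon_c}\,\chi(c)=O\left(X^{3/4+\varepsilon}\right).$$ (b) If $\chi=\chi_f$ and $m,n>0$, then there is a real number $C(D,f,m,n)$ such that for $X\ge 1$ $$\sum_{\substack{0<c\le X,\ c\ \mathrm{odd}\\ c\equiv 0\ (\mathrm{mod}\ D)}}\frac{K_2(m,n;c)}{\sqrt c}\,\overline{\epsilon_c}\,\chi(c)=C(D,f,m,n)\,X+O\left(X^{3/4+\varepsilon}\right).$$ The constant in (b) is determined as follows. Suppose that $m=tfs^2m'^2$ and $n=tfs^2n'^2$ for some positive integers $t,s,m',n'$ satisfying: (i) $t$ is square-free, $t\equiv 1\pmod 4$, $s$ is supported by $t$, and $s^2t^3\mid D$; (ii) $(m',t)=(n',t)=1$; (iii) $(m',D_1)=(n',D_1)$, where $D=D_tD_0D_1^2$ with $D_t=(D,t^\infty)$ and $D_0$ square-free. Then $$C(D,f,m,n)=\frac{8}{\pi^2}\,\frac{s\sqrt t}{D}\left(\frac{fm'n'}{t}\right)(m',D_1)\prod_{p\mid Df}(1+p^{-1})^{-1}\prod_{p\mid t}(1-p^{-1})^{-1}\prod_{p\mid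 D_1/(m',D_1)}(1-p^{-1})^{-1}.$$ If $m$ and $n$ are not of this form, then $C(D,f,m,n)=0$. In particular, $C(1,f,m,n)\ge 0$.
   Context: Write $e(z)=\exp(2\pi i z)$. For an odd positive integer $c$ and integers $m,n$, the Salié sum is $$K_2(m,n;c)=\sum_{\substack{x\ (\mathrm{mod}\ c)\\ (x,c)=1}}\left(\frac{x}{c}\right)e\left(\frac{mx+nx^{-1}}{c}\right),$$ where $\left(\frac{\cdot}{c}\right)$ is the Jacobi symbol and $x x^{-1}\equiv 1\pmod c$. For odd $c$, $\epsilon_c=1$ if $c\equiv 1\pmod 4$ and $\epsilon_c=i$ if $c\equiv 3\pmod 4$; the numbers $K_2(m,n;c)\overline{\epsilon_c}$ are real. For a positive integer $d$, $\chi_d$ is the primitive quadratic character corresponding to the extension $\mathbb{Q}(\sqrt d)/\mathbb{Q}$ (the trivial character if $d$ is a square). A character is even if $\chi(-1)=1$. $(a,b)$ denotes the gcd; a positive integer $s$ is supported by $t$ if every prime dividing $s$ divides $t$; $(a,b^\infty)$ is the greatest divisor of $a$ supported by $b$. Products over $p$ run over primes. Implied constants may depend on $D,f,\chi,m,n,\varepsilon$ but not on $X$. *)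

(* Defs.v *)
From HB Require Import structures.
From mathcomp Require Export all_boot all_order all_algebra.
From mathcomp Require Export complex.
From mathcomp Require Export reals trigo exp.

Set Implicit Arguments.
Unset Strict Implicit.
Unset Printing Implicit Defensive.

Import Order.TTheory GRing.Theory Num.Theory.

Local Open Scope ring_scope.
Local Open Scope complex_scope.

Definition squarefree (n : nat) : Prop :=
  forall d : nat, (d ^ 2 %| n)%N -> d = 1%N.

(* Meaningful for an odd prime p. *)
Definition legendre (a : int) (p : nat) : int :=
  if (p %| a)%Z then 0
  else if [exists x : 'I_p, (x%:Z ^+ 2 == a %[mod p])%Z] then 1 else -1.

(* Meaningful for an odd positive n; the empty product gives (a/1) = 1. *)
Definition jacobi (a : int) (n : nat) : int :=
  \prod_(pk <- prime_decomp n) legendre a pk.1 ^+ pk.2.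

Definition kronecker_prime (a : int) (p : nat) : int :=
  if p == 2%N then
    if (2 %| a)%Z then 0
    else if (a %% 8)%Z \in [:: 1; 7] then 1 else -1
  else legendre a p.

Definition kronecker (a : int) (n : nat) : int :=
  if n == 0%N then (`|a|%N == 1%N)%:R
  else \prod_(pk <- prime_decomp n) kronecker_prime a pk.1 ^+ pk.2.

Definition squarefree_part (d : nat) : nat :=
  (\prod_(p <- primes d | odd (logn p d)) p)%N.

(* The discriminant of Q(sqrt d), for d > 0; it is 1 when d is a square. *)
Definition quad_disc (d : nat) : nat :=
  if (squarefree_part d %% 4 == 1)%N then squarefree_part d
  else (4 * squarefree_part d)%N.

(* The primitive character of the real (or trivial) extension Q(sqrt d)/Q is
   the Kronecker symbol of its discriminant; it is even since d > 0, hence its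
   value at a negative integer is given through the absolute value. *)
Definition quad_char (R : realType) (d : nat) (a : int) : R[i] :=
  (kronecker (quad_disc d)%:Z `|a|%N)%:~R.

(* chi 1 = 1 follows from the last two conditions. *)
Definition dirichlet_character (R : realType) (f : nat) (chi : int -> R[i]) :
    Prop :=
  [/\ forall a : int, chi (a + f%:Z) = chi a,
      forall a b : int, chi (a * b) = chi a * chi b
    & forall a : int, (chi a != 0) = coprimez a f].

(* chi does not factor through (Z/d)^* for any proper divisor d of f. *)
Definition primitive_character (R : realType) (f : nat) (chi : int -> R[i]) :
    Prop :=
  dirichlet_character f chi /\
  forall d : nat, (d %| f)%N ->
    (forall a : int, coprimez a f -> (a = 1 %[mod d])%Z -> chi a = 1) ->
    d = f.

Definition even_character (R : realType) (chi : int -> R[i]) : Prop :=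
  chi (-1) = 1.

(* exp(2 pi i z) for a real number z *)
Definition e2pi (R : realType) (z : R) : R[i] :=
  cos (2 * pi * z) +i* sin (2 * pi * z).

Definition inv_mod (c x : nat) : nat := (egcdn x c).1.

Lemma inv_modP (c x : nat) :
  coprime x c -> (x * inv_mod c x = 1 %[mod c])%N.
Proof.
rewrite /inv_mod; case: x => [|x] cop.
  by move: cop; rewrite /coprime gcd0n => /eqP ->; rewrite !modn1.
case: egcdnP => //= u v def_u _.
by rewrite mulnC def_u (eqP cop) modnMDl.
Qed.

Definition salie (R : realType) (m n : int) (c : nat) : R[i] :=
  \sum_(x < c | coprime x c)
    (jacobi x%:Z c)%:~R
      * e2pi ((m * x%:Z + n * (inv_mod c x)%:Z)%:~R / c%:R).

Definition eps_odd (R : realType) (c : nat) : R[i] :=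
  if (c %% 4 == 1)%N then 1 else 'i.

Definition salie_sum (R : realType) (D : nat) (chi : int -> R[i]) (m n : int)
    (X : R) : R[i] :=
  \sum_(1 <= c < (Num.truncn X).+1 | odd c && (D %| c)%N)
    salie R m n c / (Num.sqrt c%:R)%:C * (eps_odd R c)^* * chi c%:Z.

(* (D, t^oo) is the \pi(t)-part of D; its cofactor is written D0 * D1 ^ 2 with
   D0 square-free, so D0 and D1 are determined by D and t. *)
Definition main_term_form (D f : nat) (m n : int) (t s m' n' D0 D1 : nat) :
    Prop :=
  [/\ (0 < t)%N /\ (0 < s)%N, (0 < m')%N /\ (0 < n')%N,
      m = (t * f * s ^ 2 * m' ^ 2)%N%:Z
    & n = (t * f * s ^ 2 * n' ^ 2)%N%:Z] /\
  [/\ [/\ squarefree t, t = 1 %[mod 4], \pi(t).-nat s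
        & (s ^ 2 * t ^ 3 %| D)%N],
      coprime m' t /\ coprime n' t
    & [/\ D = (D`_(\pi(t)) * D0 * D1 ^ 2)%N, squarefree D0
        & gcdn m' D1 = gcdn n' D1]].

Definition main_term_const (R : realType) (D f t s m' n' D1 : nat) : R :=
  8 / pi ^+ 2 * (s%:R * Num.sqrt t%:R / D%:R)
  * (jacobi (f * m' * n')%N%:Z t)%:~R * (gcdn m' D1)%:R
  * (\prod_(p <- primes (D * f)) (1 + p%:R^-1)^-1)
  * (\prod_(p <- primes t) (1 - p%:R^-1)^-1)
  * (\prod_(p <- primes (D1 %/ gcdn m' D1)) (1 - p%:R^-1)^-1).

(* Main.v *)
(** Write n = s l w^2 with l square-free.  Gauss sums turn K_2(m,n;c) / sqrt c
into a sum of e(h y / c), twisted by Jacobi symbols, over the roots of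
y^2 = d (mod c), where d = s l m.  A Farey dissection of y / c turns these pairs
(c, y) into binary forms A X^2 - 2 B X Y + C Y^2 with B^2 - A C = d, and completion
reduces the sum over forms to Kloosterman sums, for which Weil's bound follows
from Stepanov's method over F_q, q = p^(2^j), and the relation
S_(j+1) = 2 q - S_j^2.  Only the forms with A = 0, which exist when d is a square,
give a main term: a series whose terms vanish unless chi = chi_f, by orthogonality,
and which is otherwise an Euler product, evaluated with
sum_(n odd) n^-2 = pi^2 / 8. *)
Require Import Defs.
From mathcomp Require Import all_boot all_order all_algebra all_field.
From mathcomp Require Import complex reals trigo exp.
From mathcomp Require boolp derive subspace_topology normed_module cyclic.
From mathcomp Require Import ring lra zify.
Set Implicit Arguments.
Unset Strict Implicit.
Unset Printing Implicit Defensive.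
Import Order.TTheory GRing.Theory Num.Theory.
Import Normc.
Local Open Scope ring_scope.
Local Open Scope complex_scope.

(** The exponent 3/4 comes from the choice of the Farey order. For N < c <= 2 N take V of size
    sqrt(N / |d|). Then A c = w^2 - d v^2 with w <= 2 c / V bounds A, while B takes O(V / v) values
    and C is fixed by A and B when A <> 0. For each form the sum over v' is an incomplete
    Kloosterman sum modulo the smaller denominator v, of size about v^(1/2); all of them add up to V
    sum_(v <= V) v^(-1/2), about V^(3/2), that is N^(3/4). Two obstacles shape the details. Weil's
    bound saves only at primes that divide v exactly once and avoid the fixed data; the rest of v is
    estimated trivially, which costs little on average because that cofactor is a^2 l' with l'
    dividing a times a fixed number. And c need not be prime to l: each c is written g e k, with g =
    gcd(c, l) and e from Moebius inversion, and a periodic weight [phi] absorbs the eps factors, the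
    remaining symbols, the condition D | c and chi. The estimates over forms see only the period,
    size and support of [phi]. *)

Lemma int_ediv (a : int) c : (0 < c)%N -> exists r k, [/\ (r < c)%N & a = r%:Z + c%:Z * k].
Proof.
move=> c0; exists `|(a %% c)%Z|%N, (a %/ c)%Z.
have h : (0 <= (a %% c)%Z) by apply: modz_ge0; lia.
have h2 : ((a %% c)%Z < c) by apply: ltz_pmod; lia.
split; first by lia.
by lia.
Qed.

Lemma dvdz_small r c : (r < c)%N -> (c %| r%:Z)%Z -> r = 0%N.
Proof.
move=> rc; rewrite dvdzE /= => /dvdnP[[|k] e]; first by [].
by lia.
Qed.

(** Inverse of an integer of either sign, as a Bezout coefficient; it is not reduced, so only its
    class modulo [c] is meaningful. *)
Definition iv (c : nat) (x : int) : int := (egcdz x c%:Z).1.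
Lemma iv_mul c x : coprimez x c%:Z -> (c %| x * iv c x - 1)%Z.
Proof.
rewrite /iv /coprimez => /eqP cp; case: egcdzP => u v /= e _.
by apply/dvdzP; exists (- v); rewrite -cp -e; ring.
Qed.

Lemma iv_uniq c x y z : coprimez x c%:Z -> (c %| x * y - 1)%Z -> (c %| x * z - 1)%Z -> (c %| y - z)%Z.
Proof.
move=> cp h1 h2; have : (c %| x * (y - z))%Z.
 by have := rpredB h1 h2; rewrite (_ : _ - _ - _ = x * (y - z)) //; ring.
by rewrite Gauss_dvdzr // coprimez_sym.
Qed.

Lemma copz_per c x k : coprimez (x + c%:Z * k) c = coprimez x c.
Proof. by rewrite /coprimez ![gcdz _ c]gcdzC addrC mulrC gcdzMDl. Qed.
Lemma copz_nat (x c : nat) : coprimez x c = coprime x c.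
Proof. by []. Qed.
Lemma dvdz_coprime c x y : (c%:Z %| x * y - 1)%Z -> coprimez x c.
Proof.
case/dvdzP => k e; apply/coprimezP; exists (y, - k) => /=.
by lia.
Qed.

(** * Additive characters and sums over residues *)

Section Basics.
Variable R : realType.
Implicit Types (a b k m n x y : int) (c d : nat) (z : R) (F : int -> R[i]).

Lemma normC_normc (w : R[i]) : `|w| = (normc w)%:C.
Proof. by []. Qed.
Lemma normc_ge0 (w : R[i]) : 0 <= normc w.
Proof. by rewrite -ler0c -normC_normc. Qed.
Lemma normc_real z : normc z%:C = `|z|.
Proof. by rewrite /= expr0n addr0 sqrtr_sqr. Qed.
Lemma normc_nat n : normc (n%:~R : R[i]) = `|n%:~R|.
Proof. by rewrite -normc_real; rewrite rmorph_int. Qed.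
Lemma normc_natr c : normc (c%:R : R[i]) = c%:R.
Proof. by rewrite (normc_nat c) ger0_norm. Qed.

Lemma normc_sum (I : Type) (r : seq I) (P : pred I) (F : I -> R[i]) : normc (\sum_(i <- r | P i) F i) <= \sum_(i <- r | P i) normc (F i).
Proof.
elim/big_rec2: _ => [|i x y _ h]; first by rewrite normc0.
by apply: (le_trans (le_normcD _ _)); rewrite lerD2l.
Qed.

Lemma normc_conj (w : R[i]) : normc (conjc w) = normc w.
Proof. by case: w => u v /=; rewrite sqrrN. Qed.
Lemma conjCM (w1 w2 : R[i]) : (conjc (w1 * w2)) = conjc w1 * conjc w2.
Proof.
by case: w1 w2 => a b [c d]; apply/eqP; rewrite eq_complex /=; apply/andP; split; apply/eqP; ring.
Qed.

Lemma conjC_real z : (conjc (z%:C)) = z%:C.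
Proof. by rewrite /= oppr0. Qed.

Lemma conjC_sum (I : Type) (r : seq I) (P : pred I) (F : I -> R[i]) : (conjc (\sum_(i <- r | P i) F i)) = \sum_(i <- r | P i) (conjc (F i)).
Proof.
elim/big_rec2: _ => [|i x y _ <-]; first exact: conjc0.
by case: x F => a b [c d]; apply/eqP; rewrite eq_complex; apply/andP; split; apply/eqP; ring.
Qed.

Lemma normc_le_bound (K : R) (w : R[i]) : normc w <= K -> `|w| <= K%:C.
Proof. by rewrite lecR. Qed.
Lemma mulC_conj (w : R[i]) : w * conjc w = ((normc w) ^+ 2)%:C.
Proof. by rewrite -sqr_normc rmorphXn. Qed.
Lemma e2piD z1 z2 : e2pi (z1 + z2) = e2pi z1 * e2pi z2.
Proof.
rewrite /e2pi mulrDr cosD sinD.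
by apply/eqP; rewrite eq_complex /=; apply/andP; split; apply/eqP; ring.
Qed.

Lemma e2pi0 : e2pi (0 : R) = 1.
Proof. by rewrite /e2pi mulr0 cos0 sin0. Qed.
Lemma normc_e2pi z : normc (e2pi z) = 1.
Proof. by rewrite /e2pi /= cos2Dsin2 sqrtr1. Qed.
Lemma e2piN z : e2pi (- z) = (conjc (e2pi z)).
Proof. by rewrite /e2pi mulrN cosN sinN. Qed.
Lemma e2pi_nat c : e2pi (c%:R : R) = 1.
Proof.
elim: c => [|c IH]; first exact: e2pi0.
by rewrite -addn1 natrD e2piD IH mul1r /e2pi mulr1 mulrC mulr_natr cos2pi sin2pi.
Qed.

Lemma e2pi_int n : e2pi (n%:~R : R) = 1.
Proof.
case: n => n; first exact: e2pi_nat.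
by rewrite e2piN e2pi_nat; rewrite /= oppr0.
Qed.

Lemma e2pi_neq1 z : 0 < z < 1 -> e2pi z != 1.
Proof.
move=> /andP[z0 z1]; apply/eqP => /(congr1 (@complex.Re R)) /=.
have -> : 2 * pi * z = (pi * z) *+ 2 by rewrite -mulr_natl; ring.
rewrite cos_mulr2n => h.
have s : 0 < sin (pi * z).
 by apply: sin_gt0_pi; rewrite mulr_gt0 ?pi_gt0 //= -[ltRHS]mulr1 ltr_pM2l ?pi_gt0.
have := cos2Dsin2 (pi * z); have : 0 < sin (pi * z) ^+ 2 by rewrite exprn_gt0.
by lra.
Qed.

Definition efrac c a : R[i] := e2pi (a%:~R / c%:R).
Lemma eeD c a b : efrac c (a + b) = efrac c a * efrac c b.
Proof. by rewrite /efrac intrD mulrDl e2piD. Qed.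
Lemma ee0 c : efrac c 0 = 1.
Proof. by rewrite /efrac mul0r e2pi0. Qed.
Lemma eeN c a : efrac c (- a) = (conjc (efrac c a)).
Proof. by rewrite /efrac mulrNz mulNr e2piN. Qed.
Lemma normc_ee c a : normc (efrac c a) = 1.
Proof. exact: normc_e2pi. Qed.
Lemma ee_neq0 c a : efrac c a != 0.
Proof.
by apply/eqP => h; have := normc_ee c a; rewrite h normc0 => /esym/eqP; rewrite oner_eq0.
Qed.

Lemma ee_per c a k : (0 < c)%N -> efrac c (a + c%:Z * k) = efrac c a.
Proof.
move=> c0; rewrite /efrac intrD intrM mulrDl e2piD [c%:~R * _]mulrC mulfK ?e2pi_int ?mulr1 //.
by rewrite pnatr_eq0; lia.
Qed.

Lemma ee_mul c k : (0 < c)%N -> efrac c (c%:Z * k) = 1.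
Proof. by move=> c0; rewrite -[_ * _]add0r ee_per ?ee0. Qed.
Lemma ee_eqm c a b : (0 < c)%N -> (c %| a - b)%Z -> efrac c a = efrac c b.
Proof.
by move=> c0 /dvdzP[k e]; rewrite -(subrK b a) e addrC mulrC ee_per.
Qed.

Lemma ee_scale c d a : (0 < c)%N -> efrac (d * c) (a * c) = efrac d a.
Proof.
move=> c0; rewrite /efrac; congr e2pi; rewrite intrM natrM -pmulrn.
have cn : c%:R != 0 :> R by rewrite pnatr_eq0; lia.
case: (eqVneq (d%:R : R) 0) => [-> | dn]; last by field; rewrite dn.
by lra.
Qed.

Lemma ee1 a : efrac 1 a = 1.
Proof. by rewrite /efrac divr1 e2pi_int. Qed.
Lemma ee_eq1 c a : (0 < c)%N -> (efrac c a == 1) = (c %| a)%Z.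
Proof.
move=> c0; apply/eqP/idP => [|/dvdzP[k ->]]; last by rewrite mulrC ee_mul.
have [r [k [rc ->]]] := int_ediv a c0.
rewrite ee_per // => h; rewrite rpredD ?dvdz_mulr //.
case: r rc h => [|r] rc h; first by rewrite dvdz0.
exfalso; move/eqP: h; apply/negP.
have cr : 0 < c%:R :> R by rewrite ltr0n.
apply: e2pi_neq1; rewrite divr_gt0 //=.
by rewrite ltr_pdivrMr // mul1r ltr_nat.
Qed.

Lemma ee_prod c a d : efrac c (a * d) = efrac c a ^+ d.
Proof.
elim: d => [|d IH]; first by rewrite mulr0 ee0.
by rewrite exprS -IH -eeD; congr efrac; lia.
Qed.

Lemma ee_orth c a : (0 < c)%N -> \sum_(x < c) efrac c (a * x) = if (c %| a)%Z then c%:R else 0.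
Proof.
move=> c0; case: ifP => h.
 rewrite (eq_bigr (fun=> 1)) ?sumr_const ?card_ord // => i _. by case/dvdzP: h => k ->; rewrite mulrAC mulrC ee_mul.
rewrite (eq_bigr (fun x : 'I_c => efrac c a ^+ x)); last by move=> i; rewrite ee_prod.
have n1 : efrac c a != 1 by rewrite ee_eq1 // h.
have /eqP := subrX1 (efrac c a) c.
rewrite -ee_prod mulrC ee_mul // subrr eq_sym mulf_eq0 subr_eq0 (negbTE n1) /=.
by move/eqP.
Qed.

Definition per c F := forall x k, F (x + c%:Z * k) = F x.
Lemma per_eqm c F a b : per c F -> (c %| a - b)%Z -> F a = F b.
Proof. by move=> p /dvdzP[k e]; rewrite -(subrK b a) e addrC mulrC. Qed.

(** An injection of the finite set of residues is a permutation. Shifts, reflections, scalings by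
    units and inversion are the uses. *)
Lemma sum_perm c (h : int -> int) F : (0 < c)%N -> per c F -> (forall x y, (c %| h x - h y)%Z -> (c %| x - y)%Z) -> \sum_(x < c) F (h x) = \sum_(x < c) F x.
Proof.
move=> c0 pF inj.
have lt (x : 'I_c) : (`|(h x %% c)%Z| < c)%N.
 have := modz_ge0 (h x) (d := c); have := @ltz_pmod (h x) c; lia.
pose s (x : 'I_c) : 'I_c := Ordinal (lt x).
have e (x : 'I_c) : (s x)%:Z = (h x %% c)%Z.
 by rewrite gez0_abs //; lia.
have sI : injective s.
 move=> x y exy; have := e x; rewrite exy e => /eqP; rewrite eqz_mod_dvd => /inj. rewrite -eqz_mod_dvd !modz_nat => /eqP [] /eqP; rewrite eq_sym !modn_small // => /eqP. by move/val_inj.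
rewrite [RHS](reindex_inj sI); apply: eq_bigr => x _; rewrite e.
by apply: per_eqm => //; rewrite {1}(divz_eq (h x) c) addrK dvdz_mull.
Qed.

Lemma sum_shift c F b : (0 < c)%N -> per c F -> \sum_(x < c) F (x%:Z + b) = \sum_(x < c) F x.
Proof. by move=> c0 p; apply: (@sum_perm c (fun x => x + b)) => // x y; rewrite opprD addrACA subrr addr0. Qed.

Lemma sum_scale c F a : (0 < c)%N -> per c F -> coprimez a c -> \sum_(x < c) F (a * x) = \sum_(x < c) F x.
Proof.
move=> c0 p cp; apply: (@sum_perm c (fun x => a * x)) => // x y.
by rewrite -mulrBr Gauss_dvdzr // coprimez_sym.
Qed.

Lemma sum_opp c F : (0 < c)%N -> per c F -> \sum_(x < c) F (- x%:Z) = \sum_(x < c) F x.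
Proof.
by move=> c0 p; apply: (@sum_perm c (fun x => - x)) => // x y /(dvdz_mulr (-1)); rewrite (_ : _ * -1 = x - y) //; ring.
Qed.

Lemma sum_split c d (F : int -> R[i]) : \sum_(x < c * d) F x = \sum_(y < c) \sum_(l < d) F (y%:Z + c%:Z * l).
Proof.
elim: d => [|d IH].
 by rewrite muln0 big_ord0 big1 // => i; rewrite big_ord0.
under [RHS]eq_bigr => y _ do rewrite big_ord_recr /=.
rewrite big_split -IH mulnS addnC big_split_ord /=; congr (_ + _).
by apply: eq_bigr => i _; congr F; lia.
Qed.

Lemma sum_crt c d F : (0 < c)%N -> (0 < d)%N -> coprime c d -> per (c * d) F -> \sum_(x < c * d) F x = \sum_(x < c) \sum_(y < d) F (d%:Z * x + c%:Z * y).
Proof.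
move=> c0 d0 cp p; rewrite sum_split.
pose G x := \sum_(l < d) F (x + c%:Z * l).
have pG : per c G.
 move=> x k; rewrite /G. rewrite -(@sum_shift d (fun y => F (x + c%:Z * y)) k) //; last first.
  by move=> y j; rewrite -[RHS](p _ j); congr F; lia.
 by apply: eq_bigr => l _; congr F; lia.
transitivity (\sum_(x < c) G (d%:Z * x)); last by [].
by rewrite sum_scale // coprimezE coprime_sym.
Qed.

End Basics.

(** * Stepanov's estimate for the zeros of the trace of a x + b / x + c *)

Section Stepanov.
Variables (L : finFieldType) (p mu : nat).
Hypotheses (p_pr : prime p) (chp : p \in [pchar L]).
Let E := (p ^ mu)%N.
Let s := (p ^ mu.+1)%N.
Hypothesis cardL : #|L| = (s ^ 2)%N.
Variables a b c : L.
Hypothesis a0 : a != 0.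

Let sE : s = (p * E)%N. Proof. by rewrite /s expnS. Qed.
Let E0 : (0 < E)%N. Proof. by rewrite expn_gt0 prime_gt0. Qed.
Let p1 : (1 < p)%N. Proof. exact: prime_gt1. Qed.
Let pi_le i : (i <= mu)%N -> (p ^ i <= E)%N.
Proof. by move=> h; rewrite leq_pexp2l ?prime_gt0. Qed.
Lemma pchar_exp k : [pchar L].-nat (p ^ k)%N.
Proof. by rewrite pnatX (eq_pnat _ (pcharf_eq chp)) pnat_id. Qed.
Lemma frobD (x y : L) k : (x + y) ^+ (p ^ k) = x ^+ (p ^ k) + y ^+ (p ^ k).
Proof. exact/exprDn_pchar/pchar_exp. Qed.
Lemma frobN (x : L) k : (- x) ^+ (p ^ k) = - x ^+ (p ^ k).
Proof. exact/exprNn_pchar/pchar_exp. Qed.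

Lemma frob_sum (I : Type) (r : seq I) (P : pred I) (F : I -> L) k : (\sum_(i <- r | P i) F i) ^+ (p ^ k) = \sum_(i <- r | P i) F i ^+ (p ^ k).
Proof.
apply: (big_morph (fun x => x ^+ (p ^ k))); first by move=> x y; exact: frobD.
by rewrite expr0n expn_eq0; case: p p_pr.
Qed.

(** Half of the trace: the trace of [L] to its prime field is U + U^s, so the points counted below
    are those where the trace of a x + b / x + c vanishes. *)
Definition stepU x := \sum_(i < mu.+1) (a * x + b / x + c) ^+ (p ^ i).

Let Ut : {poly L} := \sum_(i < mu.+1) ((a ^+ (p ^ i))%:P * 'X^(p ^ i + E) + (b ^+ (p ^ i))%:P * 'X^(E - p ^ i) + (c ^+ (p ^ i))%:P * 'X^E).

Let hornerUt x : x != 0 -> Ut.[x] = x ^+ E * stepU x.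
Proof.
move=> x0; rewrite horner_sum mulr_sumr; apply: eq_bigr => i _.
rewrite !hornerE !frobD !exprMn exprVn exprD.
have -> : x ^+ (E - p ^ i) = x ^+ E / x ^+ (p ^ i) by rewrite expfB_cond ?(negbTE x0) ?pi_le // -ltnS.
by ring.
Qed.

Let size_mono (u : L) k n : (k < n)%N -> (size (u%:P * 'X^k)%R <= n)%N.
Proof.
by move=> kn; rewrite mul_polyC; apply: (leq_trans (size_scale_leq _ _)); rewrite size_polyXn.
Qed.

Let sizeUt : size Ut = (2 * E).+1.
Proof.
have le : (size Ut <= (2 * E).+1)%N.
 apply: (leq_trans (size_sum _ _ _)); apply/bigmax_leqP => i _. have h := @pi_le i (ltnSE (ltn_ord i)). apply: (leq_trans (size_polyD _ _)); rewrite geq_max size_mono ?andbT; last by lia.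
 apply: (leq_trans (size_polyD _ _)); rewrite geq_max !size_mono; lia.
have co : Ut`_(2 * E) != 0.
 rewrite coef_sum big_ord_recr /= big1 ?add0r => [|i _].
  rewrite !coefD !coefCM !coefXn. have -> : (2 * E == p ^ mu + E)%N by rewrite /E; lia. have -> : (2 * E == E - p ^ mu)%N = false by rewrite -/E; lia. have -> : 2 * E == E = false by lia.
  by rewrite !mulr0 !addr0 mulr1 expf_neq0.
 have h : (p ^ i < E)%N by rewrite ltn_exp2l. rewrite !coefD !coefCM !coefXn. have -> : (2 * E == p ^ i + E)%N = false by lia. have -> : (2 * E == E - p ^ i)%N = false by lia.
 have -> : 2 * E == E = false by lia. by rewrite !mulr0 !addr0.
apply/eqP; rewrite eqn_leq le ltnNge; apply/negP => h.
by move/negP: co; rewrite nth_default.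
Qed.

Let Ut0 : Ut != 0. Proof. by rewrite -size_poly_eq0 sizeUt. Qed.
(** The degrees form an arithmetic progression of step [E]. Raising k by one trades a factor X^E for
    [Ut], of degree 2 E; at a carry, X^s comes in and p - 1 such exchanges are undone, which again
    adds E. *)
Let M k : {poly L} := 'X^(k %/ p * s) * Ut ^+ (k %% p) * 'X^((p.-1 - k %% p) * E).
Let sizeM k : size (M k) = (k * E + p.-1 * E).+1.
Proof.
have X0 n : 'X^n != 0 :> {poly L} by rewrite monic_neq0 ?monicXn.
have U0 n : Ut ^+ n != 0 by rewrite expf_neq0.
have sU n : size (Ut ^+ n) = (2 * E * n).+1.
 have := size_exp Ut n; rewrite sizeUt => <-; rewrite prednK //. by rewrite size_poly_gt0.
rewrite /M !size_mul ?mulf_neq0 // !size_polyXn sU sE.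
have := ltn_pmod k (prime_gt0 p_pr); have := divn_eq k p.
set d := (k %/ p)%N; set r := (k %% p)%N => ek h.
rewrite !(addSn, addnS); congr S.
have -> : (p.-1 * E = r * E + (p.-1 - r) * E)%N by rewrite -mulnDl; congr (_ * _); lia.
by lia.
Qed.

(** Coefficients of degree below [E] cannot bridge the gap [E] between the degrees of consecutive
    [M k], so the leading term of the last one survives. *)
Let indep n (r : nat -> {poly L}) : (forall k, size (r k) <= E)%N -> \sum_(k < n) r k * M k = 0 -> forall k, (k < n)%N -> r k = 0.
Proof.
move=> sr; elim: n => // n IH; rewrite big_ord_recr /= => h.
have rest : (size (\sum_(k < n) r k * M k)%R <= n * E + p.-1 * E)%N.
 apply: (leq_trans (size_sum _ _ _)); apply/bigmax_leqP => i _. apply: (leq_trans (size_polyMleq _ _)); rewrite sizeM. have := sr i; have : (i.+1 * E <= n * E)%N by rewrite leq_mul2r ltn_ord orbT. by lia.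
have rn : r n = 0.
 apply/eqP; case: eqP => // /eqP rn. have /(congr1 (@size _ \o polyseq)) /= := addr0_eq h. rewrite size_polyN => e. move: rest; rewrite e size_mul // -?size_poly_gt0 sizeM //.
 have rn' : (0 < size (r n))%N by rewrite size_poly_gt0. move: rn'; set w := size (r n); set x := (n * E + _)%N; clearbody w x => hw hh. by lia.
move: h; rewrite rn mul0r addr0 => /IH h k; rewrite ltnS leq_eqVlt => /orP[/eqP->|] //.
exact: h.
Qed.

(** Chosen for the pigeonhole below: (E + 4) s coefficients against (E + 1) s + E + 4 conditions. *)
Let J := (E + 4)%N.
Let n := (J * p)%N.
Let row_of (r : 'M[L]_(n, E)) (k : nat) : {poly L} := if insub k is Some i then rVpoly (row i r) else 0.
Let size_row r k : (size (row_of r k) <= E)%N.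
Proof. by rewrite /row_of; case: insubP => [i _ _|_]; rewrite ?size_poly // size_poly0. Qed.

(** The [s]-th power of the combination of the [M k], reduced by x^(s^2) = x and U^s = - U, up to
    powers of x. The reduction brings the degree from about E s^2 down to about E s. *)
Let Zp r : {poly L} := \sum_(k < n) row_of r k ^+ s * 'X^(k %/ p) * (- Ut) ^+ (k %% p) * 'X^((p.-1 - k %% p) * E).
Let Mx := (E * s + s + J)%N.
Let sizeZ r : (size (Zp r) <= Mx)%N.
Proof.
apply: (leq_trans (size_sum _ _ _)); apply/bigmax_leqP => k _.
have h1 : (size (row_of r k ^+ s) <= (E.-1 * s).+1)%N.
 apply: (leq_trans (size_poly_exp_leq _ _)); rewrite ltnS leq_mul2r. by have := size_row r k; lia.
have h2 : (size ((- Ut) ^+ (k %% p)) <= (2 * E * (k %% p)).+1)%N.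
 by apply: (leq_trans (size_poly_exp_leq _ _)); rewrite size_polyN sizeUt.
have kJ : (k %/ p < J)%N by rewrite ltn_divLR ?prime_gt0.
apply: (leq_trans (size_polyMleq _ _)); rewrite size_polyXn.
have := size_polyMleq (row_of r k ^+ s * 'X^(k %/ p)) ((- Ut) ^+ (k %% p)).
have := size_polyMleq (row_of r k ^+ s) 'X^(k %/ p).
rewrite size_polyXn.
have e1 : (E.-1 * s + s = E * s)%N by rewrite -mulSnr prednK.
have e2 : (E * (k %% p) + (p.-1 - k %% p) * E = p.-1 * E)%N.
 by rewrite mulnC -mulnDl; congr (_ * _); lia.
have e3 : (E * (k %% p) <= p.-1 * E)%N by rewrite mulnC leq_mul2r; lia.
have e4 : (p.-1 * E + E = s)%N by lia.
rewrite /Mx; move: h1 h2 e1 e2 e3 e4 kJ; rewrite -mulnA mulSn mul1n.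
set w1 := size _; set w2 := size _.
set w3 := size (_ * 'X^_)%R; set w4 := size (_ * (- Ut) ^+ _)%R.
set x1 := (E.-1 * s)%N; set x2 := (E * s)%N; set x3 := (E * _)%N.
set x4 := ((_ - _) * E)%N; set x5 := (_ * E)%N; set x6 := (k %/ p)%N.
clearbody w1 w2 w3 w4 x1 x2 x3 x4 x5 x6.
lia.
Qed.

Let row_ofB r r' k : row_of (r - r') k = row_of r k - row_of r' k.
Proof. by rewrite /row_of; case: insubP => [i _ _|_]; rewrite ?subr0 // !linearB. Qed.
Let ZB r r' : Zp (r - r') = Zp r - Zp r'.
Proof.
rewrite /Zp -sumrB; apply: eq_bigr => k _; rewrite row_ofB.
have pc : [pchar {poly L}].-nat s by rewrite (eq_pnat _ (pchar_poly L)); apply: pchar_exp.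
by rewrite exprDn_pchar // exprNn_pchar //; ring.
Qed.

(** The map to [Zp] is additive but only semilinear over [L], so the pigeonhole counts elements
    instead of dimensions. *)
Let exists_r : exists2 r : 'M[L]_(n, E), r != 0 & Zp r = 0.
Proof.
pose f (r : 'M[L]_(n, E)) : 'rV[L]_Mx := poly_rV (Zp r).
have : ~~ injectiveb f.
 apply/injectiveP => /leq_card; rewrite !card_mx mul1n leqNgt => /negP; apply. rewrite ltn_exp2l; last by rewrite cardL -(exp1n 2) ltn_exp2r // /s -(expn0 p) ltn_exp2l. rewrite /Mx /n /J -mulnA -sE mulnDl.
 have : (2 * E <= s)%N by rewrite sE leq_mul2r p1 orbT. by lia.
case/injectivePn => r [r' rr' /(congr1 rVpoly)]; rewrite !poly_rV_K // => e.
by exists (r - r'); rewrite ?subr_eq0 // ZB e subrr.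
Qed.

(** The nonzero polynomial [Q], of degree below s (E + 5), vanishes at every point counted: its
    [s]-th power there equals [Zp r], which is the zero polynomial, up to powers of x. The expected
    number of points is s E, so the excess is O(s). *)
Lemma stepanov_card : (#|[set x : L | (x != 0)%R & (stepU x + stepU x ^+ s == 0)%R]| <= s * (E + 5))%N.
Proof.
have [r r0 zr] := exists_r.
pose Q := \sum_(k < n) row_of r k * M k.
have Q0 : Q != 0.
 apply/eqP => /(indep (size_row r)) h; move/negP: r0; apply; apply/eqP/row_matrixP => i. have := h i (ltn_ord i); rewrite /row_of insubT //= => hi.
 rewrite (_ : Sub (nat_of_ord i) hi = i); last by apply: val_inj; rewrite SubK. by move/(congr1 (@poly_rV L E)); rewrite rVpolyK linear0 row0.
have sQ : (size Q <= s * (E + 5))%N.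
 apply: (leq_trans (size_sum _ _ _)); apply/bigmax_leqP => i _. apply: (leq_trans (size_polyMleq _ _)); rewrite sizeM. have := size_row r i; have : (i.+1 * E <= n * E)%N by rewrite leq_mul2r ltn_ord orbT.
 have -> : (n * E = s * (E + 4))%N by rewrite /n /J sE; ring. by lia.
set P := [set x | _]; rewrite cardE.
apply: ltnW; apply: leq_trans sQ; apply: max_poly_roots (enum_uniq _) => //.
apply/allP => x; rewrite mem_enum inE => /andP[x0 /eqP hx].
have Us : stepU x ^+ s = - stepU x by apply/eqP; rewrite -addr_eq0 addrC hx.
have xs : x ^+ s ^+ s = x by rewrite -exprM mulnn -cardL expf_card.
have key : Q.[x] ^+ s * x ^+ (p.-1 * E) = (Zp r).[x] * x ^+ (p.-1 * E) ^+ s.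
 rewrite !horner_sum frob_sum !mulr_suml; apply: eq_bigr => k _. rewrite -/s /M !hornerM !horner_exp !hornerX hornerN !hornerUt // !exprMn -!exprM. have -> : (p.-1 * E = E * (k %% p) + (p.-1 - k %% p) * E)%N.
  by rewrite [(E * _)%N]mulnC -mulnDl; congr (_ * _); lia.
 have -> : (- (x ^+ E * stepU x)) ^+ (k %% p) = x ^+ (E * (k %% p)) * stepU x ^+ (s * (k %% p)) by rewrite [stepU x ^+ (_ * _)]exprM Us -mulrN exprMn exprM.
 have -> : x ^+ (k %/ p * s * s) = x ^+ (k %/ p) by rewrite -mulnA mulnC !exprM xs. rewrite [(s * _)%N]mulnC mulnDl !exprD !mulnA; ring.
move: key; rewrite zr horner0 mul0r => /eqP; rewrite mulf_eq0 expf_eq0.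
by rewrite expf_eq0 (negbTE x0) andbF orbF => /andP[_ hq]; rewrite /root.
Qed.

End Stepanov.

(** * Kloosterman sums in a tower of quadratic extensions *)

Section Tower.
Variables (R : realType) (L : finFieldType) (p J : nat).
Hypotheses (p_pr : prime p) (chp : p \in [pchar L]) (cardL : #|L| = (p ^ (2 ^ J))%N).
Variables a b : L.
Hypotheses (a_prime : a ^+ p = a) (b_prime : b ^+ p = b) (a0 : a != 0) (b0 : b != 0).
Local Notation ee := (efrac R).

Let p0 : (0 < p)%N := prime_gt0 p_pr.
Definition twq j := (p ^ (2 ^ j))%N.
Local Notation q := twq.
(** The subfield of [twq j] elements, as the fixed points of a power of Frobenius; keeping it a set
    inside [L] avoids a tower of types. *)
Definition twk j := [set x : L | x ^+ q j == x].
Local Notation k := twk.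
Definition twtr j (x : L) : L := \sum_(i < 2 ^ j) x ^+ (p ^ i).
Local Notation tr := twtr.

Lemma twqS j : q j.+1 = (q j * q j)%N.
Proof. by rewrite /q expnS mul2n -addnn expnD. Qed.
Lemma twq_gt1 j : (1 < q j)%N.
Proof. by rewrite -(exp1n (2 ^ j)) /q ltn_exp2r ?prime_gt1 // expn_gt0. Qed.
Let frobD' (x y : L) j := @frobD L p p_pr chp x y (2 ^ j).
Let frobN' (x : L) j := @frobN L p p_pr chp x (2 ^ j).
Lemma twkP j x : reflect (x ^+ q j = x) (x \in k j).
Proof. by rewrite inE; apply: eqP. Qed.
Lemma twkD j x y : x \in k j -> y \in k j -> x + y \in k j.
Proof. by move=> /twkP hx /twkP hy; apply/twkP; rewrite frobD' -/(q j) hx hy. Qed.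
Lemma twkN j x : x \in k j -> - x \in k j.
Proof. by move=> /twkP hx; apply/twkP; rewrite frobN' -/(q j) hx. Qed.
Lemma twkM j x y : x \in k j -> y \in k j -> x * y \in k j.
Proof. by move=> /twkP hx /twkP hy; apply/twkP; rewrite exprMn hx hy. Qed.
Lemma twkV j x : x \in k j -> x^-1 \in k j.
Proof. by move=> /twkP hx; apply/twkP; rewrite exprVn hx. Qed.
Lemma twk0 j : 0 \in k j.
Proof. by apply/twkP; rewrite expr0n eqn0Ngt (ltnW (twq_gt1 j)). Qed.
Lemma twkS j x : x \in k j -> x \in k j.+1.
Proof. by move=> /twkP hx; apply/twkP; rewrite twqS exprM hx. Qed.
Lemma twk_prime (x : L) j : x ^+ p = x -> x \in k j.
Proof.
move=> hx; elim: j => [|j]; last exact: twkS.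
by apply/twkP.
Qed.

Lemma dvd_twq j i : (('X^(q j) - 'X : {poly L}) %| 'X^(q (j + i)) - 'X)%R.
Proof.
elim: i => [|i IH]; first by rewrite addn0.
have -> : 'X^(q (j + i.+1)) - 'X = ('X^(q (j + i)) - 'X) ^+ q (j + i) + ('X^(q (j + i)) - 'X) :> {poly L}.
 have pc : [pchar {poly L}].-nat (q (j + i)) by rewrite (eq_pnat _ (pchar_poly L)); apply: pchar_exp. by rewrite exprDn_pchar // exprNn_pchar // -exprM -twqS addnS; ring.
rewrite dvdp_add //; apply: (dvdp_trans IH); rewrite -[X in X %| _]expr1.
by rewrite dvdp_exp2l // ltnW // twq_gt1.
Qed.

Lemma size_twq j : size ('X^(q j) - 'X : {poly L}) = (q j).+1.
Proof.
by rewrite size_polyDl ?size_polyXn // size_polyN size_polyX ltnS twq_gt1.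
Qed.

(** X^(q_j) - X divides the polynomial X^#|L| - X, which splits into distinct linear factors over
    [L], so all its roots lie in [L] and are distinct. *)
Lemma card_twk j : (j <= J)%N -> #|k j| = q j.
Proof.
move=> jJ; have pn0 : 'X^(q j) - 'X != 0 :> {poly L} by rewrite -size_poly_eq0 size_twq.
have rt x : root ('X^(q j) - 'X) x = (x \in k j) by rewrite /root !hornerE inE subr_eq0.
apply/eqP; rewrite eqn_leq; apply/andP; split.
 rewrite -ltnS -size_twq cardE; apply: max_poly_roots (enum_uniq _) => //. by apply/allP => x; rewrite mem_enum rt.
have := dvd_twq j (J - j); rewrite subnKC // /q -cardL finField_genPoly.
rewrite -(big_enum _ _ predT) => /dvdp_prod_XsubC [ms eqm].
have := eqp_size eqm; rewrite size_twq size_prod_XsubC => -[e].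
rewrite -/(q j) e -(card_uniqP (mask_uniq (enum_uniq L) ms)).
apply/subset_leq_card/subsetP => x xm; rewrite -rt (eqp_root eqm).
by rewrite root_prod_XsubC.
Qed.

Lemma prime_sub_inj i j : (i < p)%N -> (j < p)%N -> i%:R = j%:R :> L -> i = j.
Proof.
move=> ip jp; wlog ij : i j ip jp / (i <= j)%N => [hw e|].
 by case: (leqP i j) => [h|/ltnW h]; [apply: hw|apply/esym/hw].
move/eqP; rewrite eq_sym -subr_eq0 -natrB // -(dvdn_pcharf chp) => h.
case: (posnP (j - i)) => h0; first by lia; lia.
by have := dvdn_leq h0 h; lia.
Qed.

Lemma frob_nat i : (i%:R : L) ^+ p = i%:R.
Proof. by rewrite -pFrobenius_autE rmorph_nat. Qed.
Lemma twk0E (x : L) : x ^+ p = x -> exists2 i, (i < p)%N & x = i%:R.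
Proof.
move=> hx; pose f (i : 'I_p) : L := i%:R.
have fI : injective f by move=> i j /prime_sub_inj e; apply/val_inj/e.
have sub : f @: setT \subset k 0.
 by apply/subsetP => _ /imsetP[i _ ->]; apply/twk_prime/frob_nat.
have /eqP ek : f @: setT == k 0 by rewrite eqEcard sub card_imset // cardsT card_ord card_twk //= /q.
have : x \in k 0 by apply: twk_prime.
by rewrite -ek => /imsetP[i _ ->]; exists i.
Qed.

(** The additive character i -> e(i / p) of the prime field, extended by 0 to the rest of [L]. *)
Definition psi (x : L) : R[i] := \sum_(i < p | x == i%:R) ee p i%:Z.
Lemma psi_nat i : psi i%:R = ee p i.
Proof.
pose i0 := Ordinal (ltn_pmod i p0).
have ei : i%:R = i0%:R :> L by rewrite (divn_eq i p) natrD natrM (pcharf0 chp) mulr0 add0r.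
rewrite /psi (big_pred1 i0) /= => [|j].
 apply: ee_eqm => //=; apply/dvdzP; exists (- (i %/ p)%:Z). by lia.
rewrite ei; apply/eqP/eqP => [/prime_sub_inj e|->] //.
by apply/val_inj/esym/e.
Qed.

Lemma psiD (x y : L) : x ^+ p = x -> y ^+ p = y -> psi (x + y) = psi x * psi y.
Proof.
by move=> /twk0E[i _ ->] /twk0E[j _ ->]; rewrite -natrD !psi_nat -eeD.
Qed.

Lemma psi0 : psi 0 = 1.
Proof. by rewrite (psi_nat 0) ee0. Qed.
Lemma psi_eq1 (x : L) : x ^+ p = x -> psi x = 1 -> x = 0.
Proof.
move=> /twk0E[i ip ->]; rewrite psi_nat => /eqP; rewrite ee_eq1 // => h.
by rewrite (dvdz_small ip h).
Qed.

Lemma trD j (x y : L) : tr j (x + y) = tr j x + tr j y.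
Proof. by rewrite -big_split; apply: eq_bigr => i _; apply: frobD. Qed.
Lemma tr0 j : tr j 0 = 0.
Proof.
by rewrite /tr big1 // => i; rewrite expr0n expn_eq0; case: p p0.
Qed.

Lemma trS j (x : L) : tr j.+1 x = tr j (x + x ^+ q j).
Proof.
rewrite trD /twtr expnS mul2n -addnn big_split_ord /=; congr (_ + _).
by apply: eq_bigr => i; rewrite -exprM /q -expnD.
Qed.

Lemma tr_frob j (x : L) : tr j (x ^+ p) = tr j x ^+ p.
Proof.
have := @frob_sum L p p_pr chp _ (index_enum 'I_(2 ^ j)) predT (fun i : 'I_(2 ^ j) => x ^+ (p ^ i)) 1.
by rewrite expn1 => ->; apply: eq_bigr => i; rewrite -!exprM mulnC.
Qed.

Lemma tr_prime j (x : L) : x \in k j -> tr j x ^+ p = tr j x.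
Proof.
move=> /twkP hx; rewrite -tr_frob /twtr.
have e : (2 ^ j)%N = (2 ^ j).-1.+1 by rewrite prednK // expn_gt0.
rewrite e big_ord_recr big_ord_recl /= addrC; congr (_ + _).
 by rewrite -exprM -expnS -e.
by apply: eq_bigr => i; rewrite -exprM -expnS.
Qed.

Lemma tr_scale j (t x : L) : t ^+ p = t -> tr j (t * x) = t * tr j x.
Proof.
move=> ht; rewrite /twtr mulr_sumr; apply: eq_bigr => i _; rewrite exprMn; congr (_ * _).
by elim: (i : nat) => [|n IH]; rewrite // expnSr exprM IH.
Qed.

(** The trace is a nonzero polynomial of degree below [twq j], so it cannot vanish on the whole
    subfield. *)
Lemma tr_nontriv j : (j <= J)%N -> exists2 x, x \in k j & tr j x != 0.
Proof.
move=> jJ; case: (boolP [exists x in k j, tr j x != 0]) => [/exists_inP //|].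
rewrite negb_exists_in => /forall_inP h; exfalso.
pose P : {poly L} := \sum_(i < 2 ^ j) 'X^(p ^ i).
have sP : (size P <= q j)%N.
 apply: (leq_trans (size_sum _ _ _)); apply/bigmax_leqP => i _. by rewrite size_polyXn /q ltn_exp2l ?prime_gt1.
have P0 : P != 0.
 apply/eqP => /(congr1 (fun u : {poly L} => u`_1)); rewrite coef0 coef_sum. have e : (2 ^ j)%N = (2 ^ j).-1.+1 by rewrite prednK // expn_gt0.
 rewrite e big_ord_recl /= coefXn big1 ?addr0 => [/eqP|i _]; first by rewrite oner_eq0. rewrite coefXn; case: eqP => // /esym/eqP; rewrite /bump /= add1n.
 by move/eqP => e1; have := ltn_expl i.+1 (prime_gt1 p_pr); rewrite e1.
have : (size (enum (k j)) < size P)%N.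
 apply: max_poly_roots (enum_uniq _) => //; apply/allP => x; rewrite mem_enum => /h. rewrite negbK /root horner_sum => /eqP e; apply/eqP; rewrite -[RHS]e. by apply: eq_bigr => i; rewrite hornerXn.
by rewrite -cardE card_twk // ltnNge sP.
Qed.

Lemma tr_orth j z : (j <= J)%N -> z \in k j -> \sum_(T in k j) psi (tr j (T * z)) = if z == 0 then (q j)%:R else 0.
Proof.
move=> jJ zk; case: eqP => [->|/eqP z0].
 rewrite (eq_bigr (fun=> 1)) => [|i _]; last by rewrite mulr0 tr0 psi0. by rewrite sumr_const card_twk.
have [x0 x0k hx] := tr_nontriv jJ; set S := LHS.
have : S = psi (tr j x0) * S.
 rewrite {1}/S (reindex (fun T => x0 / z + T)) /=; last first.
  by exists (fun T => T - x0 / z) => T _; ring.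
 have h0 : x0 / z \in k j by rewrite twkM ?twkV. rewrite mulr_sumr; apply: eq_big => T.
  apply/idP/idP => h; last exact: twkD. by have := twkD (twkN h0) h; rewrite addKr.
 move=> h; have Tk : T \in k j by have := twkD (twkN h0) h; rewrite addKr. by rewrite mulrDl divfK // trD psiD ?tr_prime // twkM.
move/eqP; rewrite -{1}[S]mul1r -subr_eq0 -mulrBl mulf_eq0 subr_eq0 => /orP[/eqP e|/eqP //].
by move/negP: hx; case; apply/eqP; apply: psi_eq1; rewrite ?tr_prime.
Qed.

Definition twS j := \sum_(x in k j | x != 0) psi (tr j (a * x + b / x)).
Local Notation S := twS.

Section Step.
Variable j : nat.
Hypothesis jJ : (j < J)%N.
(** Pairs (T, N) of a trace and a nonzero norm. Elements of the quadratic extension, with their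
    conjugates, and pairs of elements of [twk j] are both sent to (sum, product), where a x + b / x
    added over the two roots becomes a T + b T / N. *)
Let X := setX (k j) (k j :\ 0).
Let phi (t : L * L) := psi (tr j (a * t.1 + b * (t.1 / t.2))).
Let A := [set x in k j.+1 | x != 0].
Let fA x : L * L := (x + x ^+ q j, x * x ^+ q j).
Let B := setX (k j :\ 0) (k j :\ 0).
Let fB (x : L * L) : L * L := (x.1 + x.2, x.1 * x.2).
Let kq x : x \in k j.+1 -> x ^+ q j ^+ q j = x.
Proof. by move/twkP; rewrite twqS exprM. Qed.
Let fA_X x : x \in A -> fA x \in X.
Proof.
rewrite inE => /andP[xk x0]; rewrite in_setX in_setD1.
rewrite mulf_neq0 ?expf_neq0 //=; apply/andP; split; apply/twkP.
 by rewrite frobD' -/(q j) kq // addrC.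
by rewrite exprMn kq // mulrC.
Qed.

Let fB_X x : x \in B -> fB x \in X.
Proof.
case: x => x y; rewrite in_setX !in_setD1 => /andP[/andP[x0 xk] /andP[y0 yk]].
by rewrite in_setX in_setD1 mulf_neq0 //= twkM // twkD.
Qed.

Let cnt t := (#|[set x in A | fA x == t]| + #|[set x in B | fB x == t]|)%N.
(** The preimages of (T, N) are roots of Y^2 - T Y + N, lying in the extension or forming ordered
    pairs in the subfield. If both kinds occur, the root is double and each kind occurs once. *)
Let cnt_le2 t : (cnt t <= 2)%N.
Proof.
rewrite /cnt; set SA := [set x in A | _]; set SB := [set x in B | _].
have rootA x y : x \in SA -> y ^+ 2 - t.1 * y + t.2 = 0 -> y = x \/ y = t.1 - x.
 rewrite inE => /andP[_ /eqP <-] /= e. have /eqP : (y - x) * (y - x ^+ q j) = 0 by rewrite -e; ring. by rewrite mulf_eq0 !subr_eq0 => /orP[/eqP->|/eqP->]; [left|right; ring].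
have eqA x : x \in SA -> x ^+ 2 - t.1 * x + t.2 = 0.
 by rewrite inE => /andP[_ /eqP <-] /=; ring.
have eqB x : x \in SB -> x.1 ^+ 2 - t.1 * x.1 + t.2 = 0 /\ x.2 = t.1 - x.1.
 by rewrite inE => /andP[_ /eqP <-] /=; split; ring.
have kB x : x \in SB -> x.1 \in k j /\ x.2 \in k j.
 by case: x => x y; rewrite inE in_setX !in_setD1 => /andP[/andP[/andP[_ ->] /andP[_ ->]]].
have B2 x : x \in SB -> SB \subset [set x; (x.2, x.1)].
 move=> xS; apply/subsetP => y yS; have [e1 e2] := eqB _ xS; have [e3 e4] := eqB _ yS. have /eqP : (y.1 - x.1) * (y.1 - x.2) = 0.
  by rewrite -[RHS]subr0 -{1}e3 -e1 e2; ring.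
 rewrite mulf_eq0 !subr_eq0 !inE => /orP[/eqP h|/eqP h]; apply/orP; [left|right]; apply/eqP.
  by rewrite [y]surjective_pairing [x]surjective_pairing e4 e2 h.
 by rewrite [y]surjective_pairing e4 h e2; congr (_, _); ring.
have [SB0|[z zB]] := set_0Vmem SB.
 rewrite SB0 cards0 addn0; have [->|[x xA]] := set_0Vmem SA; first by rewrite cards0. apply: leq_trans (subset_leq_card (B := mem [set x; t.1 - x]) _) _; last by rewrite cards2; case: eqP.
 by apply/subsetP => y /eqA /(rootA _ _ xA) []->; rewrite !inE eqxx ?orbT.
have [SA0|[x xA]] := set_0Vmem SA.
 rewrite SA0 cards0 add0n; apply: leq_trans (subset_leq_card (B2 _ zB)) _. by rewrite cards2; case: eqP.
have [z1 z2] := kB _ zB; have [ez ez2] := eqB _ zB.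
have xk : x \in k j.
 have [e|e] := rootA _ _ xA ez; first by rewrite -e. by have -> : x = z.2; [rewrite ez2 e; ring|].
have xq : x ^+ q j = x by apply/twkP.
have et : t = (x + x, x * x) by move: xA; rewrite inE => /andP[_ /eqP <-]; rewrite /fA xq.
have zx : z.1 = x.
 have [//|->] := rootA _ _ xA ez; rewrite et /=; ring.
have z2x : z.2 = x by rewrite ez2 zx et /=; ring.
apply: (@leq_trans (1 + 1)); last by [].
apply: leq_add.
 rewrite -(cards1 x); apply/subset_leq_card/subsetP => y /eqA /(rootA _ _ xA). by rewrite et inE => -[->|->] //; rewrite addrK.
rewrite -(cards1 z); apply: (leq_trans (subset_leq_card (B2 _ zB))).
apply/subset_leq_card/subsetP => y; rewrite !inE => /orP[//|/eqP->].
by rewrite [z]surjective_pairing zx z2x.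
Qed.

(** Equality follows from the total (q^2 - 1) + (q - 1)^2 = 2 q (q - 1), which is twice the number
    of pairs (T, N). *)
Let cnt_eq2 t : t \in X -> cnt t = 2%N.
Proof.
move=> tX; have h : (\sum_(t in X) (2 - cnt t) = 0)%N.
 rewrite sumnB; last by move=> i _; exact: cnt_le2. rewrite big_split /= sum_nat_const. have cA : (\sum_(t in X) #|[set x in A | fA x == t]| = q j * q j - 1)%N.
  have -> : (q j * q j - 1 = #|A|)%N.
   rewrite -twqS -(card_twk jJ) (cardsD1 0 (k j.+1)) twk0 add1n subn1 /=. by apply: eq_card => x; rewrite !inE andbC.
  rewrite -sum1_card (partition_big fA (mem X)) => [|x xA]; last exact: fA_X. by apply: eq_bigr => t' _; rewrite -sum1_card; apply: eq_bigl => x; rewrite inE.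
 have ck : #|k j :\ 0| = (q j - 1)%N.
  by have := cardsD1 0 (k j); rewrite twk0 (card_twk (ltnW jJ)) => ->; rewrite subn1.
 have cB : (\sum_(t in X) #|[set x in B | fB x == t]| = (q j - 1) * (q j - 1))%N.
  rewrite -ck -cardsX -sum1_card [RHS](partition_big fB (mem X)) => [|x xB]; last exact: fB_X. by apply: eq_bigr => t' _; rewrite -sum1_card; apply: eq_bigl => x; rewrite inE.
 rewrite cA cB cardsX ck (card_twk (ltnW jJ)); have := twq_gt1 j. case: q => [|q']; rewrite subn1; nia.
move/eqP: h; rewrite sum_nat_eq0 => /forall_inP /(_ t tX); have := cnt_le2 t; lia.
Qed.

(* If |S_j| > 2 sqrt q_j, then |S_k| / sqrt q_k is unbounded, against Stepanov's estimate. *)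
Lemma twS_step : S j.+1 = (2 * q j)%N%:R - S j ^+ 2.
Proof.
have SA : S j.+1 = \sum_(t in X) #|[set x in A | fA x == t]|%:R * phi t.
 have -> : S j.+1 = \sum_(x in A) phi (fA x).
  rewrite /S; apply: eq_big => [x|x /andP[xk x0]]; first by rewrite !inE. rewrite /phi trS; congr (psi (tr j _)); rewrite /fA /=. have xq0 : x ^+ q j != 0 by rewrite expf_neq0.
  rewrite frobD' -/(q j) !exprMn exprVn. have /twkP -> := twk_prime j a_prime; have /twkP -> := twk_prime j b_prime. by field; rewrite xq0.
 rewrite (partition_big fA (mem X)) => [|x xA]; last exact: fA_X. apply: eq_bigr => t _; rewrite (eq_bigr (fun=> phi t)); last by move=> x /andP[_ /eqP->].
 transitivity (\sum_(x in [set x in A | fA x == t]) phi t); first by apply: eq_bigl => x; rewrite inE. by rewrite mulr_natl -sumr_const.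
have SB : S j ^+ 2 = \sum_(t in X) #|[set x in B | fB x == t]|%:R * phi t.
 have -> : S j ^+ 2 = \sum_(x in B) phi (fB x).
  rewrite expr2 /S mulr_suml. transitivity (\sum_(x in k j :\ 0) \sum_(y in k j :\ 0) phi (fB (x, y))); last first.
   by rewrite pair_big; apply: eq_big => [[x y]|[x y] _] //; rewrite in_setX.
  apply: eq_big => [x|x /andP[xk x0]]; first by rewrite in_setD1 andbC. rewrite mulr_sumr; apply: eq_big => [y|y /andP[yk y0]]; first by rewrite in_setD1 andbC.
  have ka := twk_prime j a_prime; have kb := twk_prime j b_prime. rewrite -psiD ?tr_prime ?twkD ?twkM ?twkV // -trD /phi /=; congr (psi (tr j _)). by field; rewrite y0.
 rewrite (partition_big fB (mem X)) => [|x xA]; last exact: fB_X. apply: eq_bigr => t _; rewrite (eq_bigr (fun=> phi t)); last by move=> x /andP[_ /eqP->].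
 transitivity (\sum_(x in [set x in B | fB x == t]) phi t); first by apply: eq_bigl => x; rewrite inE. by rewrite mulr_natl -sumr_const.
apply/eqP; rewrite eq_sym subr_eq eq_sym; apply/eqP; rewrite SA SB -big_split /=.
rewrite (eq_bigr (fun t => 2 * phi t)); last first.
 by move=> t tX; rewrite -mulrDl -natrD -/(cnt t) cnt_eq2.
rewrite -mulr_sumr natrM; congr (_ * _).
(* For fixed N the sum over T of the character of T (a + b / N) vanishes unless N = - b / a. *)
transitivity (\sum_(N in k j :\ 0) \sum_(T in k j) phi (T, N)).
 rewrite exchange_big pair_big; apply: eq_big => [[x y]|[x y] _] //. by rewrite in_setX.
have ka := twk_prime j a_prime; have kb := twk_prime j b_prime.
rewrite (eq_bigr (fun N => if N == - b / a then (q j)%:R else 0)) => [|N]; last first.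
 rewrite in_setD1 => /andP[N0 Nk]. transitivity (\sum_(T in k j) psi (tr j (T * (a + b / N)))).
  by apply: eq_bigr => T _; rewrite /phi /=; congr (psi (tr j _)); ring.
 rewrite tr_orth ?(ltnW jJ) ?twkD ?twkM ?twkV //; congr (if _ then _ else _). apply/eqP/eqP => [h|->]; last by field; rewrite a0 oppr_eq0. have ea : a = - (b / N) by apply/eqP; rewrite -addr_eq0 h.
 by rewrite ea invrN mulrNN invf_div mulrCA divff // mulr1.
rewrite -big_mkcondr (big_pred1 (- b / a)) // => N /=.
rewrite andbC; case: eqP => //= ->; rewrite in_setD1 mulf_neq0 ?oppr_eq0 ?invr_eq0 //=.
by rewrite twkM ?twkV ?twkN.
Qed.

End Step.
End Tower.

Section TopBound.
Variables (R : realType) (L : finFieldType) (p j : nat).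
Hypotheses (p_pr : prime p) (chp : p \in [pchar L]) (cardL : #|L| = (p ^ (2 ^ j.+1))%N).
Variables a b : L.
Hypotheses (a_prime : a ^+ p = a) (b_prime : b ^+ p = b) (a0 : a != 0) (b0 : b != 0).
Local Notation ee := (efrac R).
Let p0 : (0 < p)%N := prime_gt0 p_pr.
Let mu := (2 ^ j).-1.
Let E := (p ^ mu)%N.
Let q := twq p j.
Let muS : mu.+1 = (2 ^ j)%N. Proof. by rewrite prednK // expn_gt0. Qed.
Let qE : q = (p * E)%N. Proof. by rewrite /q /twq -muS expnS. Qed.
Let N (i : nat) := #|[set x : L | (x != 0)%R & (twtr p j.+1 (a * x + b / x) == i%:R)%R]|.
(** Translation by an element of trace - i moves the value i of the trace to 0. *)
Let N_le i : (N i <= q * (E + 5))%N.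
Proof.
have [x0 x0k t0] := tr_nontriv p_pr chp cardL (leqnn j.+1).
set t := twtr p j.+1 x0 in t0; have tp : t ^+ p = t by apply: tr_prime.
pose c := - (i%:R / t) * x0.
have ic : twtr p j.+1 c = - i%:R.
 rewrite tr_scale; first by rewrite -/t mulNr divfK. have := frobN p_pr chp (i%:R / t) 1; rewrite expn1 => ->. by rewrite exprMn exprVn tp frob_nat.
have cL : #|L| = ((p ^ mu.+1) ^ 2)%N by rewrite cardL muS -expnM expnSr.
have := stepanov_card p_pr chp cL b c a0; rewrite muS -/(twq p j) -/q -/E.
apply: leq_trans; apply: subset_leq_card; apply/subsetP => x; rewrite !inE => /andP[-> /= /eqP h].
have -> : stepU p mu a b c x = twtr p j (a * x + b / x + c) by rewrite /stepU muS.
have -> : twtr p j (a * x + b / x + c) + twtr p j (a * x + b / x + c) ^+ q = twtr p j.+1 (a * x + b / x + c).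
 rewrite (trS p_pr chp) (trD p_pr chp); congr (_ + _). by rewrite /q /twq (frob_sum p_pr chp); apply: eq_bigr => k; rewrite -!exprM mulnC.
by rewrite (trD p_pr chp) h ic subrr.
Qed.

(** The common upper bound B for the [N i] also controls the deficits, because the [N i] add up to
    q^2 - 1: the sum of the B - N i is p B - (q^2 - 1) = 5 p q + 1. *)
Lemma twS_top : normc (twS R p a b j.+1) <= (6 * p * q)%:R.
Proof.
have kT (x : L) : x \in twk L p j.+1 by apply/twkP; rewrite /twq -cardL expf_card.
have lt_p := prime_gt1 p_pr.
pose F x := twtr p j.+1 (a * x + b / x).
have -> : twS R p a b j.+1 = \sum_(i < p) ee p i * (N i)%:R.
 rewrite /twS (eq_bigl (fun x : L => x != 0)); last by move=> x; rewrite kT. have dec (x : L) : psi R p (F x) = \sum_(i < p) ee p i * (F x == i%:R)%:R.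
  by rewrite /psi big_mkcond; apply: eq_bigr => i; case: eqP; rewrite ?mulr1 ?mulr0.
 rewrite (eq_bigr _ (fun x _ => dec x)) exchange_big /=; apply: eq_bigr => i _. rewrite -mulr_sumr; congr (_ * _); rewrite -natr_sum; congr (_%:R).
 rewrite /N -sum1_card big_mkcond [RHS]big_mkcond; apply: eq_bigr => x _. by rewrite inE; case: eqP.
have s0 : \sum_(i < p) ee p i = 0.
 have := ee_orth R 1 p0; rewrite (eq_bigr (fun i : 'I_p => ee p i)) => [->|i _]; last by rewrite mul1r. by case: ifP => // /(@dvdz_small 1 p lt_p).
have sN : (\sum_(i < p) N i = #|L|.-1)%N.
 have -> : #|L|.-1 = #|[set x : L | x != 0]|.
  by rewrite -cardsT (cardsD1 0 setT) in_setT; apply: eq_card => x; rewrite !inE andbT.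
 have dec (x : L) : (\sum_(i < p) (F x == i%:R) = 1)%N.
  have [i ip ei] := twk0E p_pr chp cardL a0 b0 (tr_prime p_pr chp (kT (a * x + b / x))). rewrite (bigD1 (Ordinal ip)) //= {1}/F ei eqxx big1 // => k kn; case: eqP => // e.
  move/negP: kn; case; apply/eqP/val_inj/(prime_sub_inj p_pr chp cardL a0 b0 (ltn_ord k) ip). by rewrite -e /F.
 rewrite -sum1_card; under eq_bigr => x _ do rewrite -(dec x). rewrite exchange_big /=; apply: eq_bigr => i _. rewrite /N -sum1_card big_mkcond [RHS]big_mkcond; apply: eq_bigr => x _.
 by rewrite !inE; case: eqP.
pose B := (q * (E + 5))%N.
have -> : \sum_(i < p) ee p i * (N i)%:R = - \sum_(i < p) ee p i * (B - N i)%:R.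
 have hB : \sum_(i < p) ee p i * B%:R = 0 by rewrite -mulr_suml s0 mul0r. apply/eqP; rewrite -subr_eq0 opprK -big_split /= -[X in _ == X]hB; apply/eqP. by apply: eq_bigr => i _; rewrite natrB //; ring.
rewrite normcN; apply: (le_trans (normc_sum _ _ _)).
rewrite (eq_bigr (fun i : 'I_p => (B - N i)%:R)); last first.
 by move=> i; rewrite normcM normc_ee mul1r normc_natr.
rewrite -natr_sum ler_nat sumnB; last by move=> i _; exact: N_le.
rewrite sum_nat_const card_ord sN cardL expnS mul2n -addnn expnD -/(twq p j) -/q /B.
have : (p * (q * (E + 5)) = q * q + 5 * p * q)%N by rewrite mulnDr mulnDr mulnCA -qE; ring.
move=> ->; have : (1 < q)%N by lia.
have : (0 < p * q)%N by lia.
rewrite -!mulnA; set pq := (p * q); set qq := (q * q); clearbody pq qq; lia.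
Qed.
End TopBound.

(** * Weil's bound for Kloosterman sums to prime moduli *)

Section Weil.
Variable R : realType.
Local Notation ee := (efrac R).

Definition kl c (a b : int) : R[i] := \sum_(x < c | coprime x c) ee c (a * x%:Z + b * iv c x%:Z).

Section Fixed.
Variables (p : nat) (a b : int).
Hypotheses (p_pr : prime p) (pa : ~~ (p%:Z %| a)%Z) (pb : ~~ (p%:Z %| b)%Z).
Let p0 : (0 < p)%N := prime_gt0 p_pr.

Section InL.
Variables (L : finFieldType) (J : nat).
Hypotheses (chp : p \in [pchar L]) (cardL : #|L| = (p ^ (2 ^ J))%N).

Lemma intr_eq0_pchar m : (m%:~R == 0 :> L) = (p %| m)%Z.
Proof.
by case: m => m; rewrite ?oppr_eq0 -(dvdn_pcharf chp).
Qed.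

Lemma int_frob m : (m%:~R : L) ^+ p = m%:~R.
Proof. by rewrite -pFrobenius_autE rmorph_int. Qed.
Let a0 : (a%:~R : L) != 0. Proof. by rewrite intr_eq0_pchar. Qed.
Let b0 : (b%:~R : L) != 0. Proof. by rewrite intr_eq0_pchar. Qed.
Lemma psi_int m : psi R p (m%:~R : L) = ee p m.
Proof.
have [r [k [rp ->]]] := int_ediv m p0.
by rewrite ee_per // intrD intrM -[p%:~R]pmulrn (pcharf0 chp) mul0r addr0 (psi_nat R p_pr chp cardL a0 b0).
Qed.

Lemma twS_kl : twS R p (a%:~R : L) b%:~R 0 = kl p a b.
Proof.
pose f (i : 'I_p) : L := i%:R.
have fI : injective f by move=> i j /(prime_sub_inj p_pr chp cardL a0 b0 (ltn_ord i) (ltn_ord j)) /val_inj.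
have kE : twk L p 0 = f @: setT.
 apply/setP => x; apply/idP/imsetP => [/twkP|[i _ ->]].
  rewrite /twq expn0 expn1 => /(twk0E p_pr chp cardL a0 b0) [i ip ->]. by exists (Ordinal ip).
 exact/twk_prime/frob_nat.
rewrite /twS big_mkcondr kE big_imset /=; last by move=> x y _ _; apply: fI.
rewrite /kl [RHS]big_mkcond; apply: eq_big => [i|i _]; first by rewrite inE.
have -> : (f i != 0) = coprime i p by rewrite /f -(dvdn_pcharf chp) coprime_sym prime_coprime.
case: ifP => // cp; rewrite /twtr expn0 big_ord1 expn0 expr1 -psi_int.
congr psi; rewrite intrD !intrM /f -!pmulrn; congr (_ + _ * _).
have f0 : (i%:R : L) != 0 by rewrite -(dvdn_pcharf chp) -prime_coprime // coprime_sym.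
apply: (mulfI f0); rewrite divff // pmulrn -intrM; apply/eqP; rewrite eq_sym -subr_eq0.
by rewrite -[1]/(1%:~R) -intrB intr_eq0_pchar iv_mul.
Qed.
End InL.

Lemma weil_kl : normc (kl p a b) <= 2 * Num.sqrt p%:R.
Proof.
rewrite leNgt; apply/negP => hgt.
have sp : 0 < Num.sqrt p%:R :> R by rewrite sqrtr_gt0 ltr0n.
pose d := normc (kl p a b) / Num.sqrt p%:R - 2.
have d0 : 0 < d by rewrite /d subr_gt0 ltr_pdivlMr.
have bound J : 2 + 4 ^+ J.+1 * d <= (6 * p)%:R.
 have [L chp cardL] := @pPrimePowerField p (2 ^ J.+1) p_pr (expn_gt0 2 J.+1). have a0 : (a%:~R : L) != 0 by rewrite intr_eq0_pchar. have b0 : (b%:~R : L) != 0 by rewrite intr_eq0_pchar.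
 have ap := int_frob chp a; have bp := int_frob chp b. pose S j := normc (twS R p (a%:~R : L) b%:~R j). have q0 j : 0 < (twq p j)%:R :> R by rewrite ltr0n ltnW // twq_gt1.
 (* If |S_j| >= (2 + y) sqrt(q_j), then |S_(j+1)| >= (2 + 4 y + y^2) q_j, and q_j = sqrt(q_(j+1)):
    the excess over 2 at least quadruples. *)
 have grow j : (j <= J.+1)%N -> (2 + 4 ^+ j * d) * Num.sqrt (twq p j)%:R <= S j.
  elim: j => [|j IH] jJ.
   by rewrite mul1r /S (twS_kl chp cardL) /d /twq addrC subrK divfK // gt_eqF.
  have := IH (ltnW jJ); set r := Num.sqrt _ => h. have r2 : r ^+ 2 = (twq p j)%:R by rewrite sqr_sqrtr. have r0 : 0 <= r by apply: sqrtr_ge0.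
  have -> : Num.sqrt (twq p j.+1)%:R = r ^+ 2 by rewrite twqS natrM sqrtr_sqr ger0_norm. have : S j ^+ 2 <= S j.+1 + 2 * r ^+ 2.
   have := twS_step R p_pr chp cardL ap bp a0 b0 jJ => e. have -> : S j ^+ 2 = normc (twS R p (a%:~R : L) b%:~R j ^+ 2) by rewrite normcM.
   have -> : twS R p (a%:~R : L) b%:~R j ^+ 2 = (2 * twq p j)%:R + - twS R p (a%:~R : L) b%:~R j.+1.
    by rewrite e; ring.
   apply: (le_trans (le_normcD _ _)); rewrite normcN addrC lerD2l. by rewrite normc_natr natrM r2.
  have h4 : 0 <= 4 ^+ j * d by rewrite mulr_ge0 ?exprn_ge0 // ltW. have : ((2 + 4 ^+ j * d) * r) ^+ 2 <= S j ^+ 2.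
   by rewrite ler_sqr // nnegrE; [rewrite mulr_ge0 // addr_ge0|apply: normc_ge0].
  rewrite exprMn (exprS 4) -mulrA; move: (4 ^+ j * d) h4 => y y0. have : 0 <= r ^+ 2 by rewrite sqr_ge0. move: (r ^+ 2) (S j ^+ 2) (S j.+1) => u v w u0. have : 0 <= y ^+ 2 * u by rewrite mulr_ge0 // sqr_ge0.
  by lra.
 have := grow J.+1 (leqnn _); have := twS_top R p_pr chp cardL a0 b0. rewrite -/(S J.+1). have -> : Num.sqrt (twq p J.+1)%:R = (twq p J)%:R :> R by rewrite twqS natrM sqrtr_sqr ger0_norm.
 by rewrite natrM => h1 h2; have := le_trans h2 h1; rewrite ler_pM2r.
have [n hn] : exists n, (6 * p)%:R / d < n%:R.
 by exists (Num.truncn ((6 * p)%:R / d)).+1; rewrite truncnS_gt.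
have := bound n; have : n%:R < 4 ^+ n.+1 :> R.
 by rewrite -natrX ltr_nat; apply: (leq_trans (ltn_expl n (isT : (1 < 4)%N))); rewrite leq_exp2l.
move: hn; rewrite ltr_pdivrMr // => h1 h2 h3.
have : n%:R * d < 4 ^+ n.+1 * d by rewrite ltr_pM2r.
lra.
Qed.
End Fixed.
End Weil.

(** * Gaussian binomials and the sign of the quadratic Gauss sum *)

Section QBinomial.
Variables (F : fieldType) (q : F).

Fixpoint qbin (n j : nat) : F := match n, j with | _, 0 => 1 | 0, _.+1 => 0 | n'.+1, j'.+1 => qbin n' j' + q ^+ j * qbin n' j end.

Arguments qbin : simpl never.

Lemma qbin0 n : qbin n 0 = 1. Proof. by case: n. Qed.
Lemma qbinS n j : qbin n.+1 j.+1 = qbin n j + q ^+ j.+1 * qbin n j.+1.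
Proof. by []. Qed.
Lemma qbin_small n j : (n < j)%N -> qbin n j = 0.
Proof.
elim: n j => [|n IH] [|j] //; rewrite ltnS => h.
by rewrite qbinS !IH ?mulr0 ?addr0 // ltnW.
Qed.

(** This identity stands in for the quotient formula, whose denominators may vanish at roots of
    unity. *)
Lemma qbin_absorb n j : (1 - q ^+ j.+1) * qbin n.+1 j.+1 = (1 - q ^+ n.+1) * qbin n j.
Proof.
elim: n j => [|n IH] [|j].
- by rewrite qbinS (@qbin_small 0 1) // mulr0 addr0.
- by rewrite !qbin_small ?mulr0.
- have := IH 0%N; rewrite [qbin n.+2 _]qbinS !qbin0 !expr1 => h. have -> : (1 - q) * (1 + q * qbin n.+1 1) = 1 - q + q * ((1 - q) * qbin n.+1 1) by ring. by rewrite h [q ^+ n.+2]exprS; ring.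
- have h1 := IH j.+1; have h2 := IH j; have h3 := qbinS n j. rewrite qbinS. have -> : (1 - q ^+ j.+2) * (qbin n.+1 j.+1 + q ^+ j.+2 * qbin n.+1 j.+2)
   = (1 - q ^+ j.+2) * qbin n.+1 j.+1 + q ^+ j.+2 * ((1 - q ^+ j.+2) * qbin n.+1 j.+2) by ring.
 rewrite h1. have -> : q ^+ j.+2 * ((1 - q ^+ n.+1) * qbin n j.+1) = q * ((1 - q ^+ n.+1) * qbin n.+1 j.+1) - q * ((1 - q ^+ n.+1) * qbin n j).
  by rewrite h3 exprS; ring.
 by rewrite -h2 [q ^+ n.+2]exprS exprS; ring.
Qed.

Definition qalt n := \sum_(j < n.+1) (-1) ^+ j * qbin n j.
Lemma qaltSS n : qalt n.+2 = (1 - q ^+ n.+1) * qalt n.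
Proof.
have e : qalt n.+2 = \sum_(j < n.+2) (-1) ^+ j * (q ^+ j - 1) * qbin n.+1 j.
 rewrite /qalt big_ord_recl qbin0 /=. under eq_bigr => j _ do rewrite /bump add1n exprS. rewrite (eq_bigr (fun j : 'I_n.+2 => - ((-1) ^+ j * qbin n.+1 j) +
      (-1) ^+ j.+1 * q ^+ j.+1 * qbin n.+1 j.+1)); last first.
  by move=> j _; rewrite qbinS [(-1) ^+ j.+1]exprS; ring.
 rewrite big_split /= sumrN [in RHS](eq_bigr (fun j : 'I_n.+2 => (-1) ^+ j * q ^+ j * qbin n.+1 j - (-1) ^+ j * qbin n.+1 j)); last by move=> j _; ring.
 rewrite sumrB [X in _ = X - _]big_ord_recl [X in _ + (_ + X)]big_ord_recr /= qbin0. rewrite (@qbin_small n.+1 n.+2) // mulr0 addr0 !expr0 !mul1r addrCA addrC. by [].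
rewrite e big_ord_recl expr0 subrr mulr0 mul0r add0r mulr_sumr; apply: eq_bigr => j _.
rewrite !lift0 exprS.
have h := qbin_absorb n j.
have -> : -1 * (-1) ^+ j * (q ^+ j.+1 - 1) * qbin n.+1 j.+1 = (-1) ^+ j * ((1 - q ^+ j.+1) * qbin n.+1 j.+1) by ring.
by rewrite h; ring.
Qed.

(** Gauss's product for the alternating sum of Gaussian binomials, from which he found the sign of
    his sums. *)
Lemma qalt_even k : qalt k.*2 = \prod_(i < k) (1 - q ^+ i.*2.+1).
Proof.
elim: k => [|k IH]; first by rewrite big_ord0 /qalt big_ord1 mul1r.
by rewrite qaltSS IH big_ord_recr mulrC.
Qed.

(** At a primitive root of unity of order c + 1 the inner coefficients of row c + 1 vanish, so the
    Pascal rule links consecutive entries of row c by the factor - q^(-j-1). *)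
Lemma qbin_root c j : q ^+ c.+1 = 1 -> (forall i, (0 < i < c.+1)%N -> q ^+ i != 1) -> (j <= c)%N -> (-1) ^+ j * qbin c j * q ^+ (\sum_(i < j.+1) i) = 1.
Proof.
move=> qc prim; elim: j => [|j IH] jc; first by rewrite qbin0 big_ord1 !mulr1.
have z : qbin c.+1 j.+1 = 0.
 have /eqP := qbin_absorb c j; rewrite qc subrr mul0r mulf_eq0 subr_eq0 eq_sym. by rewrite (negbTE (prim _ _)) // => /eqP.
move: z; rewrite qbinS => /eqP; rewrite addrC addr_eq0 => /eqP z.
rewrite big_ord_recr /= exprD exprS -[RHS](IH (ltnW jc)).
have -> : -1 * (-1) ^+ j * qbin c j.+1 * (q ^+ (\sum_(i < j.+1) i) * q ^+ j.+1) = -1 * (-1) ^+ j * q ^+ (\sum_(i < j.+1) i) * (q ^+ j.+1 * qbin c j.+1) by ring.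
by rewrite z; ring.
Qed.
End QBinomial.

Section Gauss.
Variable R : realType.
Local Notation ee := (efrac R).
Local Notation eps := (eps_odd R).

Definition gauss c (a : int) : R[i] := \sum_(y < c) ee c (a * y%:Z ^+ 2).
Lemma gs_per c a : (0 < c)%N -> per c (fun y => ee c (a * y ^+ 2)).
Proof.
move=> c0 x k; rewrite (_ : a * _ = a * x ^+ 2 + c%:Z * (a * (2 * x * k + c%:Z * k ^+ 2))).
 exact: ee_per.
by ring.
Qed.

Lemma gs_norm c a : odd c -> coprimez a c -> normc (gauss c a) ^+ 2 = c%:R.
Proof.
move=> oc cp; have c0 : (0 < c)%N by lia.
apply: complexI; rewrite -mulC_conj rmorph_nat.
rewrite [X in _ * X](_ : _ = \sum_(z < c) ee c (- (a * z%:Z ^+ 2))); last first.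
 by rewrite /gauss rmorph_sum; apply: eq_bigr => z; rewrite eeN.
rewrite mulr_sumr.
have -> : \sum_(z < c) gauss c a * ee c (- (a * z%:Z ^+ 2)) = \sum_(z < c) \sum_(y < c) ee c (a * y%:Z ^+ 2) * ee c (2 * a * y * z).
 apply: eq_bigr => z _; rewrite /gauss -(sum_shift z c0 (gs_per a c0)) mulr_suml. by apply: eq_bigr => y _; rewrite -!eeD; congr ee; ring.
rewrite exchange_big /=.
under eq_bigr => y _ do rewrite -mulr_sumr ee_orth //.
rewrite (bigD1 (Ordinal c0)) //= !mulr0 dvdz0 ee0 mul1r big1 ?addr0 // => y yn.
case: ifP; rewrite ?mulr0 // -mulrA Gauss_dvdzr; last first.
 by rewrite coprimezE coprimen2.
rewrite Gauss_dvdzr; last by rewrite coprimez_sym.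
move=> /(dvdz_small (ltn_ord y)) e; move/negP: yn; case; apply/eqP/val_inj.
by [].
Qed.

(** With q = e(-2 / c) the terms of the alternating sum become e((j^2 + j) / c), and j^2 + j
    completes to a square because 2 (k + 1) = 1 modulo c. Gauss's product then gives a product of
    sines. *)
Lemma gs_prod k : let c := k.*2.+1 in gauss c 1 = \prod_(i < k) (2 * 'i * (sin (2 * pi * (i.*2.+1)%:R / c%:R) : R)%:C).
Proof.
move=> c; have c0 : (0 < c)%N by [].
pose q := ee c (-2).
have qX n : q ^+ n = ee c (- 2 * n%:Z) by rewrite -ee_prod.
have cz : c%:Z = 2 * k%:Z + 1 by rewrite /c; lia.
have qc : q ^+ c = 1 by rewrite qX mulrC ee_mul.
have prim i : (0 < i < k.*2.+1)%N -> q ^+ i != 1.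
 move=> /andP[i0 ic]; rewrite qX ee_eq1 // mulNr; apply/negP => h. have : (c %| 2 * i%:Z)%Z by rewrite -rpredN. rewrite Gauss_dvdzr; last by rewrite coprimezE coprimen2 /c /= odd_double.
 by move=> /(dvdz_small ic) e; rewrite e in i0.
have tri j : (2 * (\sum_(i < j.+1) i)%N%:Z = j%:Z * j + j)%R.
 elim: j => [|j IH]; first by rewrite big_ord1. by rewrite big_ord_recr /= PoszD mulrDr IH; lia.
have e1 : qalt q k.*2 = \sum_(j < c) ee c (j%:Z ^+ 2 + j).
 apply: eq_bigr => j _; have := qbin_root qc prim (ltnSE (ltn_ord j)). rewrite qX mulNr tri => h. apply: (mulIf (ee_neq0 R c (- (j%:Z * j + j)))). by rewrite -eeD subrr ee0.
have e2 : ee c ((k%:Z + 1) ^+ 2) * qalt q k.*2 = gauss c 1.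
 rewrite e1 mulr_sumr /gauss -(sum_shift (k%:Z + 1) c0 (gs_per 1 c0)). apply: eq_bigr => j _; rewrite -eeD; apply: ee_eqm => //; apply/dvdzP; exists (- j%:Z). by lia.
(* (k + 1)^2 = k^2 modulo c, and k^2 is the sum of the odd numbers 2 i + 1. So e((k + 1)^2 / c)
   spreads over the factors and turns 1 - e(-2 (2 i + 1) / c) into e((2 i + 1) / c) - e(- (2 i + 1)
   / c). *)
have sq : (\sum_(i < k) i.*2.+1 = k ^ 2)%N.
 elim: (k) => [|n IH]; first by rewrite big_ord0. by rewrite big_ord_recr /= IH; lia.
rewrite -e2 qalt_even.
have -> : ee c ((k%:Z + 1) ^+ 2) = ee c (k ^ 2)%N.
 by apply: ee_eqm => //; apply/dvdzP; exists 1; lia.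
rewrite -sq (big_morph (fun n : nat => ee c n) (id1 := 1) (op1 := *%R)) ?ee0 //; last first.
 by move=> x y; rewrite PoszD eeD.
rewrite -big_split /=; apply: eq_bigr => i _; rewrite qX mulrBr mulr1 -eeD.
have -> : (i.*2.+1)%:Z + -2 * (i.*2.+1)%:Z = - (i.*2.+1)%:Z by ring.
rewrite eeN /ee /e2pi -mulrA; set t := 2 * _.
have -> : sin (2 * pi * (i.*2.+1)%:R / c%:R) = sin t by rewrite /t !mulrA.
by apply/eqP; rewrite eq_complex /=; apply/andP; split; apply/eqP; ring.
Qed.

(** The angle exceeds pi exactly for the last [l] of the [k] factors, which are the negative
    ones. *)
Lemma sin_prod_sign k l (b : bool) : k = (l.*2 + b)%N -> exists2 P : R, 0 < P & \prod_(i < k) sin (2 * pi * (i.*2.+1)%:R / (k.*2.+1)%:R) = (-1) ^+ l * P.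
Proof.
move=> ek; set c := (k.*2.+1)%:R : R.
have c0 : 0 < c by [].
pose f i : R := sin (2 * pi * (i.*2.+1)%:R / c).
have pos i : (i < l + b)%N -> 0 < f i.
 move=> il; apply: sin_gt0_pi; rewrite divr_gt0 ?mulr_gt0 ?pi_gt0 //=. rewrite ltr_pdivrMr // mulrAC [ltRHS]mulrC ltr_pM2r ?pi_gt0 // /c -natrM ltr_nat. by lia.
have neg i : (i < l)%N -> f (l + b + i)%N < 0.
 move=> il; rewrite /f; set x := _ / c. have -> : x = (x - pi) + pi by lra. rewrite sinDpi oppr_lt0; apply: sin_gt0_pi. have e : x - pi = pi * ((2 * ((l + b + i).*2.+1)%:R - c) / c).
  by rewrite mulrBl (divff (lt0r_neq0 c0)) /x; ring.
 have h1 : c < 2 * ((l + b + i).*2.+1)%:R.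
  by rewrite /c -natrM ltr_nat; lia.
 have h2 : 2 * ((l + b + i).*2.+1)%:R - c < c.
  by rewrite ltrBlDr /c -natrM -natrD ltr_nat; lia.
 by rewrite e mulr_gt0 ?pi_gt0 ?divr_gt0 ?subr_gt0 //= -[ltRHS]mulr1 ltr_pM2l ?pi_gt0 // ltr_pdivrMr // mul1r.
exists ((\prod_(i < l + b) f i) * \prod_(i < l) - f (l + b + i)%N).
 by apply: mulr_gt0; apply: prodr_gt0 => i _; rewrite ?oppr_gt0; [apply: pos|apply: neg].
have -> : k = (l + b + l)%N by rewrite ek; lia.
rewrite big_split_ord /= prodrN card_ord.
have sg : (-1) ^+ l * (-1) ^+ l = 1 :> R by rewrite -exprMn mulrNN mulr1 expr1n.
by rewrite mulrCA [(-1) ^+ l * (_ * _)]mulrA sg mul1r.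
Qed.

Lemma normc_eps c : normc (eps c) = 1.
Proof. by rewrite /eps_odd; case: ifP; rewrite ?normc1 //= expr0n expr1n add0r sqrtr1. Qed.
(** The absolute value is known from [gs_norm]; the product of sines supplies the argument, with
    ['i] to the power k and the sign (-1)^l combining to eps. *)
Lemma gs1 c : odd c -> gauss c 1 = eps c * (Num.sqrt c%:R)%:C.
Proof.
move=> oc; pose k := c./2; have ec : c = k.*2.+1 by lia.
pose l := k./2; have ek : k = (l.*2 + odd k)%N by lia.
have [P P0 eP] := sin_prod_sign ek.
have eG : gauss c 1 = eps c * (2 ^+ k * P)%:C.
 rewrite ec gs_prod (eq_bigr (fun i : 'I_k => (2 * 'i) * (sin (2 * pi * (i.*2.+1)%:R / (k.*2.+1)%:R))%:C)) // big_split /= prodr_const card_ord -(rmorph_prod (real_complex R)) eP /eps_odd; have -> : (k.*2.+1 %% 4 == 1)%N = ~~ odd k.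
  by lia.
 rewrite rmorphM exprMn rmorphM !rmorphXn /= rmorphN1. have i2 : 'i ^+ k = 'i ^+ odd k * (-1) ^+ l :> R[i] by rewrite {1}ek exprD -mul2n exprM sqr_i mulrC.
 rewrite i2 (_ : 2%:C = 2); last by rewrite rmorph_nat. have s2 : ((-1) ^+ l) ^+ 2 = 1 :> R[i] by rewrite -exprM mulnC exprM sqrrN !expr1n.
 transitivity ('i ^+ odd k * ((-1) ^+ l) ^+ 2 * (2 ^+ k * P%:C)); first by ring. by rewrite s2 mulr1; case: odd.
rewrite eG; congr (_ * _%:C).
have c1 : coprimez 1 c by rewrite coprimezE coprime1n.
have := gs_norm oc c1; rewrite eG normcM normc_eps mul1r normc_real.
have p0 : 0 <= 2 ^+ k * P by rewrite mulr_ge0 ?exprn_ge0 // ltW.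
by rewrite ger0_norm // => <-; rewrite sqrtr_sqr ger0_norm.
Qed.

Lemma gs1_neq0 c : odd c -> gauss c 1 != 0.
Proof.
move=> oc; have c0 : (0 < c)%N by lia.
have := gs_norm oc (a := 1); rewrite coprimezE coprime1n => /(_ isT) h.
by apply/eqP => e; move: h; rewrite e normc0 expr0n => /esym/eqP; rewrite pnatr_eq0; lia.
Qed.

Lemma gs_crt c d a : (0 < c)%N -> (0 < d)%N -> coprime c d -> gauss (c * d) a = gauss c (a * d) * gauss d (a * c).
Proof.
move=> c0 d0 cp; rewrite /gauss (@sum_crt R c d (fun y => ee (c * d) (a * y ^+ 2))) //; last by apply: gs_per; rewrite muln_gt0 c0.
rewrite mulr_suml; apply: eq_bigr => x _; rewrite mulr_sumr; apply: eq_bigr => y _.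
rewrite -(ee_scale R c _ d0) -(ee_scale R d _ c0) [(d * c)%N]mulnC -eeD.
have cd0 : (0 < c * d)%N by lia.
rewrite -[in RHS](ee_per R _ (2 * a * x * y) cd0); congr ee; rewrite PoszM; ring.
Qed.

(** For y = y0 + p b l the phase depends on l through 2 a y0 l / p only, so the sum over l vanishes
    unless p divides y0. *)
Lemma gs_psq p b a : prime p -> odd p -> (0 < b)%N -> coprimez a p -> gauss (p * b * p) a = p%:R * gauss b a.
Proof.
move=> pp op b0 cp; have p0 := prime_gt0 pp.
have pb0 : (0 < p * b)%N by lia.
rewrite /gauss (@sum_split R (p * b) p (fun y => ee (p * b * p) (a * y ^+ 2))).
have step (y : int) : \sum_(l < p) ee (p * b * p) (a * (y + (p * b)%N%:Z * l) ^+ 2) = (if (p %| y)%Z then p%:R else 0) * ee (p * b * p) (a * y ^+ 2).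
 have -> : (p %| y)%Z = (p %| 2 * a * y)%Z by rewrite -mulrA Gauss_dvdzr ?coprimezE ?coprimen2 // Gauss_dvdzr // coprimez_sym. rewrite -ee_orth // mulr_suml; apply: eq_bigr => l _.
 rewrite -(ee_scale R p (2 * a * y * l) pb0) [(p * (p * b))%N]mulnC -eeD. have pp0 : (0 < p * b * p)%N by lia. rewrite -[in RHS](ee_per R _ (a * b * l%:Z ^+ 2) pp0); congr ee; rewrite !PoszM; ring.
under eq_bigr => y _ do rewrite step.
rewrite (@sum_split R p b (fun y => (if (p %| y)%Z then p%:R else 0) * ee (p * b * p) (a * y ^+ 2))) (bigD1 (Ordinal p0)) //= [X in _ + X]big1 ?addr0 => [|r rn]; last first.
 apply: big1 => l _; case: ifP; rewrite ?mul0r rpredDr ?dvdz_mulr //. by move=> /(dvdz_small (ltn_ord r)) e; move/negP: rn; case; apply/eqP/val_inj.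
rewrite mulr_sumr; apply: eq_bigr => y _.
rewrite add0r dvdz_mulr // -(ee_scale R b _ (_ : 0 < p * p)%N) ?muln_gt0 ?p0 //; congr (_ * _).
by rewrite [(p * b)%N]mulnC -mulnA; congr ee; rewrite PoszM; ring.
Qed.
End Gauss.

(** * Legendre and Jacobi symbols and quadratic reciprocity *)

Lemma Euclid_dvdz p (a b : int) : prime p -> (p %| a * b)%Z = (p %| a)%Z || (p %| b)%Z.
Proof. by move=> pp; rewrite !dvdzE abszM Euclid_dvdM. Qed.

Lemma copz_prime p a : prime p -> coprimez a p = ~~ (p %| a)%Z.
Proof. by move=> pp; rewrite coprimezE coprime_sym prime_coprime. Qed.
Lemma dvdz_eqm (p a b : int) : (p %| a - b)%Z -> (p %| a)%Z = (p %| b)%Z.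
Proof. by move=> h; rewrite -(subrK b a) rpredDl. Qed.
Lemma eqmod_small p x y : (x < p)%N -> (y < p)%N -> (p %| x%:Z - y%:Z)%Z -> x = y.
Proof.
by move=> xp yp; rewrite -eqz_mod_dvd !modz_nat => /eqP []; rewrite !modn_small.
Qed.

Section Legendre.
Variable p : nat.
Hypotheses (pp : prime p) (op : odd p).
Let p0 : (0 < p)%N := prime_gt0 pp.

Lemma legendreE a : legendre a p = if (p %| a)%Z then 0 else if [exists x : 'I_p, (p %| x%:Z ^+ 2 - a)%Z] then 1 else -1.
Proof.
rewrite /legendre; case: ifP => // _; congr (if _ then _ else _).
by apply: eq_existsb => x; rewrite eqz_mod_dvd.
Qed.

Lemma legendre_eqm a b : (p %| a - b)%Z -> legendre a p = legendre b p.
Proof.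
move=> h; rewrite !legendreE.
have -> : (p %| a)%Z = (p %| b)%Z by apply: dvdz_eqm.
have -> // : [exists x : 'I_p, (p %| x%:Z ^+ 2 - a)%Z] = [exists x : 'I_p, (p %| x%:Z ^+ 2 - b)%Z].
apply: eq_existsb => x.
by apply: dvdz_eqm; rewrite (_ : _ - _ = - (a - b)) ?rpredN //; ring.
Qed.

Lemma sqset_card (b x : int) : ~~ (p %| b)%Z -> (#|[set y : 'I_p | (p %| (b * y%:Z ^+ 2 - x)%R)%Z]| <= 2)%N.
Proof.
move=> pb; set A := [set y | _].
have [->|[z zA]] := set_0Vmem A; first by rewrite cards0.
pose nz := Ordinal (ltn_pmod (p - z) p0).
apply: (@leq_trans #|[set z; nz]|); last by rewrite cards2; case: eqP.
apply/subset_leq_card/subsetP => y; rewrite !inE => hy; move: zA; rewrite inE => hz.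
have := rpredB hy hz; rewrite (_ : _ - _ - _ = b * ((y%:Z - z%:Z) * (y%:Z + z))); last by ring.
rewrite !Euclid_dvdz // (negbTE pb) /= => /orP[h|h]; apply/orP; [left|right]; apply/eqP/val_inj => /=.
 exact: eqmod_small.
have [z0|z0] := posnP z.
 rewrite z0 subn0 modnn; rewrite z0 addr0 in h; exact: dvdz_small.
have zp := ltn_ord z; rewrite modn_small; last by lia.
apply: eqmod_small => //; first by lia.
rewrite (_ : _ - _ = (y%:Z + z) - p%:Z); last by lia.
by rewrite rpredB.
Qed.

Lemma sum_delta (T : nmodType) (f : int -> T) (z : int) : (forall x y, (p %| x - y)%Z -> f x = f y) -> \sum_(x < p | (p %| z - x%:Z)%Z) f x = f z.
Proof.
move=> pf; have [r [k [rp ez]]] := int_ediv z p0.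
rewrite (big_pred1 (Ordinal rp)) => [|x] /=.
 by apply: pf; rewrite ez opprD addrA subrr add0r rpredN dvdz_mulr.
apply/idP/eqP => [h|->]; last by rewrite ez addrAC subrr add0r dvdz_mulr.
apply/val_inj/esym/(@eqmod_small p) => //=; move: h.
by rewrite ez addrAC rpredDr // dvdz_mulr.
Qed.

(** For a nonresidue b the values y^2 and b y^2 together meet each class exactly twice: at most
    twice, since no nonzero class is met by both, and 2 p times in all. *)
Lemma nonres_sum (V : zmodType) b (f : int -> V) : (forall x y, (p %| x - y)%Z -> f x = f y) -> legendre b p = -1 -> \sum_(y < p) f (y%:Z ^+ 2) + \sum_(y < p) f (b * y%:Z ^+ 2) = (\sum_(x < p) f x) *+ 2.
Proof.
move=> pf; rewrite legendreE; case: ifP => // pb; case: ifP => // nr _.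
have p1 : ~~ (p %| 1)%Z by rewrite dvdzE dvdn1 neq_ltn prime_gt1 ?orbT.
pose A (x : int) := [set y : 'I_p | (p %| 1 * y%:Z ^+ 2 - x)%Z].
pose B (x : int) := [set y : 'I_p | (p %| b * y%:Z ^+ 2 - x)%Z].
pose cnt (x : 'I_p) := (#|A x| + #|B x|)%N.
have le1 c (x : 'I_p) : ~~ (p %| c)%Z -> (p %| x%:Z)%Z -> (#|[set y : 'I_p | (p %| (c * y%:Z ^+ 2 - x%:Z)%R)%Z]| <= 1)%N.
 move=> pc px; apply: (@leq_trans #|[set Ordinal p0]|); last by rewrite cards1. apply/subset_leq_card/subsetP => y. rewrite !inE rpredBr // expr2 !Euclid_dvdz // (negbTE pc) /= orbb => h.
 by apply/eqP/val_inj/(dvdz_small (ltn_ord y) h).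
have cnt2 x : (cnt x <= 2)%N.
 rewrite /cnt; case: (boolP (p %| x%:Z)%Z) => px.
  by apply: (leq_add (le1 1 x p1 px)); apply: le1; rewrite ?pb.
 have [->|[y yA]] := set_0Vmem (A x); first by rewrite cards0; apply: sqset_card; rewrite pb. have [->|[z zB]] := set_0Vmem (B x); first by rewrite cards0 addn0; apply: sqset_card.
 exfalso; move: yA zB; rewrite !inE mul1r => hy hz. have pz : coprimez z p.
  rewrite copz_prime //; apply/negP => pz; move/negP: px; apply. by rewrite -(dvdz_eqm hz) mulrA dvdz_mull.
 move/existsP: nr; apply; have [r [k [rp er]]] := int_ediv (y%:Z * iv p z) p0. exists (Ordinal rp) => /=. have e1 := iv_mul pz; set w := iv p _ in er e1.
 have -> : r%:Z = y%:Z * w - p%:Z * k by rewrite er; ring. have -> : (y%:Z * w - p%:Z * k) ^+ 2 - b = p%:Z * (p%:Z * k ^+ 2 - 2 * y%:Z * w * k) + w ^+ 2 * (y%:Z ^+ 2 - x%:Z)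
   - w ^+ 2 * (b * z%:Z ^+ 2 - x%:Z) + b * (z%:Z * w - 1) * (z%:Z * w + 1) by ring.
 apply: rpredD; last by rewrite -mulrA dvdz_mull // dvdz_mulr. apply: rpredB; last by rewrite dvdz_mull. by apply: rpredD; [apply: dvdz_mulr | rewrite dvdz_mull].
have sumE (c : int) (T : nmodType) (g : int -> T) : (forall x y, (p %| x - y)%Z -> g x = g y) -> \sum_(y < p) g (c * y%:Z ^+ 2) = \sum_(x < p) g x *+ #|[set y : 'I_p | (p %| c * y%:Z ^+ 2 - x%:Z)%Z]|.
 move=> pg; under eq_bigr => y _ do rewrite -(sum_delta _ pg). under eq_bigr => y _ do rewrite big_mkcond. rewrite exchange_big /=; apply: eq_bigr => x _; rewrite -big_mkcond /=.
 by rewrite -sumr_const; apply: eq_bigl => y; rewrite inE.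
have tot : (\sum_(x < p) (2 - cnt x) = 0)%N.
 rewrite sumnB; last by move=> x _; exact: cnt2. have h c : (\sum_(x < p) #|[set y : 'I_p | (p %| (c * y%:Z ^+ 2 - x%:Z)%R)%Z]| = p)%N.
  have := @sumE c nat (fun=> 1%N) (fun _ _ _ => erefl). rewrite sum_nat_const card_ord muln1 => hh; apply/esym; rewrite {1}hh. by apply: eq_bigr => x; elim: #|_| => // n IH; rewrite mulrS IH.
 by rewrite big_split /= !h sum_nat_const card_ord; lia.
have c2 x : cnt x = 2%N.
 move/eqP: tot; rewrite sum_nat_eq0 => /forallP /(_ x); have := cnt2 x; lia.
under eq_bigr => y _ do rewrite -[y%:Z ^+ 2]mul1r.
rewrite !sumE // -big_split /= -sumrMnl; apply: eq_bigr => x _.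
by rewrite -mulrnDr -/(cnt x) c2.
Qed.

Variable R : realType.
Local Notation ee := (efrac R).
Local Notation gs := (gauss R).

(** For a residue b its square root rescales the variable. For a nonresidue the sums for a and a b
    add up to twice a complete sum of a nontrivial character, which is 0. *)
Lemma gs_legM a b : ~~ (p %| a)%Z -> ~~ (p %| b)%Z -> gs p (a * b) = (legendre b p)%:~R * gs p a.
Proof.
move=> pa pb; case: (boolP [exists x : 'I_p, (p %| x%:Z ^+ 2 - b)%Z]) => ex.
 have -> : legendre b p = 1 by rewrite legendreE (negbTE pb) ex. rewrite mul1r; case/existsP: ex => x hx. have cx : coprimez x p.
  rewrite copz_prime //; apply: contra pb => h. by rewrite -(dvdz_eqm hx) dvdz_mulr.
 rewrite /gs -(sum_scale p0 (gs_per R a p0) cx); apply: eq_bigr => y _. apply: ee_eqm => //; rewrite (_ : _ - _ = (x%:Z ^+ 2 - b) * (- a * y%:Z ^+ 2)); last by ring. by rewrite dvdz_mulr.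
have lb : legendre b p = -1 by rewrite legendreE (negbTE pb) (negbTE ex).
have pf x y : (p %| x - y)%Z -> ee p (a * x) = ee p (a * y).
 by move=> h; apply: ee_eqm => //; rewrite -mulrBr dvdz_mull.
have := ee_orth R a p0; rewrite (negbTE pa) => s0.
rewrite lb mulN1r; apply/eqP; rewrite -addr_eq0 addrC; apply/eqP.
transitivity ((\sum_(x < p) ee p (a * x)) *+ 2); last by rewrite s0 mul0rn.
rewrite -(nonres_sum pf lb).
by congr (_ + _); apply: eq_bigr => y; rewrite mulrA.
Qed.

(** The Gauss sum for a b is reached from the one for 1 in one step or in two, and it does not
    vanish. *)
Lemma legendreM a b : legendre (a * b) p = legendre a p * legendre b p.
Proof.
case: (boolP (p %| a)%Z) => pa.
 by rewrite [legendre a p]legendreE pa mul0r legendreE Euclid_dvdz // pa.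
case: (boolP (p %| b)%Z) => pb.
 by rewrite [legendre b p]legendreE pb mulr0 legendreE Euclid_dvdz // pb orbT.
have p1 : ~~ (p %| 1)%Z by rewrite dvdzE dvdn1 neq_ltn prime_gt1 ?orbT.
have h1 := gs_legM pa pb; have h2 := gs_legM p1 pa; rewrite mul1r in h2.
have pab : ~~ (p %| a * b)%Z by rewrite Euclid_dvdz // negb_or pa.
have h3 := gs_legM p1 pab; rewrite mul1r in h3.
have := h3; rewrite h1 h2 mulrA => /(mulIf (gs1_neq0 R op)) e.
by apply: (@intr_inj R[i]); rewrite -e rmorphM mulrC.
Qed.

Lemma legendre_sq a : ~~ (p %| a)%Z -> legendre a p ^+ 2 = 1.
Proof. by rewrite legendreE => /negbTE->; case: ifP. Qed.
End Legendre.

Lemma jacobiE a c : jacobi a c = \prod_(p <- primes c) legendre a p ^+ logn p c.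
Proof. by rewrite /jacobi prime_decompE big_map. Qed.

(** Gives products over the primes of different moduli a common range, so that exponents can be
    added factor by factor. *)
Lemma jacobi_index a c N : (0 < c < N)%N -> jacobi a c = \prod_(0 <= p < N | prime p) legendre a p ^+ logn p c.
Proof.
move=> /andP[c0 cN]; rewrite jacobiE.
rewrite [RHS](bigID (fun p => p %| c)%N) /= [X in _ = _ * X]big1 ?mulr1; last first.
 by move=> p /andP[pp pc]; rewrite lognE (negbTE pc) !andbF.
rewrite -[RHS]big_filter; apply/perm_big/uniq_perm; first exact: primes_uniq.
 by rewrite filter_uniq ?iota_uniq.
move=> p; rewrite mem_filter mem_index_iota mem_primes c0 /=.
case: (boolP (prime p)) => pp; case: (boolP (p %| c)%N) => //= pc.
by rewrite (leq_ltn_trans (dvdn_leq c0 pc)).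
Qed.

Lemma jacobi1 a : jacobi a 1 = 1.
Proof. by rewrite jacobiE big_nil. Qed.
Lemma jacobiMr a b c : (0 < b)%N -> (0 < c)%N -> jacobi a (b * c) = jacobi a b * jacobi a c.
Proof.
move=> b0 c0; have bc : (0 < b * c)%N by lia.
by rewrite !(@jacobi_index _ _ (b * c).+1) ?bc ?leqnn ?b0 ?c0 ?ltnS ?leq_pmull ?leq_pmulr // -big_split; apply: eq_bigr => p; rewrite lognM // exprD.
Qed.

Lemma jacobi_prime a p : prime p -> jacobi a p = legendre a p.
Proof. by move=> pp; rewrite jacobiE primes_prime // big_seq1 logn_prime // eqxx. Qed.
Lemma odd_prime_of c p : odd c -> (p \in primes c) -> prime p /\ odd p.
Proof.
by rewrite mem_primes => oc /and3P[-> pc]; split => //; apply: dvdn_odd oc.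
Qed.

Section Recip.
Variable R : realType.

Lemma jacobiMl a b c : odd c -> jacobi (a * b) c = jacobi a c * jacobi b c.
Proof.
move=> oc; rewrite !jacobiE -big_split /=; apply: eq_big_seq => p pc.
by have [pp op] := odd_prime_of oc pc; rewrite (legendreM pp op R) exprMn.
Qed.

Lemma jacobi_eqm a b c : (c%:Z %| a - b)%Z -> jacobi a c = jacobi b c.
Proof.
move=> h; rewrite !jacobiE; apply: eq_big_seq => p.
rewrite mem_primes => /and3P[pp c0 pc]; congr (_ ^+ _); apply: legendre_eqm.
by apply: dvdz_trans h.
Qed.

Lemma jacobi_sq a c : (0 < c)%N -> odd c -> coprimez a c -> jacobi a c ^+ 2 = 1.
Proof.
move=> c0 oc cp; rewrite jacobiE -prodrXl big_seq big1 // => p pc.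
have [pp op] := odd_prime_of oc pc.
have pa : ~~ (p %| a)%Z.
 rewrite -copz_prime //; move: cp; rewrite !coprimezE /=; apply: coprime_dvdr. by move: pc; rewrite mem_primes => /and3P[].
by rewrite -exprM mulnC exprM legendre_sq // expr1n.
Qed.

Lemma jacobi_0 a c : (0 < c)%N -> ~~ coprimez a c -> jacobi a c = 0.
Proof.
move=> c0; rewrite coprimezE /= => cp.
have g1 : (1 < gcdn `|a| c)%N.
 have : (0 < gcdn `|a| c)%N by rewrite gcdn_gt0 c0 orbT. by lia.
have pp := pdiv_prime g1; have pd := pdiv_dvd (gcdn `|a| c).
set p := pdiv _ in pp pd; have pa := dvdn_trans pd (dvdn_gcdl _ _).
have pc := dvdn_trans pd (dvdn_gcdr _ _).
have pin : p \in primes c by rewrite mem_primes pp c0.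
rewrite jacobiE (bigD1_seq p) ?primes_uniq //=.
have -> : legendre a p = 0 by rewrite /legendre dvdzE pa.
by rewrite -lt0n || rewrite expr0n gtn_eqF ?mul0r // logn_gt0.
Qed.

Lemma jacobi_1l c : odd c -> jacobi 1 c = 1.
Proof.
move=> oc; rewrite jacobiE big_seq big1 // => p pc.
have [pp op] := odd_prime_of oc pc; have := legendreM pp op R 1 1.
have := @legendre_sq p 1; rewrite mulr1 => h1 h2.
have p1 : ~~ (p %| 1)%Z by rewrite dvdzE dvdn1 neq_ltn prime_gt1 ?orbT.
by have := h1 p1; rewrite expr2 -h2 => ->; rewrite expr1n.
Qed.

Lemma jacobi_sqr_mul a b c : odd c -> coprimez b c -> jacobi (a * b ^+ 2) c = jacobi a c.
Proof.
move=> oc cp; have c0 : (0 < c)%N by lia.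
by rewrite jacobiMl // jacobiMl // -expr2 jacobi_sq // mulr1.
Qed.

Local Notation gs := (gauss R).
Local Notation eps := (eps_odd R).

(** Induction on c = b p with p its least prime. If p divides b, then p^2 leaves by [gs_psq] without
    changing the symbol; otherwise the sum splits by the Chinese remainder theorem. *)
Lemma gs_jac c a : odd c -> coprimez a c -> gs c a = (jacobi a c)%:~R * gs c 1.
Proof.
elim/ltn_ind: c a => c IH a oc cp; have c0 : (0 < c)%N by lia.
case: (ltnP 1 c) => [c1|c1]; last first.
 have -> : c = 1 by lia. by rewrite jacobi1 mul1r /GRing.one /efrac /gauss !big_ord1 !ee1.
have pp := pdiv_prime c1; set p := pdiv c in pp; have pc : (p %| c)%N := pdiv_dvd c.
have op : odd p := dvdn_odd pc oc; have p0 := prime_gt0 pp.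
case/dvdnP: pc => b eb; have b0 : (0 < b)%N by move: c0; rewrite eb muln_gt0 => /andP[].
have ob : odd b by move: oc; rewrite eb oddM => /andP[].
have bc : (b < c)%N by rewrite eb ltn_Pmulr ?prime_gt1.
have cpd d : (d %| c)%N -> coprimez a d.
 by move=> dc; move: cp; apply: coprime_dvdr.
have cpp : coprimez a p by apply: cpd; rewrite eb dvdn_mull.
have cpb : coprimez a b by apply: cpd; rewrite eb dvdn_mulr.
case: (boolP (p %| b)%N) => [/dvdnP[b' eb']|pb].
 have b'0 : (0 < b')%N by move: b0; rewrite eb' muln_gt0 => /andP[]. have ob' : odd b' by move: ob; rewrite eb' oddM => /andP[]. have b'c : (b' < c)%N by apply: leq_ltn_trans bc; rewrite eb' leq_pmulr.
 have cpb' : coprimez a b' by apply: cpd; rewrite eb eb' dvdn_mulr // dvdn_mulr. have ec : c = (p * b' * p)%N by lia. rewrite ec !gs_psq ?coprimezE ?coprime1n // IH //.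
 have -> : jacobi a (p * b' * p) = jacobi a b' by rewrite !jacobiMr ?muln_gt0 ?p0 // mulrAC -expr2 jacobi_prime // legendre_sq ?mul1r // -copz_prime. by rewrite mulrCA.
have cbp : coprime b p by rewrite coprime_sym prime_coprime.
rewrite eb !gs_crt // !mul1r jacobiMr // rmorphM.
have cp' : coprimez p b by rewrite coprimezE coprime_sym.
have gp x : coprimez x p -> gs p x = (legendre x p)%:~R * gs p 1.
 move=> cx; have := @gs_legM p pp op R 1 x; rewrite mul1r; apply.
  by rewrite dvdzE dvdn1 neq_ltn prime_gt1 ?orbT.
 by rewrite -copz_prime.
by rewrite (IH b bc (a * p)) ?coprimezMl ?cpb // (IH b bc p) // (gp (a * b)) ?coprimezMl ?cpp // (gp b) // jacobiMl // (legendreM pp op R) (jacobi_prime a pp); ring.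
Qed.

Lemma eps_neq0 c : eps c != 0.
Proof.
by apply/eqP => h; have := normc_eps R c; rewrite h normc0 => /esym/eqP; rewrite oner_eq0.
Qed.

(** The Gauss sum modulo b c splits into the sum of c modulo b and that of b modulo c; evaluating
    all three by [gs1] is quadratic reciprocity. *)
Lemma jacobi_recip_eps b c : odd b -> odd c -> coprime b c -> (jacobi b c * jacobi c b)%:~R * (eps b * eps c) = eps (b * c).
Proof.
move=> ob oc cp; have b0 : (0 < b)%N by lia.
have c0 : (0 < c)%N by lia.
have := gs_crt R 1 b0 c0 cp; rewrite !mul1r (gs_jac (c := b) (a := c)) ?coprimezE 1?coprime_sym //.
rewrite (gs_jac (c := c) (a := b)) // !gs1 ?oddM ?ob // natrM sqrtrM // rmorphM => h.
have sn : (Num.sqrt b%:R)%:C * (Num.sqrt c%:R)%:C != 0 :> R[i] by rewrite -rmorphM (inj_eq (@complexI R) _ 0) mulf_neq0 // gt_eqF // sqrtr_gt0 ltr0n.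
by apply: (mulIf sn); rewrite h; ring.
Qed.

Lemma eps_conj c : eps c * (conjc (eps c)) = 1.
Proof. by rewrite mulC_conj normc_eps expr1n. Qed.
(** Conjugating the Gauss sum replaces a = 1 by a = -1. *)
Lemma jacobi_m1_eps c : odd c -> (jacobi (-1) c)%:~R * eps c = (conjc (eps c)).
Proof.
move=> oc; have c0 : (0 < c)%N by lia.
have e : gs c (-1) = (conjc (gs c 1)).
 by rewrite /gauss conjC_sum; apply: eq_bigr => y; rewrite mulN1r eeN mul1r.
have := gs_jac (a := -1) oc; rewrite coprimezE coprime1n => /(_ isT).
rewrite e gs1 // conjCM conjC_real mulrA => h.
have sn : (Num.sqrt c%:R)%:C != 0 :> R[i] by rewrite (inj_eq (@complexI R) _ 0) gt_eqF // sqrtr_gt0 ltr0n.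
by apply: (mulIf sn).
Qed.

Lemma odd_mod4 c : odd c -> (c %% 4 == 1)%N \/ (c %% 4 == 3)%N /\ (c %% 4 == 1)%N = false.
Proof. by lia. Qed.
Lemma jacobi_m1 c : odd c -> jacobi (-1) c = if (c %% 4 == 1)%N then 1 else -1.
Proof.
move=> oc; apply: intr_inj; apply: (mulIf (eps_neq0 c)); rewrite jacobi_m1_eps //.
rewrite /eps_odd; case: ifP => _; first by rewrite mulr1 conjc1.
by apply/eqP; rewrite mulN1r eq_complex /= oppr0 !eqxx.
Qed.

Lemma jacobi_recip b c : odd b -> odd c -> coprime b c -> jacobi b c * jacobi c b = if (b %% 4 == 1)%N || (c %% 4 == 1)%N then 1 else -1.
Proof.
move=> ob oc cp; apply: (@intr_inj R[i]).
have en : eps b * eps c != 0 by rewrite mulf_neq0 ?eps_neq0.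
apply: (mulIf en); rewrite jacobi_recip_eps // /eps_odd.
have i2 : 'i%C * 'i%C = -1 :> R[i] by rewrite -expr2 sqr_i.
have -> : (b * c %% 4 == 1)%N = ((b %% 4 == 1)%N == (c %% 4 == 1)%N).
 by rewrite -modnMm; case: (odd_mod4 ob) => [/eqP->|[/eqP-> _]]; case: (odd_mod4 oc) => [/eqP->|[/eqP-> _]].
by case: (b %% 4 == 1)%N; case: (c %% 4 == 1)%N => /=; rewrite ?mul1r ?mulr1 // mulN1r i2 opprK.
Qed.

(** Descent from c to d = c - 2: (c / d) = (2 / d) and (d / c) = (-2 / c) are equal by reciprocity,
    since one of c and d is 1 modulo 4. *)
Lemma jacobi_2 c : odd c -> jacobi 2 c = if ((c %% 8 == 1) || (c %% 8 == 7))%N then 1 else -1.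
Proof.
elim/ltn_ind: c => c IH oc.
case: (ltnP c 2) => [c2|c2]; first by have -> : c = 1; [lia | rewrite jacobi1].
have [d ed] : exists d, c = (d + 2)%N by exists (c - 2)%N; rewrite subnK.
have od : odd d by move: oc; rewrite ed oddD addbF.
have dc : (d < c)%N by lia.
have cp : coprime d c by rewrite ed /coprime gcdnDl -/(coprime d 2) coprimen2.
have := jacobi_recip od oc cp.
have -> : ((d %% 4 == 1) || (c %% 4 == 1))%N by rewrite ed; lia.
have -> : jacobi c d = jacobi 2 d by apply: jacobi_eqm; apply/dvdzP; exists 1; rewrite ed; lia.
have -> : jacobi d c = jacobi (-1 * 2) c.
 by apply: jacobi_eqm; apply/dvdzP; exists 1; rewrite ed; ring.
rewrite jacobiMl // jacobi_m1 // (IH d dc od) => h.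
have e2 : jacobi 2 c = (if (c %% 4 == 1)%N then 1 else -1) * (if ((d %% 8 == 1) || (d %% 8 == 7))%N then 1 else -1).
 move: h; move: (jacobi 2 c) => w; case: (c %% 4 == 1)%N; case: (_ || _) => /=; by rewrite ?mul1r => h; lia.
rewrite e2 ed; have h8 := ltn_pmod d (isT : (0 < 8)%N).
have e4 : (d %% 4 = d %% 8 %% 4)%N by lia.
have o8 : odd (d %% 8) by move: od; rewrite {1}(divn_eq d 8) oddD oddM andbF.
have -> : ((d + 2) %% 4 == 1)%N = ((d %% 8 + 2) %% 4 == 1)%N by lia.
rewrite -![((d + 2) %% 8)%N]modnDml.
move: (d %% 8)%N h8 o8; do 8 (case=> [|]) => //; lia.
Qed.

(** The sign and the power of 2 in a give symbols that depend on c modulo 8; for the odd part of a,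
    reciprocity exchanges modulus and numerator. *)
Lemma jacobi_per (a : int) c c' : a != 0 -> odd c -> odd c' -> ((8 * `|a|)%N %| c%:Z - c'%:Z)%Z -> jacobi a c = jacobi a c'.
Proof.
move=> a0 oc oc' h.
have c0 : (0 < c)%N by lia. have c'0 : (0 < c')%N by lia.
have m8 : (c %% 8 = c' %% 8)%N.
 have : (8 %| c%:Z - c'%:Z)%Z by apply: dvdz_trans h; rewrite dvdzE dvdn_mulr. by lia.
have m4 : (c %% 4 = c' %% 4)%N by lia.
have an : (0 < `|a|)%N by lia.
have [k [b [ob eb]]] : exists k b, odd b /\ `|a|%N = (2 ^ k * b)%N.
 exists (logn 2 `|a|), (`|a|`_2^')%N; split; first by rewrite odd_2'nat part_pnat. by rewrite -{1}(partnC 2%N an) p_part.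
have b0 : (0 < b)%N by lia.
have hb : (b %| c%:Z - c'%:Z)%Z.
 by apply: dvdz_trans h; rewrite dvdzE eb !dvdn_mull.
have -> : a = (-1) ^+ (a < 0)%R * ((2 : int) ^+ k * b).
 by rewrite {1}[a]intEsign eb PoszM; congr (_ * (_ * _)); rewrite -natrX natz.
have jX (x : int) n d : odd d -> jacobi (x ^+ n) d = jacobi x d ^+ n.
 move=> od; elim: n => [|n IHn]; first by rewrite jacobi_1l. by rewrite !exprS jacobiMl // IHn.
rewrite !jacobiMl // !jX // !jacobi_m1 // !jacobi_2 // m8 m4; congr (_ * (_ * _)).
have gc : coprime b c = coprime b c'.
 have [u [v e]] : exists u v, (c + b * u = c' + b * v)%N.
  by case/dvdzP: hb => -[j|j] e; [exists 0, j | exists j.+1, 0%N]; rewrite ?NegzE in e; lia.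
 by rewrite -coprimenDr_mul || (rewrite -coprime_modr -[RHS]coprime_modr ; congr coprime; move: hb; rewrite -eqz_mod_dvd !modz_nat => /eqP []).
case: (boolP (coprime b c)) => cp; last first.
 rewrite !jacobi_0 // coprimezE -?gc //.
have cp' : coprime b c' by rewrite -gc.
have r1 := jacobi_recip ob oc cp; have r2 := jacobi_recip ob oc' cp'.
rewrite m4 in r1; have e : jacobi c b = jacobi c' b by apply: jacobi_eqm.
have sq : jacobi c b ^+ 2 = 1 by rewrite jacobi_sq // coprimezE coprime_sym.
rewrite -[LHS]mulr1 -sq expr2 mulrA r1 -r2 -e -mulrA -expr2 sq mulr1 //.
Qed.
End Recip.

(** * The Moebius function and Gauss sums of Jacobi symbols *)

Definition moebius (n : nat) : int := \prod_(p <- primes n) (if logn p n == 1%N then -1 else 0).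
Local Notation mu := moebius.

Lemma mu1 : mu 1 = 1. Proof. by rewrite /mu big_nil. Qed.
Lemma mu_pM p n : prime p -> (0 < n)%N -> ~~ (p %| n)%N -> mu (p * n) = - mu n.
Proof.
move=> pp n0 pn; have p0 := prime_gt0 pp.
have pin : p \notin primes n by rewrite mem_primes pp n0.
have -> : mu (p * n) = \prod_(q <- p :: primes n) (if logn q (p * n) == 1%N then -1 else 0).
 apply/perm_big/uniq_perm; rewrite //= ?pin ?primes_uniq //. by move=> q; rewrite primesM // primes_prime // inE.
rewrite big_cons lognM // logn_prime // eqxx (logn_coprime (m := n)) ?prime_coprime //= mulN1r.
congr (- _); apply: eq_big_seq => q qn.
rewrite lognM // logn_prime; case: (eqVneq q p) => [e0|_] //=.
by move: pin; rewrite -e0 qn.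
Qed.

Lemma mu_ppM p n : prime p -> (0 < n)%N -> (p * p %| n)%N -> mu n = 0.
Proof.
move=> pp n0 pn; have pin : p \in primes n.
 by rewrite mem_primes pp n0 (dvdn_trans _ pn) // dvdn_mulr.
rewrite /mu (bigD1_seq p) ?primes_uniq //=.
have : (2 <= logn p n)%N by rewrite -pfactor_dvdn.
by case: eqP => [->|] //; rewrite mul0r.
Qed.

Lemma mu_abs n : `|mu n| <= 1.
Proof.
rewrite /mu; elim/big_ind: _ => // [x y x1 y1|p _]; last by case: ifP.
by rewrite normrM -[1]mulr1; apply: ler_pM.
Qed.

(** Let p be the least prime of n. Divisors divisible by p^2 contribute 0, and d cancels against p d
    for d prime to p. *)
Lemma sum_divisors_mu n : (0 < n)%N -> \sum_(d <- divisors n) mu d = (n == 1%N)%:R.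
Proof.
move=> n0; case: (ltnP 1 n) => n1; last first.
 by have -> : n = 1; [lia | rewrite (_ : divisors 1 = [:: 1%N]) // big_seq1 mu1].
have pp := pdiv_prime n1; set p := pdiv n in pp; have p0 := prime_gt0 pp.
have pn : (p %| n)%N := pdiv_dvd n.
rewrite (bigID (fun d => p %| d)%N) (bigID (fun d => p * p %| d)%N) /= big1_seq ?add0r; last first.
 move=> d /andP[/andP[_ pd]]; rewrite -dvdn_divisors // => dn. by rewrite (mu_ppM pp _ pd) // (dvdn_gt0 n0 dn).
rewrite -big_filter (perm_big [seq (p * d)%N | d <- divisors n & ~~ (p %| d)%N]) /=; last first.
 apply: uniq_perm; rewrite ?filter_uniq ?divisors_uniq //.
  rewrite map_inj_uniq ?filter_uniq ?divisors_uniq // => x y /eqP. by rewrite eqn_pmul2l // => /eqP.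
 move=> q; rewrite mem_filter -dvdn_divisors //; apply/idP/mapP => [/andP[/andP[pq ppq] qn]|[d]].
  case/dvdnP: pq => d ed; exists d; last by lia. move: qn ppq; rewrite mem_filter -dvdn_divisors // ed dvdn_pmul2r // => qn ->. by rewrite (dvdn_trans _ qn) // dvdn_mulr.
 rewrite mem_filter -dvdn_divisors // => /andP[pd dn] ->. by rewrite dvdn_mulr // dvdn_pmul2l // pd Gauss_dvd ?prime_coprime // pn.
rewrite big_map big_filter (gtn_eqF n1) -big_split /= big1_seq // => d /andP[pd].
by rewrite -dvdn_divisors // => dn; rewrite mu_pM ?addNr // (dvdn_gt0 n0 dn).
Qed.

Lemma sum_mu_coprime c x : (0 < c)%N -> \sum_(d <- divisors c | (d %| x)%N) mu d = (coprime x c)%:R.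
Proof.
move=> c0; have g0 : (0 < gcdn x c)%N by rewrite gcdn_gt0 c0 orbT.
rewrite /coprime -sum_divisors_mu // -big_filter; apply/perm_big/uniq_perm.
- by rewrite filter_uniq ?divisors_uniq.
- exact: divisors_uniq.
by move=> d; rewrite mem_filter -!dvdn_divisors // dvdn_gcd.
Qed.

Section PrimitiveGauss.
Variable R : realType.
Local Notation ee := (efrac R).
Local Notation gs := (gauss R).
Local Notation eps := (eps_odd R).

Definition jsum g (N : int) : R[i] := \sum_(r < g) (jacobi r%:Z g)%:~R * ee g (N * r%:Z).
Lemma jsum_per g N : (0 < g)%N -> per g (fun r => (jacobi r g)%:~R * ee g (N * r)).
Proof.
move=> g0 x k; rewrite mulrDr mulrCA ee_per //; congr (_%:~R * _).
by apply: jacobi_eqm; rewrite addrAC subrr add0r dvdz_mulr.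
Qed.

Lemma sq_count p (x : int) : prime p -> odd p -> #|[set y : 'I_p | (p %| (1 * y%:Z ^+ 2 - x)%R)%Z]|%:R = 1 + legendre x p.
Proof.
move=> pp op; have p0 := prime_gt0 pp; set A := [set y | _].
have p1 : ~~ (p %| 1)%Z by rewrite dvdzE dvdn1 neq_ltn prime_gt1 ?orbT.
have hA : (#|A| <= 2)%N := sqset_card pp op x p1.
rewrite legendreE; case: ifP => px.
 have -> : A = [set Ordinal p0].
  apply/setP => y; rewrite !inE mul1r rpredBr // expr2 Euclid_dvdz // orbb. by apply/idP/eqP => [h|->]; rewrite //; apply/val_inj/(dvdz_small (ltn_ord y) h).
 by rewrite cards1.
case: ifP => ex; last first.
 have -> : A = set0.
  apply/setP => y; rewrite !inE mul1r; apply/negbTE/negP => h. by move/existsP: ex; apply; exists y.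
 by rewrite cards0.
case/existsP: ex => z hz.
have z0 : (0 < z)%N.
 rewrite lt0n; apply/negP => /eqP e; move: hz; rewrite e expr0n sub0r rpredN px //.
have nzp : (p - z < p)%N by have := ltn_ord z; lia.
have : [set z; Ordinal nzp] \subset A.
 apply/subsetP => y; rewrite !inE mul1r => /orP[/eqP-> //|/eqP->] /=. rewrite (_ : _ - _ = p%:Z * (p%:Z - 2 * z%:Z) + (z%:Z ^+ 2 - x)).
  by rewrite rpredD // dvdz_mulr.
 by rewrite -subzn ?(ltnW (ltn_ord z)); ring.
move/subset_leq_card; rewrite cards2.
have -> : z != Ordinal nzp.
 apply/eqP => /(congr1 val) /= e; have := ltn_ord z. have : odd (z + z) by lia. by lia.
by lia.
Qed.

(** In the Gauss sum each value x of y^2 is taken 1 + (x / p) times. *)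
Lemma jsum_prime p N : prime p -> odd p -> jsum p N = (jacobi N p)%:~R * gs p 1.
Proof.
move=> pp op; have p0 := prime_gt0 pp.
have e : gs p N = \sum_(x < p) ee p (N * x) + jsum p N.
 rewrite /jsum -big_split /= /gauss. have pf x y : (p %| x - y)%Z -> ee p (N * x) = ee p (N * y).
  by move=> h; apply: ee_eqm => //; rewrite -mulrBr dvdz_mull.
 rewrite (eq_bigr (fun y : 'I_p => \sum_(x < p) if (p %| y%:Z ^+ 2 - x%:Z)%Z then ee p (N * x) else 0)); last first.
  by move=> y; rewrite -big_mkcond -(sum_delta pp _ pf).
 rewrite exchange_big /=; apply: eq_bigr => x _; rewrite -big_mkcond /= jacobi_prime //. rewrite -[X in X + _]mul1r -mulrDl -[1]/(1%:~R) -intrD -sq_count // rmorph_nat mulr_natl.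
 by rewrite -sumr_const; apply: eq_bigl => y; rewrite inE mul1r.
case: (boolP (p %| N)%Z) => pN.
 have -> : jacobi N p = 0 by rewrite jacobi_prime // legendreE pN. rewrite mul0r; have := e; rewrite ee_orth // pN /gauss (eq_bigr (fun=> 1)) => [|y _].
  by rewrite sumr_const card_ord => /eqP; rewrite addrC -subr_eq subrr => /eqP.
 by case/dvdzP: pN => k ->; rewrite mulrAC mulrC ee_mul.
have := e; rewrite ee_orth // (negbTE pN) add0r => <-.
by rewrite gs_jac // copz_prime.
Qed.

Lemma jsum_crt a b N : odd a -> odd b -> coprime a b -> jsum (a * b) N = (jacobi a b)%:~R * (jacobi b a)%:~R * (jsum a N * jsum b N).
Proof.
move=> oa ob cp; have a0 : (0 < a)%N by lia.
have b0 : (0 < b)%N by lia.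
have ab0 : (0 < a * b)%N by lia.
rewrite /jsum (@sum_crt R a b (fun r => (jacobi r (a * b))%:~R * ee (a * b) (N * r))) //; last exact: jsum_per.
rewrite mulr_suml mulr_sumr; apply: eq_bigr => x _.
rewrite !mulr_sumr; apply: eq_bigr => y _.
rewrite jacobiMr // (@jacobi_eqm _ (b%:Z * x) a); last by rewrite addrAC subrr add0r dvdz_mulr.
rewrite (@jacobi_eqm _ (a%:Z * y) b); last by rewrite addrK dvdz_mulr.
by rewrite !jacobiMl // mulrDr eeD [N * (b%:Z * _)]mulrCA [b%:Z * _]mulrC [N * (a%:Z * _)]mulrCA [a%:Z * (N * _)]mulrC ee_scale // mulnC ee_scale //; ring.
Qed.

(** Square-freeness makes the symbol a primitive character, which is why the formula also holds, as
    0 = 0, for N not prime to g. *)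
Lemma jsumE g N : odd g -> squarefree g -> jsum g N = (jacobi N g)%:~R * gs g 1.
Proof.
elim/ltn_ind: g N => g IH N og sg; have g0 : (0 < g)%N by lia.
case: (ltnP 1 g) => [g1|g1]; last first.
 have -> : g = 1 by lia. by rewrite /jsum /gauss !big_ord1 !ee1 !jacobi1.
have pp := pdiv_prime g1; set p := pdiv g in pp; have p0 := prime_gt0 pp.
case/dvdnP: (pdiv_dvd g) => b eb; rewrite -/p in eb.
have b0 : (0 < b)%N by move: g0; rewrite eb muln_gt0 => /andP[].
have /andP[ob op] : odd b && odd p by rewrite -oddM -eb.
have pb : ~~ (p %| b)%N.
 apply/negP => /dvdnP[k ek]; have := sg p; rewrite eb ek -mulnA mulnn dvdn_mull // => /(_ isT) e. by rewrite e in pp.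
have cp : coprime b p by rewrite coprime_sym prime_coprime.
have bg : (b < g)%N by lia.
have sb : squarefree b by move=> d db; apply: sg; rewrite eb dvdn_mulr.
by rewrite eb jsum_crt // IH // jsum_prime // gs_crt // !mul1r (@gs_jac R b p) ?coprimezE 1?coprime_sym // (@gs_jac R p b) // jacobiMr //; ring.
Qed.
End PrimitiveGauss.

(** * Salie sums as sums over square roots *)

Section Salie.
Variable R : realType.
Local Notation ee := (efrac R).
Local Notation gs := (gauss R).
Local Notation eps := (eps_odd R).

Lemma sum_multiples e k (F : int -> R[i]) : (0 < e)%N -> \sum_(x < e * k | (e %| x)%N) F x = \sum_(x < k) F (e%:Z * x).
Proof.
move=> e0; rewrite big_mkcond /=.
transitivity (\sum_(x < e * k) (fun x => if (e %| x)%Z then F x else 0) x).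
 by [].
rewrite (@sum_split R e k (fun x => if (e %| x)%Z then F x else 0)) (bigD1 (Ordinal e0)) //= [X in _ + X]big1 ?addr0 => [|r rn].
 by apply: eq_bigr => l; rewrite add0r dvdz_mulr.
apply: big1 => l _; case: ifP; rewrite rpredDr ?dvdz_mulr //.
by move=> /(dvdz_small (ltn_ord r)) e1; move/negP: rn; case; apply/eqP/val_inj.
Qed.

(** For x = r + g l the sum over l vanishes unless c divides N, and leaves a Gauss sum over r modulo
    g. *)
Lemma jsum_lift g c N : odd g -> squarefree g -> (0 < c)%N -> \sum_(x < g * c) (jacobi x g)%:~R * ee (g * c) (N * x%:Z) = if (c %| N)%Z then c%:R * (jacobi (N %/ c)%Z g)%:~R * gs g 1 else 0.
Proof.
move=> og sg c0; have g0 : (0 < g)%N by lia.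
rewrite (@sum_split R g c (fun x => (jacobi x g)%:~R * ee (g * c) (N * x))).
transitivity (\sum_(r < g) (jacobi r g)%:~R * ee (g * c) (N * r) * \sum_(l < c) ee c (N * l)).
 apply: eq_bigr => r _; rewrite mulr_sumr; apply: eq_bigr => l _. rewrite (@jacobi_eqm _ r g); last by rewrite addrAC subrr add0r dvdz_mulr. rewrite mulrDr eeD -mulrA; congr (_ * (_ * _)).
 by rewrite -(ee_scale R c _ g0); congr ee; ring.
rewrite -mulr_suml ee_orth //; case: ifP => h; last by rewrite mulr0.
rewrite mulrC -mulrA -jsumE //; congr (_ * _); apply: eq_bigr => r _.
by rewrite -(ee_scale R g _ c0) mulrAC divzK.
Qed.

(** Moebius inversion detects that x is prime to c; that x is prime to g is enforced by the
    symbol. *)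
Lemma twisted_ramanujan g c N : odd g -> squarefree g -> odd c -> \sum_(x < g * c | coprime x (g * c)) (jacobi x g)%:~R * ee (g * c) (N * x%:Z) = \sum_(e <- divisors c) (mu e)%:~R * (jacobi e g)%:~R *
  (if ((c %/ e)%N %| N)%Z
   then (c %/ e)%:R * (jacobi (N %/ (c %/ e)%N)%Z g)%:~R * gs g 1 else 0).
Proof.
move=> og sg oc; have g0 : (0 < g)%N by lia. have c0 : (0 < c)%N by lia.
transitivity (\sum_(x < g * c) \sum_(e <- divisors c | (e %| x)%N) (mu e)%:~R * ((jacobi x g)%:~R * ee (g * c) (N * x))).
 rewrite big_mkcond; apply: eq_bigr => x _; rewrite -mulr_suml -(rmorph_sum (intmul 1)) sum_mu_coprime //.
 rewrite coprimeMr; case: (boolP (coprime x g)) => [_|xg] /=; first by case: ifP => _; rewrite ?mul1r ?mul0r. by rewrite jacobi_0 ?mul0r ?mulr0.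
rewrite (exchange_big_dep xpredT) //=; apply: eq_big_seq => e; rewrite -dvdn_divisors // => ec.
have e0 : (0 < e)%N := dvdn_gt0 c0 ec.
rewrite -mulr_sumr -mulrA; congr (_ * _).
have ce0 : (0 < c %/ e)%N by lia.
rewrite -jsum_lift // mulr_sumr.
have egc : (g * c = e * (g * (c %/ e)))%N by lia.
have key := @sum_multiples e (g * (c %/ e)) (fun x => (jacobi x g)%:~R * ee (g * c) (N * x)) e0.
rewrite -egc in key; rewrite key.
apply: eq_bigr => x _; rewrite jacobiMl // rmorphM -mulrA; congr (_ * (_ * _)).
by rewrite egc -[in RHS](ee_scale R _ _ e0); congr ee; ring.
Qed.

(** A Weyl sum over roots. The symbol depends only on y modulo c because [g] divides [nu] in the
    formula below. *)
Definition rootsum (nu m h : int) g c : R[i] := \sum_(y < c | (c%:Z %| m - nu * y%:Z ^+ 2)%Z) (jacobi ((m - nu * y%:Z ^+ 2) %/ c%:Z)%Z g)%:~R * ee c (h * y%:Z).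

Section Formula.
Variables (m nu1 w : int) (g c : nat).
Hypotheses (og : odd g) (sg : squarefree g) (oc : odd c) (cp : coprimez nu1 (g * c)%N%:Z).
Let nu : int := nu1 * g%:Z.
Let n : int := nu * w ^+ 2.
Let g0 := odd_gt0 og.
Let c0 := odd_gt0 oc.
Let gc0 : (0 < g * c)%N. Proof. by rewrite muln_gt0 g0. Qed.
Let cpc : coprimez (- nu1) c.
Proof.
rewrite coprimezE abszN; move: cp; rewrite coprimezE /=; apply: coprime_dvdr.
by rewrite dvdn_mull.
Qed.

(** The sum is multiplied by a Gauss sum modulo c whose variable is shifted by w / x. The phase -
    nu1 x (y + w / x)^2 absorbs the term n / x, so that x occurs only linearly, in (m - nu y^2)
    x. *)
Let salie_gauss : salie R m n (g * c) * ((jacobi (- nu1) c)%:~R * gs c 1) = \sum_(y < c) ee c (- 2 * nu1 * w * y) * \sum_(x < g * c | coprime x (g * c)) (jacobi x g)%:~R * ee (g * c) ((m - nu * y%:Z ^+ 2) * x).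
Proof.
rewrite /salie mulr_suml; under [RHS]eq_bigr => y _ do rewrite mulr_sumr.
rewrite exchange_big /=; apply: eq_bigr => x xc.
have xcc : coprimez x c by move: xc; rewrite coprimeMr => /andP[].
set z := (inv_mod (g * c) x)%:Z.
have hz : ((g * c)%N %| x%:Z * z - 1)%Z by rewrite -eqz_mod_dvd /z !modz_nat inv_modP.
have hzc : (c %| x%:Z * z - 1)%Z by apply: dvdz_trans hz; rewrite PoszM dvdz_mull.
have e1 : (jacobi x c)%:~R * ((jacobi (- nu1) c)%:~R * gs c 1) = \sum_(y < c) ee c (- nu1 * x * (y%:Z + w * z) ^+ 2).
 rewrite mulrA -rmorphM -jacobiMl // -gs_jac //; last first.
  by rewrite coprimezMl xcc.
 rewrite mulrC /gauss -(sum_shift (w * z) c0 (gs_per R _ c0)). by [].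
rewrite jacobiMr // rmorphM.
transitivity ((jacobi x g)%:~R * ee (g * c) (m * x + n * z) * ((jacobi x c)%:~R * ((jacobi (- nu1) c)%:~R * gs c 1))).
 by rewrite /efrac; ring.
rewrite e1 mulr_sumr; apply: eq_bigr => y _.
rewrite -mulrA [RHS]mulrCA; congr (_ * _).
rewrite -[ee c _ in LHS](ee_scale R _ _ g0) -[ee c _ in RHS](ee_scale R _ _ g0) ![(c * g)%N]mulnC -!eeD.
apply: ee_eqm => //; case/dvdzP: hz => k hk.
apply/dvdzP; exists (g%:Z * nu1 * (- 2 * y%:Z * w - w ^+ 2 * z) * k); rewrite /n /nu.
have -> : g%:Z * nu1 * (- 2 * y%:Z * w - w ^+ 2 * z) * k * (g * c) = g%:Z * nu1 * (- 2 * y%:Z * w - w ^+ 2 * z) * (x%:Z * z - 1) by rewrite hk; ring.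
by ring.
Qed.

(** For y = y0 + (c / e) l the sum over l is a full sum modulo e, nonzero only if e divides w,
    because 2 nu1 is a unit modulo e. *)
Lemma rootsum_lift e : (e %| c)%N ->  \sum_(y < c) ee c (- 2 * nu1 * w * y) * (if ((c %/ e)%N %| m - nu * y%:Z ^+ 2)%Z then (jacobi ((m - nu * y%:Z ^+ 2) %/ (c %/ e)%N)%Z g)%:~R else 0) =
 if (e %| w)%Z then e%:R * rootsum nu m (- 2 * nu1 * (w %/ e)%Z) g (c %/ e) else 0.
Proof.
move=> ec; have e0 : (0 < e)%N := dvdn_gt0 c0 ec.
set c2 := (c %/ e)%N; have ce : c = (c2 * e)%N by rewrite /c2 divnK.
have c20 : (0 < c2)%N by rewrite divn_gt0 dvdn_leq.
pose f y := if (c2 %| m - nu * y ^+ 2)%Z then (jacobi ((m - nu * y ^+ 2) %/ c2)%Z g)%:~R else 0 : R[i].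
have fper y l : f (y + c2%:Z * l) = f y.
 rewrite /f; have e2 : m - nu * (y + c2%:Z * l) ^+ 2 = m - nu * y ^+ 2 + (- nu * (2 * y * l + c2%:Z * l ^+ 2)) * c2.
  by ring.
 rewrite e2 rpredDr ?dvdz_mull //; case: ifP => // h; congr (_%:~R). rewrite addrC divzMDl; last by rewrite -lt0n. apply: jacobi_eqm; rewrite addrK. by rewrite /nu !mulNr rpredN -!mulrA dvdz_mull // dvdz_mulr.
have key := @sum_split R c2 e (fun y => ee (c2 * e) (- 2 * nu1 * w * y) * f y).
transitivity (\sum_(y < c2 * e) ee (c2 * e) (- 2 * nu1 * w * y) * f y); first by rewrite -ce.
rewrite key.
transitivity (\sum_(y < c2) ee (c2 * e) (- 2 * nu1 * w * y) * f y * \sum_(l < e) ee e (- 2 * nu1 * w * l)).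
 apply: eq_bigr => y _; rewrite mulr_sumr; apply: eq_bigr => l _. by rewrite fper mulrDr eeD mulrAC; congr (_ * _); rewrite -(ee_scale R e _ c20); congr ee; ring.
rewrite -mulr_suml ee_orth //.
have -> : (e %| - 2 * nu1 * w)%Z = (e %| w)%Z.
 rewrite -mulrA mulNr rpredN Gauss_dvdzr; last first.
  by rewrite coprimezE coprimen2 (dvdn_odd ec).
 rewrite Gauss_dvdzr // coprimez_sym; move: cpc; rewrite !coprimezE abszN; exact: coprime_dvdr.
case: ifP => ew; last by rewrite mulr0.
rewrite mulrC; congr (_ * _); rewrite /rootsum [RHS]big_mkcond; apply: eq_bigr => y _.
rewrite /f; case: ifP => _; rewrite ?mulr0 // mulrC; congr (_ * _).
by rewrite -(ee_scale R c2 _ e0) -{1}(divzK ew); congr ee; ring.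
Qed.

Lemma salie_formula : salie R m n (g * c) / (Num.sqrt (g * c)%:R)%:C * (conjc (eps (g * c))) = (jacobi (- nu1) c)%:~R * conjc (eps c) * eps g * conjc (eps (g * c)) *
 \sum_(e <- divisors c | (e %| w)%Z) (mu e)%:~R * (jacobi e g)%:~R *
   rootsum nu m (- 2 * nu1 * (w %/ e)%Z) g (c %/ e).
Proof.
set S := \sum_(e <- _ | _) _.
have e1 : salie R m n (g * c) * ((jacobi (- nu1) c)%:~R * gs c 1) = gs g 1 * c%:R * S.
 rewrite salie_gauss; under eq_bigr => y _ do rewrite twisted_ramanujan // mulr_sumr. rewrite exchange_big /= /S [in RHS]big_mkcond mulr_sumr; apply: eq_big_seq => e.
 rewrite -dvdn_divisors // => ec; have e0 : (0 < e)%N := dvdn_gt0 c0 ec. transitivity ((mu e)%:~R * (jacobi e g)%:~R * (c %/ e)%:R * gs g 1 *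
   (if (e %| w)%Z then e%:R * rootsum nu m (- 2 * nu1 * (w %/ e)%Z) g (c %/ e) else 0)).
  rewrite -rootsum_lift // mulr_sumr; apply: eq_bigr => y _. by case: ifP => _; ring.
 case: ifP => _; rewrite ?mulr0 //. have -> : c%:R = (c %/ e)%:R * e%:R :> R[i] by rewrite -natrM divnK. by ring.
have cR : c%:R = (Num.sqrt c%:R)%:C * (Num.sqrt c%:R)%:C :> R[i] by rewrite -rmorphM -expr2 sqr_sqrtr // rmorph_nat.
have sn k : (0 < k)%N -> (Num.sqrt k%:R)%:C != 0 :> R[i].
 by move=> k0; rewrite (inj_eq (@complexI R) _ 0) gt_eqF // sqrtr_gt0 ltr0n.
have j2 : (jacobi (- nu1) c)%:~R * (jacobi (- nu1) c)%:~R = 1 :> R[i] by rewrite -rmorphM -expr2 jacobi_sq.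
have ec := eps_conj R c.
move: e1; rewrite !gs1 // cR natrM sqrtrM // rmorphM => e1.
have e2 : salie R m n (g * c) = (jacobi (- nu1) c)%:~R * conjc (eps c) * eps g * (Num.sqrt g%:R)%:C * (Num.sqrt c%:R)%:C * S.
 have e3 : (jacobi (- nu1) c)%:~R * (eps c * (Num.sqrt c%:R)%:C) != 0.
  rewrite !mulf_neq0 ?eps_neq0 ?sn //. by apply/eqP => h; have /eqP := j2; rewrite h mul0r eq_sym oner_eq0.
 apply: (mulIf e3); rewrite e1. transitivity (eps g * (Num.sqrt g%:R)%:C * ((Num.sqrt c%:R)%:C * (Num.sqrt c%:R)%:C) * S * ((jacobi (- nu1) c)%:~R * (jacobi (- nu1) c)%:~R) * (eps c * conjc (eps c))).
  by rewrite j2 ec !mulr1.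
 by ring.
rewrite e2; field; rewrite !sn //.
Qed.
End Formula.
End Salie.

(** * Kloosterman sums to composite moduli *)

Lemma coprimez_dvd d c x : (d %| c)%N -> coprimez x c -> coprimez x d.
Proof. by exact: coprime_dvdr. Qed.
Lemma iv_coprime c x : coprimez x c%:Z -> coprimez (iv c x) c.
Proof. by move=> cp; apply: (@dvdz_coprime _ _ x); rewrite mulrC iv_mul. Qed.
Lemma iv_eqm c x y : coprimez x c%:Z -> (c %| x - y)%Z -> (c %| iv c x - iv c y)%Z.
Proof.
move=> cx h; have cy : coprimez y c.
 by case/dvdzP: h => k e; rewrite -(copz_per c y k) mulrC -e addrC subrK.
apply: (iv_uniq cx); first exact: iv_mul.
have -> : x * iv c y - 1 = (x - y) * iv c y + (y * iv c y - 1) by ring.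
by rewrite rpredD ?iv_mul // dvdz_mulr.
Qed.

Section Klw.
Variable R : realType.
Local Notation ee := (efrac R).

(** Inversion is extended by the identity to non-units, so that it permutes all residues. *)
Lemma sum_inv c (F : int -> R[i]) : (0 < c)%N -> per c F -> \sum_(x < c | coprime x c) F (iv c x) = \sum_(x < c | coprime x c) F x.
Proof.
move=> c0 p; pose h x := if coprimez x c then iv c x else x.
pose F' x := if coprimez x c then F x else 0.
have hc x : coprimez (h x) c = coprimez x c.
 by rewrite /h; case: ifP => // cx; rewrite iv_coprime.
rewrite !(big_mkcond (fun x : 'I_c => coprime x c)) /=.
transitivity (\sum_(x < c) F' (h x)).
 by apply: eq_bigr => x; rewrite /F' hc /h copz_nat; case: ifP.
transitivity (\sum_(x < c) F' x); last by apply: eq_bigr => x; rewrite /F'.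
apply: sum_perm => //.
- by move=> x k; rewrite /F' copz_per p.
move=> x y; have [cx|cx] := boolP (coprimez x c); have [cy|cy] := boolP (coprimez y c).
- rewrite /h cx cy => e; apply: (@iv_uniq c (iv c x)); rewrite ?iv_coprime //; first by rewrite mulrC iv_mul. have -> : iv c x * y - 1 = (iv c x - iv c y) * y + (y * iv c y - 1) by ring.
 by rewrite rpredD ?iv_mul // dvdz_mulr.
- move=> /dvdzP[k e]; move: (hc y); rewrite (negbTE cy) -(copz_per c (h y) k) mulrC -e addrC subrK. by rewrite hc cx.
- move=> /dvdzP[k e]; move: (hc x); rewrite (negbTE cx) -(subrK (h y) (h x)) e addrC mulrC copz_per. by rewrite hc cy.
by rewrite /h (negbTE cx) (negbTE cy).
Qed.

(** If p divides a, the sum is a Ramanujan sum, equal to - 1. *)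
Lemma kl_bound p a b : prime p -> ~~ (p %| b)%Z -> normc (kl R p a b) <= 2 * Num.sqrt p%:R.
Proof.
move=> pp pb; have p0 := prime_gt0 pp.
have [pa|pa] := boolP (p %| a)%Z; last exact: weil_kl.
have -> : kl R p a b = -1.
 transitivity (\sum_(x < p | coprime x p) ee p (b * iv p x)).
  apply: eq_bigr => x _; apply: ee_eqm => //. by rewrite addrK dvdz_mulr.
 rewrite (@sum_inv p (fun x => ee p (b * x))) //; last first.
  by move=> x k; rewrite mulrDr mulrCA ee_per.
 have := ee_orth R b p0; rewrite (negbTE pb) (bigD1 (Ordinal p0)) //= mulr0 ee0 => /eqP. rewrite addrC addr_eq0 => /eqP <-; apply: eq_bigl => x.
 rewrite coprime_sym prime_coprime //; congr (~~ _); apply/idP/eqP => [h|-> //]. by apply: val_inj => /=; apply: dvdz_small => //.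
rewrite normcN normc1; apply: le_trans (_ : 1 * Num.sqrt 1 <= _); first by rewrite sqrtr1 mulr1.
by apply: ler_pM; rewrite ?ler1n ?sqrtr_ge0 // ler_sqrt ?ler1n.
Qed.

(** A complete sum modulo q v in which only the inverse modulo v occurs; G, of period q, will be the
    periodic weight restricted to a form. *)
Definition klsum q v (G : int -> R[i]) (k a : int) : R[i] := \sum_(x < q * v | coprime x v) G x%:Z * ee v (k * iv v x%:Z) * ee (q * v) (a * x%:Z).

Definition klterm q v (G : int -> R[i]) (k a x : int) : R[i] := if coprimez x v%:Z then G x * ee v (k * iv v x) * ee (q * v) (a * x) else 0.

Lemma klterm_per q v G k a : (0 < q)%N -> (0 < v)%N -> per q G -> per (q * v) (klterm q v G k a).
Proof.
move=> q0 v0 pG x l; rewrite /klterm.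
have e : x + (q * v)%N%:Z * l = x + v%:Z * (q%:Z * l) by rewrite PoszM; ring.
rewrite {1}e copz_per; case: ifP => // cx; congr (_ * _ * _).
- by rewrite (_ : x + _ = x + q%:Z * (v%:Z * l)) //; ring.
- apply: ee_eqm => //; rewrite -mulrBr dvdz_mull // iv_eqm //; first by rewrite e copz_per. by rewrite e addrAC subrr add0r dvdz_mulr.
by rewrite mulrDr mulrCA ee_per // muln_gt0 q0.
Qed.

Lemma klsum_term q v G k a : klsum q v G k a = \sum_(x < q * v) klterm q v G k a x.
Proof. by rewrite /klsum big_mkcond. Qed.

(** The variable is q v x + p y by the Chinese remainder theorem. The inverse modulo p v decomposes
    in the same way, and the factor at p is a Kloosterman sum. *)
Lemma klsum_prime p q v G k a : prime p -> (0 < q)%N -> (0 < v)%N -> per q G -> coprime p (q * v) -> klsum q (p * v) G k a = kl R p a (k * iv p (v * (q * v))%N) *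
 klsum q v (fun x => G (p%:Z * x)) (k * iv v (p * p)%N) a.
Proof.
move=> pp q0 v0 pG cp; have p0 := prime_gt0 pp.
have cpq : coprime p q by move: cp; rewrite coprimeMr => /andP[].
have cpv : coprime p v by move: cp; rewrite coprimeMr => /andP[].
have pv0 : (0 < p * v)%N by lia.
have W0 : (0 < q * v)%N by lia.
have eW : (q * (p * v) = p * (q * v))%N by lia.
rewrite klsum_term.
have pF := klterm_per k a q0 pv0 pG; rewrite eW in pF.
transitivity (\sum_(x < p * (q * v)) klterm q (p * v) G k a x); first by rewrite eW.
rewrite (sum_crt p0 W0 cp pF) /kl mulr_suml [RHS]big_mkcond; apply: eq_bigr => x _.
rewrite klsum_term; set s := \sum_(y < q * v) klterm q v _ _ _ _.
transitivity (\sum_(y < q * v) if coprime x p then ee p (a * x + k * iv p (v * (q * v))%N * iv p x) * klterm q v (fun z => G (p%:Z * z)) (k * iv v (p * p)%N) a y else 0); last first.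
 by case: ifP => _; [rewrite /s mulr_sumr | rewrite big1].
apply: eq_bigr => y _; set z := (q * v)%N%:Z * x + p%:Z * y.
have czp : coprimez z p = coprime x p by rewrite /z copz_per coprimezMl !copz_nat coprime_sym cp.
have czv : coprimez z v = coprimez y v.
 have -> : z = p%:Z * y + v%:Z * (q%:Z * x) by rewrite /z; ring. by rewrite copz_per coprimezMl !copz_nat cpv.
rewrite /klterm.
have -> : coprimez z (p * v) = coprime x p && coprimez y v by rewrite PoszM coprimezMr czp czv.
case: (boolP (coprime x p)) => //= cx; case: (boolP (coprimez y v)) => cy; last by rewrite mulr0.
rewrite cx in czp; rewrite cy in czv.
have cVp : coprimez (v * (q * v))%N p by rewrite copz_nat coprime_sym coprimeMr cpv.
have cpp : coprimez (p * p)%N v by rewrite copz_nat coprimeMl cpv.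
have eG : G z = G (p%:Z * y).
 by rewrite (_ : z = p%:Z * y + q%:Z * (v * x)) // /z; ring.
have ea : ee (q * (p * v)) (a * z) = ee p (a * x) * ee (q * v) (a * y).
 rewrite eW -(ee_scale R p _ W0) -(ee_scale R (q * v) _ p0) mulnC -eeD; congr ee. by lia.
have ek : ee (p * v) (k * iv (p * v) z) = ee p (k * iv p (v * (q * v))%N * iv p x) * ee v (k * iv v (p * p)%N * iv v y).
 rewrite -(ee_scale R p _ v0) -(ee_scale R v _ p0) [(v * p)%N]mulnC -eeD; apply: ee_eqm => //. have -> : k * iv (p * v) z - (k * iv p (v * (q * v)) * iv p x * v + k * iv v (p * p) * iv v y * p)
  = k * (iv (p * v) z - (iv p (v * (q * v))%N * iv p x * v + iv v (p * p)%N * iv v y * p)) by ring.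
 rewrite dvdz_mull //; apply: (@iv_uniq _ z); rewrite ?iv_mul //; try by rewrite PoszM coprimezMr czp. rewrite [(p * v)%N%:Z]PoszM Gauss_dvdz //; apply/andP; split.
  have -> : z * (iv p (v * (q * v))%N * iv p x * v + iv v (p * p)%N * iv v y * p) - 1 = ((v * (q * v))%N%:Z * iv p (v * (q * v))%N - 1) * (x%:Z * iv p x) + (x%:Z * iv p x - 1) +
    (y%:Z * iv p (v * (q * v))%N * iv p x * v + z * iv v (p * p)%N * iv v y) * p.
   by lia.
  by rewrite rpredD ?dvdz_mull // rpredD ?iv_mul // dvdz_mulr // iv_mul.
 have -> : z * (iv p (v * (q * v))%N * iv p x * v + iv v (p * p)%N * iv v y * p) - 1 = ((p * p)%N%:Z * iv v (p * p)%N - 1) * (y%:Z * iv v y) + (y%:Z * iv v y - 1) +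
    (z * iv p (v * (q * v))%N * iv p x + q%:Z * x * iv v (p * p)%N * iv v y * p) * v.
  by lia.
 by rewrite rpredD ?dvdz_mull // rpredD ?iv_mul // dvdz_mulr // iv_mul.
by rewrite eG ea ek eeD; ring.
Qed.

Lemma klsum_trivial q v G k a : (forall x, normc (G x) <= 1) -> normc (klsum q v G k a) <= (q * v)%N%:R.
Proof.
move=> G1; apply: le_trans (normc_sum _ _ _) _.
apply: le_trans (_ : \sum_(x < q * v | coprime x v) 1 <= _).
 by apply: ler_sum => x; rewrite !normcM !normc_ee !mulr1.
apply: le_trans (_ : \sum_(x < q * v) 1 <= _); last by rewrite sumr_const card_ord.
by rewrite big_mkcond; apply: ler_sum => x; case: ifP.
Qed.

(** Weil's bound at each prime of [s], the trivial bound for what remains. *)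
Lemma klsum_bound (s : seq nat) q v G k a : (0 < q)%N -> (0 < v)%N -> per q G -> (forall x, normc (G x) <= 1) -> all prime s -> uniq s -> (forall p, p \in s -> coprime p (q * v) && ~~ (p %| k)%Z) ->
 normc (klsum q ((\prod_(p <- s) p) * v) G k a) <=
 (q * v)%N%:R * \prod_(p <- s) (2 * Num.sqrt p%:R).
Proof.
move=> q0 v0; elim: s G k => [|p s IH] G k pG G1 /=.
 by rewrite !big_nil mul1n mulr1 => *; exact: klsum_trivial.
move=> /andP[pp ps] /andP[pns us] h; rewrite !big_cons -mulnA.
have hp : coprime p (q * v) && ~~ (p %| k)%Z by apply: h; rewrite inE eqxx.
case/andP: hp => cp pk; set V := (\prod_(r <- s) r * v)%N.
have sp r : r \in s -> prime r by move/allP: ps => H /H.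
have V0 : (0 < V)%N.
 by rewrite muln_gt0 big_seq prodn_cond_gt0 // => r rs; rewrite prime_gt0 ?sp.
have cps : coprime p (\prod_(r <- s) r).
 rewrite big_seq; elim/big_ind: _ => [|x y cx cy|r rs]; rewrite ?coprimen1 ?coprimeMr ?cx //. by rewrite prime_coprime // dvdn_prime2 ?(sp r rs) //; apply: contraNN pns => /eqP ->.
have cpV : coprime p (q * V) by rewrite /V mulnCA coprimeMr cps.
rewrite klsum_prime // normcM mulrCA; apply: ler_pM; rewrite ?normc_ge0 //.
 apply: kl_bound => //; rewrite Euclid_dvdz // negb_or pk -copz_prime // iv_coprime //. rewrite copz_nat coprime_sym coprimeMr cpV andbT. by move: cpV; rewrite coprimeMr => /andP[].
apply: IH => // [x l|r rs].
 by rewrite mulrDr mulrCA.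
have := h r; rewrite inE rs orbT => /(_ isT) /andP[cr rk]; rewrite cr /=.
rewrite Euclid_dvdz ?sp // negb_or rk /= -copz_prime ?sp //.
apply: (@coprimez_dvd r V); first by rewrite /V dvdn_mulr // (big_rem r) //= dvdn_mulr.
apply: iv_coprime; rewrite copz_nat coprimeMl.
by move: cpV; rewrite coprimeMr => /andP[_ ->].
Qed.

End Klw.

(** * Completion of incomplete sums *)

Section SinMvt.
Import normed_module.numFieldNormedType.Exports.
Variable R : realType.

Lemma sin_mvt (z : R) : 0 <= z -> exists2 x : R, 0 <= x <= z & sin z = cos x * z.
Proof.
move=> z0; have [|x xz e] := @derive.MVT_segment R sin cos 0 z z0.
 by apply: (@subspace_topology.continuous_subspaceT _ _ _ sin) => x; exact: continuous_sin.
by exists x; [move: xz; rewrite in_itv | move: e; rewrite sin0 !subr0].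
Qed.

End SinMvt.

Section Completion.
Variable R : realType.
Local Notation ee := (efrac R).

Lemma cos_ge_half (z : R) : 0 <= z <= pi / 4 -> 1 / 2 <= cos z.
Proof.
move=> /andP[z0 z4]; have p0 := pi_gt0 R.
have h : sin z <= cos z.
 have -> : cos z = sin (pi / 2 - z) by rewrite sinB sin_pihalf cos_pihalf mul1r mul0r subr0. by rewrite leNgt ltr_sin ?in_itv /=; lra.
have s0 : 0 <= sin z by apply: sin_ge0_pi; lra.
have := cos2Dsin2 z; nra.
Qed.

(** sin(2 z) = 2 sin z cos z, where cosines up to pi / 4 are at least 1 / 2 and sin z >= z / 2 by
    the mean value theorem. *)
Lemma sin_ge (y : R) : 0 <= y <= pi / 2 -> y / 4 <= sin y.
Proof.
move=> /andP[y0 y2]; pose z := y / 2; have ez : y = z + z by rewrite /z; field.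
have [x /andP[x0 xz] e] : exists2 x : R, 0 <= x <= z & sin z = cos x * z by apply: sin_mvt; rewrite /z; lra.
have c1 : 1 / 2 <= cos x by apply: cos_ge_half; move: xz; rewrite /z; lra.
have c2 : 1 / 2 <= cos z by apply: cos_ge_half; rewrite /z; lra.
have z0 : 0 <= z by rewrite /z; lra.
rewrite {2}ez sinD e; have -> : y = 2 * z by rewrite /z; field.
have h : 1 / 2 * z <= cos x * z by rewrite ler_wpM2r.
have : 1 / 2 * z * (1 / 2) <= cos x * z * cos z by apply: ler_pM; lra.
lra.
Qed.

Lemma normc_1e2pi (z : R) : normc (1 - e2pi z) = 2 * `|sin (pi * z)|.
Proof.
rewrite /e2pi /=; have -> : 2 * pi * z = pi * z + pi * z by ring.
rewrite cosD sinD; have h := cos2Dsin2 (pi * z); set s := sin _ in h *; set c := cos _ in h *.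
have -> : (1 - (c * c - s * s)) ^+ 2 + (0 - (s * c + c * s)) ^+ 2 = (2 * s) ^+ 2.
 have -> : 1 = c ^+ 2 + s ^+ 2 by []. transitivity (4 * s ^+ 2 * (c ^+ 2 + s ^+ 2)); first by ring. by rewrite h; ring.
by rewrite sqrtr_sqr normrM ger0_norm.
Qed.

Lemma normc_1e2pi_ge (z : R) : 0 <= z <= 1 / 2 -> z <= normc (1 - e2pi z).
Proof.
move=> /andP[z0 z1]; rewrite normc_1e2pi; have p2 := pi_ge2 R.
have h : pi * z / 4 <= sin (pi * z) by apply: sin_ge; nra.
have : 2 * (pi * z / 4) <= 2 * `|sin (pi * z)| by rewrite ler_pM2l // (le_trans h) // ler_norm.
nra.
Qed.

Lemma normc_1ee_ge c a : (0 < c)%N -> (0 < a < c)%N -> (minn a (c - a))%:R / c%:R <= normc (1 - ee c a).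
Proof.
move=> c0 /andP[a0 ac]; have c0' : 0 < c%:R :> R by rewrite ltr0n.
case: (leqP (a + a) c) => h.
 have -> : minn a (c - a) = a by lia. apply: normc_1e2pi_ge; rewrite divr_ge0 //= ler_pdivrMr //. by have : (a + a)%:R <= c%:R :> R; [rewrite ler_nat | rewrite natrD; lra].
have -> : minn a (c - a) = (c - a)%N by lia.
have -> : normc (1 - ee c a) = normc (1 - ee c (c - a)%N).
 have -> : ee c (c - a)%N = conjc (ee c a).
  by rewrite -eeN -[RHS](ee_per R _ 1 c0); congr ee; lia.
 by rewrite -normc_conj; rewrite rmorphB /= oppr0.
apply: normc_1e2pi_ge; rewrite divr_ge0 //= ler_pdivrMr //.
by have : ((c - a) + (c - a))%:R <= c%:R :> R; [rewrite ler_nat; lia | rewrite natrD; lra].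
Qed.

Lemma sin_le (z : R) : `|sin z| <= `|z|.
Proof.
wlog z0 : z / 0 <= z.
 move=> H; case: (lerP 0 z) => h; first exact: H. by rewrite -normrN -sinN -[`|z|]normrN; apply: H; lra.
have [x _ ->] := sin_mvt z0; rewrite normrM ler_piMl //.
exact: cos_max.
Qed.

Lemma e2pi_lip (x y : R) : normc (e2pi x - e2pi y) <= 2 * pi * `|x - y|.
Proof.
have -> : e2pi x - e2pi y = e2pi x * (1 - e2pi (y - x)) by rewrite mulrBr mulr1 -e2piD (addrC x) subrK.
rewrite normcM normc_e2pi mul1r normc_1e2pi -mulrA ler_pM2l //.
by apply: le_trans (sin_le _) _; rewrite normrM distrC gtr0_norm // pi_gt0.
Qed.

Definition harm_sum n : R := \sum_(k < n) (k.+1%:R)^-1.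

(** A geometric sum is at most 2 / |1 - e(a / Q)|, and this distance is at least min(a, Q - a) / Q.
    Both reciprocals are kept in place of the one of the minimum. *)
Lemma geom_bound Q a b n : (0 < Q)%N -> (0 < a < Q)%N -> normc (\sum_(i < n) ee Q (- (a%:Z * (b + i%:Z)))) <= 2 * Q%:R * (a%:R^-1 + (Q - a)%:R^-1).
Proof.
move=> Q0 /andP[a0 aQ]; set z := ee Q (- a%:Z).
have -> : \sum_(i < n) ee Q (- (a%:Z * (b + i))) = ee Q (- (a%:Z * b)) * \sum_(i < n) z ^+ i.
 rewrite mulr_sumr; apply: eq_bigr => i _; rewrite -ee_prod -eeD; congr ee; ring.
rewrite normcM normc_ee mul1r.
have zn : normc z = 1 by rewrite normc_ee.
have h1 : normc (1 - z) = normc (1 - ee Q a) by rewrite /z eeN -[RHS]normc_conj rmorphB /= oppr0.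
have h2 := @normc_1ee_ge Q a Q0; rewrite a0 aQ -h1 in h2; move: (h2 isT) => {h2} h2.
have Qp : 0 < Q%:R :> R by rewrite ltr0n.
have mp : 0 < (minn a (Q - a))%:R :> R by rewrite ltr0n; lia.
have nz : 0 < normc (1 - z) by apply: lt_le_trans h2; rewrite divr_gt0.
have e : normc (\sum_(i < n) z ^+ i) * normc (1 - z) <= 2.
 rewrite -normcM mulrC. have -> : (1 - z) * (\sum_(i < n) z ^+ i) = 1 - z ^+ n by rewrite -[RHS]opprB subrX1; ring. apply: le_trans (le_normcD _ _) _; rewrite normc1 normcN.
 have -> : normc (z ^+ n) = 1 by elim: n => [|k IH]; rewrite ?normc1 // exprS normcM IH mulr1. lra.
rewrite -(ler_pM2r nz); apply: le_trans e _.
have h3 : (minn a (Q - a))%:R^-1 <= a%:R^-1 + (Q - a)%:R^-1 :> R.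
 by case: leqP => _; rewrite ?lerDl ?lerDr invr_ge0.
apply: le_trans (_ : 2 * Q%:R * (minn a (Q - a))%:R^-1 * ((minn a (Q - a))%:R / Q%:R) <= _).
 by rewrite le_eqVlt; apply/orP; left; apply/eqP; field; rewrite !gt_eqF.
apply: ler_pM; rewrite ?divr_ge0 ?mulr_ge0 //.
by rewrite ler_pM2l // mulr_gt0.
Qed.

Lemma harm_ge0 n : 0 <= harm_sum n.
Proof. by apply: sumr_ge0 => i; rewrite invr_ge0 ler0n. Qed.
Lemma harm_mono m n : (m <= n)%N -> harm_sum m <= harm_sum n.
Proof.
move=> mn; rewrite /harm_sum -(subnKC mn) big_split_ord /= lerDl.
by apply: sumr_ge0 => i; rewrite invr_ge0 ler0n.
Qed.

(** F is expanded in additive characters modulo Q. The frequency 0 contributes at most M n / Q <= M,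
    the others M times a harmonic sum. *)
Lemma completion Q (F : int -> R[i]) (M : R) b n : (0 < Q)%N -> (n <= Q)%N -> (forall a, normc (\sum_(x < Q) F x * ee Q (a * x%:Z)) <= M) -> per Q F ->
 normc (\sum_(i < n) F (b + i%:Z)) <= M * (1 + 4 * harm_sum Q).
Proof.
move=> Q0 nQ FM pF; have Qp : 0 < Q%:R :> R by rewrite ltr0n.
have M0 : 0 <= M by apply: le_trans (FM 0); exact: normc_ge0.
pose Fh a := \sum_(x < Q) F x * ee Q (a * x%:Z).
have inv y : F y * Q%:R = \sum_(a < Q) Fh a * ee Q (- (a%:Z * y)).
 have [r [k [rQ ->]]] := int_ediv y Q0; rewrite pF. under eq_bigr => a _ do rewrite mulr_suml. rewrite exchange_big (bigD1 (Ordinal rQ)) //= [X in _ + X]big1 => [|x xr].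
  rewrite addr0; transitivity (\sum_(a < Q) F r); first by rewrite sumr_const card_ord mulr_natr. apply: eq_bigr => a _; rewrite -mulrA -eeD. rewrite (_ : a%:Z * r + _ = Q%:Z * (- (a%:Z * k))); last by ring.
  by rewrite ee_mul // mulr1.
 transitivity (F x * \sum_(a < Q) ee Q ((x%:Z - (r%:Z + Q%:Z * k)) * a)).
  rewrite mulr_sumr; apply: eq_bigr => a _; rewrite -mulrA -eeD; congr (_ * ee _ _). by ring.
 rewrite ee_orth //; case: ifP; rewrite ?mulr0 opprD addrA rpredBr ?dvdz_mulr // => h. case/eqP: xr; apply: val_inj => /=; exact: eqmod_small.
have e : (\sum_(i < n) F (b + i)) * Q%:R = \sum_(a < Q) Fh a * \sum_(i < n) ee Q (- (a%:Z * (b + i))).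
 rewrite mulr_suml; under eq_bigr => i _ do rewrite inv. by rewrite exchange_big; apply: eq_bigr => a; rewrite mulr_sumr.
rewrite -(ler_pM2r Qp) -{1}normc_natr -normcM e.
apply: le_trans (normc_sum _ _ _) _.
have -> : Q = Q.-1.+1 by lia.
rewrite big_ord_recl /=; set q := Q.-1.
apply: le_trans (_ : M * Q%:R + \sum_(i < q) M * (2 * Q%:R * ((i.+1)%:R^-1 + (q - i)%:R^-1)) <= _).
 apply: lerD.
  rewrite normcM; apply: ler_pM; rewrite ?normc_ge0 ?FM //. apply: le_trans (normc_sum _ _ _) _; under eq_bigr => i _ do rewrite normc_ee. by rewrite sumr_const card_ord ler_nat.
 apply: ler_sum => i _; rewrite normcM; apply: ler_pM; rewrite ?normc_ge0 ?FM //. have -> : (q - i)%N = (Q - i.+1)%N by rewrite /q; lia.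
 rewrite prednK //; apply: (@geom_bound Q i.+1); have := ltn_ord i; rewrite /q; lia.
have hq : \sum_(i < q) ((i.+1)%:R^-1 + (q - i)%:R^-1) = 2 * harm_sum q.
 rewrite big_split /= [X in _ + X](reindex_inj rev_ord_inj) /= mulr_natl mulr2n; congr (_ + _). by apply: eq_bigr => i _; congr (_%:R^-1); have := ltn_ord i; lia.
rewrite -mulr_sumr -mulr_sumr hq prednK //.
have : harm_sum q <= harm_sum Q by apply: harm_mono; rewrite /q; lia.
move=> hh; have : M * Q%:R * (4 * harm_sum q) <= M * Q%:R * (4 * harm_sum Q).
 by rewrite ler_wpM2l ?mulr_ge0 // ler_pM2l.
lra.
Qed.

End Completion.

(** * Weights for moduli that need not be square-free *)

Definition sprimes (B v : nat) : seq nat := [seq p <- primes v | (logn p v == 1%N) && ~~ (p %| B)%N].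
(** The product of the primes at which Weil's bound will be applied: those that divide v exactly
    once and avoid the fixed number B. *)
Definition spart (B v : nat) : nat := (\prod_(p <- sprimes B v) p)%N.
Lemma sprimes_prime B v p : p \in sprimes B v -> prime p.
Proof. by rewrite mem_filter mem_primes => /andP[_ /and3P[]]. Qed.
Lemma spart_gt0 B v : (0 < spart B v)%N.
Proof. by rewrite /spart big_seq prodn_cond_gt0 // => p /sprimes_prime/prime_gt0. Qed.
Lemma uniq_sprimes B v : uniq (sprimes B v).
Proof. by rewrite filter_uniq ?primes_uniq. Qed.

Lemma logn_prod_primes (s : seq nat) p : uniq s -> all prime s -> prime p -> logn p (\prod_(r <- s) r) = (p \in s).
Proof.
move=> us /allP ps pp; elim: s us ps => [|r s IH] /=; first by rewrite big_nil logn1.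
move=> /andP[rs us] ps; have pr : prime r by apply: ps; rewrite inE eqxx.
rewrite big_cons lognM ?(prime_gt0 pr) //; last first.
 by rewrite big_seq prodn_cond_gt0 // => x xs; rewrite prime_gt0 // ps // inE xs orbT.
rewrite IH // => [|x xs]; last by rewrite ps // inE xs orbT.
rewrite logn_prime // inE; case: eqVneq => //= e.
by rewrite e (negbTE rs).
Qed.

Lemma spart_logn B v p : prime p -> logn p (spart B v) = (p \in sprimes B v).
Proof.
by apply: logn_prod_primes; rewrite ?uniq_sprimes //; apply/allP => r /sprimes_prime.
Qed.

Lemma dvdn_logn m n : (0 < m)%N -> (0 < n)%N -> (forall p, prime p -> (logn p m <= logn p n)%N) -> (m %| n)%N.
Proof.
move=> m0 n0 h; apply/(dvdn_partP _ m0) => p; rewrite mem_primes => /and3P[pp _ _].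
by rewrite p_part (dvdn_trans (dvdn_exp2l _ (h p pp))) // pfactor_dvdnn.
Qed.

Lemma spart_dvd B v : (0 < v)%N -> (spart B v %| v)%N.
Proof.
move=> v0; apply: dvdn_logn => // [|p pp]; first exact: spart_gt0.
rewrite spart_logn // mem_filter; case: (logn p v =P 1) => [->|] //=.
by lia.
Qed.

Definition scof B v := (v %/ spart B v)%N.
Lemma spart_scof B v : (0 < v)%N -> (spart B v * scof B v)%N = v.
Proof. by move=> v0; rewrite mulnC divnK // spart_dvd. Qed.
Lemma scof_gt0 B v : (0 < v)%N -> (0 < scof B v)%N.
Proof. by move=> v0; rewrite divn_gt0 ?spart_gt0 // dvdn_leq ?spart_dvd. Qed.
Lemma sprimes_scof B v p : (0 < v)%N -> p \in sprimes B v -> coprime p (scof B v).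
Proof.
move=> v0 ps; have pp := sprimes_prime ps; rewrite prime_coprime //; apply/negP => h.
have e : logn p v = (logn p (spart B v) + logn p (scof B v))%N by rewrite -{1}(spart_scof B v0) lognM ?spart_gt0 ?scof_gt0.
move: ps e; rewrite spart_logn // => ps; rewrite ps; move: ps.
rewrite mem_filter => /andP[/andP[/eqP -> _] _].
have : (0 < logn p (scof B v))%N by rewrite logn_gt0 mem_primes pp scof_gt0.
by lia.
Qed.

Lemma sqf_logn l p : (0 < l)%N -> prime p -> squarefree l -> (logn p l <= 1)%N.
Proof.
move=> l0 pp sl; rewrite leqNgt; apply/negP => h.
have : (p ^ 2 %| l)%N by rewrite pfactor_dvdn.
by move/sl => e; move: pp; rewrite e.
Qed.

Lemma sq_decomp n : (0 < n)%N -> exists a l, [/\ (0 < a)%N, (0 < l)%N, n = (a ^ 2 * l)%N & squarefree l].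
Proof.
elim/ltn_ind: n => n IH n0.
case: (boolP [exists p : 'I_n.+1, prime p && (p ^ 2 %| n)%N]) => [/existsP[p /andP[pp pn]]|h].
 have p1 := prime_gt1 pp; have [m e] := dvdnP pn; have m0 : (0 < m)%N by lia. have mn : (m < n)%N by rewrite e -[X in (X < _)%N]muln1 ltn_mul2l m0; case: nat_of_ord p1 => [|[|k]].
 have [a [l [a0 l0 em sl]]] := IH m mn m0. exists (a * p)%N, l; split => //; first by lia. by lia.
exists 1, n; split; rewrite ?mul1n // => d dn.
have d0 : (0 < d)%N by case: d dn => //; rewrite dvd0n; move: n0; case: (n).
case: (ltnP 1 d) => d1; last by lia.
have pp := pdiv_prime d1; case/negP: h; apply/existsP.
have pdn : (pdiv d ^ 2 %| n)%N by apply: dvdn_trans dn; rewrite dvdn_exp2r // pdiv_dvd.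
have lt : (pdiv d < n.+1)%N by rewrite ltnS dvdn_leq // (dvdn_trans _ pdn) // dvdn_exp.
by exists (Ordinal lt); rewrite pp.
Qed.

(** A prime dividing l but not a divides the cofactor exactly once, so only its dividing B can have
    kept it out of [sprimes]. *)
Lemma scof_decomp B v : (0 < v)%N -> (0 < B)%N -> exists a l, [/\ (0 < a)%N, (0 < l)%N, scof B v = (a ^ 2 * l)%N & (l %| a * B)%N].
Proof.
move=> v0 B0; have [a [l [a0 l0 e sl]]] := sq_decomp (scof_gt0 B v0).
exists a, l; split => //; apply: dvdn_logn; rewrite ?muln_gt0 ?a0 // => p pp.
have l1 := sqf_logn l0 pp sl; rewrite lognM //.
case: (posnP (logn p l)) => [-> //|lp]; have {}l1 : logn p l = 1%N by lia.
rewrite l1; case: (posnP (logn p a)) => [la|]; last by lia.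
rewrite la logn_gt0 mem_primes pp B0 /=; apply/negPn/negP => pB.
have ls : logn p (scof B v) = 1%N by rewrite e lognM ?expn_gt0 ?a0 // lognX la.
have lv : logn p v = (logn p (spart B v) + logn p (scof B v))%N by rewrite -{1}(spart_scof B v0) lognM ?spart_gt0 ?scof_gt0.
have : p \in sprimes B v.
 case: (boolP (p \in sprimes B v)) => // ps; move: lv. rewrite spart_logn // (negbTE ps) ls => lv; case/negP: ps. by rewrite mem_filter pB mem_primes pp v0 -[p]expn1 pfactor_dvdn // lv.
by move/(sprimes_scof v0); rewrite prime_coprime // => /negP; apply; rewrite -[p]expn1 pfactor_dvdn ?scof_gt0 // ls.
Qed.

Lemma size_divisors_prod (s : seq nat) : uniq s -> all prime s -> (2 ^ size s <= size (divisors (\prod_(p <- s) p)))%N.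
Proof.
elim: s => [|p s IH] /=; first by rewrite big_nil.
move=> /andP[ps us] /andP[pp pr]; set m := (\prod_(r <- s) r)%N.
have m0 : (0 < m)%N by rewrite /m big_seq prodn_cond_gt0 // => r rs; rewrite prime_gt0 // (allP pr).
have pm : ~~ (p %| m)%N.
 rewrite -[p]expn1 pfactor_dvdn // /m logn_prod_primes // (negbTE ps) //.
rewrite big_cons -/m expnS mul2n -addnn.
apply: leq_trans (_ : size (divisors m ++ [seq p * d | d <- divisors m]) <= _)%N.
 by rewrite size_cat size_map leq_add // IH.
apply: uniq_leq_size.
 rewrite cat_uniq divisors_uniq map_inj_uniq ?divisors_uniq => [|x y /eqP]; last first.
  by rewrite eqn_pmul2l ?prime_gt0 // => /eqP.
 rewrite andbT; apply/hasPn => _ /mapP[d _ ->]; rewrite -dvdn_divisors //. by apply: contra pm => h; apply: dvdn_trans h; rewrite dvdn_mulr.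
move=> d; rewrite mem_cat -!dvdn_divisors ?muln_gt0 ?(prime_gt0 pp) // => /orP[h|/mapP[e]].
 by rewrite dvdn_mull.
by rewrite -dvdn_divisors // => h ->; rewrite dvdn_mul.
Qed.

Lemma size_divisorsM a b : (0 < a)%N -> (0 < b)%N -> (size (divisors (a * b)) <= size (divisors a) * size (divisors b))%N.
Proof.
move=> a0 b0; rewrite -(size_allpairs muln); apply: uniq_leq_size; first exact: divisors_uniq.
move=> d; rewrite -dvdn_divisors ?muln_gt0 ?a0 // => dab.
have g0 : (0 < gcdn d a)%N by rewrite gcdn_gt0 a0 orbT.
apply/allpairsP; exists (gcdn d a, d %/ gcdn d a)%N => /=; split.
- by rewrite -dvdn_divisors // dvdn_gcdr.
- rewrite -dvdn_divisors // -(@Gauss_dvdr _ (a %/ gcdn d a)); last first.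
  by rewrite /coprime -(eqn_pmul2r g0) mul1n muln_gcdl !divnK ?dvdn_gcdl ?dvdn_gcdr.
 by rewrite -(@dvdn_pmul2r (gcdn d a)) // mulnAC !divnK ?dvdn_gcdl ?dvdn_gcdr.
by rewrite mulnC divnK // dvdn_gcdl.
Qed.

Section Weights.
Variable R : realType.
Local Notation ee := (efrac R).
Local Notation harm := (harm_sum R).

(** Bound for a complete Kloosterman sum modulo v: Weil at the primes of [sprimes], trivial on the
    cofactor. *)
Definition wt B v : R := (scof B v)%:R * \prod_(p <- sprimes B v) (2 * Num.sqrt p%:R).
Lemma wt_ge0 B v : 0 <= wt B v.
Proof. by rewrite mulr_ge0 // prodr_ge0 // => p; rewrite mulr_ge0 ?sqrtr_ge0. Qed.

(** Completion modulo q v. B contains q and the primes of k, since Weil's bound is applied at primes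
    that divide neither. *)
Lemma incomplete_kl B q v (G : int -> R[i]) k b n : (0 < q)%N -> (0 < v)%N -> per q G -> (forall x, normc (G x) <= 1) -> (q %| B)%N -> (forall p, prime p -> (p %| k)%Z -> (p %| B)%N) -> (n <= q * v)%N ->
 normc (\sum_(i < n) if coprimez (b + i%:Z) v then G (b + i) * ee v (k * iv v (b + i)) else 0)
  <= q%:R * wt B v * (1 + 4 * harm (q * v)).
Proof.
move=> q0 v0 pG G1 qB kB nQ.
pose F x := klterm q v G k 0 x.
have -> : \sum_(i < n) (if coprimez (b + i) v then G (b + i) * ee v (k * iv v (b + i)) else 0) = \sum_(i < n) F (b + i).
 by apply: eq_bigr => i; rewrite /F /klterm mul0r ee0 mulr1.
apply: completion => //; first by lia.
 move=> a; have -> : \sum_(x < q * v) F x * ee (q * v) (a * x) = klsum q v G k a.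
  rewrite klsum_term; apply: eq_bigr => x _; rewrite /F /klterm; case: ifP => _; last by rewrite mul0r. by rewrite ee0 mulr1.
 have := @klsum_bound R (sprimes B v) q (scof B v) G k a q0 (scof_gt0 B v0) pG G1. rewrite -/(spart B v) spart_scof // => h; rewrite /wt mulrA -natrM; apply: h.
 - by apply/allP => p /sprimes_prime.
 - exact: uniq_sprimes.
 move=> p ps; have pp := sprimes_prime ps. have pB : ~~ (p %| B)%N by move: ps; rewrite mem_filter => /andP[/andP[]]. rewrite coprimeMr sprimes_scof // andbT prime_coprime //; apply/andP; split.
  by apply: contra pB => /dvdn_trans; apply.
 by apply: contra pB; exact: kB.
exact: klterm_per.
Qed.

(** A pair (i, j) belongs to at most one n. Indices are shifted by one throughout. *)
Lemma harm_sum_prod V (f : nat -> nat -> R) : (forall i j, 0 <= f i j) -> \sum_(n < V) \sum_(i < V) \sum_(j < V | (i.+1 * j.+1 == n.+1)%N) f i j <= \sum_(i < V) \sum_(j < V) f i j.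
Proof.
move=> f0; rewrite exchange_big; apply: ler_sum => i _.
rewrite (exchange_big_dep xpredT) //=; apply: ler_sum => j _.
rewrite sumr_const; case: (pickP (fun n : 'I_V => (i.+1 * j.+1 == n.+1)%N)) => [n0 /eqP e|h].
 rewrite (_ : #|_| = 1%N) //; rewrite -(card1 n0); apply: eq_card => n. change ((i.+1 * j.+1 == n.+1)%N = (n == n0)); rewrite e. by apply/eqP/eqP => [[h]|->] //; exact: val_inj.
by rewrite eq_card0 //.
Qed.

Lemma card_dvd_le V N : (0 < N)%N -> (#|[pred i : 'I_V | (i.+1 %| N)%N]| <= size (divisors N))%N.
Proof.
move=> N0; rewrite cardE -(size_map (fun i : 'I_V => i.+1)); apply: uniq_leq_size.
 by rewrite map_inj_uniq ?enum_uniq // => i j [] /val_inj.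
by move=> d; case/mapP=> i hi ->; move: hi; rewrite mem_enum -dvdn_divisors.
Qed.

Lemma size_divisors_le V N : (0 < N <= V)%N -> (size (divisors N) <= #|[pred i : 'I_V | (i.+1 %| N)%N]|)%N.
Proof.
move=> /andP[N0 NV]; rewrite cardE -(size_map (fun i : 'I_V => i.+1)); apply: uniq_leq_size.
 exact: divisors_uniq.
move=> d; rewrite -dvdn_divisors // => dN; have d0 := dvdn_gt0 N0 dN.
have dV : (d.-1 < V)%N by rewrite prednK // (leq_trans (dvdn_leq N0 dN)).
apply/mapP; exists (Ordinal dV); last by rewrite prednK.
by rewrite mem_enum inE prednK.
Qed.

Lemma tau_sum V : \sum_(n < V) (size (divisors n.+1))%:R / (n.+1)%:R <= harm V ^+ 2.
Proof.
pose f i j : R := (i.+1)%:R^-1 * (j.+1)%:R^-1.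
have f0 i j : 0 <= f i j by rewrite mulr_ge0 ?invr_ge0.
apply: le_trans (_ : \sum_(i < V) \sum_(j < V) f i j <= _); last first.
 by rewrite expr2 /harm_sum mulr_suml; apply: ler_sum => i; rewrite mulr_sumr.
apply: le_trans (harm_sum_prod V f0); apply: ler_sum => n _.
apply: le_trans (_ : #|[pred i : 'I_V | (i.+1 %| n.+1)%N]|%:R / (n.+1)%:R <= _).
 by rewrite ler_pM2r ?invr_gt0 // ler_nat size_divisors_le //=.
rewrite -sumr_const mulr_suml big_mkcond; apply: ler_sum => i _; case: ifP => [|_]; last first.
 by apply: sumr_ge0 => j _.
rewrite inE => /dvdnP[[//|j] e]; rewrite mulnC in e.
have jV : (j < V)%N.
 by apply: leq_trans (ltn_ord n); rewrite e; apply: leq_pmull.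
rewrite (bigD1 (Ordinal jV)) /= ?e // /f -[X in X <= _]addr0; apply: lerD.
 by rewrite mul1r natrM invfM.
by apply: sumr_ge0 => k _; exact: f0.
Qed.

(** Let v = P m with P = [spart] and cofactor m = a^2 l. Then wt v / v = 2^omega(P) / sqrt(P) <=
    sqrt(V) tau(P) / (P a), since a sqrt(P) <= sqrt(P m) <= sqrt(V), and the sums over P and over
    (a, l) separate. *)
Lemma wt_sum B V : (0 < B)%N -> \sum_(n < V) wt B n.+1 / (n.+1)%:R <= Num.sqrt V%:R * (size (divisors B))%:R * harm V ^+ 4.
Proof.
move=> B0.
pose tau n : R := (size (divisors n))%:R.
(* Instead of choosing a and l for each cofactor, 1 / a is summed over all admissible pairs. *)
pose g j : R := \sum_(a < V) \sum_(l < V | (a.+1 ^ 2 * l.+1 == j.+1)%N && (l.+1 %| a.+1 * B)%N) (a.+1)%:R^-1.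
pose f i : R := tau i.+1 / (i.+1)%:R.
have f0 i : 0 <= f i by rewrite mulr_ge0 ?invr_ge0.
have g0 i : 0 <= g i by do 2![apply: sumr_ge0 => ? _]; rewrite invr_ge0 ler0n.
have fg0 i j : 0 <= f i * g j by rewrite mulr_ge0.
have gauss : \sum_(j < V) g j <= tau B * harm V ^+ 2.
 rewrite /g exchange_big /=. apply: le_trans (_ : \sum_(a < V) tau B * (tau a.+1 / (a.+1)%:R) <= _); last first.
  by rewrite -mulr_sumr ler_wpM2l // tau_sum.
 apply: ler_sum => a _; rewrite (exchange_big_dep (fun l : 'I_V => (l.+1 %| a.+1 * B)%N)) /=; last first.
  by lia.
 apply: le_trans (_ : \sum_(l < V | (l.+1 %| a.+1 * B)%N) (a.+1)%:R^-1 <= _).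
  apply: ler_sum => l lB; rewrite sumr_const -[X in _ <= X]mulr1n; apply: ler_wpMn2l; rewrite ?invr_ge0 //. apply/card_le1_eqP => x y; rewrite -!topredE /= !lB !andbT => /eqP hx /eqP; rewrite hx => -[].
  by move/val_inj.
 have -> : \sum_(l < V | (l.+1 %| a.+1 * B)%N) (a.+1)%:R^-1 = #|[pred l : 'I_V | (l.+1 %| a.+1 * B)%N]|%:R * (a.+1)%:R^-1 :> R.
  by rewrite -sumr_const mulr_suml; rewrite mul1r.
 by rewrite mulrA ler_pM2r ?invr_gt0 // -natrM ler_nat mulnC (leq_trans (card_dvd_le _ _)) ?muln_gt0 ?B0 // size_divisorsM.
apply: le_trans (_ : Num.sqrt V%:R * \sum_(i < V) \sum_(j < V) f i * g j <= _); last first.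
 rewrite -mulrA ler_wpM2l ?sqrtr_ge0 //. under eq_bigr => i _ do rewrite -mulr_sumr. rewrite -mulr_suml (_ : _ * harm V ^+ 4 = harm V ^+ 2 * (tau B * harm V ^+ 2)); last by lra; ring.
 by apply: ler_pM; rewrite ?sumr_ge0 // tau_sum.
apply: le_trans (_ : Num.sqrt V%:R * (\sum_(n < V) \sum_(i < V) \sum_(j < V | (i.+1 * j.+1 == n.+1)%N) f i * g j) <= _); last first.
 by rewrite ler_wpM2l ?sqrtr_ge0 //; exact: (@harm_sum_prod V (fun i j => f i * g j)).
rewrite mulr_sumr; apply: ler_sum => n _; set v := n.+1.
have v0 : (0 < v)%N by [].
have P0 := spart_gt0 B v; have c0 := scof_gt0 B v0; have e := spart_scof B v0.
have [a [l [a0 l0 ec la]]] := scof_decomp v0 B0.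
set P := spart B v in P0 e *; set m := scof B v in c0 e ec *.
have vV : (v <= V)%N by rewrite /v.
have PV : (P.-1 < V)%N by rewrite prednK // (leq_trans _ vV) // -e leq_pmulr.
have mV : (m <= V)%N by rewrite (leq_trans _ vV) // -e leq_pmull.
have mV1 : (m.-1 < V)%N by lia.
have aV : (a.-1 < V)%N by rewrite prednK // (leq_trans _ mV) // ec (leq_trans (_ : a <= a ^ 2)%N) ?leq_pmulr.
have lV : (l.-1 < V)%N by rewrite prednK // (leq_trans _ mV) // ec leq_pmull // expn_gt0 a0.
have ga : a%:R^-1 <= g m.-1.
 by rewrite /g (bigD1 (Ordinal aV)) //= (bigD1 (Ordinal lV)) ?prednK ?ec ?eqxx ?muln_gt0 ?a0 // -[X in X <= _]addr0 -[X in X <= _]addr0 !lerD ?sumr_ge0 => *; rewrite ?sumr_ge0 // => *; rewrite invr_ge0 ler0n.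
have inner : f P.-1 * g m.-1 <= \sum_(i < V) \sum_(j < V | (i.+1 * j.+1 == v)%N) f i * g j.
 by rewrite (bigD1 (Ordinal PV)) //= (bigD1 (Ordinal mV1)) ?prednK ?e // -[X in X <= _]addr0 -[X in X <= _]addr0 !lerD ?sumr_ge0 => *; rewrite ?sumr_ge0.
apply: le_trans (_ : Num.sqrt V%:R * (tau P / P%:R * a%:R^-1) <= _); last first.
 rewrite ler_wpM2l ?sqrtr_ge0 //; apply: le_trans inner; rewrite /f prednK //. by rewrite ler_wpM2l // mulr_ge0 ?invr_ge0.
have Pp : 0 < P%:R :> R by rewrite ltr0n.
have mp : 0 < m%:R :> R by rewrite ltr0n.
have ap : 0 < a%:R :> R by rewrite ltr0n.
have sP : \prod_(p <- sprimes B v) (2 * Num.sqrt p%:R) = 2 ^+ size (sprimes B v) * Num.sqrt P%:R :> R.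
 rewrite /P /spart; elim: sprimes => [|p s IH]; first by rewrite !big_nil sqrtr1 mul1r. by rewrite !big_cons exprS natrM sqrtrM // IH; ring.
have tP : 2 ^+ size (sprimes B v) <= tau P.
 rewrite -natrX ler_nat; apply: size_divisors_prod; first exact: uniq_sprimes. by apply/allP => p /sprimes_prime.
have ev : v%:R = P%:R * m%:R :> R by rewrite -natrM e.
rewrite /wt sP -/m ev.
have am : a%:R <= Num.sqrt m%:R :> R.
 rewrite -[X in X <= _]ger0_norm // -sqrtr_sqr ler_sqrt // -natrX ler_nat ec. by rewrite leq_pmulr.
have sq : Num.sqrt P%:R * Num.sqrt m%:R <= Num.sqrt V%:R :> R by rewrite -sqrtrM // ler_sqrt // -natrM ler_nat e.
set S := Num.sqrt P%:R in sq *; set A := Num.sqrt m%:R in am sq; set T := 2 ^+ _ in tP *.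
have S0 : 0 <= S by rewrite sqrtr_ge0.
have -> : m%:R * (T * S) / (P%:R * m%:R) = T * (S * a%:R) / (P%:R * a%:R).
 by field; rewrite !gt_eqF.
have -> : Num.sqrt V%:R * (tau P / P%:R / a%:R) = tau P * Num.sqrt V%:R / (P%:R * a%:R).
 by lra.
rewrite ler_pM2r ?invr_gt0 ?mulr_gt0 //; apply: ler_pM; rewrite ?mulr_ge0 ?exprn_ge0 //.
by apply: le_trans sq; rewrite ler_wpM2l.
Qed.

End Weights.

(** * The Farey dissection *)

Definition fareyu (v v' : nat) : int := ((- iv v v'%:Z) %% v%:Z)%Z.
(** For neighbours u / v < u' / v', that is u' v - u v' = 1, both numerators are determined by the
    denominators once 0 <= u < v; so cells can be indexed by pairs of denominators. *)
Definition fareyu' (v v' : nat) : int := ((1 + fareyu v v' * v'%:Z) %/ v%:Z)%Z.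
Lemma fareyu_range v v' : (0 < v)%N -> 0 <= fareyu v v' < v.
Proof.
move=> v0; rewrite /fareyu modz_ge0 ?ltz_pmod //; first by lia.
Qed.

Lemma fareyu_unimod v v' : (0 < v)%N -> coprime v v' -> fareyu' v v' * v - fareyu v v' * v' = 1.
Proof.
move=> v0 cp; rewrite /fareyu' divzK ?addrK //.
have h : (v %| v'%:Z * iv v v' - 1)%Z by apply: iv_mul; rewrite copz_nat coprime_sym.
have -> : 1 + fareyu v v' * v' = (fareyu v v' - (- iv v v')) * v' - (v'%:Z * iv v v' - 1) by ring.
rewrite rpredB // dvdz_mulr // /fareyu -eqz_mod_dvd modz_mod //.
Qed.

Lemma fareyu'_range v v' : (0 < v)%N -> (0 < v')%N -> coprime v v' -> 0 < fareyu' v v' <= v'.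
Proof.
move=> v0 v'0 cp; have e := fareyu_unimod v0 cp; have /andP[u0 u1] := fareyu_range v' v0.
by nia.
Qed.

Lemma fareyuE v v' (u u' : int) : (0 < v)%N -> u' * v - u * v'%:Z = 1 -> 0 <= u < v -> coprime v v' /\ u = fareyu v v' /\ u' = fareyu' v v'.
Proof.
move=> v0 e /andP[u0 u1].
have cp : coprimez v' v by apply/coprimezP; exists (- u, u') => /=; rewrite -e; ring.
have cp' : coprime v v' by rewrite coprime_sym.
have e' := fareyu_unimod v0 cp'; have /andP[w0 w1] := fareyu_range v' v0.
have eu : u = fareyu v v'.
 have : (v %| u - fareyu v v')%Z.
  rewrite -(@Gauss_dvdzr _ v'); last by []. apply/dvdzP; exists (u' - fareyu' v v').
  have -> : v'%:Z * (u - fareyu v v') = - (u' * v - u * v') + (fareyu' v v' * v - fareyu v v' * v') + (u' - fareyu' v v') * v by ring. by lia.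
 case/dvdzP => k ek; have : k = 0 by nia. by lia.
split => //; split => //; apply: (@mulIf _ v%:Z); first by lia.
by lia.
Qed.

(** Induction on the order: the mediant is inserted as soon as its denominator does not exceed the
    order. *)
Lemma farey_ex (V c : nat) (y : int) : (0 < V)%N -> 0 <= y < c -> exists v v', exists u u' : int, [/\ (0 < v <= V)%N, (0 < v' <= V)%N, (V < v + v')%N, u' * v - u * v' = 1 &
  [/\ 0 <= u < v, u * c <= y * v & y * v' < u' * c]].
Proof.
move=> V0 /andP[y0 yc]; elim: V V0 => // V IH _; case: (posnP V) => [->|V0].
 by exists 1, 1, 0, 1; rewrite ?mulr1 ?mul1r.
have [v [v' [u [u' [/andP[v0 vV] /andP[v'0 v'V] vv e [/andP[u0 uv] h1 h2]]]]]] := IH V0.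
case: (ltnP V.+1 (v + v')) => h.
 by exists v, v', u, u'; split; try lia; rewrite u0.
case: (lerP ((u + u') * c) (y * (v + v')%N)) => h3.
 exists (v + v')%N, v', (u + u'), u'; split; try lia; split => //. by nia.
exists v, (v + v'), u, (u + u'); split; try lia; split => //; first by lia.
Qed.

Lemma farey_between (v v' v2 : nat) (u u' u2 : int) : u' * v - u * v' = 1 -> u * v2 < u2 * v -> u2 * v' < u' * v2 -> (v + v' <= v2)%N.
Proof.
move=> e h1 h2.
have : v2%:Z = v%:Z * (u' * v2 - u2 * v') + v'%:Z * (u2 * v - u * v2).
 have -> : v%:Z * (u' * v2 - u2 * v') + v'%:Z * (u2 * v - u * v2) = v2%:Z * (u' * v - u * v') by ring. by rewrite e mulr1.
have : v%:Z * 1 <= v%:Z * (u' * v2 - u2 * v') by rewrite ler_wpM2l; lia.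
have : v'%:Z * 1 <= v'%:Z * (u2 * v - u * v2) by rewrite ler_wpM2l; lia.
lia.
Qed.

Lemma farey_eq (v v' v2 v2' : nat) (u u' u2 u2' : int) : (0 < v)%N -> (0 < v2)%N -> u' * v - u * v' = 1 -> u2' * v2 - u2 * v2' = 1 -> u * v2 = u2 * v -> v = v2.
Proof.
move=> v0 v20 e e2 h.
have d1 : (v %| v2)%N.
 suff : (v %| v2%:Z)%Z by []. by apply/dvdzP; exists (u' * v2 - u2 * v'); rewrite -[LHS]mulr1 -e mulrBr [_ * (u * _)]mulrA [v2%:Z * u]mulrC h; ring.
have d2 : (v2 %| v)%N.
 suff : (v2 %| v%:Z)%Z by []. by apply/dvdzP; exists (u2' * v - u * v2'); rewrite -[LHS]mulr1 -e2 mulrBr [v%:Z * (u2 * _)]mulrA [v%:Z * u2]mulrC -h; ring.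
by apply/eqP; rewrite eqn_dvd d1.
Qed.

(** A fraction strictly between neighbours has denominator at least v + v' > V. So two cells with a
    common point have the same left end, and then the same right end. *)
Lemma farey_uniq (V c v v' v2 v2' : nat) (y u u' u2 u2' : int) : (0 < v <= V)%N -> (0 < v' <= V)%N -> (V < v + v')%N -> u' * v - u * v' = 1 -> u * c <= y * v -> y * v' < u' * c ->
 (0 < v2 <= V)%N -> (0 < v2' <= V)%N -> (V < v2 + v2')%N -> u2' * v2 - u2 * v2' = 1 ->
 u2 * c <= y * v2 -> y * v2' < u2' * c -> v = v2 /\ v' = v2'.
Proof.
move=> /andP[v0 vV] /andP[v'0 v'V] vv e h1 h2 /andP[v20 v2V] /andP[v2'0 v2'V] vv2 e2 h3 h4.
have c0 : 0 < c%:Z by nia.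
have lr (a b a' b' : int) d d' : (0 < d)%N -> (0 < d')%N -> a * c <= y * d -> y * d' < b * c -> a * d' < b * d.
 move=> d0 d'0 k1 k2; rewrite -(ltr_pM2r c0). have k3 : a * c * d' <= y * d * d' by rewrite ler_wpM2r. have k4 : y * d' * d < b * c * d by rewrite ltr_pM2r. by lia.
have k12 : u2 * v' < u' * v2 by apply: lr.
have k21 : u * v2' < u2' * v by apply: lr.
have eu : u * v2 = u2 * v.
 apply/eqP; rewrite eq_le !leNgt; apply/andP; split; apply/negP => h.
  by have := farey_between e2 h k21; lia.
 by have := farey_between e h k12; lia.
have ev := farey_eq v0 v20 e e2 eu; split => //; subst v2.
have euu : u = u2 by move: eu => /mulIf; apply; rewrite -lt0n.
subst u2.
have [k|k|k] := ltgtP (u' * v2') (u2' * v').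
- by have := @farey_between v v2' v' u u2' u' e2; lia.
- by have := @farey_between v v' v2' u u' u2' e; lia.
apply: (@farey_eq v' v v2' v (- u') (- u) (- u2') (- u)); try lia.
Qed.

(** Coprime denominators up to V belong to neighbours of order V exactly when their sum exceeds V;
    the bounds by V are left to the ranges of summation. *)
Definition fcell (V v v' : nat) := [&& coprime v v' & (V < v + v')%N].
Local Notation "\fsum_ ( V , v ; x ) F" :=
 (\sum_(1 <= x < V.+1 | fcell V v x && (v < x)%N) F) (at level 41, x name, F at level 41).

Section Partition.
Variable T : nmodType.

(** The half-open cells [u / v, u' / v') contain each y / c once; 1 <= u' c - y v' is the strict
    inequality between integers. *)
Lemma farey_partition (V c : nat) (y : int) (z : T) : (0 < V)%N -> 0 <= y < c -> z = \sum_(1 <= v < V.+1) \sum_(1 <= v' < V.+1 | fcell V v v')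
    (if (0 <= y * v - fareyu v v' * c) && (1 <= fareyu' v v' * c - y * v') then z else 0).
Proof.
move=> V0 yc; have [v [v' [u [u' [v0 v'0 vv e [u0 h1 h2]]]]]] := farey_ex V0 yc.
have /andP[v1 _] := v0; have [cp [eu eu']] := fareyuE v1 e u0.
have r0 : v \in index_iota 1 V.+1 by rewrite mem_index_iota.
have r'0 : v' \in index_iota 1 V.+1 by rewrite mem_index_iota.
pose G a b := if fcell V a b then if (0 <= y * a - fareyu a b * c) && (1 <= fareyu' a b * c - y * b) then z else 0 else 0.
have G0 a b : a \in index_iota 1 V.+1 -> b \in index_iota 1 V.+1 -> ~~ ((a == v) && (b == v')) -> G a b = 0.
 rewrite /G !mem_index_iota !ltnS => ra rb ne; case: ifP => // /andP[cab Vab]; case: ifP => // /andP[k1 k2]. have a0 : (0 < a)%N by lia. have k1' : fareyu a b * c <= y * a by lia.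
 have k2' : y * b < fareyu' a b * c by lia. have [e1 e2] := farey_uniq v0 v'0 vv e h1 h2 ra rb Vab (fareyu_unimod a0 cab) k1' k2'. by lia.
transitivity (\sum_(1 <= a < V.+1) \sum_(1 <= b < V.+1) G a b); last first.
 by apply: eq_bigr => a; rewrite [RHS]big_mkcond.
rewrite (bigD1_seq v) ?iota_uniq //= (bigD1_seq v') ?iota_uniq //= {1}/G /fcell cp vv -eu -eu' subr_ge0 h1 /=.
have -> : 1 <= u' * c - y * v' by lia.
rewrite big_seq_cond big1 => [|b /andP[rb nb]]; last first.
 by apply: G0 => //; rewrite eqxx.
rewrite big_seq_cond big1 ?addr0 // => a /andP[ra na].
by rewrite big_seq big1 // => b rb; apply: G0 => //; rewrite (negbTE na).
Qed.
End Partition.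

(** * From Farey cells to binary forms *)

Lemma sum_bij (T : nmodType) (I J : eqType) (s : seq I) (t : seq J) (P : pred I) (Q : pred J) (f : I -> J) (k : J -> I) (F : I -> T) : uniq s -> uniq t ->
 (forall x, x \in s -> P x -> [/\ f x \in t, Q (f x) & k (f x) = x]) ->
 (forall y, y \in t -> Q y -> [/\ k y \in s, P (k y) & f (k y) = y]) ->
 \sum_(x <- s | P x) F x = \sum_(y <- t | Q y) F (k y).
Proof.
move=> us ut h1 h2; rewrite -big_filter -[RHS]big_filter -(big_map k xpredT F).
apply: perm_big; apply: uniq_perm; first exact: filter_uniq.
 rewrite map_inj_in_uniq ?filter_uniq // => x y; rewrite !mem_filter => /andP[qx xt] /andP[qy yt] e. by have [_ _ <-] := h2 x xt qx; have [_ _ <-] := h2 y yt qy; rewrite e.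
move=> x; rewrite mem_filter; apply/andP/mapP => [[px xs]|[y]].
 by have [a b c] := h1 x xs px; exists (f x); rewrite ?mem_filter ?b.
by rewrite mem_filter => /andP[qy yt] ->; have [a b _] := h2 y yt qy.
Qed.

Definition zs (K : nat) : seq int := [seq i%:Z - K%:Z | i <- iota 0 (2 * K).+1].
Lemma uniq_zs K : uniq (zs K).
Proof. by rewrite map_inj_uniq ?iota_uniq // => i; lia. Qed.
Lemma mem_zs K (x : int) : (x \in zs K) = (`|x| <= K)%N.
Proof.
apply/mapP/idP => [[j]|h]; first by rewrite mem_iota => h ->; lia.
exists `|(x + K)%R|%N; last by lia.
by rewrite mem_iota; lia.
Qed.

Lemma sum_zs_opp (T : nmodType) K (F : int -> T) : \sum_(x <- zs K) F (- x) = \sum_(x <- zs K) F x.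
Proof.
symmetry; apply: (@sum_bij T _ _ (zs K) (zs K) xpredT xpredT (fun x => - x) (fun x => - x)); rewrite ?uniq_zs //.
 by move=> x; rewrite !mem_zs abszN opprK.
by move=> x; rewrite !mem_zs abszN opprK.
Qed.

Lemma sum_ord_zs (T : nmodType) c K (F : int -> T) : (c <= K.+1)%N -> (forall x, ~~ (0 <= x < c%:Z) -> F x = 0) -> \sum_(y < c) F y = \sum_(x <- zs K) F x.
Proof.
move=> cK F0; rewrite (bigID (fun x : int => 0 <= x < c)) /= [X in _ = _ + X]big1 ?addr0 //.
rewrite -(big_mkord xpredT (fun y => F y)); symmetry.
apply: (@sum_bij T _ _ (zs K) (index_iota 0 c) (fun x => 0 <= x < c) xpredT (fun x => `|x|%N) (fun y => y)).
- exact: uniq_zs.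
- exact: iota_uniq.
- by move=> x; rewrite mem_index_iota => h1; split; lia.
by move=> y; rewrite mem_zs mem_index_iota => h; split; lia.
Qed.

Lemma cell_arith1 (D X c N : int) : 1 <= X -> (32 * D + 1) * X <= 4 * c -> c <= 2 * N -> N <= 4 * D * X -> False.
Proof. by lia. Qed.

Lemma cell_arith2 (D X c w2 : int) : 0 < c -> (32 * D + 2) * c * X <= (w2 + c) * X -> w2 * X <= 4 * c ^+ 2 -> (32 * D + 1) * X <= 4 * c.
Proof.
move=> c0 h1 h2; rewrite -(ler_pM2l c0).
have -> : c * ((32 * D + 1) * X) = (32 * D + 2) * c * X - c * X by ring.
have -> : c * (4 * c) = 4 * c ^+ 2 by ring.
by lia.
Qed.

Section Cells.
Variable R : realType.
Local Notation ee := (efrac R).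
Variables (d : int) (g : nat) (phi : int -> R[i]).

Definition jterm (c Y : int) : R[i] := phi c * (jacobi ((Y ^+ 2 - d) %/ c)%Z g)%:~R.
Definition rterm (h c Y : int) : R[i] := jterm c Y * ee `|c|%N (h * Y).

(** [al] and [be] are 0 or 1 and say which end of the cell is closed; reflection exchanges them. *)
Definition cellc (al be U U' : int) (v v' : nat) (c Y : int) : bool := (c %| Y ^+ 2 - d)%Z && (al <= Y * v%:Z - U * c) && (be <= U' * c - Y * v'%:Z).

Definition cellsum (al be : int) (U U' : nat -> nat -> int) (h : int) (N M V : nat) : R[i] := \sum_(1 <= v < V.+1) \fsum_(V, v; v') \sum_(N.+1 <= c < M.+1) \sum_(Y <- zs (2 * N))
   if cellc al be (U v v') (U' v v') v v' c Y then rterm h c Y else 0.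

Definition blocksum (h : int) (N M : nat) : R[i] := \sum_(N.+1 <= c < M.+1) \sum_(y < c | (c%:Z %| y%:Z ^+ 2 - d)%Z) rterm h c y%:Z.

Lemma rterm_opp h c Y : rterm h c (- Y) = rterm (- h) c Y.
Proof. by rewrite /rterm /jterm sqrrN mulrN mulNr. Qed.
Lemma fcell_sym V v v' : fcell V v v' = fcell V v' v.
Proof. by rewrite /fcell coprime_sym addnC. Qed.

(** Cells with v > v' are reflected by Y -> - Y, h -> - h, so that the first denominator, the future
    Kloosterman modulus, is always the smaller one. Equal denominators would force V = 1. *)
Lemma blocksum_cells h N M V : (1 < V)%N -> (M <= 2 * N)%N -> blocksum h N M = cellsum 0 1 fareyu fareyu' h N M V + cellsum 1 0 (fun v v' => - fareyu' v' v) (fun v v' => - fareyu v' v) (- h) N M V.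
Proof.
move=> V1 M2N; have V0 : (0 < V)%N by lia.
pose H v v' := \sum_(N.+1 <= c < M.+1) \sum_(Y <- zs (2 * N)) if cellc 0 1 (fareyu v v') (fareyu' v v') v v' c Y then rterm h c Y else 0.
have e : blocksum h N M = \sum_(1 <= v < V.+1) \sum_(1 <= v' < V.+1 | fcell V v v') H v v'.
 transitivity (\sum_(N.+1 <= c < M.+1) \sum_(1 <= v < V.+1) \sum_(1 <= v' < V.+1 | fcell V v v') \sum_(Y <- zs (2 * N)) if cellc 0 1 (fareyu v v') (fareyu' v v') v v' c Y then rterm h c Y else 0); last first.
  by rewrite exchange_big; apply: eq_bigr => v; rewrite exchange_big.
 apply: eq_big_nat => c /andP[c1 c2]. transitivity (\sum_(y < c) \sum_(1 <= v < V.+1) \sum_(1 <= v' < V.+1 | fcell V v v') if cellc 0 1 (fareyu v v') (fareyu' v v') v v' c y then rterm h c y else 0).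
  rewrite big_mkcond; apply: eq_bigr => y _; case: ifP => cy; last first.
   by rewrite big1 // => v; rewrite big1 // => v'; rewrite /cellc cy.
  have yc : 0 <= y%:Z < c by rewrite ltz_nat ltn_ord. rewrite {1}(farey_partition (rterm h c y) V0 yc); apply: eq_bigr => v _; apply: eq_bigr => v' _. by rewrite /cellc cy.
 rewrite exchange_big; apply: eq_big_nat => v /andP[v0 _]. rewrite exchange_big /= big_nat_cond [RHS]big_nat_cond; apply: eq_bigr => v' /andP[/andP[v'0 _] cf].
 apply: (@sum_ord_zs _ c (2 * N) (fun Y => if cellc 0 1 (fareyu v v') (fareyu' v v') v v' c Y then rterm h c Y else 0)); first by lia. move=> x xc; case: ifP => // /andP[/andP[_ k1] k2]; case/negP: xc.
 have /andP[u0 u1] := fareyu_range v' v0. have cp : coprime v v' by case/andP: cf. have /andP[u'0 u'1] := fareyu'_range v0 v'0 cp. by nia.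
rewrite e.
have sp v v' : fcell V v v' -> (v == v') = false.
 by move=> /andP[cp Vv]; apply/eqP => ev; move: cp Vv; rewrite ev /coprime gcdnn => /eqP ->; lia.
transitivity (\sum_(1 <= v < V.+1) \fsum_(V, v; v') H v v' + \sum_(1 <= v < V.+1) \sum_(1 <= v' < V.+1 | fcell V v v' && (v' < v)%N) H v v').
 rewrite -big_split; apply: eq_bigr => v _. rewrite (bigID (fun v' => (v < v')%N)); congr (_ + _); apply: eq_bigl => v'. by case: (boolP (fcell V v v')) => //= /sp; lia.
congr (_ + _); rewrite (exchange_big_dep xpredT) //=; apply: eq_bigr => v' _.
apply: eq_big => v; first by rewrite fcell_sym.
move=> _; apply: eq_bigr => c _; rewrite -sum_zs_opp; apply: eq_bigr => Y _.
rewrite rterm_opp; congr (if _ then _ else _).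
rewrite /cellc sqrrN -!andbA; congr (_ && _); rewrite andbC.
by lia.
Qed.

Section Cell.
Variables (v v' : nat) (U U' : int).
Hypothesis uni : U' * v%:Z - U * v'%:Z = 1.

Definition qval (A B C : int) : int := A * v'%:Z ^+ 2 - 2 * B * v%:Z * v'%:Z + C * v%:Z ^+ 2.
(** The polar form at (v', v) and (U', U). Together with the values [qval] and [zval] at these two
    vectors it gives the form (c, Y, z) equivalent to (A, B, C), since the determinant is 1; [aval],
    [bval], [cval] invert the substitution. *)
Definition yval (A B C : int) : int := A * U' * v'%:Z - B * (U * v'%:Z + U' * v%:Z) + C * U * v%:Z.
Definition zval (A B C : int) : int := A * U' ^+ 2 - 2 * B * U * U' + C * U ^+ 2.
Lemma yval_eq A B C : yval A B C ^+ 2 - qval A B C * zval A B C = B ^+ 2 - A * C.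
Proof.
transitivity ((B ^+ 2 - A * C) * (U' * v - U * v') ^+ 2); last by rewrite uni mulr1.
by rewrite /yval /qval /zval; ring.
Qed.

(** With the next lemma: the quantities w = Y v - U c and w' = U' c - Y v' that define the cell
    become linear in A, B, C, and the numerators U, U' disappear. *)
Lemma wval_eq A B C : yval A B C * v - U * qval A B C = A * v' - B * v.
Proof.
transitivity ((A * v' - B * v) * (U' * v - U * v')); last by rewrite uni mulr1.
by rewrite /yval /qval; ring.
Qed.

Lemma w'val_eq A B C : U' * qval A B C - yval A B C * v' = C * v - B * v'.
Proof.
transitivity ((C * v - B * v') * (U' * v - U * v')); last by rewrite uni mulr1.
by rewrite /yval /qval; ring.
Qed.

Lemma qval_w A B C : qval A B C = v'%:Z * (A * v' - B * v) + v%:Z * (C * v - B * v').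
Proof. rewrite /qval; ring. Qed.
Lemma qval_A A B C : A * qval A B C = (A * v' - B * v) ^+ 2 - (B ^+ 2 - A * C) * v%:Z ^+ 2.
Proof. rewrite /qval; ring. Qed.
Lemma qval_C A B C : C * qval A B C = (C * v - B * v') ^+ 2 - (B ^+ 2 - A * C) * v'%:Z ^+ 2.
Proof. rewrite /qval; ring. Qed.
Definition aval (c Y z : int) : int := c * U ^+ 2 - 2 * Y * U * v%:Z + z * v%:Z ^+ 2.
Definition bval (c Y z : int) : int := c * U * U' - Y * (U * v'%:Z + U' * v%:Z) + z * v%:Z * v'%:Z.
Definition cval (c Y z : int) : int := c * U' ^+ 2 - 2 * Y * U' * v'%:Z + z * v'%:Z ^+ 2.
Lemma qval_K c Y z : qval (aval c Y z) (bval c Y z) (cval c Y z) = c.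
Proof.
transitivity (c * (U' * v - U * v') ^+ 2); last by rewrite uni mulr1.
by rewrite /qval /aval /bval /cval; ring.
Qed.

Lemma yval_K c Y z : yval (aval c Y z) (bval c Y z) (cval c Y z) = Y.
Proof.
transitivity (Y * (U' * v - U * v') ^+ 2); last by rewrite uni mulr1.
by rewrite /yval /aval /bval /cval; ring.
Qed.

Lemma aval_K A B C : aval (qval A B C) (yval A B C) (zval A B C) = A.
Proof.
transitivity (A * (U' * v - U * v') ^+ 2); last by rewrite uni mulr1.
by rewrite /qval /yval /zval /aval; ring.
Qed.

Lemma bval_K A B C : bval (qval A B C) (yval A B C) (zval A B C) = B.
Proof.
transitivity (B * (U' * v - U * v') ^+ 2); last by rewrite uni mulr1.
by rewrite /qval /yval /zval /bval; ring.
Qed.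

Lemma cval_K A B C : cval (qval A B C) (yval A B C) (zval A B C) = C.
Proof.
transitivity (C * (U' * v - U * v') ^+ 2); last by rewrite uni mulr1.
by rewrite /qval /yval /zval /cval; ring.
Qed.

Lemma disc_val c Y z : bval c Y z ^+ 2 - aval c Y z * cval c Y z = Y ^+ 2 - c * z.
Proof.
transitivity ((Y ^+ 2 - c * z) * (U' * v - U * v') ^+ 2); last by rewrite uni mulr1.
by rewrite /aval /bval /cval; ring.
Qed.

Variables (N M V : nat).
Hypotheses (M2N : (M <= 2 * N)%N) (v0 : (0 < v)%N) (vv' : (v < v')%N) (v'V : (v' <= V)%N) (Vvv : (V < v + v')%N) (dN : (`|d| * V ^ 2 <= N)%N) (Nd : (N < `|d| * V.+1 ^ 2)%N) (d0 : d != 0).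

(* The pair (c, y) has c = qval, the value at (v', v) of the form attached to it. *)
Definition cellQ (al be : int) (A B C : int) : bool := [&& B ^+ 2 - A * C == d, N%:Z < qval A B C, qval A B C <= M%:Z, al <= A * v'%:Z - B * v%:Z & be <= C * v%:Z - B * v'%:Z].

(** Everything follows from c = v' w + v w', A c = w^2 - d v^2 and C c = w'^2 - d v'^2. As v' > V /
    2, w <= 2 c / V, and c <= 2 N <= 8 |d| V^2 then bounds A; negative values below - 1 are excluded
    by |d| V^2 <= N < c. For B use B v = A v' - w. *)
Lemma cell_bounds al be A B C : 0 <= al -> 0 <= be -> cellQ al be A B C -> [/\ (`|A| <= 32 * `|d| + 1)%N, (`|B| * v <= (48 * `|d| + 1) * V)%N & (`|C| <= 2 * N + 1)%N].
Proof.
move=> al0 be0 /and5P[/eqP e h1 h2 hw hw'].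
have {}h2 : qval A B C <= (2 * N)%N by apply: le_trans h2 _; rewrite lez_nat.
have eA := qval_A A B C; have eC := qval_C A B C; have ec := qval_w A B C.
rewrite e in eA eC; set c := qval A B C in eA eC ec h1 h2 *.
set w := A * v' - B * v in eA ec hw *; set w' := C * v - B * v' in eC ec hw' *.
have w0 : 0 <= w by lia.
have w'0 : 0 <= w' by lia.
have D1 : 1 <= `|d|%N%:Z by lia.
set D := `|d|%N%:Z in D1 *.
have dN' : D * V%:Z ^+ 2 <= N by rewrite /D; move: dN; rewrite -lez_nat.
have Nd' : N%:Z <= 4 * D * V%:Z ^+ 2.
 move: Nd; rewrite -ltz_nat PoszM -/D => k; apply: ltW; apply: lt_le_trans k _. have k0 : (V.+1 <= 2 * V)%N by lia. have k1 : (V.+1 ^ 2)%N%:Z <= 4 * V%:Z ^+ 2.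
  by rewrite -[4 * _]/((4 * V ^ 2)%N%:Z); apply: leq_trans (leq_mul k0 k0) _; rewrite mulnACA.
 by rewrite [4 * D]mulrC -mulrA ler_wpM2l; lia.
have c0 : 0 < c by lia.
have dD : - D <= d <= D by rewrite /D; lia.
have vV2 : v%:Z ^+ 2 <= V%:Z ^+ 2 by apply: lerXn2r; rewrite ?nnegrE; lia.
have v'V2 : v'%:Z ^+ 2 <= V%:Z ^+ 2 by apply: lerXn2r; rewrite ?nnegrE; lia.
have wV : w * V <= 2 * c.
 have : w * V <= w * (2 * v'%:Z) by rewrite ler_wpM2l; lia. lia.
have dv : `|d * v%:Z ^+ 2| <= c.
 rewrite normrM [`|_ ^+ 2|]ger0_norm //. have : `|d| * v%:Z ^+ 2 <= D * V%:Z ^+ 2 by apply: ler_pM; rewrite /D; lia. lia.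
have dv' : `|d * v'%:Z ^+ 2| <= c.
 rewrite normrM [`|_ ^+ 2|]ger0_norm //. have : `|d| * v'%:Z ^+ 2 <= D * V%:Z ^+ 2 by apply: ler_pM; rewrite /D; lia. lia.
have A1 : -1 <= A.
 rewrite leNgt; apply/negP => hA. have : A * c <= -2 * c by rewrite ler_wpM2r; lia. by rewrite eA; have := sqr_ge0 w; lia.
have A2 : A <= 32 * D + 1.
 rewrite leNgt; apply/negP => hA. have k1 : (32 * D + 2) * c <= A * c by rewrite ler_wpM2r; lia. have k2 : (32 * D + 2) * c * V%:Z ^+ 2 <= (w ^+ 2 + c) * V%:Z ^+ 2.
  by rewrite ler_wpM2r; lia.
 have k3 : (w * V) ^+ 2 <= (2 * c) ^+ 2 by apply: lerXn2r; rewrite ?nnegrE; lia. rewrite !exprMn in k3; have k4 := cell_arith2 c0 k2 k3. have k5 : 1 <= V%:Z ^+ 2 by rewrite expr_ge1; lia.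
 have h2' : c <= 2 * N%:Z by move: h2; rewrite PoszM. exact: cell_arith1 k5 k4 h2' Nd'.
have DV0 : 0 <= D * V by apply: mulr_ge0; lia.
split; first by rewrite /D in A2; lia.
- have k1 : w <= 16 * D * V.
  rewrite leNgt; apply/negP => k. have : (16 * D * V) * V < w * V by rewrite ltr_pM2r; lia. by lra.
 have k2 : `|B * v| <= (48 * D + 1) * V.
  have -> : B * v = A * v' - w by rewrite /w; ring. have k3 : A * v' <= (32 * D + 1) * V.
   case: (lerP 0 A) => hA; first by apply: ler_pM; lia. have : A * v' <= 0 by rewrite mulr_le0_ge0; lia. by move: DV0; lia.
  have k4 : - V%:Z <= A * v'.
   have : -1 * v'%:Z <= A * v' by rewrite ler_wpM2r. lia.
  by move: k1 k3 k4 DV0; rewrite ler_norml; lia.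
 by move: k2; rewrite normrM.
have k1 : w' <= c.
 have : 1 * w' <= v%:Z * w' by rewrite ler_wpM2r; lia. have : 0 <= v'%:Z * w by apply: mulr_ge0. by lra.
have k2 : w' ^+ 2 <= c * c by rewrite expr2; apply: ler_pM.
have C1 : C <= c + 1.
 rewrite leNgt; apply/negP => hC. have : (c + 2) * c <= C * c by rewrite ler_wpM2r; lia. lia.
have C2 : -1 <= C.
 rewrite leNgt; apply/negP => hC. have : C * c <= -2 * c by rewrite ler_wpM2r; lia. by have := sqr_ge0 w'; lia.
lia.
Qed.

(** The substitution is a bijection between the pairs (c, Y) of the cell and the forms. The
    conditions - v <= U and U' <= v' keep |Y| <= c, inside the range of Y. *)
Lemma cell_reindex al be h : 0 <= al -> 0 <= be -> - v%:Z <= U -> U' <= v' -> \sum_(N.+1 <= c < M.+1) \sum_(Y <- zs (2 * N)) (if cellc al be U U' v v' c Y then rterm h c Y else 0) =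
 \sum_(A <- zs (32 * `|d| + 1)) \sum_(B <- zs ((48 * `|d| + 1) * V %/ v)) \sum_(C <- zs (2 * N + 1))
   (if cellQ al be A B C then rterm h (qval A B C) (yval A B C) else 0).
Proof.
move=> al0 be0 Uv U'v'.
pose s := [seq (c, Y) | c <- index_iota N.+1 M.+1, Y <- zs (2 * N)].
pose t := [seq (A, x) | A <- zs (32 * `|d| + 1), x <- [seq (B, C) | B <- zs ((48 * `|d| + 1) * V %/ v), C <- zs (2 * N + 1)]].
transitivity (\sum_(x <- s | cellc al be U U' v v' x.1 x.2) rterm h x.1 x.2).
 by rewrite [RHS]big_mkcond big_allpairs.
transitivity (\sum_(x <- t | cellQ al be x.1 x.2.1 x.2.2) rterm h (qval x.1 x.2.1 x.2.2) (yval x.1 x.2.1 x.2.2)); last first.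
 rewrite big_mkcond big_allpairs; apply: eq_bigr => A _. by rewrite big_allpairs.
pose f (x : nat * int) := let z := ((x.2 ^+ 2 - d) %/ x.1)%Z in (aval x.1 x.2 z, (bval x.1 x.2 z, cval x.1 x.2 z)).
pose k (x : int * (int * int)) := (`|qval x.1 x.2.1 x.2.2|%N, yval x.1 x.2.1 x.2.2).
have us : uniq s by apply: allpairs_uniq; rewrite ?iota_uniq ?uniq_zs // => -[? ?] [? ?] _ _ [-> ->].
have ut : uniq t.
 apply: allpairs_uniq; rewrite ?uniq_zs //; last by move=> -[? ?] [? ?] _ _ [-> ->]. by apply: allpairs_uniq; rewrite ?uniq_zs // => -[? ?] [? ?] _ _ [-> ->].
have mt A B C : cellQ al be A B C -> (A, (B, C)) \in t.
 move=> cq; have [b1 b2 b3] := cell_bounds al0 be0 cq. apply: allpairs_f; first by rewrite mem_zs. by apply: allpairs_f; rewrite mem_zs // leq_divRL.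
rewrite (@sum_bij _ _ _ s t (fun x => cellc al be U U' v v' x.1 x.2) (fun x => cellQ al be x.1 x.2.1 x.2.2) f k _ us ut).
- rewrite big_seq_cond [RHS]big_seq_cond; apply: eq_bigr => -[A [B C]] /andP[_ /= /and5P[_ q1 q2 _ _]]. by rewrite gez0_abs //; lia.
- move=> [c Y] /allpairsP[[c' Y'] /= [cI YI [-> ->]]] {c Y} /andP[/andP[/dvdzP[z ez] k1] k2]. have c0 : c'%:Z != 0 by move: cI; rewrite mem_index_iota; lia.
 have ez' : ((Y' ^+ 2 - d) %/ c')%Z = z by rewrite ez mulzK. rewrite /f /k /= ez' qval_K yval_K. have cq : cellQ al be (aval c' Y' z) (bval c' Y' z) (cval c' Y' z).
  rewrite /cellQ disc_val -(wval_eq (aval c' Y' z) (bval c' Y' z) (cval c' Y' z)) -(w'val_eq (aval c' Y' z) (bval c' Y' z) (cval c' Y' z)) qval_K yval_K k1 k2.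
  have -> : Y' ^+ 2 - c'%:Z * z = d by rewrite mulrC -ez; ring. by move: cI; rewrite mem_index_iota; lia.
 by split => //; apply: mt.
move=> [A [B C]] _ /= cq; have /and5P[/eqP e q1 q2 q3 q4] := cq.
rewrite /k /f /=; have q0 : 0 < qval A B C by lia.
have qn : `|qval A B C|%N%:Z = qval A B C by lia.
have ey : yval A B C ^+ 2 - d = zval A B C * qval A B C by have := yval_eq A B C; rewrite e => <-; ring.
split.
- apply: allpairs_f; first by rewrite mem_index_iota; lia. rewrite mem_zs; have k1 := wval_eq A B C; have k2 := w'val_eq A B C. have k5 : - v%:Z * qval A B C <= U * qval A B C by rewrite ler_pM2r.
 have k6 : U' * qval A B C <= v'%:Z * qval A B C by rewrite ler_pM2r. have k7 : - qval A B C <= yval A B C.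
  by rewrite -(@ler_pM2r _ v%:Z); lia.
 have k8 : yval A B C <= qval A B C.
  by rewrite -(@ler_pM2r _ v'%:Z); lia.
 lia.
- by rewrite /cellc qn ey dvdz_mull //= wval_eq w'val_eq q3.
by rewrite qn ey mulzK ?gt_eqF // aval_K bval_K cval_K.
Qed.

End Cell.
End Cells.

(** Serves for the v' that satisfy the conditions of a cell with A, B, C fixed: completion needs
    them to be consecutive. *)
Lemma convex_range (P : pred nat) n : (forall i j k, (i <= j <= k)%N -> (k < n)%N -> P i -> P k -> P j) -> exists a m, (a + m <= n)%N /\ forall i, (i < n)%N -> P i = (a <= i < a + m)%N.
Proof.
elim: n => [|n IH] cv; first by exists 0, 0.
have [|a [m [am e]]] := IH; first by move=> i j k ijk kn; apply: cv; lia.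
case: (boolP (P n)) => pn; last first.
 exists a, m; split; first lia. move=> i; rewrite ltnS leq_eqVlt => /orP[/eqP ->|/e //]; rewrite (negbTE pn); lia.
case: (posnP m) => m0.
 exists n, 1; split; first lia. move=> i; rewrite ltnS leq_eqVlt => /orP[/eqP ->|lt]; first by lia; lia. by rewrite e; lia.
have an : (a + m = n)%N.
 apply/eqP; rewrite eqn_leq am leqNgt; apply/negP => lt. have Pa : P a by rewrite e; lia. have : P (a + m)%N by apply: (cv a (a + m)); lia. by rewrite e; lia.
exists a, m.+1; split; first lia.
move=> i; rewrite ltnS leq_eqVlt => /orP[/eqP ->|lt]; first by lia; lia.
by rewrite e; lia.
Qed.

Lemma convex_sum (T : nmodType) (P : pred nat) n lo (F : nat -> T) : (forall i j k, (i <= j <= k)%N -> (k < n)%N -> P i -> P k -> P j) -> (forall i, (i < n)%N -> P i -> (lo <= i)%N) -> (lo <= n)%N ->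
 exists a m, (m <= n - lo)%N /\ \sum_(0 <= i < n | P i) F i = \sum_(i < m) F (a + i)%N.
Proof.
move=> cv hlo ln; have [a [m [am e]]] := convex_range cv; exists a, m; split.
 case: (posnP m) => [->|m0] //; have : (lo <= a)%N by apply: hlo; rewrite ?e; lia. lia.
transitivity (\sum_(0 <= i < n | (a <= i < a + m)%N) F i).
 by rewrite big_nat_cond [RHS]big_nat_cond; apply: eq_bigl => i; case: (boolP (i < n)%N) => //= /e ->.
rewrite -(big_mkord xpredT (fun i => F (a + i)%N)).
apply: (@sum_bij _ _ _ _ _ _ _ (fun i => i - a)%N (fun i => a + i)) => [||i|i]; rewrite ?iota_uniq // !mem_index_iota; split; lia.
Qed.

(** * Estimates for the forms in the cells with a given denominator *)

Section Bound.
Variable R : realType.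
Local Notation ee := (efrac R).
Local Notation harm := (harm_sum R).

Lemma sum_atmost1 (I : eqType) (s : seq I) (P : pred I) (X : I -> R[i]) (M : R) : uniq s -> 0 <= M -> (forall x y, P x -> P y -> x = y) -> (forall x, P x -> normc (X x) <= M) ->
 normc (\sum_(x <- s | P x) X x) <= M.
Proof.
move=> us M0 h hX; elim: s us => [|x s IH] /=; first by rewrite big_nil normc0.
move=> /andP[xs us]; rewrite big_cons; case: ifP => px; last exact: IH.
rewrite big_seq_cond big1 ?addr0 ?hX // => y /andP[ys py].
by move: xs; rewrite (h x y px py) ys.
Qed.

(** The genus character of the form at the primes of g, read from A, or from C where p divides A. *)
Definition sgm (g : nat) (A C : int) : int := \prod_(p <- primes g) legendre (if (p%:Z %| A)%Z then C else A) p.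

Lemma legendre_abs a p : `|legendre a p| <= 1.
Proof. by rewrite legendreE; case: ifP => //; case: ifP. Qed.
Lemma sgm_abs g A C : `|sgm g A C| <= 1.
Proof.
rewrite /sgm; elim/big_ind: _ => // [x y x1 y1|p _]; last exact: legendre_abs.
by rewrite normrM -[1]mulr1; apply: ler_pM.
Qed.

Lemma jacobi_abs a c : `|jacobi a c| <= 1.
Proof.
rewrite jacobiE; elim/big_ind: _ => // [x y x1 y1|p _]; last by rewrite normrX exprn_ile1 ?legendre_abs.
by rewrite normrM -[1]mulr1; apply: ler_pM.
Qed.

Lemma jacobi_squarefree a g : (0 < g)%N -> squarefree g -> jacobi a g = \prod_(p <- primes g) legendre a p.
Proof.
move=> g0 sg; rewrite jacobiE; apply: eq_big_seq => p; rewrite mem_primes => /and3P[pp _ pg].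
have l1 : (0 < logn p g)%N by rewrite logn_gt0 mem_primes pp g0.
by have := sqf_logn g0 pp sg; case: logn l1 => [|[|]] //; rewrite expr1.
Qed.

Lemma sgm0 g C : (0 < g)%N -> squarefree g -> sgm g 0 C = jacobi C g.
Proof. by move=> g0 sg; rewrite jacobi_squarefree //; apply: eq_bigr => p; rewrite dvdz0. Qed.

(** The left end U / v of the cell replaces Y / c, at distance w / (c v), and U is - 1 / v' modulo
    v. *)
Lemma phase_cell (h : int) v v' U U' A B C : (0 < v)%N -> (0 < v')%N -> U' * v%:Z - U * v'%:Z = 1 -> 0 < qval v v' A B C -> 0 <= A * v' - B * v ->
 normc (ee `|qval v v' A B C| (h * yval v v' U U' A B C) - ee v (- h * iv v v'))
  <= 2 * pi * `|h%:~R| * ((A * v' - B * v)%:~R / ((qval v v' A B C)%:~R * v%:R)).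
Proof.
move=> v0 v'0 uni; set c := qval _ _ _ _ _; set y := yval _ _ _ _ _ _ _; set w := A * _ - _ => c0 w0.
have -> : ee v (- h * iv v v') = ee v (h * U).
 apply: ee_eqm => //; have -> : - h * iv v v' - h * U = - h * (iv v v' - (- U)) by ring. rewrite dvdz_mull //. have cp : coprimez v' v by apply/coprimezP; exists (- U, U') => /=; rewrite -uni; ring.
 apply: (iv_uniq cp); first exact: iv_mul. have -> : v'%:Z * - U - 1 = - U' * v by have := uni; lia. by rewrite dvdz_mull.
apply: le_trans (e2pi_lip _ _) _; rewrite -!mulrA ler_pM2l // ler_pM2l ?pi_gt0 //.
have cn : (c%:~R : R) != 0 by rewrite intr_eq0 gt_eqF.
have vn : (v%:R : R) != 0 by rewrite pnatr_eq0 -lt0n.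
have ec : (`|c|%N%:R : R) = c%:~R by rewrite -(gtz0_abs c0).
have ew : y%:~R * v%:R - U%:~R * c%:~R = w%:~R :> R by rewrite -[v%:R]/(v%:~R) -!intrM -intrB wval_eq.
have -> : (h * y)%:~R / `|c|%N%:R - (h * U)%:~R / v%:R = h%:~R * (w%:~R / (c%:~R * v%:R)) :> R.
 by rewrite -ew ec; field; rewrite vn.
by rewrite normrM ler_wpM2l // ger0_norm // divr_ge0 ?ler0z // mulr_ge0 // ler0z ltW.
Qed.

Section Fixed.
Variables (d : int) (g q : nat) (phi : int -> R[i]) (h : int).
Hypotheses (og : odd g) (sg : squarefree g) (gd : (g%:Z %| d)%Z) (q0 : (0 < q)%N) (h0 : h != 0) (pphi : per q phi) (phi1 : forall x, normc (phi x) <= 1) (phig : forall x, phi x != 0 -> (g%:Z %| x)%Z) (d0 : d != 0).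

Let g0 := odd_gt0 og.
Lemma legendre_sqr_mul p z v : prime p -> odd p -> ~~ (p %| v)%Z -> legendre (z * v ^+ 2) p = legendre z p.
Proof. by move=> pp op pv; rewrite (legendreM pp op R) (legendreM pp op R) -expr2 legendre_sq // mulr1. Qed.

(** A prime p of g divides d and c, hence Y. Modulo p this leaves A = z v^2 and C = z v'^2, and p
    does not divide both v and v'. *)
Lemma symbol_cell v v' U U' A B C : U' * v%:Z - U * v'%:Z = 1 -> B ^+ 2 - A * C = d -> (g %| qval v v' A B C)%Z -> jacobi (zval U U' A B C) g = sgm g A C.
Proof.
move=> uni e gq; rewrite jacobi_squarefree //; apply: eq_big_seq => p.
rewrite mem_primes => /and3P[pp _ pg]; have op : odd p := dvdn_odd pg og.
have pgz : (p %| g%:Z)%Z by [].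
have pq := dvdz_trans pgz gq; have pd := dvdz_trans pgz gd.
set c := qval _ _ _ _ _ in pq; set z := zval _ _ _ _ _; set y := yval v v' U U' A B C.
have ey : y ^+ 2 = d + c * z by have := yval_eq uni A B C; rewrite e -/y -/c -/z => <-; ring.
have py : (p %| y)%Z.
 have : (p %| y ^+ 2)%Z by rewrite ey rpredD // dvdz_mulr. by rewrite Euclid_dvdz // orbb.
have eA : (p %| A - z * v%:Z ^+ 2)%Z.
 rewrite -(aval_K uni A B C) /aval -/c -/y -/z. have -> : c * U ^+ 2 - 2 * y * U * v + z * v ^+ 2 - z * v ^+ 2 = c * U ^+ 2 - y * (2 * U * v) by ring. by rewrite rpredB // dvdz_mulr.
have eC : (p %| C - z * v'%:Z ^+ 2)%Z.
 rewrite -(cval_K uni A B C) /cval -/c -/y -/z. have -> : c * U' ^+ 2 - 2 * y * U' * v' + z * v' ^+ 2 - z * v' ^+ 2 = c * U' ^+ 2 - y * (2 * U' * v') by ring. by rewrite rpredB // dvdz_mulr.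
have pA := dvdz_eqm eA.
case: ifP => hA.
 rewrite (legendre_eqm eC). case: (boolP (p %| z)%Z) => pz.
  by rewrite !legendreE pz dvdz_mulr.
 have pv : (p %| v%:Z)%Z.
  by move: hA; rewrite pA Euclid_dvdz // (negbTE pz) Euclid_dvdz // orbb.
 rewrite legendre_sqr_mul //; apply/negP => pv'. have : (p %| U' * v - U * v')%Z by rewrite rpredB // dvdz_mull. by rewrite uni dvdzE /= dvdn1 => /eqP p1; rewrite p1 in pp.
rewrite (legendre_eqm eA) legendre_sqr_mul //; apply: contraFN hA => pv.
by rewrite pA mulrA dvdz_mull.
Qed.

(** Weil's bound is applied away from the primes of the period q and of the frequency h. *)
Definition bstarf : nat := (q * `|h|)%N.
Lemma bstar_gt0 : (0 < bstarf)%N.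
Proof. by rewrite /bstarf muln_gt0 q0 absz_gt0. Qed.

Definition approx v (A B C : int) (v' : nat) : R[i] := phi (qval v v' A B C) * (sgm g A C)%:~R * ee v (- h * iv v v'%:Z).

(** The admissible v' form an interval, because w and w' are linear in v' and c increases with v' as
    long as w >= 0. Its length is at most v, as V - v < v' <= V, so the sum is an incomplete
    Kloosterman sum. *)
Lemma inner_bound V N M v al be A B C : (0 < v <= V)%N -> 0 <= al -> normc (\fsum_(V, v; v') if cellQ d v v' N M al be A B C then approx v A B C v' else 0) <= q%:R * wt R bstarf v * (1 + 4 * harm (q * v)).
Proof.
move=> /andP[v0 vV] al0.
pose P v' := [&& (0 < v')%N, (V < v + v')%N, (v < v')%N & cellQ d v v' N M al be A B C].
pose G (x : int) := phi (A * x ^+ 2 - 2 * B * v * x + C * v%:Z ^+ 2) * (sgm g A C)%:~R.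
pose F (v' : nat) := if coprimez v' v then G v' * ee v (- h * iv v v') else 0.
have -> : \fsum_(V, v; v') (if cellQ d v v' N M al be A B C then approx v A B C v' else 0) = \sum_(0 <= v' < V.+1 | P v') F v'.
 rewrite big_mkcond [RHS]big_mkcond [RHS]big_ltn // /P /= add0r; apply: eq_big_nat => v' /andP[v'0 _]; rewrite v'0 /=.
 rewrite /fcell /F copz_nat coprime_sym; case: (boolP (coprime v' v)) => /= cp; last by rewrite if_same. case: (V < v + v')%N => //=; case: (v < v')%N => //=; case: ifP => _.
have wlin i j k (x : int) (X Y : int) : (i <= j <= k)%N -> x <= X * i - Y -> x <= X * k - Y -> x <= X * j - Y.
 move=> /andP[ij jk] h1 h2; case: (lerP 0 X) => hX.
  have : X * i <= X * j by apply: ler_wpM2l. lia.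
 have : X * k <= X * j by apply: ler_wnM2l => //; exact: ltW. lia.
have mono i j : (i <= j)%N -> 0 <= A * i - B * v -> 0 <= A * j - B * v -> qval v i A B C <= qval v j A B C.
 move=> ij w1 w2; rewrite -subr_ge0. have -> : qval v j A B C - qval v i A B C = (j%:Z - i%:Z) * (A * i - B * v + (A * j - B * v)).
  by rewrite /qval; ring.
 by apply: mulr_ge0; lia.
have cv i j k : (i <= j <= k)%N -> (k < V.+1)%N -> P i -> P k -> P j.
 move=> ijk kV /and4P[i0 i1 i2 /and5P[e q1 q2 q3 q4]] /and4P[_ _ _ /and5P[_ q1' q2' q3' q4']]. have w3 : al <= A * j - B * v by apply: wlin ijk q3 q3'. have w4 : be <= C * v - B * j.
  have -> : C * v - B * j = - B * j - (- (C * v)) by ring. by apply: (wlin i j k); lia.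
 have /andP[ij jk] := ijk. have m1 : qval v i A B C <= qval v j A B C by apply: mono; lia. have m2 : qval v j A B C <= qval v k A B C by apply: mono; lia.
 by apply/and4P; split; try lia; apply/and5P; split; lia.
have [||a [m [mV ->]]] := @convex_sum _ P V.+1 (V.+1 - v) F cv.
- by move=> i _ /and4P[]; lia.
- lia.
have -> : \sum_(i < m) F (a + i)%N = \sum_(i < m) (if coprimez (a%:Z + i) v then G (a%:Z + i) * ee v (- h * iv v (a%:Z + i)) else 0).
 by [].
apply: incomplete_kl => //.
- move=> x k; rewrite /G; congr (_ * _). have -> : A * (x + q%:Z * k) ^+ 2 - 2 * B * v * (x + q%:Z * k) + C * v ^+ 2 =
  A * x ^+ 2 - 2 * B * v * x + C * v%:Z ^+ 2 + q%:Z * (A * (2 * x * k + q%:Z * k ^+ 2) - 2 * B * v * k) by ring.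
 exact: pphi.
- move=> x; rewrite /G normcM -[X in _ <= X]mulr1; apply: ler_pM; rewrite ?normc_ge0 //. by rewrite normc_nat -intr_norm lerz1 sgm_abs.
- by rewrite /bstarf dvdn_mulr.
- by move=> p pp; rewrite rpredN /bstarf => ph; rewrite dvdn_mull.
have : (m <= v)%N by lia.
by move=> mv; apply: leq_trans mv _; rewrite leq_pmull.
Qed.

End Fixed.
End Bound.

Lemma size_zs K : size (zs K) = (2 * K).+1.
Proof. by rewrite size_map size_iota. Qed.

Section Count.
Variable R : realType.

Lemma count_le K m (x lo hi : int) : (0 < m)%N -> lo <= hi -> \sum_(C <- zs K | (lo < x + C * m) && (x + C * m <= hi)) (1 : R) <= (hi - lo)%:~R / m%:R + 1.
Proof.
move=> m0 lh; rewrite big_const_seq iter_addr addr0; set P := (fun C => _ && _).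
pose f (C : int) := `|((x + C * m - lo - 1) %/ m)%Z|%N.
have fE C : P C -> (x + C * m - lo - 1 = (f C)%:Z * m + ((x + C * m - lo - 1) %% m)%Z) .
 move=> /andP[p1 p2]; rewrite /f gez0_abs; first exact: divz_eq. by rewrite divz_ge0; lia.
have mr z : 0 <= (z %% m)%Z < m by rewrite modz_ge0; lia.
have le : (count P (zs K) <= (`|hi - lo| %/ m).+1)%N.
 rewrite -size_filter -(size_map f) -(size_iota 0 (`|hi - lo| %/ m).+1); apply: uniq_leq_size.
  rewrite map_inj_in_uniq ?filter_uniq ?uniq_zs // => a b; rewrite !mem_filter => /andP[pa _] /andP[pb _] e.
  have ea := fE a pa; have eb := fE b pb; have := mr (x + a * m - lo - 1); have := mr (x + b * m - lo - 1). rewrite e in ea; set ra := (_ %% _)%Z in ea *; set rb := (_ %% _)%Z in eb * => h1 h2.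
  have : a * m - b * m = ra - rb by lia. by nia.
 move=> y; case/mapP => C; rewrite mem_filter => /andP[pC _] ->; rewrite mem_iota /= ltnS leq_divRL //. have := fE C pC; have := mr (x + C * m - lo - 1); case/andP: pC; set r := (_ %% _)%Z; set z := f C.
 move=> k1 k2 k3 k4; have k5 : (z * m)%N%:Z <= hi - lo by rewrite PoszM; lia. by lia.
apply: le_trans (_ : ((`|hi - lo| %/ m).+1)%:R <= _); first by rewrite ler_nat.
rewrite -addn1 natrD lerD2r ler_pdivlMr ?ltr0n // -natrM.
have -> : (hi - lo)%:~R = `|hi - lo|%N%:R :> R by rewrite pmulrn gez0_abs // subr_ge0.
by rewrite ler_nat leq_divM.
Qed.

End Count.

Section Split.
Variable R : realType.
Local Notation ee := (efrac R).
Local Notation harm := (harm_sum R).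
Variables (d : int) (g q : nat) (phi : int -> R[i]) (h : int).
Hypotheses (og : odd g) (sg : squarefree g) (gd : (g%:Z %| d)%Z) (q0 : (0 < q)%N) (h0 : h != 0) (pphi : per q phi) (phi1 : forall x, normc (phi x) <= 1) (phig : forall x, phi x != 0 -> (g%:Z %| x)%Z) (d0 : d != 0).

Local Notation bstar := (bstarf q h).
Definition wqf v : R := q%:R * wt R bstar v * (1 + 4 * harm (q * v)).
Definition hpi : R := 2 * pi * `|h%:~R|.
Lemma wq_ge0 v : 0 <= wqf v.
Proof.
rewrite /wqf; apply: mulr_ge0; first by rewrite mulr_ge0 ?wt_ge0.
by apply: addr_ge0 => //; apply: mulr_ge0 => //; exact: harm_ge0.
Qed.

Lemma hpi_ge0 : 0 <= hpi.
Proof. by rewrite /hpi !mulr_ge0 // pi_ge0. Qed.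

Variables (N M V : nat).
Hypotheses (NM : (N <= M)%N) (M2N : (M <= 2 * N)%N) (V0 : (0 < V)%N) (dN : (`|d| * V ^ 2 <= N)%N) (Nd : (N < `|d| * V.+1 ^ 2)%N).

Local Notation K1 := (32 * `|d| + 1)%N.
Local Notation K2 v := ((48 * `|d| + 1) * V %/ v)%N.
Local Notation K3 := (2 * N + 1)%N.

(** The contribution of A = 0, the only possible source of a main term, with the approximate
    phase. *)
Definition zpart (al be : int) (v : nat) : R[i] := \fsum_(V, v; v') \sum_(B <- zs (K2 v)) \sum_(C <- zs K3) if cellQ d v v' N M al be 0 B C then approx g phi h v 0 B C v' else 0.

Lemma count_v' v : (v <= V)%N -> \fsum_(V, v; v') (1 : R) <= v%:R.
Proof.
move=> vV; rewrite big_const_seq iter_addr addr0 ler_nat -size_filter.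
apply: leq_trans (_ : size (iota (V.+1 - v) v) <= _)%N; last by rewrite size_iota.
apply: uniq_leq_size; first by rewrite filter_uniq ?iota_uniq.
by move=> x; rewrite mem_filter mem_index_iota mem_iota /fcell; lia.
Qed.

Section OneCell.
Variables (v v' : nat) (U U' : int).
Hypotheses (v0 : (0 < v)%N) (v'0 : (0 < v')%N) (uni : U' * v%:Z - U * v'%:Z = 1).

Lemma rterm_cell al be A B C : 0 <= al -> cellQ d v v' N M al be A B C -> normc (rterm d g phi h (qval v v' A B C) (yval v v' U U' A B C) - approx g phi h v A B C v') <=
 hpi * ((A * v' - B * v)%:~R / ((qval v v' A B C)%:~R * v%:R)).
Proof.
move=> al0 /and5P[/eqP e q1 q2 q3 q4]; set c := qval _ _ _ _ _ in q1 q2 *.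
have c0 : 0 < c by lia.
have b0 : 0 <= (A * v' - B * v)%:~R / (c%:~R * v%:R) :> R.
 by rewrite divr_ge0 ?mulr_ge0 ?ler0z //; lia.
rewrite /rterm /jterm /approx.
have -> : ((yval v v' U U' A B C ^+ 2 - d) %/ c)%Z = zval U U' A B C.
 have -> : yval v v' U U' A B C ^+ 2 - d = zval U U' A B C * c.
  by have := yval_eq uni A B C; rewrite e -/c => <-; ring.
 by rewrite mulzK ?gt_eqF.
have [->|pc] := eqVneq (phi c) 0.
 by rewrite !mul0r subrr normc0 mulr_ge0 ?hpi_ge0.
rewrite (symbol_cell R og sg gd uni e) ?phig // -mulrBr normcM.
apply: le_trans (_ : 1 * normc (ee `|c| (h * yval v v' U U' A B C) - ee v (- h * iv v v')) <= _).
 apply: ler_wpM2r; first exact: normc_ge0. rewrite normcM -[X in _ <= X]mulr1; apply: ler_pM; rewrite ?normc_ge0 //. by rewrite normc_nat -intr_norm lerz1 sgm_abs.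
have w0 : 0 <= A * v' - B * v by lia.
by rewrite mul1r; exact: phase_cell.
Qed.

End OneCell.

(** Three errors. For A <> 0, where A and B determine C, the incomplete sums and the change of
    phase, at most hpi / v for each v' because w <= c. For A = 0 the change of phase, where w = |B|
    v with B^2 = d, so that each term costs at most hpi |d| / N, and C takes at most N / v^2 + 1
    values. *)
Lemma per_v_bound al be (U U' : nat -> int) v : (0 < v <= V)%N -> 0 <= al -> 0 <= be -> (forall v', (0 < v')%N -> fcell V v v' -> U' v' * v - U v' * v' = 1) -> normc (\fsum_(V, v; v')
  \sum_(A <- zs K1) \sum_(B <- zs (K2 v)) \sum_(C <- zs K3)
   (if cellQ d v v' N M al be A B C then rterm d g phi h (qval v v' A B C) (yval v v' (U v') (U' v') A B C) else 0)
  - zpart al be v) <=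
 (2 * K1).+1%:R * (2 * K2 v).+1%:R * (wqf v + hpi) + v%:R * (2 * (N%:R / v%:R ^+ 2 + 1) * (hpi * `|d|%N%:R / N%:R)).
Proof.
move=> /andP[v0 vV] al0 be0 uni.
have vr : 0 < v%:R :> R by rewrite ltr0n.
set Sv' := fun (f : nat -> R[i]) => \fsum_(V, v; v') f v'.
pose ap v' A B C := if cellQ d v v' N M al be A B C then approx g phi h v A B C v' else 0.
pose de v' A B C := if cellQ d v v' N M al be A B C then rterm d g phi h (qval v v' A B C) (yval v v' (U v') (U' v') A B C) - approx g phi h v A B C v' else 0.
have zK1 : 0 \in zs K1 by rewrite mem_zs.
have Atmost A B : A != 0 -> forall x y, B ^+ 2 - A * x == d -> B ^+ 2 - A * y == d -> x = y.
 move=> A0 x y /eqP e1 /eqP e2; apply: (mulfI A0); lia.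
have card K (x : R) : \sum_(A <- zs K) x = (2 * K).+1%:R * x by rewrite big_const_seq iter_addr addr0 count_predT size_zs mulr_natl.
have M1 : normc (\sum_(A <- zs K1 | A != 0) \sum_(B <- zs (K2 v)) \sum_(C <- zs K3) \fsum_(V, v; v') ap v' A B C) <= (2 * K1).+1%:R * ((2 * K2 v).+1%:R * wqf v).
 apply: le_trans (normc_sum _ _ _) _; rewrite -card big_mkcond; apply: ler_sum => A _; case: ifP => A0; last first.
  by rewrite mulr_ge0 ?wq_ge0.
 apply: le_trans (normc_sum _ _ _) _; rewrite -card; apply: ler_sum => B _. rewrite (bigID (fun C => B ^+ 2 - A * C == d)) /= [X in _ + X]big1 ?addr0 => [|C hC]; last first.
  by apply: big1 => v'; rewrite /ap /cellQ (negbTE hC).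
 apply: sum_atmost1; rewrite ?uniq_zs ?wq_ge0 //; first exact: Atmost. by move=> C _; apply: inner_bound => //; rewrite v0.
have M2 v' : (0 < v')%N -> fcell V v v' -> normc (\sum_(A <- zs K1 | A != 0) \sum_(B <- zs (K2 v)) \sum_(C <- zs K3) de v' A B C) <= (2 * K1).+1%:R * ((2 * K2 v).+1%:R * (hpi / v%:R)).
 move=> v'0 fc; have hv : 0 <= hpi / v%:R by rewrite divr_ge0 ?hpi_ge0. apply: le_trans (normc_sum _ _ _) _; rewrite -card big_mkcond; apply: ler_sum => A _; case: ifP => A0; last first.
  by rewrite mulr_ge0.
 apply: le_trans (normc_sum _ _ _) _; rewrite -card; apply: ler_sum => B _. rewrite (bigID (fun C => B ^+ 2 - A * C == d)) /= [X in _ + X]big1 ?addr0 => [|C hC]; last first.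
  by rewrite /de /cellQ (negbTE hC).
 apply: sum_atmost1; rewrite ?uniq_zs //; first exact: Atmost. move=> C _; rewrite /de; case: ifP => [cq|_]; last by rewrite normc0. apply: le_trans (rterm_cell v0 v'0 (uni _ v'0 fc) al0 cq) _.
 rewrite ler_wpM2l ?hpi_ge0 // invfM mulrA ler_piMl ?invr_ge0 //. have /and5P[_ q1 q2 q3 q4] := cq; have cw := qval_w v v' A B C. have c0 : 0 < qval v v' A B C by lia.
 rewrite ler_pdivrMr ?ltr0z // mul1r ler_int cw. have k1 : 1 * (A * v' - B * v) <= v'%:Z * (A * v' - B * v) by rewrite ler_wpM2r; lia. have : 0 <= v%:Z * (C * v%:Z - B * v'%:Z) by apply: mulr_ge0; lia. lia.
have M3 v' : (0 < v')%N -> fcell V v v' -> normc (\sum_(B <- zs (K2 v)) \sum_(C <- zs K3) de v' 0 B C) <= 2 * (N%:R / v%:R ^+ 2 + 1) * (hpi * `|d|%N%:R / N%:R).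
 move=> v'0 fc. have N0 : (0 < N)%N by apply: leq_trans dN; rewrite muln_gt0 absz_gt0 d0 expn_gt0 V0. have Nr : 0 < N%:R :> R by rewrite ltr0n.
 have e0 : 0 <= hpi * `|d|%N%:R / N%:R by rewrite divr_ge0 // mulr_ge0 // hpi_ge0. have n0 : 0 <= N%:R / v%:R ^+ 2 + 1 :> R by rewrite addr_ge0 // divr_ge0 ?exprn_ge0.
 have ne0 : 0 <= (N%:R / v%:R ^+ 2 + 1) * (hpi * `|d|%N%:R / N%:R) by apply: mulr_ge0. have one B : B ^+ 2 == d -> normc (\sum_(C <- zs K3) de v' 0 B C) <= (N%:R / v%:R ^+ 2 + 1) * (hpi * `|d|%N%:R / N%:R).
  move=> /eqP eB; apply: le_trans (normc_sum _ _ _) _. apply: le_trans (_ : \sum_(C <- zs K3 | (N%:Z < - 2 * B * v * v' + C * (v ^ 2)%N) &&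
    (- 2 * B * v * v' + C * (v ^ 2)%N <= M)) 1 * (hpi * `|d|%N%:R / N%:R) <= _).
   rewrite [X in _ <= X]big_mkcond; apply: ler_sum => C _; rewrite /de; case: ifP => [cq|_]; last first.
    by rewrite normc0; case: ifP => //; rewrite mul1r.
   have /and5P[_ q1 q2 q3 q4] := cq. have eq : qval v v' 0 B C = - 2 * B * v * v' + C * (v ^ 2)%N by rewrite /qval; ring. rewrite -eq q1 q2 mul1r; apply: le_trans (rterm_cell v0 v'0 (uni _ v'0 fc) al0 cq) _.
   rewrite -mulrA ler_wpM2l ?hpi_ge0 //. have c0 : 0 < qval v v' 0 B C by apply: le_lt_trans q1. have c0r : 0 < (qval v v' 0 B C)%:~R :> R by rewrite ltr0z. rewrite mul0r sub0r mulrNz intrM.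
   have -> : - (B%:~R * v%:~R) / ((qval v v' 0 B C)%:~R * v%:R) = (- B)%:~R / (qval v v' 0 B C)%:~R :> R.
    by rewrite -[v%:~R]/(v%:R); field; rewrite !gt_eqF.
   have k1 : 0 < - B.
    rewrite oppr_gt0 ltNge; apply/negP => k; have : 0 <= B * v by apply: mulr_ge0. move: q3; rewrite sub0r => q3 k3; have kz : B * v = 0 by apply/eqP; rewrite eq_le -oppr_ge0 (le_trans al0).
    move: d0; rewrite -eB; move/eqP: kz; rewrite mulf_eq0 => /orP[/eqP ->|]; first by []. by rewrite eqz_nat => /eqP vz; move: v0; rewrite vz.
   apply: ler_pM; rewrite ?invr_ge0 ?ler0z ?(ltW c0) ?(ltW k1) //.
    rewrite pmulrn ler_int -eB -sqrrN. have : 1 * - B <= - B * - B by rewrite ler_wpM2r // ltW. by rewrite mul1r => k; rewrite abszE ger0_norm ?sqr_ge0.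
   by rewrite lef_pV2 // -[N%:R]/(N%:~R) ler_int ltW.
  rewrite -mulr_suml ler_wpM2r //; apply: le_trans (count_le _ _ _ _ _) _; rewrite ?expn_gt0 ?v0 //.
  by rewrite natrX lerD2r ler_pM2r ?invr_gt0 ?exprn_gt0 // -[N%:R]/(N%:~R) ler_int lerBlDr -PoszD addnn -mul2n.
 rewrite (bigID (fun B => B ^+ 2 == d)) /= [X in _ + X]big1 ?addr0 => [|B hB]; last first.
  by apply: big1 => C; rewrite /de /cellQ mul0r subr0 (negbTE hB).
 rewrite (bigID (fun B => 0 <= B)) /=; apply: le_trans (le_normcD _ _) _. rewrite -[2]/(1 + 1) mulrDl mul1r mulrDl; apply: lerD.
  apply: (sum_atmost1 (uniq_zs _) ne0); last by move=> B /andP[hB _]; exact: one. move=> x y /andP[/eqP e1 x0] /andP[/eqP e2 y0]. by apply/eqP; rewrite -(@eqrXn2 _ 2) // e1 e2.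
 apply: (sum_atmost1 (uniq_zs _) ne0); last by move=> B /andP[hB _]; exact: one. move=> x y /andP[/eqP e1 x0] /andP[/eqP e2 y0].
 by apply: oppr_inj; apply/eqP; rewrite -(@eqrXn2 _ 2) ?sqrrN ?e1 ?e2 // oppr_ge0 ltW // ltNge.
have -> : \fsum_(V, v; v') \sum_(A <- zs K1) \sum_(B <- zs (K2 v)) \sum_(C <- zs K3) (if cellQ d v v' N M al be A B C then rterm d g phi h (qval v v' A B C) (yval v v' (U v') (U' v') A B C) else 0)
  - zpart al be v = \sum_(A <- zs K1 | A != 0) \sum_(B <- zs (K2 v)) \sum_(C <- zs K3) \fsum_(V, v; v') ap v' A B C +
 (\fsum_(V, v; v') \sum_(A <- zs K1 | A != 0) \sum_(B <- zs (K2 v)) \sum_(C <- zs K3) de v' A B C + \fsum_(V, v; v') \sum_(B <- zs (K2 v)) \sum_(C <- zs K3) de v' 0 B C).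
 have -> : \sum_(A <- zs K1 | A != 0) \sum_(B <- zs (K2 v)) \sum_(C <- zs K3) \fsum_(V, v; v') ap v' A B C = \fsum_(V, v; v') \sum_(A <- zs K1 | A != 0) \sum_(B <- zs (K2 v)) \sum_(C <- zs K3) ap v' A B C.
  rewrite [RHS]exchange_big; apply: eq_bigr => A _; rewrite [RHS]exchange_big; apply: eq_bigr => B _. by rewrite exchange_big.
 rewrite /zpart -sumrB -!big_split; apply: eq_bigr => v' _ /=. rewrite (bigD1_seq 0) ?uniq_zs //= addrAC addrC. have es A : \sum_(B <- zs (K2 v)) \sum_(C <- zs K3)
   (if cellQ d v v' N M al be A B C then rterm d g phi h (qval v v' A B C) (yval v v' (U v') (U' v') A B C) else 0)
   = \sum_(B <- zs (K2 v)) \sum_(C <- zs K3) ap v' A B C + \sum_(B <- zs (K2 v)) \sum_(C <- zs K3) de v' A B C.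
  rewrite -big_split; apply: eq_bigr => B _; rewrite -big_split; apply: eq_bigr => C _ /=. by rewrite /ap /de; case: ifP => _; rewrite ?addr0 // addrC subrK.
 rewrite es; under eq_bigr => A _ do rewrite es. rewrite big_split -!addrA; congr (_ + (_ + _)). by rewrite addrCA subrr addr0.
apply: le_trans (le_normcD _ _) _.
have -> : (2 * K1).+1%:R * (2 * K2 v).+1%:R * (wqf v + hpi) = (2 * K1).+1%:R * ((2 * K2 v).+1%:R * wqf v) + v%:R * ((2 * K1).+1%:R * ((2 * K2 v).+1%:R * (hpi / v%:R))).
 by field; rewrite gt_eqF.
rewrite -addrA lerD //; apply: le_trans (le_normcD _ _) _; apply: lerD.
 apply: le_trans (normc_sum _ _ _) _. apply: le_trans (_ : (\fsum_(V, v; v') 1) * ((2 * K1).+1%:R * ((2 * K2 v).+1%:R * (hpi / v%:R))) <= _).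
  rewrite mulr_suml big_nat_cond [X in _ <= X]big_nat_cond; apply: ler_sum => v' /andP[/andP[v'0 _] /andP[fc _]]. by rewrite mul1r M2.
 rewrite ler_wpM2r ?count_v' //; do 2![apply: mulr_ge0; rewrite //]. by apply: divr_ge0; rewrite ?hpi_ge0.
apply: le_trans (normc_sum _ _ _) _.
have N00 : 0 <= 2 * (N%:R / v%:R ^+ 2 + 1) * (hpi * `|d|%N%:R / N%:R).
 apply: mulr_ge0; first by apply: mulr_ge0; rewrite addr_ge0 // divr_ge0 ?exprn_ge0. by apply: divr_ge0; rewrite // mulr_ge0 // hpi_ge0.
apply: le_trans (_ : (\fsum_(V, v; v') 1) * (2 * (N%:R / v%:R ^+ 2 + 1) * (hpi * `|d|%N%:R / N%:R)) <= _).
 rewrite mulr_suml big_nat_cond [X in _ <= X]big_nat_cond; apply: ler_sum => v' /andP[/andP[v'0 _] /andP[fc _]]. by rewrite mul1r M3.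
by rewrite ler_wpM2r // count_v'.
Qed.

End Split.

Lemma ceil_leq n m C : (0 < m)%N -> (n <= C * m)%N = ((n + m.-1) %/ m <= C)%N.
Proof. by move=> m0; rewrite -[RHS]ltnS ltn_divLR; lia. Qed.

(** * The forms with A = 0 *)

Section Periodic.
Variable R : realType.

Lemma periodic_sum q (F : int -> R[i]) (W : R) (a : int) L : (0 < q)%N -> per q F -> (forall x, normc (F x) <= W) -> normc (\sum_(i < L) F (a + i) - (L%:R / q%:R) * \sum_(x < q) F x) <= 2 * q%:R * W.
Proof.
move=> q0 pF FW; have W0 : 0 <= W by apply: le_trans (FW 0); exact: normc_ge0.
set T := \sum_(x < q) F x.
have T1 b : \sum_(i < q) F (b + i%:Z) = T.
 by rewrite /T -(sum_shift b q0 pF); apply: eq_bigr => i; rewrite addrC.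
have Tb : normc T <= q%:R * W.
 apply: le_trans (normc_sum _ _ _) _; apply: le_trans (_ : \sum_(x < q) W <= _); first exact: ler_sum. by rewrite sumr_const card_ord mulr_natl.
have main k r : \sum_(i < k * q + r) F (a + i) = k%:R * T + \sum_(i < r) F (a + i).
 have [b eb] : exists b : int, b = a + (k * q)%N by exists (a + (k * q)). rewrite big_split_ord /=; congr (_ + _); last first.
  apply: eq_bigr => i; rewrite PoszD addrA addrAC (_ : (k * q)%N%:Z = q%:Z * k) //. by lia.
 elim: k {eb} => [|k IH]; first by rewrite big_ord0 mul0r. rewrite mulSnr big_split_ord /= IH -natr1 mulrDl mul1r; congr (_ + _).
 rewrite -(T1 (a + (k * q))); apply: eq_bigr => i _; congr F; rewrite PoszD; ring.
have qn : q%:R != 0 :> R[i] by rewrite pnatr_eq0 -lt0n.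
have eL := divn_eq L q; set k := (L %/ q)%N in eL; set r := (L %% q)%N in eL.
have -> : \sum_(i < L) F (a + i) = k%:R * T + \sum_(i < r) F (a + i) by rewrite -main -eL.
have -> : L%:R = k%:R * q%:R + r%:R :> R[i] by rewrite -natrM -natrD -eL.
have -> : k%:R * T + \sum_(i < r) F (a + i) - (k%:R * q%:R + r%:R) / q%:R * T = \sum_(i < r) F (a + i) - r%:R / q%:R * T by field.
apply: le_trans (le_normcD _ _) _; rewrite normcN -[2]/(1 + 1) !mulrDl mul1r; apply: lerD.
 apply: le_trans (normc_sum _ _ _) _; apply: le_trans (_ : \sum_(x < r) W <= _); first exact: ler_sum. apply: le_trans (_ : r%:R * W <= _); first by rewrite sumr_const card_ord mulr_natl.
 by rewrite ler_wpM2r // ler_nat ltnW // ltn_mod.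
rewrite normcM; apply: le_trans (_ : 1 * normc T <= _); last by lra.
apply: ler_wpM2r; first exact: normc_ge0.
have -> : r%:R / q%:R = (r%:R / q%:R)%:C :> R[i] by rewrite rmorphM fmorphV !rmorph_nat.
rewrite normc_real ger0_norm ?divr_ge0 // ler_pdivrMr ?ltr0n // mul1r ler_nat ltnW // ltn_mod //.
Qed.
End Periodic.

Section Square.
Variable R : realType.
Local Notation ee := (efrac R).
Local Notation harm := (harm_sum R).
Variables (d1 : nat) (g q : nat) (phi : int -> R[i]) (h : int).
Hypotheses (og : odd g) (sg : squarefree g) (gd1 : (g %| d1)%N) (gq : (g %| q)%N) (q0 : (0 < q)%N) (h0 : h != 0) (pphi : per q phi) (phi1 : forall x, normc (phi x) <= 1) (d10 : (0 < d1)%N).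
Let d : int := (d1 ^ 2)%N%:Z.
Local Notation wq := (wqf R q h).

(** The summand of [approx] for A = 0 and B = - d1; the genus character then depends on C alone. *)
Definition omega v (C x : int) : R[i] := phi (2 * d1%:Z * v%:Z * x + C * v%:Z ^+ 2) * (jacobi C g)%:~R * ee v (- h * iv v x).

(** The mean over C modulo q of complete sums over v': the density of the main term at v. *)
Definition mterm v : R[i] := (q%:R)^-1 * \sum_(C < q) \sum_(i < v | coprime i v) omega v C%:Z i%:Z.

Definition osum v (b : int) (C : int) : R[i] := \sum_(i < v) if coprimez (b + i%:Z) v%:Z then omega v C (b + i%:Z) else 0.

Lemma osum_bound v b C : (0 < v)%N -> normc (osum v b C) <= wq v.
Proof.
move=> v0; pose G (x : int) := phi (2 * d1%:Z * v * x + C * v%:Z ^+ 2) * (jacobi C g)%:~R.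
have -> : osum v b C = \sum_(i < v) if coprimez (b + i) v then G (b + i) * ee v (- h * iv v (b + i)) else 0 by [].
apply: incomplete_kl => //.
- move=> x k; rewrite /G; congr (_ * _). rewrite (_ : _ + _ = 2 * d1%:Z * v * x + C * v ^+ 2 + q%:Z * (2 * d1%:Z * v * k)) //; ring.
- move=> x; rewrite /G normcM -[X in _ <= X]mulr1; apply: ler_pM; rewrite ?normc_ge0 //. by rewrite normc_nat -intr_norm lerz1 jacobi_abs.
- by rewrite /bstarf dvdn_mulr.
- by move=> p pp; rewrite rpredN /bstarf => ph; rewrite dvdn_mull.
by rewrite leq_pmull.
Qed.

Lemma omega_perC v x : per q (omega v ^~ x).
Proof.
move=> C k; rewrite /omega.
have -> : 2 * d1%:Z * v * x + (C + q%:Z * k) * v ^+ 2 = 2 * d1%:Z * v * x + C * v%:Z ^+ 2 + q%:Z * (k * v%:Z ^+ 2) by ring.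
rewrite pphi; congr (_ * _%:~R * _).
by apply: jacobi_eqm; rewrite addrAC subrr add0r dvdz_mulr.
Qed.

Lemma osum_perC v b : per q (osum v b).
Proof.
move=> C k; apply: eq_bigr => i _; case: ifP => // _; exact: omega_perC.
Qed.

Lemma mterm_osum v b : (0 < v)%N -> \sum_(C < q) osum v b C = q%:R * mterm v.
Proof.
move=> v0; have qn : q%:R != 0 :> R[i] by rewrite pnatr_eq0 -lt0n.
rewrite /mterm mulrA divff // mul1r.
pose f x := if coprimez x v then \sum_(C < q) omega v C x else 0.
have pf1 x : f (x + v%:Z) = f x.
 have cpv : coprimez (x + v) v = coprimez x v by rewrite -{1}[v%:Z]mulr1 copz_per. rewrite /f cpv; case: ifP => // cx. rewrite -(sum_shift (2 * d1%:Z) q0 (@omega_perC v x)); apply: eq_bigr => C _.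
 rewrite /omega; congr (phi _ * _%:~R * _); first by ring.
  by apply: jacobi_eqm; rewrite opprD addrA subrr add0r rpredN dvdz_mull.
 apply: ee_eqm => //; rewrite -mulrBr dvdz_mull //; apply: iv_eqm.
  by rewrite cpv.
 by rewrite addrAC subrr.
have pf : per v f.
 have pn x (n : nat) : f (x + v%:Z * n) = f x.
  elim: n => [|n IH]; first by rewrite mulr0 addr0. by rewrite -addn1 PoszD mulrDr mulr1 addrA pf1.
 move=> x k; case: (intP k) => [|n|n]; first by rewrite mulr0 addr0.
  exact: pn.
 by rewrite -(pn (x + v%:Z * - n.+1%:Z) n.+1); congr f; ring.
rewrite exchange_big /=.
transitivity (\sum_(i < v) f (i%:Z + b)).
 by apply: eq_bigr => i; rewrite /f addrC; case: ifP => //; rewrite big1.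
rewrite (sum_shift b v0 pf) exchange_big /= [RHS]big_mkcond; apply: eq_bigr => i _.
by rewrite /f.
Qed.

Lemma mterm_bound v : (0 < v)%N -> normc (mterm v) <= wq v.
Proof.
move=> v0; have qr : 0 < q%:R :> R by rewrite ltr0n.
rewrite -(ler_pM2l qr) -{1}normc_natr -normcM -(mterm_osum 0 v0).
apply: le_trans (normc_sum _ _ _) _; apply: le_trans (_ : \sum_(C < q) wq v <= _).
 by apply: ler_sum => C _; apply: osum_bound.
by rewrite sumr_const card_ord mulr_natl.
Qed.

Variables (N M V : nat).
Hypotheses (NM : (N <= M)%N) (M2N : (M <= 2 * N)%N) (V0 : (0 < V)%N) (dN : (`|d| * V ^ 2 <= N)%N) (Nd : (N < `|d| * V.+1 ^ 2)%N).
Variables (al be : int).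
Hypotheses (al0 : 0 <= al) (al1 : al <= 1) (be1 : be <= 1).

Local Notation K2 v := ((48 * `|d| + 1) * V %/ v)%N.
Local Notation K3 := (2 * N + 1)%N.

Let cC (v v' : nat) (C : int) : int := 2 * d1%:Z * v%:Z * v'%:Z + C * v%:Z ^+ 2.

Let tC v (C : int) : R[i] := \fsum_(V, v; v') if cellQ d v v' N M al be 0 (- d1%:Z) C then approx g phi h v 0 (- d1%:Z) C v' else 0.

(** The conditions of the cell follow from c > N: w = d1 v is positive, and so is v w' = c - d1 v
    v', as d1 v v' <= d V^2 <= N. *)
Lemma cellQ0 v v' C : (0 < v <= V)%N -> (0 < v' <= V)%N -> cellQ d v v' N M al be 0 (- d1%:Z) C = (N%:Z < cC v v' C <= M).
Proof.
move=> /andP[v0 vV] /andP[v'0 v'V]; have eq : qval v v' 0 (- d1%:Z) C = cC v v' C by rewrite /qval /cC; ring.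
rewrite /cellQ eq mul0r subr0 sqrrN eqxx; case: (boolP (N%:Z < _)) => //= q1.
case: (_ <= M%:Z) => //=.
have dv : 1 <= d1%:Z * v by rewrite lez_nat muln_gt0 d10.
apply/andP; split; first by rewrite mulNr opprK (le_trans al1).
apply: le_trans be1 _; rewrite -gtz0_ge1 -(@pmulr_rgt0 _ v%:Z) //.
have -> : v%:Z * (C * v - - d1%:Z * v') = cC v v' C - d1%:Z * v * v' by rewrite /cC; ring.
rewrite subr_gt0; apply: le_lt_trans q1; rewrite -!PoszM lez_nat; apply: leq_trans dN.
rewrite -mulnA; apply: leq_mul; first by rewrite leq_pexp2l || (rewrite -[d1]expn1 leq_pexp2l).
by rewrite leq_mul.
Qed.

(** Of the two square roots of d only B = - d1 makes w = - B v nonnegative. *)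
Lemma zpart_tC v : (0 < v <= V)%N -> zpart d g phi h N M V al be v = \sum_(C <- zs K3) tC v C.
Proof.
move=> /andP[v0 vV]; rewrite /zpart /tC [RHS]exchange_big /=; apply: eq_bigr => v' _.
rewrite (bigD1_seq (- d1%:Z)) ?uniq_zs //=; last first.
 rewrite mem_zs leq_divRL // abszN absz_nat; apply: leq_mul => //. by nia.
rewrite [X in _ + X]big1 ?addr0 // => B nB; apply: big1 => C _; case: ifP => // /and5P[/eqP e _ _ q3 _].
case/negP: nB; have : (B - d1%:Z) * (B + d1) == 0.
 by lra.
rewrite mulf_eq0 subr_eq0 addr_eq0 => /orP[/eqP eB|//].
move: (le_trans al0 q3); rewrite eB mul0r sub0r oppr_ge0 -PoszM lez_nat; lia.
Qed.

Lemma tC_bound v C : (0 < v <= V)%N -> normc (tC v C) <= wq v.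
Proof.
move=> vV; apply: inner_bound => //.
 by rewrite /d dvdzE (dvdn_trans gd1) // dvdn_exp.
by rewrite /d -lt0n expn_gt0 d10.
Qed.

Lemma tC_relevant v C : (0 < v <= V)%N -> tC v C != 0 -> N%:Z < cC v V C /\ cC v V C <= (M + 2 * d1 * v ^ 2)%N.
Proof.
move=> vV tn; have /andP[v0 vV'] := vV.
have [v' [v'1 v'2 v'3]] : exists v', [/\ (0 < v' <= V)%N, (V < v + v')%N & N%:Z < cC v v' C <= M].
  case: (boolP [exists x : 'I_V.+1, [&& (0 < x)%N, (V < v + x)%N & N%:Z < cC v x C <= M]]).
  by move=> /existsP[x /and3P[x0 x1 x2]]; exists x; rewrite x0 -ltnS ltn_ord.
 move=> nex; case/eqP: tn; rewrite /tC big_nat_cond big1 // => v' /andP[/andP[v'0 v'V] /andP[/andP[_ Vv] _]]. rewrite cellQ0 //; last by lia.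
 case: ifP => // hc; case/negP: nex; apply/existsP; exists (Ordinal v'V) => /=. by lia.
have /andP[v'0 v'V] := v'1; have /andP[c1 c2] := v'3.
have e : cC v V C = cC v v' C + 2 * d1%:Z * v * (V%:Z - v'%:Z) by rewrite /cC; ring.
split; first by rewrite e (lt_le_trans c1) // lerDl mulr_ge0 // subr_ge0.
rewrite e PoszD lerD //.
have -> : (2 * d1 * v ^ 2)%N%:Z = 2 * d1%:Z * v * v by rewrite !PoszM; ring.
by rewrite ler_wpM2l; lia.
Qed.

(** For most C the sum over v' is complete, and the mean of these sums over C is [mterm v]. The
    O(d1) values of C at the ends of the range, and all C when V < 2 v, are left to the bound for
    incomplete sums. *)
Lemma zpart_sq v : (0 < v <= V)%N -> normc (zpart d g phi h N M V al be v - ((M - N)%N%:R / v%:R ^+ 2)%:C * mterm v) <= (14 * d1 ^ 2 + 2 * q + 4)%N%:R * wq v.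
Proof.
move=> vV; have /andP[v0 vV'] := vV; rewrite zpart_tC //.
have W0 := wq_ge0 R q h v; have vr : 0 < v%:R :> R by rewrite ltr0n.
have v2r : 0 < v%:R ^+ 2 :> R by rewrite exprn_gt0.
have MN : (M - N <= N)%N by move: M2N; clear; lia.
have Mv0 : 0 <= (M - N)%N%:R / v%:R ^+ 2 :> R by rewrite divr_ge0 // ltW.
have MNv : (M - N)%N%:R / v%:R ^+ 2 <= N%:R / v%:R ^+ 2 :> R by rewrite ler_pM2r ?invr_gt0 // ler_nat.
have MM : normc (((M - N)%N%:R / v%:R ^+ 2)%:C * mterm v) <= N%:R / v%:R ^+ 2 * wq v.
 rewrite normcM normc_real ger0_norm //; apply: ler_pM => //; first exact: normc_ge0. exact: mterm_bound.
have dd : d1%:R <= (d1 ^ 2)%:R :> R by rewrite ler_nat -[d1]expn1 leq_pexp2l.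
have xe C : cC v V C = 2 * d1%:Z * v * V + C * (v ^ 2)%N by [].
have v20 : (0 < v ^ 2)%N by rewrite expn_gt0 v0.
(* If 2 v <= V, then v < v' follows from v' > V - v, and v' runs over all residues modulo v. In the
   other case N / v^2 is bounded, so only boundedly many C occur. *)
case: (ltnP V (2 * v)) => Vv.
 have Nb : N%:R / v%:R ^+ 2 <= 4 * (d1 ^ 2)%:R :> R.
  rewrite ler_pdivrMr // -natrX -!natrM ler_nat; apply: ltnW; apply: leq_trans Nd _. rewrite [(4 * _)%N]mulnC -mulnA; apply: leq_mul => //. by have := leq_mul Vv Vv; rewrite mulnACA.
 apply: le_trans (le_normcD _ _) _; rewrite normcN. apply: le_trans (_ : (N%:R / v%:R ^+ 2 + 2 * d1%:R + 1) * wq v + N%:R / v%:R ^+ 2 * wq v <= _); last first.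
  rewrite -mulrDl ler_wpM2r // !natrD !natrM. have : 0 <= q%:R :> R by []. lra.
 apply: lerD => //; apply: le_trans (normc_sum _ _ _) _. apply: le_trans (_ : (\sum_(C <- zs K3 | (N%:Z < 2 * d1%:Z * v * V + C * (v ^ 2)%N) &&
   (2 * d1%:Z * v * V + C * (v ^ 2)%N <= (M + 2 * d1 * v ^ 2)%N)) 1) * wq v <= _).
  rewrite mulr_suml [X in _ <= X]big_mkcond; apply: ler_sum => C _; rewrite -!xe. have [->|tn] := eqVneq (tC v C) 0; first by rewrite normc0; case: ifP; rewrite ?mul1r.
  by have [-> ->] := tC_relevant vV tn; rewrite mul1r tC_bound.
 rewrite ler_wpM2r //; apply: le_trans (count_le _ _ _ v20 _) _; first by rewrite lez_nat; exact: leq_trans NM (leq_addr _ _). apply: le_trans (_ : (N + 2 * d1 * v ^ 2)%N%:~R / (v ^ 2)%:R + 1 <= _).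
  by rewrite lerD2r ler_pM2r ?invr_gt0 ?ltr0n // ler_int lerBlDr lez_nat addnAC leq_add2r addnn -mul2n.
 by rewrite -[_%:~R]/((N + 2 * d1 * v ^ 2)%:R) le_eqVlt; apply/orP; left; apply/eqP; field; rewrite pnatr_eq0 -lt0n.
(* If n1 <= C v^2 <= n2, then every v' in (V - v, V] gives N < c <= M. *)
pose n1 := (N - 2 * d1 * v * (V - v))%N; pose n2 := (M - 2 * d1 * v * V)%N.
have dV : (2 * d1 * v * V <= N)%N.
 apply: leq_trans dN; rewrite /d absz_nat. have k1 : (d1 * (2 * v) * V <= d1 * V * V)%N by rewrite leq_mul2r leq_mul2l Vv !orbT.
 have k2 : (d1 * V * V <= d1 ^ 2 * V ^ 2)%N by rewrite -mulnA; apply: leq_mul => //; rewrite -[d1]expn1 leq_pexp2l. by apply: leq_trans k2; apply: leq_trans k1; rewrite mulnA [(d1 * 2)%N]mulnC.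
have dV' : (2 * d1 * v * (V - v) <= N)%N by apply: leq_trans dV; rewrite leq_mul2l leq_subr orbT.
pose a := ((n1 + (v ^ 2).-1) %/ v ^ 2)%N; pose b := (n2 %/ v ^ 2).+1; pose L := (b - a)%N.
pose I (C : int) := (n1%:Z <= C * (v ^ 2)%N) && (C * (v ^ 2)%N <= n2).
have IE (C : nat) : I C = (a <= C < b)%N.
 rewrite /I -!PoszM !lez_nat /a /b ltnS leq_divRL //; congr (_ && _). exact: ceil_leq.
have S1 C : I C -> tC v C = osum v (V - v).+1 C.
 move=> /andP[i1 i2]; rewrite /tC /osum. have -> : \fsum_(V, v; v') (if cellQ d v v' N M al be 0 (- d1%:Z) C then approx g phi h v 0 (- d1%:Z) C v' else 0) =
   \sum_((V - v).+1 <= v' < V.+1) if coprimez v' v then omega v C v' else 0.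
  rewrite (@big_cat_nat _ _ _ (V - v).+1) //=; last by rewrite ltnS leq_subr. rewrite big_nat_cond big1 ?add0r; last first.
   by move=> v' /andP[/andP[v'0 v'V] /andP[/andP[_ Vv'] _]]; exfalso; move: v0 vV' v'V Vv'; clear; lia.
  rewrite big_mkcond; apply: eq_big_nat => v' /andP[v'0 v'V]. have -> : fcell V v v' && (v < v')%N = coprimez v' v.
   rewrite copz_nat coprime_sym /fcell; case: coprime => //=. by move: v'0 v'V v0 vV' Vv; clear; lia.
  have v'1 : (0 < v' <= V)%N by move: v'0 v'V; clear; lia. case: ifP => // _; rewrite cellQ0 //. have e1 : cC v v' C = C * (v ^ 2)%N + (2 * d1 * v * v')%N by rewrite /cC; ring.
  have e2 : (2 * d1 * v * (V - v) < 2 * d1 * v * v')%N by rewrite ltn_pmul2l ?muln_gt0 ?d10 //; move: v'0; clear; lia.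
  have e3 : (2 * d1 * v * v' <= 2 * d1 * v * V)%N by rewrite leq_mul2l; apply/orP; right; case/andP: v'1. have -> : N%:Z < cC v v' C <= M.
   rewrite e1; move: i1 i2 NM dV dV' e2 e3; rewrite /n1 /n2. move: (2 * d1 * v * V)%N (2 * d1 * v * (V - v))%N (2 * d1 * v * v')%N (C * (v ^ 2)%N). by clear; lia.
  rewrite /approx /omega sgm0 //; last by case: g og. by congr (phi _ * _ * _); rewrite /qval; ring.
 rewrite -{1}[(V - v).+1]add0n big_addn big_mkord. have -> : (V.+1 - (V - v).+1)%N = v by rewrite subSS subKn. by apply: eq_bigr => i; rewrite addnC.
have S2 : \sum_(C <- zs K3 | I C) tC v C = \sum_(i < L) osum v (V - v).+1 (a%:Z + i).
 rewrite -(big_mkord xpredT (fun i => osum v (V - v).+1 (a%:Z + i))) (eq_bigr (osum v (V - v).+1)); last by [].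
 apply: (@sum_bij _ _ _ _ _ _ _ (fun C => `|C| - a)%N (fun i => a%:Z + i)); rewrite ?uniq_zs ?iota_uniq //.
  move=> C _ iC; have C0 : 0 <= C.
   by move: iC => /andP[i1 _]; rewrite -(@pmulr_lge0 _ (v ^ 2)%N%:Z) // (le_trans _ i1).
  move: iC; rewrite -[C]gez0_abs // IE mem_index_iota /L => h1; rewrite absz_nat. by split; move: h1; move: (a) (b); clear; lia.
 move=> i; rewrite mem_index_iota /L => /andP[_ iL] _; rewrite -PoszD IE mem_zs absz_nat. have bK : (b <= K3)%N by rewrite /b /n2 addn1 ltnS (leq_trans (leq_div _ _)) // (leq_trans (leq_subr _ _)).
 by split; move: iL bK; move: (a) (b); clear; lia.
rewrite (bigID I) /= S2.
have qn : q%:R != 0 :> R[i] by rewrite pnatr_eq0 -lt0n.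
have P1 := @periodic_sum R q (osum v (V - v).+1) (wq v) a L q0 (@osum_perC v _) (fun x => osum_bound _ x v0).
rewrite mterm_osum // in P1.
have eL : L%:R / q%:R * (q%:R * mterm v) = L%:R%:C * mterm v by rewrite rmorph_nat; field.
rewrite eL in P1.
have P2 : normc (\sum_(C <- zs K3 | ~~ I C) tC v C) <= (4 * d1%:R + 2) * wq v.
 apply: le_trans (normc_sum _ _ _) _. pose Q lo (C : int) := (lo%:Z < 2 * d1%:Z * v * V + C * (v ^ 2)%N) && (2 * d1%:Z * v * V + C * (v ^ 2)%N <= (lo + 2 * d1 * v ^ 2)%N).
 have cQ lo : \sum_(C <- zs K3 | Q lo C) (1 : R) <= 2 * d1%:R + 1.
  apply: le_trans (count_le _ _ _ v20 _) _; first by rewrite lez_nat leq_addr. by rewrite PoszD addrAC subrr -[_%:~R]/((2 * d1 * v ^ 2)%:R) natrM mulfK ?gt_eqF // natrM.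
 apply: le_trans (_ : (\sum_(C <- zs K3 | Q N C) 1 + \sum_(C <- zs K3 | Q M C) 1) * wq v <= _); last first.
  rewrite ler_wpM2r; have := cQ N; have := cQ M; lra.
 rewrite (big_mkcond (Q N)) (big_mkcond (Q M)) [X in X <= _]big_mkcond mulrDl !mulr_suml -big_split /=. apply: ler_sum => C _.
 have p1 (b1 : bool) : 0 <= (if b1 then 1 else 0) * wq v by case: b1; rewrite ?mul1r ?mul0r. have p0 (b1 b2 : bool) : 0 <= (if b1 then 1 else 0) * wq v + (if b2 then 1 else 0) * wq v by rewrite addr_ge0.
 case: ifP => // nI; have [->|tn] := eqVneq (tC v C) 0; first by rewrite normc0. have [r1 r2] := tC_relevant vV tn. have : Q N C || Q M C.
  rewrite /Q -!xe; have r3 : cC v V C = C * (v ^ 2)%N + (2 * d1 * v * V)%N by rewrite /cC; ring. have r4 : (2 * d1 * v * V = 2 * d1 * v * (V - v) + 2 * d1 * v ^ 2)%N by rewrite mulnA -mulnDr subnK.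
  move: nI r1 r2 r3 r4 dV dV' NM; rewrite /I /n1 /n2. move: (2 * d1 * v * V)%N (2 * d1 * v * (V - v))%N (2 * d1 * v ^ 2)%N (C * (v ^ 2)%N) (cC v V C). by clear; lia.
 case/orP => ->; rewrite mul1r; apply: le_trans (tC_bound C vV) _.
  by rewrite lerDl.
 by rewrite lerDr.
have P3 : normc (L%:R%:C * mterm v - ((M - N)%N%:R / v%:R ^+ 2)%:C * mterm v) <= (2 * d1%:R + 1) * wq v.
 rewrite -mulrBl -rmorphB normcM normc_real; apply: ler_pM; rewrite ?normc_ge0 ?mterm_bound //. have e1 : (L * v ^ 2 <= (M - N) + v ^ 2)%N.
  have k1 : ((n2 %/ v ^ 2) * v ^ 2 <= n2)%N := leq_divM _ _. have k2 : (n1 <= a * v ^ 2)%N by rewrite ceil_leq. have r4 : (2 * d1 * v * (V - v) <= 2 * d1 * v * V)%N by rewrite leq_mul2l leq_subr orbT.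
  rewrite /L mulnBl /b mulSn; move: k1 k2 dV dV' NM r4; rewrite /n1 /n2. move: ((M - 2 * d1 * v * V) %/ v ^ 2 * v ^ 2)%N => X; move: (a * v ^ 2)%N => Y. by clear; lia.
 have e2 : (M - N <= L * v ^ 2 + 2 * d1 * v ^ 2 + v ^ 2)%N.
  have k1 : (n2 < b * v ^ 2)%N := ltn_ceil n2 v20. have k2 : (a * v ^ 2 <= n1 + (v ^ 2).-1)%N := leq_divM _ _.
  have r4 : (2 * d1 * v * V = 2 * d1 * v * (V - v) + 2 * d1 * v ^ 2)%N by rewrite mulnA -mulnDr subnK. rewrite /L mulnBl; move: k1 k2 dV dV' NM r4 v20; rewrite /n1 /n2.
  move: (a * v ^ 2)%N => Y; move: (b * v ^ 2)%N => X. move: (2 * d1 * v ^ 2)%N => Z; move: (2 * d1 * v * V)%N (2 * d1 * v * (V - v))%N (v ^ 2)%N. by clear; lia.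
 have L1 : L%:R * v%:R ^+ 2 <= (M - N)%N%:R + v%:R ^+ 2 :> R by rewrite -natrX -natrM -natrD ler_nat.
 have L2 : (M - N)%N%:R <= L%:R * v%:R ^+ 2 + 2 * d1%:R * v%:R ^+ 2 + v%:R ^+ 2 :> R by rewrite -natrX -!natrM -!natrD ler_nat. set x := v%:R ^+ 2 in L1 L2 v2r *.
 have -> : L%:R - (M - N)%N%:R / x = (L%:R * x - (M - N)%N%:R) / x by field; rewrite gt_eqF. rewrite normrM (@ger0_norm _ x^-1) ?invr_ge0 ?(ltW v2r) // ler_pdivrMr // ler_norml.
 have : 0 <= d1%:R * x by rewrite mulr_ge0 // ltW. by lra.
set T1 := \sum_(i < L) _ in P1 *; set T2 := \sum_(C <- _ | _) _ in P2 *; set M1 := _ * mterm v in P1 P3 *.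
set M2 := _ * mterm v in P3 *.
have -> : T1 + T2 - M2 = (T1 - M1) + T2 + (M1 - M2) by ring.
apply: le_trans (le_normcD _ _) _; apply: le_trans (lerD (le_normcD _ _) (lexx _)) _.
apply: le_trans (lerD (lerD P1 P2) P3) _; rewrite -!mulrDl ler_wpM2r // !natrD !natrM.
have : 0 <= d1%:R :> R by [].
lra.
Qed.

End Square.

(** * Blocks N < c <= M *)

Section Block.
Variables (R : realType) (d : int) (g q : nat) (phi : int -> R[i]).
Hypotheses (og : odd g) (sg : squarefree g) (gd : (g%:Z %| d)%Z) (q0 : (0 < q)%N) (pphi : per q phi) (phi1 : forall x, normc (phi x) <= 1) (phig : forall x, phi x != 0 -> (g%:Z %| x)%Z) (d0 : d != 0).

(** 64 |d| + 3 is the number of values of A, and (96 |d| + 3) V / v bounds that of B, in the ranges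
    of [cell_bounds]; the last term comes from the change of phase at A = 0. *)
Definition cellK (h : int) : R := (64 * `|d| + 3)%N%:R * (96 * `|d| + 3)%N%:R * (1 + hpi R h) + 4 * hpi R h * `|d|%N%:R.

Lemma cellK_ge0 h : 0 <= cellK h.
Proof.
have := hpi_ge0 R h; rewrite /cellK; move: (hpi R h) => x x0.
by rewrite addr_ge0 ?mulr_ge0 ?addr_ge0.
Qed.

Lemma cellsum_zpart (al be h : int) (U U' : nat -> nat -> int) N M V : h != 0 -> 0 <= al -> 0 <= be -> (N <= M)%N -> (M <= 2 * N)%N -> (0 < V)%N -> (`|d| * V ^ 2 <= N)%N -> (N < `|d| * V.+1 ^ 2)%N ->
 (forall v v', (0 < v)%N -> (0 < v')%N -> fcell V v v' ->
  [/\ U' v v' * v - U v v' * v' = 1, - v%:Z <= U v v' & U' v v' <= v']) ->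
 normc (cellsum d g phi al be U U' h N M V - \sum_(1 <= v < V.+1) zpart d g phi h N M V al be v) <=
 cellK h * \sum_(1 <= v < V.+1) V%:R / v%:R * (wqf R q h v + 1).
Proof.
move=> h0 al0 be0 NM M2N V0 dN Nd HU.
have D1 : 1 <= `|d|%N%:R :> R by rewrite ler1n absz_gt0.
have VN : (V ^ 2 <= N)%N by apply: leq_trans dN; rewrite leq_pmull // absz_gt0.
have N0 : 0 < N%:R :> R by rewrite ltr0n; apply: leq_trans VN; rewrite expn_gt0 V0.
have hp := hpi_ge0 R h.
rewrite /cellsum -sumrB mulr_sumr; apply: le_trans (normc_sum _ _ _) _.
rewrite big_nat_cond [X in _ <= X]big_nat_cond; apply: ler_sum => v /andP[/andP[v0 vV] _].
have vV' : (0 < v <= V)%N by rewrite v0.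
have vr : 0 < v%:R :> R by rewrite ltr0n.
have eq : \fsum_(V, v; v') \sum_(N.+1 <= c < M.+1) \sum_(Y <- zs (2 * N)) (if cellc d al be (U v v') (U' v v') v v' c Y then rterm d g phi h c Y else 0) = \fsum_(V, v; v')
  \sum_(A <- zs (32 * `|d| + 1)) \sum_(B <- zs ((48 * `|d| + 1) * V %/ v)) \sum_(C <- zs (2 * N + 1))
   (if cellQ d v v' N M al be A B C then rterm d g phi h (qval v v' A B C) (yval v v' (U v v') (U' v v') A B C) else 0).
 rewrite big_nat_cond [RHS]big_nat_cond; apply: eq_bigr => v' /andP[/andP[v'0 v'V] /andP[fc vv]]. have [uni u1 u2] := HU v v' v0 v'0 fc; have /andP[_ Vvv] := fc. exact: cell_reindex.
have P := @per_v_bound R d g q phi h og sg gd q0 h0 pphi phi1 phig d0 N M V NM M2N V0 dN Nd al be (U v) (U' v) v vV' al0 be0.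
rewrite eq; apply: le_trans (P _) _.
 by move=> v' v'0 fc; have [] := HU v v' v0 v'0 fc.
have w0 := wq_ge0 R q h v; set w := wqf R q h v in w0 *.
set r := V%:R / v%:R; have r1 : 1 <= r by rewrite ler_pdivlMr // mul1r ler_nat.
set D := `|d|%N%:R in D1 *.
have k2 : (2 * ((48 * `|d| + 1) * V %/ v)).+1%:R <= (96 * D + 3) * r.
 have : ((48 * `|d| + 1) * V %/ v)%N%:R <= (48 * D + 1) * r.
  rewrite /r mulrA ler_pdivlMr // -natrM; apply: le_trans (_ : ((48 * `|d| + 1) * V)%N%:R <= _).
   by rewrite ler_nat leq_divM.
  by rewrite natrM natrD natrM.
 move: (_ %/ v)%N => k hk; rewrite -(addn1 (2 * k)) natrD natrM. have : 0 <= D * r by apply: mulr_ge0; lra. by lra.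
have k1 : (2 * (32 * `|d| + 1)).+1%:R = 64 * D + 3.
 by rewrite -(addn1 (2 * _)) /D; ring.
have k3 : v%:R * (2 * (N%:R / v%:R ^+ 2 + 1) * (hpi R h * D / N%:R)) <= 4 * hpi R h * D * r.
 have -> : v%:R * (2 * (N%:R / v%:R ^+ 2 + 1) * (hpi R h * D / N%:R)) = 2 * (hpi R h * D) * (v%:R^-1 + v%:R / N%:R).
  by field; rewrite !gt_eqF.
 have j1 : v%:R^-1 <= 1 :> R by rewrite invf_le1 // ler1n. have j2 : v%:R / N%:R <= 1 :> R.
  have VV : (V <= V ^ 2)%N by rewrite -[V]expn1 leq_pexp2l. by rewrite ler_pdivrMr // mul1r ler_nat; apply: leq_trans VN; apply: leq_trans VV.
 have hD : 0 <= hpi R h * D by apply: mulr_ge0 => //; exact: le_trans. have : hpi R h * D * 1 <= hpi R h * D * r by rewrite ler_wpM2l.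
 have : hpi R h * D * (v%:R^-1 + v%:R / N%:R) <= hpi R h * D * 2 by rewrite ler_wpM2l //; lra. lra.
have k4 : (2 * (32 * `|d| + 1)).+1%:R * (2 * ((48 * `|d| + 1) * V %/ v)).+1%:R * (w + hpi R h) <= (64 * D + 3) * (96 * D + 3) * (1 + hpi R h) * (r * (w + 1)).
 have e5 : w + hpi R h <= (1 + hpi R h) * (w + 1).
  by have : 0 <= hpi R h * w; [rewrite mulr_ge0 | rewrite mulrDl; lra].
 have -> : (64 * D + 3) * (96 * D + 3) * (1 + hpi R h) * (r * (w + 1)) = (64 * D + 3) * ((96 * D + 3) * r) * ((1 + hpi R h) * (w + 1)) by ring. apply: ler_pM; rewrite ?mulr_ge0 ?addr_ge0 //.
 by rewrite k1 ler_wpM2l //; lra.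
have -> : cellK h = (64 * D + 3) * (96 * D + 3) * (1 + hpi R h) + 4 * hpi R h * D by rewrite /cellK (natrD _ (64 * _)) (natrD _ (96 * _)) natrM natrM.
apply: le_trans (lerD k4 k3) _; rewrite [X in _ <= X]mulrDl lerD2l.
have : 4 * hpi R h * D * r * 1 <= 4 * hpi R h * D * r * (w + 1).
 rewrite ler_wpM2l ?lerDr //; apply: mulr_ge0; last exact: le_trans. by apply: mulr_ge0; [apply: mulr_ge0 | exact: le_trans].
lra.
Qed.

Variables (h : int) (Mt : nat -> R[i]) (Kz : R).
Hypotheses (h0 : h != 0) (Kz0 : 0 <= Kz).
(** The main term in abstract form: [Mt] will be the sum of two densities [mterm] if d is a square,
    and 0 otherwise. *)
Hypothesis HM : forall N M V v, (N <= M)%N -> (M <= 2 * N)%N -> (0 < V)%N ->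
 (`|d| * V ^ 2 <= N)%N -> (N < `|d| * V.+1 ^ 2)%N -> (0 < v <= V)%N ->
 normc (zpart d g phi h N M V 0 1 v + zpart d g phi (- h) N M V 1 0 v - ((M - N)%N%:R / v%:R ^+ 2)%:C * Mt v)
 <= Kz * wqf R q h v.

Definition msum V : R[i] := \sum_(1 <= v < V.+1) ((v%:R ^+ 2)^-1)%:C * Mt v.
Definition esum V : R := \sum_(1 <= v < V.+1) (v%:R)^-1 * (wqf R q h v + 1).

Lemma block_est N M V : (N <= M)%N -> (M <= 2 * N)%N -> (1 < V)%N -> (`|d| * V ^ 2 <= N)%N -> (N < `|d| * V.+1 ^ 2)%N ->
 normc (blocksum d g phi h N M - (M - N)%N%:R * msum V) <= (2 * cellK h + Kz) * (V%:R * esum V).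
Proof.
move=> NM M2N V1 dN Nd; have V0 : (0 < V)%N by lia.
rewrite (blocksum_cells _ _ _ _ V1 M2N).
set S1 := cellsum _ _ _ _ _ _ _ h _ _ _; set S2 := cellsum _ _ _ _ _ _ _ (- h) _ _ _.
have wqN v : wqf R q (- h) v = wqf R q h v by rewrite /wqf /bstarf abszN.
have B1 : normc (S1 - \sum_(1 <= v < V.+1) zpart d g phi h N M V 0 1 v) <= cellK h * (V%:R * esum V).
 have -> : V%:R * esum V = \sum_(1 <= v < V.+1) V%:R / v%:R * (wqf R q h v + 1).
  by rewrite /esum mulr_sumr; apply: eq_bigr => v; rewrite mulrA.
 apply: cellsum_zpart => // v v' v0 v'0 /andP[cp _]; split; first exact: fareyu_unimod.
  by have /andP[u0 _] := fareyu_range v' v0; apply: le_trans u0; rewrite oppr_le0.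
 by have /andP[_] := fareyu'_range v0 v'0 cp.
have B2 : normc (S2 - \sum_(1 <= v < V.+1) zpart d g phi (- h) N M V 1 0 v) <= cellK h * (V%:R * esum V).
 have -> : cellK h = cellK (- h) by rewrite /cellK /hpi mulrNz normrN. have -> : V%:R * esum V = \sum_(1 <= v < V.+1) V%:R / v%:R * (wqf R q (- h) v + 1).
  by rewrite /esum mulr_sumr; apply: eq_bigr => v; rewrite wqN mulrA.
 apply: cellsum_zpart => //; first by rewrite oppr_eq0. move=> v v' v0 v'0 /andP[cp _]; rewrite coprime_sym in cp; split.
 - by rewrite -(fareyu_unimod v'0 cp); ring.
 - by have /andP[_] := fareyu'_range v'0 v0 cp; rewrite lerN2.
 by have /andP[u0 _] := fareyu_range v v'0; apply: le_trans (_ : 0 <= _) => //; rewrite oppr_le0.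
have B3 : normc (\sum_(1 <= v < V.+1) zpart d g phi h N M V 0 1 v + \sum_(1 <= v < V.+1) zpart d g phi (- h) N M V 1 0 v
  - (M - N)%N%:R * msum V) <= Kz * (V%:R * esum V).
 rewrite -big_split /msum mulr_sumr -sumrB /esum !mulr_sumr; apply: le_trans (normc_sum _ _ _) _. rewrite big_nat_cond [X in _ <= X]big_nat_cond; apply: ler_sum => v /andP[/andP[v0 vV] _] /=.
 have vr : 0 < v%:R :> R by rewrite ltr0n. have -> : (M - N)%N%:R * (((v%:R ^+ 2)^-1)%:C * Mt v) = ((M - N)%N%:R / v%:R ^+ 2)%:C * Mt v by rewrite mulrA rmorphM rmorph_nat.
 apply: le_trans (HM NM M2N V0 dN Nd _) _; first by rewrite v0. rewrite ler_wpM2l // mulrA; have w0 := wq_ge0 R q h v. have r1 : 1 <= V%:R / v%:R :> R by rewrite ler_pdivlMr // mul1r ler_nat.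
 have : 1 * (wqf R q h v + 1) <= V%:R / v%:R * (wqf R q h v + 1) by rewrite ler_wpM2r; lra. lra.
set Z1 := \sum_(1 <= v < _) _ in B1 B3; set Z2 := \sum_(1 <= v < _) _ in B2 B3; set X := _ * msum V in B3 *.
have -> : S1 + S2 - X = (S1 - Z1) + (S2 - Z2) + (Z1 + Z2 - X) by ring.
apply: le_trans (le_normcD _ _) _; apply: le_trans (lerD (le_normcD _ _) (lexx _)) _.
lra.
Qed.

End Block.

Lemma sqrt_scaled D N : (0 < D)%N -> exists V, (D * V ^ 2 <= N)%N /\ (N < D * V.+1 ^ 2)%N.
Proof.
move=> D0; elim: N => [|N [V [h1 h2]]]; first by exists 0; rewrite muln0 muln_gt0 D0.
case: (ltnP N.+1 (D * V.+1 ^ 2)) => h; first by exists V; split => //; apply: leq_trans.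
exists V.+1; split => //; apply: leq_ltn_trans h2 _.
by rewrite ltn_pmul2l // ltn_sqr.
Qed.

(** * Growth of the errors and passage to all c <= X *)

Section Growth.
Variable R : realType.
Local Notation harm := (harm_sum R).

Lemma powR_nat_ge1 n (s : R) : (0 < n)%N -> 0 <= s -> 1 <= (n%:R : R) `^ s.
Proof. by move=> n0 s0; rewrite -[X in X <= _](powRr0 n%:R); apply: ler_powR => //; rewrite ler1n. Qed.
Lemma powR_mono (x y s : R) : 0 <= x -> x <= y -> 0 <= s -> x `^ s <= y `^ s.
Proof. by move=> x0 xy s0; apply: ge0_ler_powR; rewrite ?nnegrE // (le_trans x0). Qed.
Lemma powR_add (x r s : R) : 0 < x -> x `^ (r + s) = x `^ r * x `^ s.
Proof. by move=> x0; apply: powRD; apply/implyP => _; rewrite gt_eqF. Qed.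
Lemma harm_ln n : (0 < n)%N -> harm n <= 1 + ln (n%:R : R).
Proof.
case: n => // n _; elim: n => [|n IH]; first by rewrite /harm_sum big_ord1 invr1 ln1 addr0.
rewrite /harm_sum big_ord_recr /=; apply: le_trans (lerD IH (lexx _)) _.
rewrite -addrA lerD2l -lerBrDl -opprB lerNr.
have n1 : 0 < n.+1%:R :> R by [].
have n2 : 0 < n.+2%:R :> R by [].
rewrite -ln_div //; have -> : n.+1%:R / n.+2%:R = 1 + - n.+2%:R^-1 :> R.
 have -> : n.+1%:R = n.+2%:R - 1 :> R by rewrite -[n.+2%:R]natr1 addrK. by rewrite mulrBl divff ?gt_eqF // mul1r.
apply: le_ln1Dx; rewrite ltrN2 invf_lt1 // ltr1n //.
Qed.

Lemma harm_pow (e : R) : 0 < e -> exists2 H : R, 0 <= H & forall n, (0 < n)%N -> harm n <= H * n%:R `^ e.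
Proof.
move=> e0; exists (1 + e^-1); first by rewrite addr_ge0 // invr_ge0 ltW.
move=> n n0; apply: le_trans (harm_ln n0) _; have nr : 0 < n%:R :> R by rewrite ltr0n.
have h1 : 1 + e * ln n%:R <= n%:R `^ e.
 by rewrite /powR gt_eqF //; exact: expR_ge1Dx.
have h2 := powR_nat_ge1 n0 (ltW e0).
have ei : 0 < e^-1 by rewrite invr_gt0.
have : e^-1 * (1 + e * ln n%:R) <= e^-1 * n%:R `^ e by rewrite ler_pM2l.
rewrite mulrDr mulr1 mulrA mulVf ?gt_eqF // mul1r mulrDl mul1r => h3; lra.
Qed.

Lemma esum_pow q h (e : R) : (0 < q)%N -> h != 0 -> 0 < e -> exists2 K : R, 0 <= K & forall V, (0 < V)%N -> esum R q h V <= K * V%:R `^ (1 / 2 + e).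
Proof.
(* Five harmonic sums occur, four from [wt_sum] and one from completion; each is O(V^dl). *)
move=> q0 h0 e0; pose dl := e / 5; have dl0 : 0 < dl by rewrite divr_gt0.
have [H H0 hH] := harm_pow dl0.
pose tau : R := (size (divisors (bstarf q h)))%:R.
pose P : R := q%:R * (1 + 4 * (H * q%:R `^ dl)) * tau * H ^+ 4 + H.
have qd0 : 0 <= q%:R `^ dl by exact: powR_ge0.
have A0 : 0 <= 1 + 4 * (H * q%:R `^ dl) by rewrite addr_ge0 ?mulr_ge0.
exists P => [|V V0]; first by rewrite /P addr_ge0 ?mulr_ge0.
have Vr : 0 < V%:R :> R by rewrite ltr0n.
set x := V%:R `^ dl; have x1 : 1 <= x by apply: powR_nat_ge1 => //; exact: ltW.
have x0 : 0 <= x by lra.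
have hV : harm V <= H * x by exact: hH.
have hq v : (v <= V)%N -> harm (q * v) <= H * q%:R `^ dl * x.
 move=> vV; apply: le_trans (harm_mono R (_ : (q * v <= q * V)%N)) _; first by rewrite leq_mul2l vV orbT. by apply: le_trans (hH _ _) _; rewrite ?muln_gt0 ?q0 // natrM powRM // mulrA.
have -> : V%:R `^ (1 / 2 + e) = Num.sqrt V%:R * x ^+ 5.
 rewrite powR_add // mul1r powR12_sqrt // /x -powR_mulrn // -powRrM; congr (_ * _ `^ _). by rewrite /dl; field.
have s1 : 1 <= Num.sqrt V%:R :> R by rewrite -[X in X <= _]sqrtr1 ler_sqrt ?ler1n.
have e1 : esum R q h V = \sum_(n < V) (n.+1%:R)^-1 * (wqf R q h n.+1 + 1) by rewrite /esum big_add1 big_mkord.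
have e2 : esum R q h V <= q%:R * (1 + 4 * (H * q%:R `^ dl * x)) * (\sum_(n < V) wt R (bstarf q h) n.+1 / n.+1%:R) + harm V.
 rewrite e1 mulr_sumr -big_split /=; apply: ler_sum => n _; rewrite mulrDr mulr1 lerD2r. have -> : (n.+1%:R)^-1 * wqf R q h n.+1 = q%:R * (1 + 4 * harm (q * n.+1)) * (wt R (bstarf q h) n.+1 / n.+1%:R).
  by rewrite /wqf; ring.
 rewrite ler_wpM2r ?divr_ge0 ?wt_ge0 // ler_wpM2l // lerD2l ler_pM2l //. by apply: hq; exact: ltn_ord.
apply: le_trans e2 _.
have w1 := wt_sum R V (bstar_gt0 q0 h0); rewrite -/tau in w1.
have hV0 := harm_ge0 R V.
have w2 : \sum_(n < V) wt R (bstarf q h) n.+1 / n.+1%:R <= Num.sqrt V%:R * tau * (H * x) ^+ 4.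
 apply: le_trans w1 _; rewrite ler_wpM2l ?mulr_ge0 ?sqrtr_ge0 //. by apply: lerXn2r; rewrite ?nnegrE // mulr_ge0.
have B1 : 1 + 4 * (H * q%:R `^ dl * x) <= (1 + 4 * (H * q%:R `^ dl)) * x.
 have -> : (1 + 4 * (H * q%:R `^ dl)) * x = x + 4 * (H * q%:R `^ dl * x) by ring. by rewrite lerD2r.
set S := Num.sqrt V%:R in s1 w2 *; have S0 : 0 <= S by lra.
have B2 : q%:R * (1 + 4 * (H * q%:R `^ dl * x)) * (\sum_(n < V) wt R (bstarf q h) n.+1 / n.+1%:R) <= q%:R * ((1 + 4 * (H * q%:R `^ dl)) * x) * (S * tau * (H * x) ^+ 4).
 apply: ler_pM => //.
 - by rewrite !mulr_ge0 // addr_ge0 // !mulr_ge0.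
 - by apply: sumr_ge0 => n; rewrite divr_ge0 ?wt_ge0.
 by rewrite ler_wpM2l.
have B3 : harm V <= H * (S * x ^+ 5).
 apply: le_trans hV _; rewrite ler_wpM2l //. have x4 : 1 <= x ^+ 4 by rewrite exprn_ege1. have : 1 * x <= (S * x ^+ 4) * x.
  by rewrite ler_wpM2r // -[1]mulr1; apply: ler_pM.
 by rewrite mul1r -mulrA -exprSr.
have -> : P * (S * x ^+ 5) = q%:R * ((1 + 4 * (H * q%:R `^ dl)) * x) * (S * tau * (H * x) ^+ 4) + H * (S * x ^+ 5).
 by rewrite /P; ring.
exact: lerD.
Qed.

Definition tends (u : nat -> R[i]) (l : R[i]) : Prop := forall eta : R, 0 < eta -> exists n0, forall n, (n0 <= n)%N -> normc (u n - l) <= eta.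

End Growth.

Section Asymptotic.
Variables (R : realType) (d : int) (g q : nat) (phi : int -> R[i]).
Hypotheses (og : odd g) (sg : squarefree g) (gd : (g%:Z %| d)%Z) (q0 : (0 < q)%N) (pphi : per q phi) (phi1 : forall x, normc (phi x) <= 1) (phig : forall x, phi x != 0 -> (g%:Z %| x)%Z) (d0 : d != 0).
Variables (h : int) (Mt : nat -> R[i]) (Kz Km : R) (L : R[i]).
Hypotheses (h0 : h != 0) (Kz0 : 0 <= Kz).
Hypothesis HM : forall N M V v, (N <= M)%N -> (M <= 2 * N)%N -> (0 < V)%N ->
 (`|d| * V ^ 2 <= N)%N -> (N < `|d| * V.+1 ^ 2)%N -> (0 < v <= V)%N ->
 normc (zpart d g phi h N M V 0 1 v + zpart d g phi (- h) N M V 1 0 v - ((M - N)%N%:R / v%:R ^+ 2)%:C * Mt v)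
 <= Kz * wqf R q h v.
Hypotheses (Km0 : 0 <= Km) (Mtb : forall v, (0 < v)%N -> normc (Mt v) <= Km * wqf R q h v) (HL : tends (msum Mt) L).

(** For v > V the weight v^-2 is at most v^-1 / V, which reduces the difference to [esum]. *)
Lemma msum_dyadic V W : (0 < V)%N -> (V <= W <= 2 * V)%N -> normc (msum Mt W - msum Mt V) <= Km / V%:R * esum R q h (2 * V).
Proof.
move=> V0 /andP[VW W2]; have Vr : 0 < V%:R :> R by rewrite ltr0n.
have -> : msum Mt W - msum Mt V = \sum_(V.+1 <= v < W.+1) ((v%:R ^+ 2)^-1)%:C * Mt v by rewrite /msum (@big_cat_nat _ _ _ V.+1) //= addrAC subrr add0r.
apply: le_trans (normc_sum _ _ _) _.
apply: le_trans (_ : \sum_(V.+1 <= v < W.+1) Km / V%:R * ((v%:R)^-1 * (wqf R q h v + 1)) <= _).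
 rewrite big_nat_cond [X in _ <= X]big_nat_cond; apply: ler_sum => v /andP[/andP[v1 v2] _]. have v0 : (0 < v)%N by lia. have vr : 0 < v%:R :> R by rewrite ltr0n. have w0 := wq_ge0 R q h v.
 rewrite normcM normc_real ger0_norm ?invr_ge0 ?exprn_ge0 //. apply: le_trans (_ : (v%:R ^+ 2)^-1 * (Km * wqf R q h v) <= _); first by rewrite ler_wpM2l ?invr_ge0 ?exprn_ge0 ?Mtb.
 have -> : (v%:R ^+ 2)^-1 * (Km * wqf R q h v) = Km * (v%:R^-1 * (v%:R^-1 * wqf R q h v)) by field; rewrite gt_eqF. rewrite -mulrA ler_wpM2l //; apply: ler_pM.
 - by rewrite invr_ge0 ler0n.
 - by apply: mulr_ge0; rewrite ?invr_ge0.
 - by rewrite lef_pV2 // ler_nat ltnW.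
 by rewrite ler_wpM2l ?invr_ge0 // lerDl.
rewrite -mulr_sumr ler_wpM2l ?divr_ge0 // /esum (@big_cat_nat _ _ _ V.+1 1 (2 * V).+1) //=; last by rewrite mul2n -addnn leq_addr.
rewrite (@big_cat_nat _ _ _ W.+1 V.+1 (2 * V).+1) //=.
have nn a b : 0 <= \sum_(a <= i < b) (i%:R)^-1 * (wqf R q h i + 1).
 by apply: sumr_ge0 => i; rewrite mulr_ge0 ?invr_ge0 // addr_ge0 // wq_ge0.
by rewrite addrCA lerDl addr_ge0.
Qed.

(** The dyadic differences are dominated by a geometric series of ratio 2^(e - 1/2); then the upper
    end tends to infinity. *)
Lemma msum_tail (e : R) : 0 < e -> e < 1 / 2 -> exists2 K : R, 0 <= K & forall V, (0 < V)%N -> normc (msum Mt V - L) <= K * V%:R `^ (e - 1 / 2).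
Proof.
move=> e0 e2; have [K K0 hK] := esum_pow q0 h0 e0.
pose a := 1 / 2 - e; have a0 : 0 < a by rewrite /a; lra.
pose K1 := Km * K * 2 `^ (1 / 2 + e); have K10 : 0 <= K1 by rewrite !mulr_ge0 ?powR_ge0.
have D1 V W : (0 < V)%N -> (V <= W <= 2 * V)%N -> normc (msum Mt W - msum Mt V) <= K1 * V%:R `^ (- a).
 move=> V0 VW; apply: le_trans (msum_dyadic V0 VW) _; have Vr : 0 < V%:R :> R by rewrite ltr0n. have V2 : (0 < 2 * V)%N by rewrite muln_gt0.
 apply: le_trans (_ : Km / V%:R * (K * (2 * V)%:R `^ (1 / 2 + e)) <= _).
  by rewrite ler_wpM2l ?hK // divr_ge0.
 rewrite natrM powRM //; have -> : - a = 1 / 2 + e + (- 1) by rewrite /a; lra. by rewrite [V%:R `^ (_ - 1)]powR_add // powR_inv1 // /K1 le_eqVlt; apply/orP; left; apply/eqP; ring.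
pose r : R := 2 `^ (- a).
have r1 : r < 1.
 rewrite /r /powR gt_eqF // expR_lt1 mulNr oppr_lt0 mulr_gt0 //; apply: ln_gt0; lra.
have r0 : 0 < r by exact: powR_gt0.
(* The solution of K' = K1 + K' r, which makes the induction on the number of doublings close. *)
pose K' := K1 / (1 - r); have K'0 : 0 <= K' by rewrite divr_ge0; lra.
have eK' : K' = K1 + K' * r by rewrite /K'; field; rewrite gt_eqF; lra.
have D2 n : forall V W, (0 < V)%N -> (V <= W)%N -> (W <= 2 ^ n * V)%N -> normc (msum Mt W - msum Mt V) <= K' * V%:R `^ (- a).
 elim: n => [|n IH] V W V0 VW Wn.
  have -> : W = V by apply/eqP; rewrite eqn_leq VW andbT -[V]mul1n. by rewrite subrr normc0 mulr_ge0 ?powR_ge0.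
 case: (leqP W (2 * V)) => W2.
  apply: le_trans (D1 V W V0 _) _; first by rewrite VW. by rewrite ler_wpM2r ?powR_ge0 // eK' lerDl mulr_ge0 // ltW.
 have -> : msum Mt W - msum Mt V = (msum Mt W - msum Mt (2 * V)) + (msum Mt (2 * V) - msum Mt V) by ring. apply: le_trans (le_normcD _ _) _; rewrite eK' mulrDl addrC; apply: lerD.
  by apply: D1 => //; rewrite leqnn leq_pmull.
 have -> : K' * r * V%:R `^ (- a) = K' * (2 * V)%N%:R `^ (- a) by rewrite natrM powRM // mulrA. by apply: IH; rewrite ?muln_gt0 ?(ltnW W2) // mulnA -expnSr.
exists K' => // V V0; have -> : e - 1 / 2 = - a by rewrite /a; ring.
apply/ler_addgt0Pr => eta eta0; have [n0 hn0] := HL eta0.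
pose W := maxn n0 V.
have -> : msum Mt V - L = - (msum Mt W - msum Mt V) + (msum Mt W - L) by ring.
apply: le_trans (le_normcD _ _) _; rewrite normcN; apply: lerD; last by apply: hn0; rewrite leq_maxl.
apply: (D2 W) => //; first by rewrite leq_maxr.
by apply: leq_trans (leq_pmulr _ V0); rewrite ltnW // ltn_expl.
Qed.

(** V is about sqrt(N / |d|). The error V esum V is O(V^(3/2 + e)), and replacing [msum V] by its
    limit costs O(N V^(e - 1/2)); both are O(N^(3/4 + e)). The condition 4 |d| <= N gives V > 1. *)
Lemma block_asymp (e : R) : 0 < e -> e < 1 / 2 -> exists2 K : R, 0 <= K & forall N M, (4 * `|d| <= N)%N -> (N <= M)%N -> (M <= 2 * N)%N ->
  normc (blocksum d g phi h N M - (M - N)%N%:R * L) <= K * N%:R `^ (3 / 4 + e).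
Proof.
move=> e0 e2; have [Ke Ke0 hKe] := esum_pow q0 h0 e0; have [Kt Kt0 hKt] := msum_tail e0 e2.
pose D := `|d|%N; have D0 : (0 < D)%N by rewrite /D absz_gt0.
pose a := 1 / 2 - e; have a0 : 0 < a by rewrite /a; lra.
pose Kb := 2 * cellK R d h + Kz; have Kb0 : 0 <= Kb by rewrite addr_ge0 // mulr_ge0 // cellK_ge0.
pose K2 := Kt * (4 * D%:R) `^ (a / 2).
have K20 : 0 <= K2 by rewrite mulr_ge0 ?powR_ge0.
exists (Kb * Ke + K2) => [|N M N4 NM M2]; first by rewrite addr_ge0 // mulr_ge0.
have [V [V1 V2]] := sqrt_scaled N D0.
have V3 : (1 < V)%N.
 rewrite ltnNge; apply/negP => V3; move: V2; rewrite ltnNge => /negP; apply. apply: leq_trans N4; rewrite [(4 * _)%N]mulnC leq_mul2l; apply/orP; right. by move: V3; clear; case: V => [|[|V]].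
have V0 : (0 < V)%N by apply: ltn_trans V3.
have Vr : 0 < V%:R :> R by rewrite ltr0n.
have N0 : (0 < N)%N by apply: leq_trans N4; rewrite muln_gt0.
have Nr : 0 < N%:R :> R by rewrite ltr0n.
have B1 := block_est og sg gd q0 pphi phi1 phig d0 h0 Kz0 HM NM M2 V3 V1 V2.
have VN : V%:R <= N%:R `^ (1 / 2) :> R.
 rewrite mul1r powR12_sqrt // -[X in X <= _]ger0_norm // -sqrtr_sqr ler_sqrt //. by rewrite -natrX ler_nat; apply: leq_trans V1; rewrite leq_pmull.
have B2 : V%:R * esum R q h V <= Ke * N%:R `^ (3 / 4 + e).
 apply: le_trans (_ : V%:R * (Ke * V%:R `^ (1 / 2 + e)) <= _); first by rewrite ler_pM2l ?hKe. rewrite mulrCA ler_wpM2l //. have -> : V%:R * V%:R `^ (1 / 2 + e) = V%:R `^ (3 / 2 + e).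
  by rewrite -{1}[V%:R](powRr1 (ltW Vr)) -powR_add //; congr (_ `^ _); lra.
 apply: le_trans (powR_mono (ltW Vr) VN _) _; first by lra. rewrite -powRrM; apply: ler_powR; first by rewrite ler1n. by lra.
have B3 : N%:R * normc (msum Mt V - L) <= K2 * N%:R `^ (3 / 4 + e).
 apply: le_trans (_ : N%:R * (Kt * V%:R `^ (- a)) <= _).
  rewrite ler_pM2l // (_ : - a = e - 1 / 2) ?hKt // /a; ring.
 have NV : N%:R <= 4 * D%:R * V%:R ^+ 2 :> R.
  rewrite -natrX -!natrM ler_nat; apply: ltnW; apply: leq_trans V2 _. rewrite [(4 * D)%N]mulnC -mulnA leq_mul2l; apply/orP; right. have k : (V.+1 <= 2 * V)%N by rewrite mul2n -addnn -addn1 leq_add2l.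
  by apply: leq_trans (leq_mul k k) _; rewrite mulnACA.
 have NV2 : N%:R `^ (a / 2) <= (4 * D%:R) `^ (a / 2) * V%:R `^ a.
  apply: le_trans (powR_mono (ltW Nr) NV _) _; first by lra. rewrite powRM ?mulr_ge0 // ler_wpM2l ?powR_ge0 // -powR_mulrn // -powRrM; apply: ler_powR; first by rewrite ler1n. by lra.
 have Va : 0 < V%:R `^ a by exact: powR_gt0. have NVi : V%:R `^ (- a) <= (4 * D%:R) `^ (a / 2) * N%:R `^ (- (a / 2)).
  rewrite !powRN ler_pdivlMr ?powR_gt0 // mulrC ler_pdivrMr //.
 rewrite mulrCA /K2 -mulrA ler_wpM2l //. apply: le_trans (_ : N%:R * ((4 * D%:R) `^ (a / 2) * N%:R `^ (- (a / 2))) <= _); first by rewrite ler_pM2l.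
 rewrite mulrCA ler_wpM2l ?powR_ge0 // -{1}[N%:R](powRr1 (ltW Nr)) -powR_add //. by apply: ler_powR; rewrite ?ler1n // /a; lra.
have -> : blocksum d g phi h N M - (M - N)%N%:R * L = (blocksum d g phi h N M - (M - N)%N%:R * msum Mt V) + (M - N)%N%:R * (msum Mt V - L) by ring.
apply: le_trans (le_normcD _ _) _; rewrite mulrDl; apply: lerD.
 by apply: le_trans B1 _; rewrite -/Kb -mulrA ler_wpM2l.
apply: le_trans B3; rewrite normcM normc_natr ler_wpM2r ?normc_ge0 // ler_nat.
by move: M2; clear; lia.
Qed.

Lemma blocksum_cat N M : (N <= M)%N -> blocksum d g phi h 0 M = blocksum d g phi h 0 N + blocksum d g phi h N M.
Proof. by move=> NM; rewrite /blocksum (@big_cat_nat _ _ _ N.+1). Qed.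

(** X is halved, rounding up, until it is small. From X <= 2 N and 3 N <= 2 X, each step shrinks X^s
    by r = (2 / 3)^s at least, and K3 is chosen so that (K3 + Kb) r <= K3. *)
Lemma blocksum_asymp (e : R) : 0 < e -> exists K : R, forall X, (0 < X)%N -> normc (blocksum d g phi h 0 X - X%:R * L) <= K * X%:R `^ (3 / 4 + e).
Proof.
move=> e0.
have [e1 [e10 e12 e1e]] : exists e1 : R, [/\ 0 < e1, e1 < 1 / 2 & e1 <= e].
 case: (ltrP e (1 / 2)) => e2; first by exists e. by exists (1 / 4); split; lra.
pose s : R := 3 / 4 + e1; have s0 : 0 < s by rewrite /s; lra.
have [Kb Kb0 hKb] := block_asymp e10 e12.
pose T X := blocksum d g phi h 0 X - X%:R * L.
pose X0 := (8 * `|d| + 3)%N; pose K4 := \sum_(X < X0) normc (T X).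
pose r : R := (2 / 3) `^ s.
have r23 : 0 < 2 / 3 :> R by lra.
have r0 : 0 < r by exact: powR_gt0.
have r1 : r < 1.
 by rewrite /r /powR gt_eqF // expR_lt1 pmulr_rlt0 //; apply: ln_lt0; lra.
pose K3 := K4 + Kb * r / (1 - r).
have K40 : 0 <= K4 by apply: sumr_ge0 => X _; exact: normc_ge0.
have Kq : 0 <= Kb * r / (1 - r) by rewrite divr_ge0 ?mulr_ge0; lra.
have K30 : 0 <= K3 by rewrite addr_ge0.
have main X : (0 < X)%N -> normc (T X) <= K3 * X%:R `^ s.
 elim/ltn_ind: X => X IH Xpos; case: (ltnP X X0) => hX.
  apply: le_trans (_ : K3 * 1 <= _); last by rewrite ler_wpM2l // powR_nat_ge1 // ltW. rewrite mulr1; apply: le_trans (_ : K4 <= _); last by rewrite lerDl.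
  rewrite /K4 (bigD1 (Ordinal hX)) //= lerDl; apply: sumr_ge0 => i _; exact: normc_ge0.
 pose N := uphalf X; have [N1 N2 N3] : [/\ (N < X)%N, (X <= 2 * N)%N & (4 * `|d| <= N)%N].
  by move: hX; rewrite /N /X0; clear; split; lia.
 have NX : (3 * N <= 2 * X)%N by move: hX; rewrite /N /X0; clear; lia. have N0 : (0 < N)%N by move: N2 Xpos; clear; lia. have Ns : N%:R `^ s <= r * X%:R `^ s.
  rewrite /r -powRM //; last by lra. apply: powR_mono; rewrite //; last by lra. have : (3 * N)%N%:R <= (2 * X)%N%:R :> R by rewrite ler_nat. by rewrite !natrM; lra.
 have -> : T X = T N + (blocksum d g phi h N X - (X - N)%N%:R * L).
  by rewrite /T (blocksum_cat (ltnW N1)) natrB ?(ltnW N1); ring.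
 apply: le_trans (le_normcD _ _) _. apply: le_trans (lerD (IH N N1 N0) (hKb N X N3 (ltnW N1) N2)) _.
 rewrite -mulrDl; apply: le_trans (_ : (K3 + Kb) * (r * X%:R `^ s) <= _); first by rewrite ler_wpM2l // addr_ge0. rewrite mulrA ler_wpM2r ?powR_ge0 //.
 have -> : (K3 + Kb) * r = K4 * r + Kb * r / (1 - r) by rewrite /K3; field; rewrite gt_eqF; lra. by rewrite /K3 lerD2r ler_piMr // ltW.
exists K3 => X X1; apply: le_trans (main X X1) _; rewrite ler_wpM2l //.
by apply: ler_powR; rewrite ?ler1n // /s; lra.
Qed.
End Asymptotic.

(** * From Salie sums to sums over blocks *)

Section Expand.
Variable R : realType.
Local Notation ee := (efrac R).
Local Notation eps := (eps_odd R).
Variables (D : nat) (chi : int -> R[i]) (m s : int) (l w : nat).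
Hypotheses (l0 : (0 < l)%N) (sl : squarefree l) (w0 : (0 < w)%N) (s1 : `|s|%N = 1%N).
Let nu : int := s * l%:Z.
Definition nu1 g : int := s * (l %/ g)%N%:Z.
Definition hh g e : int := - 2 * nu1 g * (w %/ e)%N%:Z.
(** All factors of the term c = g e k that depend periodically on k, including the conditions that c
    be odd and divisible by D. *)
Definition kappa g e k : R[i] := if odd k && (D %| g * (e * k))%N then (jacobi (- nu1 g) (e * k))%:~R * conjc (eps (e * k)) * eps g * conjc (eps (g * (e * k))) * chi (g * (e * k))%N%:Z else 0.
Definition coef g e : R[i] := (mu e)%:~R * (jacobi e%:Z g)%:~R.
Lemma sqf_dvd a b : (a %| b)%N -> squarefree b -> squarefree a.
Proof. by move=> ab sb d da; apply: sb; apply: dvdn_trans ab. Qed.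
Lemma sqf_coprime a b : squarefree (a * b) -> coprime a b.
Proof.
move=> sab; rewrite /coprime; apply/eqP; apply: sab.
by rewrite -mulnn; apply: dvdn_mul; [exact: dvdn_gcdl | exact: dvdn_gcdr].
Qed.

(** Only g = gcd(c, l) contributes. For any other g with c = g e k, the number l / g shares a prime
    with e k, and the symbol in [kappa] vanishes. *)
Lemma term_expand c N : (0 < c <= N)%N -> odd c -> (D %| c)%N -> salie R m (nu * w%:Z ^+ 2) c / (Num.sqrt c%:R)%:C * conjc (eps c) * chi c = \sum_(g <- divisors l | odd g) \sum_(e <- divisors w | odd e)
  coef g e * \sum_(1 <= k < N.+1 | (g * (e * k) == c)%N) kappa g e k * rootsum R nu m (hh g e) g k.
Proof.
move=> /andP[c0 cN] oc Dc; set G := gcdn c l.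
have G0 : (0 < G)%N by rewrite gcdn_gt0 c0.
have Gl : (G %| l)%N := dvdn_gcdr _ _; have Gc : (G %| c)%N := dvdn_gcdl _ _.
have oG : odd G := dvdn_odd Gc oc.
have sG : squarefree G := sqf_dvd Gl sl.
pose c' := (c %/ G)%N; have ec : c = (G * c')%N by rewrite mulnC divnK.
have oc' : odd c' by apply: dvdn_odd oc; rewrite ec dvdn_mull.
have c'0 := odd_gt0 oc'.
have eG : (nu1 G * G = nu) by rewrite /nu1 /nu -mulrA -PoszM divnK.
have cpl g : (g %| l)%N -> `|nu1 g|%N = (l %/ g)%N by rewrite /nu1 abszM s1 mul1n.
have cpG : coprimez (nu1 G) (G * c')%N.
 rewrite coprimezE cpl //= coprimeMr; apply/andP; split.
  by apply: sqf_coprime; rewrite divnK.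
 by rewrite /coprime -(eqn_pmul2r G0) mul1n muln_gcdl divnK // mulnC -ec gcdnC.
rewrite big_mkcond (bigD1_seq G) ?divisors_uniq -?dvdn_divisors //= oG [X in _ + X]big1_seq ?addr0; last first.
 move=> g /andP[gG]; rewrite -dvdn_divisors // => gl; case: ifP => // og. apply: big1 => e oe; rewrite big1 ?mulr0 // => k /eqP egk. rewrite /kappa; case: ifP; rewrite ?mul0r // => /andP[ok _].
 have ek0 : (0 < e * k)%N by case: (e * k)%N egk c0 => // <-; rewrite muln0. rewrite jacobi_0 ?mul0r // coprimezE abszN cpl //=; apply: contra gG => cp.
 rewrite eq_sym /G -egk -(divnK gl) [(l %/ g * g)%N]mulnC -muln_gcdr gcdnC (eqP cp) muln1 //.
have salieE : salie R m (nu * w%:Z ^+ 2) c / (Num.sqrt c%:R)%:C * conjc (eps c) = (jacobi (- nu1 G) c')%:~R * conjc (eps c') * eps G * conjc (eps c) *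
 \sum_(e <- divisors c' | (e %| w%:Z)%Z) (mu e)%:~R * (jacobi e G)%:~R * rootsum R nu m (- 2 * nu1 G * (w %/ e)%Z) G (c' %/ e). have := @salie_formula R m (nu1 G) w G c' oG sG oc' cpG. by rewrite -ec eG.
rewrite salieE mulrAC mulr_sumr.
have dz (e : nat) : (w %/ e)%Z = (w %/ e)%N by rewrite divz_nat.
under [LHS]eq_bigr => e _ do rewrite dz.
rewrite [LHS](_ : _ = \sum_(e <- divisors w | (e %| c')%N) (jacobi (- nu1 G) c')%:~R * conjc (eps c') * eps G * conjc (eps c) * chi c *
  ((mu e)%:~R * (jacobi e G)%:~R * rootsum R nu m (hh G e) G (c' %/ e))); last first.
 rewrite -big_filter -[RHS]big_filter; apply: perm_big; apply: uniq_perm; rewrite ?filter_uniq ?divisors_uniq //. by move=> e; rewrite !mem_filter -!dvdn_divisors // andbC.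
rewrite big_mkcond [RHS]big_mkcond; apply: eq_big_seq => e; rewrite -dvdn_divisors // => ew.
have e0 : (0 < e)%N := dvdn_gt0 w0 ew.
case: (boolP (e %| c')%N) => ec'; last first.
 case: ifP => // oe; rewrite big1 ?mulr0 // => k /eqP ek; case/negP: ec'. move: ek; rewrite ec => /eqP; rewrite eqn_pmul2l // => /eqP <-; exact: dvdn_mulr.
rewrite (dvdn_odd ec' oc').
have e1 : (e * (c' %/ e) = c')%N by rewrite mulnC divnK.
have k0 : (0 < c' %/ e)%N by rewrite divn_gt0 dvdn_leq.
rewrite big_mkcond (bigD1_seq (c' %/ e)%N) ?iota_uniq //=; last first.
 rewrite mem_index_iota k0 ltnS (leq_trans (leq_div _ _)) // (leq_trans _ cN) // dvdn_leq // ec dvdn_mull //.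
rewrite e1 -ec eqxx big1 ?addr0; last first.
 move=> k nk; case: ifP => // /eqP ek; case/eqP: nk. by move: ek; rewrite ec => /eqP; rewrite eqn_pmul2l // => /eqP <-; rewrite mulKn.
rewrite /kappa e1 -ec Dc (dvdn_odd (dvdn_div ec') oc') /= /coef; ring.
Qed.

End Expand.

Section Character.
Variables (R : realType) (f : nat) (chi : int -> R[i]).
Hypotheses (f0 : (0 < f)%N) (chid : dirichlet_character f chi).

Lemma chi_per : per f chi.
Proof.
have [p _ _] := chid.
have pn x (n : nat) : chi (x + f%:Z * n) = chi x.
 elim: n => [|n IH]; first by rewrite mulr0 addr0. by rewrite -addn1 PoszD mulrDr mulr1 addrA p.
move=> x k; case: (intP k) => [|n|n]; first by rewrite mulr0 addr0.
 exact: pn.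
by rewrite -(pn (x + f%:Z * - n.+1%:Z) n.+1); congr chi; ring.
Qed.

Lemma chi_1 : chi 1 = 1.
Proof.
have [_ M nz] := chid; have := M 1 1; rewrite mulr1 => /eqP; rewrite -subr_eq0 -{1}[chi 1]mulr1 -mulrBr mulf_eq0.
have -> : (chi 1 == 0) = false by apply/negbTE; rewrite nz coprimezE coprime1n.
by rewrite subr_eq0 => /eqP.
Qed.

Lemma chi_X a n : chi (a ^+ n) = chi a ^+ n.
Proof. by have [_ M _] := chid; elim: n => [|n IH]; rewrite ?chi_1 // !exprS M IH. Qed.
(** By Euler's theorem the value at a unit is a root of unity. *)
Lemma chi_le1 a : normc (chi a) <= 1.
Proof.
have [_ M nz] := chid; case: (boolP (coprimez a f)) => cp; last first.
 by have := nz a; rewrite (negbTE cp) => /negbFE/eqP ->; rewrite normc0.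
have [r [k [rf ea]]] := int_ediv a f0.
have cr : coprime r f by move: cp; rewrite ea copz_per.
have er : chi a = chi r by rewrite ea chi_per.
have e1 : chi r ^+ totient f = 1.
 rewrite -chi_X -chi_1; apply: (per_eqm chi_per). rewrite -eqz_mod_dvd; have h := cyclic.Euler_exp_totient cr. have -> : r%:Z ^+ totient f = (r ^ totient f)%N by rewrite -[RHS]natz natrX natz.
 by rewrite !modz_nat h.
have : normc (chi r) ^+ totient f = 1.
 have nX z n : normc (z ^+ n) = normc z ^+ n :> R.
  by elim: n => [|n IH]; rewrite ?normc1 // !exprS normcM IH.
 by rewrite -nX e1 normc1.
by rewrite er => /eqP; rewrite pexpr_eq1 ?normc_ge0 ?totient_gt0 // => /eqP ->.
Qed.
End Character.

Section Blocks.
Variable R : realType.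
Local Notation ee := (efrac R).
Local Notation eps := (eps_odd R).
Variables (D f : nat) (chi : int -> R[i]) (m s : int) (l w : nat).
Hypotheses (D0 : (0 < D)%N) (f0 : (0 < f)%N) (chid : dirichlet_character f chi) (l0 : (0 < l)%N) (sl : squarefree l) (w0 : (0 < w)%N) (s1 : `|s|%N = 1%N).
Local Notation kap := (kappa D chi s l).
Let nu : int := s * l%:Z.
Let d : int := nu * m.
(** A common period for the symbols with numerator dividing l, the eps factors, the condition D | c,
    and chi. *)
Definition q0 : nat := 8 * l * D * f.
(** [kappa] transported to the multiples of l, since the roots will be taken modulo l k; reducing
    the quotient modulo [q0] defines it at every integer. *)
Definition phi g e (x : int) : R[i] := if (l%:Z %| x)%Z then kap g e (absz (modz (divz x l%:Z) q0%:Z)) else 0.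
Lemma q0_gt0 : (0 < q0)%N. Proof. by rewrite /q0 !muln_gt0 l0 D0. Qed.
Lemma nu1_abs g : `|nu1 s l g|%N = (l %/ g)%N.
Proof. by rewrite /nu1 abszM s1 mul1n. Qed.
Lemma eps_mod c c' : (c = c' %[mod 4]) -> eps c = eps c'.
Proof. by rewrite /eps_odd => ->. Qed.
Lemma kap_mod g e k k' : (g %| l)%N -> odd e -> (k = k' %[mod q0]) -> kap g e k = kap g e k'.
Proof.
move=> gl oe kk; have g0 := dvdn_gt0 l0 gl.
have kd r : (r %| q0)%N -> (k = k' %[mod r]).
 by move=> rq; rewrite -(modn_dvdm k rq) kk modn_dvdm.
have od : odd k = odd k'.
 have : (k = k' %[mod 2]) by apply: kd; rewrite /q0 -!mulnA dvdn_mulr. by rewrite !modn2 => /eqP; case: odd; case: odd.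
have Dd : (D %| g * (e * k))%N = (D %| g * (e * k'))%N.
 have h : (k = k' %[mod D]) by apply: kd; rewrite /q0 mulnAC dvdn_mull. by rewrite /dvdn -modnMmr -[in RHS]modnMmr -(modnMmr e) -(modnMmr e k') h.
have k4 a : (a * k = a * k' %[mod 4]).
 rewrite -modnMmr -[RHS]modnMmr; congr (_ * _ %% _)%N. by apply: kd; rewrite /q0 -!mulnA dvdn_mulr.
rewrite /kappa od Dd; case: ifP => // /andP[ok' _].
have ok : odd k by rewrite od.
congr (_%:~R * conjc _ * _ * conjc _ * _).
- apply: jacobi_per; rewrite ?oddM ?oe //.
  by rewrite oppr_eq0 -absz_eq0 nu1_abs -lt0n divn_gt0 dvdn_leq.
 rewrite abszN nu1_abs -eqz_mod_dvd !PoszM !modz_nat eqz_nat -modnMmr -(modnMmr e k'). have -> // : (k = k' %[mod 8 * (l %/ g)]). by apply: kd; rewrite /q0 -!mulnA dvdn_mul // dvdn_mulr // dvdn_div.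
- by apply: eps_mod; exact: k4.
- by apply: eps_mod; rewrite !mulnA; exact: k4.
apply: (per_eqm (chi_per chid)).
rewrite -eqz_mod_dvd !modz_nat eqz_nat !mulnA -(modnMmr (g * e)) -(modnMmr (g * e) k').
by have -> : (k = k' %[mod f]) by apply: kd; rewrite /q0 dvdn_mull.
Qed.

Lemma kap_le1 g e k : normc (kap g e k) <= 1.
Proof.
rewrite /kappa; case: ifP => _; last by rewrite normc0.
rewrite !normcM !normc_conj !normc_eps !mulr1 -[X in _ <= X]mulr1; apply: ler_pM; rewrite ?normc_ge0 //.
 by rewrite normc_nat -intr_norm lerz1 jacobi_abs.
exact: chi_le1 f0 chid _.
Qed.

Lemma phi_le1 g e x : normc (phi g e x) <= 1.
Proof. by rewrite /phi; case: ifP => _; rewrite ?normc0 // kap_le1. Qed.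
Lemma phi_per g e : per (l * q0) (phi g e).
Proof.
move=> x k; rewrite /phi PoszM -mulrA rpredDr ?dvdz_mulr //; case: ifP => // _.
rewrite addrC mulrC divzMDl; last by rewrite -lt0n.
by rewrite mulrC modzMDl.
Qed.

Lemma phi_supp g e x : (g %| l)%N -> phi g e x != 0 -> (g %| x)%Z.
Proof.
rewrite /phi => gl; case: ifP => [h _|_]; last by rewrite eqxx.
by apply: dvdz_trans h; rewrite dvdzE.
Qed.

Lemma phi_mul g e k : (g %| l)%N -> odd e -> phi g e (l * k)%N = kap g e k.
Proof.
move=> gl oe; rewrite /phi PoszM dvdz_mulr // mulrC mulzK; last by rewrite -lt0n.
by rewrite modz_nat; apply: kap_mod => //; rewrite modn_mod.
Qed.

Lemma sqf_dvd_sq (y : int) : (l %| y ^+ 2)%Z -> (l %| y)%Z.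
Proof.
rewrite !dvdzE abszX /= => h; case: (posnP `|y|) => [->|y0]; first by [].
apply: dvdn_logn => // p pp; have l1 := sqf_logn l0 pp sl.
case: (posnP (logn p l)) => [-> //|lp].
have : (p %| `|y| ^ 2)%N by apply: dvdn_trans h; move: lp; rewrite logn_gt0 mem_primes => /and3P[].
rewrite Euclid_dvdX // andbT => py; apply: leq_trans l1 _.
by rewrite logn_gt0 mem_primes pp y0.
Qed.

(** Multiplied by s l, the congruence nu y^2 = m modulo k becomes Y^2 = d modulo l k with Y = l y,
    as s^2 = 1. Every root Y is divisible by l, because l is square-free and divides d. *)
Lemma rootsum_blocks h g k : (0 < k)%N -> odd g ->  rootsum R nu m h g k = (jacobi (- s) g)%:~R * \sum_(y < l * k | ((l * k)%N %| y%:Z ^+ 2 - d)%Z)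
   (jacobi ((y%:Z ^+ 2 - d) %/ (l * k)%N)%Z g)%:~R * ee (l * k) (h * y).
Proof.
move=> k0 og; have g0 := odd_gt0 og.
have ss : s * s = 1 by move: s1; lia.
have lk0 : (l * k)%N%:Z != 0 by rewrite -lt0n muln_gt0 l0.
pose F (x : int) := if ((l * k)%N %| x ^+ 2 - d)%Z then (jacobi ((x ^+ 2 - d) %/ (l * k)%N)%Z g)%:~R * ee (l * k) (h * x) else 0.
have -> : \sum_(y < l * k | ((l * k)%N %| y%:Z ^+ 2 - d)%Z) (jacobi ((y%:Z ^+ 2 - d) %/ (l * k)%N)%Z g)%:~R * ee (l * k) (h * y) = \sum_(y < l * k | (l %| y)%N) F y.
 rewrite big_mkcond [RHS]big_mkcond; apply: eq_bigr => y _; rewrite /F; case: ifP => h1; last by rewrite if_same. have -> // : (l %| y)%N. rewrite -[(l %| y)%N]/((l %| y%:Z)%Z); apply: sqf_dvd_sq.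
 rewrite -(subrK d (y%:Z ^+ 2)) rpredD //; last by rewrite /d /nu mulrAC dvdz_mull. by apply: dvdz_trans h1; rewrite PoszM dvdz_mulr.
rewrite sum_multiples // mulr_sumr /rootsum big_mkcond; apply: eq_bigr => y _; rewrite /F.
have e1 : (l%:Z * y) ^+ 2 - d = - s * (m - nu * y%:Z ^+ 2) * l.
 rewrite /d /nu mulrBr mulrBl; have -> : - s * (s * l * y%:Z ^+ 2) = - (s * s) * l * y%:Z ^+ 2 by ring. by rewrite ss; ring.
have -> : ((l * k)%N %| (l%:Z * y) ^+ 2 - d)%Z = (k %| m - nu * y%:Z ^+ 2)%Z.
 rewrite e1 mulnC PoszM dvdzE !abszM dvdn_pmul2r // -!abszM -dvdzE mulNr rpredN; apply/idP/idP => hk; last by rewrite dvdz_mull. by rewrite -[_ - _]mul1r -ss -mulrA dvdz_mull.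
case: ifP => hk; last by rewrite mulr0.
have -> : (((l%:Z * y) ^+ 2 - d) %/ (l * k)%N)%Z = - s * ((m - nu * y%:Z ^+ 2) %/ k)%Z.
 rewrite e1; have {1}-> : m - nu * y%:Z ^+ 2 = ((m - nu * y%:Z ^+ 2) %/ k)%Z * k by rewrite divzK. have -> : - s * (((m - nu * y%:Z ^+ 2) %/ k)%Z * k) * l = - s * ((m - nu * y%:Z ^+ 2) %/ k)%Z * (l * k)%N.
  by rewrite PoszM; ring.
 by rewrite mulzK.
rewrite jacobiMl // rmorphM !mulrA -rmorphM.
have -> : jacobi (- s) g * jacobi (- s) g = 1.
 by rewrite -expr2 jacobi_sq // coprimezE abszN s1; exact: coprime1n.
by rewrite -(ee_scale R k _ l0); congr (_ * ee _ _); ring.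
Qed.

Lemma blocksum_phi h g e Y : (g %| l)%N -> odd e -> odd g -> blocksum d g (phi g e) h 0 (l * Y) * (jacobi (- s) g)%:~R = \sum_(1 <= k < Y.+1) kap g e k * rootsum R nu m h g k.
Proof.
move=> gl oe og.
pose G c := \sum_(y < c | (c %| y%:Z ^+ 2 - d)%Z) rterm d g (phi g e) h c y.
have -> : blocksum d g (phi g e) h 0 (l * Y) = \sum_(1 <= k < Y.+1) G (l * k)%N.
 rewrite /blocksum (bigID (fun c => (l %| c)%N)) /= [X in _ + X]big1 ?addr0; last first.
  move=> c lc; apply: big1 => y _; rewrite /rterm /jterm /phi dvdzE (negbTE lc) !mul0r //.
 apply: (@sum_bij _ _ _ (index_iota 1 (l * Y).+1) (index_iota 1 Y.+1) (fun c => (l %| c)%N) xpredT (fun c => c %/ l)%N (fun k => l * k)%N); rewrite ?iota_uniq //.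
  move=> c; rewrite !mem_index_iota ltnS => /andP[c1 c2] lc; split => //; last by rewrite mulnC divnK. by rewrite divn_gt0 dvdn_leq //= ltnS leq_divLR // mulnC.
 move=> k; rewrite !mem_index_iota !ltnS => /andP[k1 k2] _; split; rewrite ?dvdn_mulr ?mulKn //. by rewrite muln_gt0 l0 k1 leq_mul2l k2 orbT.
rewrite mulr_suml big_nat_cond [RHS]big_nat_cond; apply: eq_bigr => k /andP[/andP[k0 _] _].
rewrite rootsum_blocks // mulrC mulrCA; congr (_ * _); rewrite /G mulr_sumr; apply: eq_bigr => y _.
by rewrite /rterm /jterm phi_mul // mulrA.
Qed.

Lemma salie_blocks n0 : \sum_(1 <= c < n0.+1 | odd c && (D %| c)%N) salie R m (nu * w%:Z ^+ 2) c / (Num.sqrt c%:R)%:C * conjc (eps c) * chi c = \sum_(g <- divisors l | odd g) \sum_(e <- divisors w | odd e)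
  coef R g e * (jacobi (- s) g)%:~R * blocksum d g (phi g e) (hh s l w g e) 0 (l * (n0 %/ (g * e))).
Proof.
transitivity (\sum_(1 <= c < n0.+1) \sum_(g <- divisors l | odd g) \sum_(e <- divisors w | odd e) coef R g e * \sum_(1 <= k < n0.+1 | (g * (e * k) == c)%N) kap g e k * rootsum R nu m (hh s l w g e) g k).
 rewrite big_mkcond; apply: eq_big_nat => c /andP[c1 c2]; case: ifP => [/andP[oc Dc]|h].
  by apply: term_expand => //; rewrite c1.
 symmetry; apply: big1 => g og; apply: big1 => e oe; rewrite big1 ?mulr0 // => k /eqP ek. rewrite /kappa; case: ifP; rewrite ?mul0r // => /andP[ok Dk]; move: h. by rewrite -ek Dk !oddM og oe ok.
rewrite exchange_big /=; rewrite big_seq_cond [RHS]big_seq_cond; apply: eq_bigr => g /andP[gl og].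
rewrite -dvdn_divisors // in gl; have g0 := dvdn_gt0 l0 gl.
rewrite exchange_big /=; rewrite big_seq_cond [RHS]big_seq_cond; apply: eq_bigr => e /andP[ew oe].
rewrite -dvdn_divisors // in ew; have e0 := dvdn_gt0 w0 ew.
rewrite -mulr_sumr -mulrA; congr (_ * _); rewrite mulrC blocksum_phi //.
have ge0 : (0 < g * e)%N by rewrite muln_gt0 g0.
rewrite (exchange_big_dep xpredT) //=.
transitivity (\sum_(1 <= k < n0.+1) if (k <= n0 %/ (g * e))%N then kap g e k * rootsum R nu m (hh s l w g e) g k else 0).
 apply: eq_big_nat => k /andP[k1 k2]; rewrite big_mkcond /=. case: ifP => hk.
  rewrite (bigD1_seq (g * (e * k))%N) ?iota_uniq //=; last first.
   by rewrite mem_index_iota !muln_gt0 g0 e0 k1 ltnS mulnA mulnC -leq_divRL.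
  rewrite eqxx big1 ?addr0 // => c nc; case: ifP => // /eqP ec. by rewrite ec eqxx in nc.
 rewrite big_seq big1 // => c; rewrite mem_index_iota ltnS => /andP[_ cn]; case: ifP => // /eqP ec. by move: hk; rewrite leq_divRL // mulnC -mulnA ec cn.
rewrite (@big_cat_nat _ _ _ (n0 %/ (g * e)).+1) //=; last by rewrite ltnS leq_div.
rewrite [X in _ + X]big_nat_cond [X in _ + X]big1 ?addr0; last first.
 by move=> k /andP[/andP[k1 _] _]; rewrite leqNgt k1.
by apply: eq_big_nat => k /andP[_]; rewrite ltnS => ->.
Qed.
End Blocks.

(** * Limits, and assembly of the asymptotic formula *)

Section Limits.
Variable R : realType.

Lemma tends_ext (u v : nat -> R[i]) L : u =1 v -> tends u L -> tends v L.
Proof. by move=> uv H eta /H[n0 h]; exists n0 => n /h; rewrite uv. Qed.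
Lemma tends_const (u : nat -> R[i]) L : (forall n, u n = L) -> tends u L.
Proof. by move=> uL eta e0; exists 0 => n; rewrite uL subrr normc0 ltW. Qed.
Lemma tendsD (u v : nat -> R[i]) L M : tends u L -> tends v M -> tends (fun n => u n + v n) (L + M).
Proof.
move=> hu hv eta e0; have e2 : 0 < eta / 2 by rewrite divr_gt0.
have [n1 h1] := hu _ e2; have [n2 h2] := hv _ e2; exists (maxn n1 n2) => n; rewrite geq_max => /andP[nn1 nn2].
have -> : u n + v n - (L + M) = (u n - L) + (v n - M) by ring.
by apply: le_trans (le_normcD _ _) _; move: (h1 _ nn1) (h2 _ nn2); lra.
Qed.

Lemma tendsZ (a : R[i]) (u : nat -> R[i]) L : tends u L -> tends (fun n => a * u n) (a * L).
Proof.
move=> hu eta e0; have a1 : 0 < normc a + 1 by rewrite ltr_wpDl // normc_ge0.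
have [n1 h1] := hu _ (divr_gt0 e0 a1); exists n1 => n /h1.
rewrite ler_pdivlMr // => hn; rewrite -mulrBr normcM.
by apply: le_trans hn; rewrite mulrC; apply: ler_wpM2l; rewrite ?normc_ge0 // lerDl.
Qed.

Lemma tends_sum (I : eqType) (r : seq I) (P : pred I) (u : I -> nat -> R[i]) (L : I -> R[i]) :
 (forall x, x \in r -> P x -> tends (u x) (L x)) -> tends (fun n => \sum_(x <- r | P x) u x n) (\sum_(x <- r | P x) L x).
Proof.
elim: r => [|x r IH] H; first by apply: tends_const => n; rewrite !big_nil.
apply: (@tends_ext (fun n => (if P x then u x n else 0) + \sum_(x <- r | P x) u x n)).
 by move=> n; rewrite big_cons; case: (P x); rewrite ?add0r.
have -> : \sum_(x <- x :: r | P x) L x = (if P x then L x else 0) + \sum_(x <- r | P x) L x.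
 by rewrite big_cons; case: (P x); rewrite ?add0r.
apply: tendsD; last by apply: IH => y yr; apply: H; rewrite in_cons yr orbT.
case: (boolP (P x)) => px; last exact: tends_const.
by apply: H; rewrite ?mem_head.
Qed.

Definition asym (s : R) (F : R -> R[i]) (c : R[i]) : Prop := exists K, forall X, 1 <= X -> normc (F X - X%:C * c) <= K * X `^ s.

Lemma asym_scale s F c a : asym s F c -> asym s (fun X => a * F X) (a * c).
Proof.
move=> [K h]; exists (normc a * K) => X X1; rewrite mulrCA -mulrBr normcM -mulrA.
by apply: ler_wpM2l (h _ X1); exact: normc_ge0.
Qed.

Lemma asym_sum s (I : eqType) (r : seq I) (P : pred I) (F : I -> R -> R[i]) (c : I -> R[i]) : (forall x, x \in r -> P x -> asym s (F x) (c x)) ->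
 asym s (fun X => \sum_(x <- r | P x) F x X) (\sum_(x <- r | P x) c x).
Proof.
elim: r => [|x r IH] H.
 by exists 0 => X; rewrite !big_nil mulr0 subr0 normc0 mul0r.
have [K hK] : asym s (fun X => \sum_(x <- r | P x) F x X) (\sum_(x <- r | P x) c x).
 by apply: IH => y yr; apply: H; rewrite in_cons yr orbT.
case: (boolP (P x)) => px; last by exists K => X X1; rewrite !big_cons (negbTE px) hK.
have [K' hK'] := H _ (mem_head _ _) px; exists (K' + K) => X X1; rewrite !big_cons px.
rewrite mulrDr opprD addrACA mulrDl; apply: le_trans (le_normcD _ _) _.
by apply: lerD; [exact: hK' | exact: hK].
Qed.
End Limits.

Section BlockLimit.
Variables (R : realType) (d : int) (g q : nat) (phi : int -> R[i]).
Hypotheses (og : odd g) (sg : squarefree g) (gd : (g%:Z %| d)%Z) (q0 : (0 < q)%N) (gq : (g %| q)%N) (pphi : per q phi) (phi1 : forall x, normc (phi x) <= 1) (phig : forall x, phi x != 0 -> (g%:Z %| x)%Z) (d0 : d != 0).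
Variables (h : int) (L : R[i]).
Hypothesis h0 : h != 0.

(** One term for the cells with v < v', one for the reflected cells, where h changes sign. *)
Definition mpair d1 v : R[i] := mterm d1 g q phi h v + mterm d1 g q phi (- h) v.
Lemma wq_opp v : wqf R q (- h) v = wqf R q h v.
Proof. by rewrite /wqf /bstarf abszN. Qed.

Lemma zpart_nonsq h' N M V al be v : (forall d1, (0 < d1)%N -> d != (d1 ^ 2)%N) -> zpart d g phi h' N M V al be v = 0.
Proof.
move=> nsq; rewrite /zpart big1 // => v'; rewrite big1 // => B; rewrite big1 // => C _.
rewrite /cellQ mul0r subr0.
case: (boolP (B ^+ 2 == d)) => //= /eqP e; exfalso.
have e2 : d = (`|B| ^ 2)%N by rewrite -natz natrX natz real_normK ?num_real.
have : (0 < `|B|)%N by rewrite absz_gt0; apply: contra_neq d0 => B0; rewrite -e B0.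
by move=> /nsq; rewrite -e2 eqxx.
Qed.

(** A = 0 forces B^2 = d, so the main term is absent unless d is a square. *)
Lemma block_limit : (forall d1, (0 < d1)%N -> d = (d1 ^ 2)%N -> tends (msum (mpair d1)) L) -> ((forall d1, (0 < d1)%N -> d != (d1 ^ 2)%N) -> L = 0) -> forall e : R, 0 < e -> exists K : R, forall X, (0 < X)%N ->
  normc (blocksum d g phi h 0 X - X%:R * L) <= K * X%:R `^ (3 / 4 + e).
Proof.
move=> Hsq Hns e e0.
case: (boolP [exists x : 'I_(`|d|).+1, (0 < x)%N && (d == (x ^ 2)%N)]) => [/existsP[d1 /andP[d10 /eqP ed]]|/existsPn nsq].
 move: (nat_of_ord d1) d10 ed => {}d1 d10 ed. have gd1 : (g %| d1)%N.
  have g0 := odd_gt0 og. rewrite -[(g %| d1)%N]/((g %| d1%:Z)%Z); apply: sqf_dvd_sq => //. by rewrite -[_ ^+ 2]/(d1%:Z * d1) -PoszM -ed.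
 have HM v V N M : (N <= M)%N -> (M <= 2 * N)%N -> (0 < V)%N -> (`|d| * V ^ 2 <= N)%N -> (N < `|d| * V.+1 ^ 2)%N -> (0 < v <= V)%N ->
 normc (zpart d g phi h N M V 0 1 v + zpart d g phi (- h) N M V 1 0 v - ((M - N)%N%:R / v%:R ^+ 2)%:C * mpair d1 v) <= (2 * (14 * d1 ^ 2 + 2 * q + 4)%N%:R) * wqf R q h v.
  rewrite ed => a1 a2 a3 a4 a5 a6; rewrite /mpair mulrDr opprD addrACA; apply: le_trans (le_normcD _ _) _. have h0' : - h != 0 by rewrite oppr_eq0.
  have := zpart_sq og sg gd1 gq q0 h0 pphi phi1 d10 a1 a2 a3 a4 a5 (lexx 0) ler01 (lexx 1) a6. have := zpart_sq og sg gd1 gq q0 h0' pphi phi1 d10 a1 a2 a3 a4 a5 ler01 (lexx 1) ler01 a6.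
  by rewrite wq_opp => b1 b2; rewrite -mulrA [2 * _]mulr_natl; apply: lerD.
 have HB v : (0 < v)%N -> normc (mpair d1 v) <= 2 * wqf R q h v.
  move=> v0; apply: le_trans (le_normcD _ _) _. rewrite mulr_natl mulr2n; apply: lerD; last rewrite -wq_opp; exact: mterm_bound.
 by apply: (blocksum_asymp og sg gd q0 pphi phi1 phig d0 h0 _ (fun N M V v => HM v V N M) _ HB (Hsq _ d10 ed) e0) => //; rewrite mulr_ge0.
have nsq' d1 : (0 < d1)%N -> d != (d1 ^ 2)%N.
 move=> d10; apply/eqP => ed; have d1d : (d1 < (`|d|).+1)%N by rewrite ltnS ed leq_pmulr. by have := nsq (Ordinal d1d); rewrite /= d10 ed eqxx.
apply: (@blocksum_asymp R d g q phi og sg gd q0 pphi phi1 phig d0 h (fun=> 0) 0 0 L h0) => //.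
- by move=> N M V v; rewrite !zpart_nonsq // mulr0 subr0 addr0 normc0 mul0r.
- by move=> v; rewrite normc0 mul0r.
by apply: tends_const => n; rewrite Hns // /msum big1 // => v; rewrite mulr0.
Qed.
End BlockLimit.

Section Assembly.
Variables (R : realType) (D f : nat) (chi : int -> R[i]) (m s : int) (l w : nat).
Hypotheses (D0 : (0 < D)%N) (f0 : (0 < f)%N) (chid : dirichlet_character f chi) (l0 : (0 < l)%N) (sl : squarefree l) (w0 : (0 < w)%N) (s1 : `|s|%N = 1%N) (m0 : m != 0).
Let d : int := s * l%:Z * m.
Let q := (l * q0 D f l)%N.
Lemma d_neq0 : d != 0.
Proof.
by rewrite /d mulf_neq0 // mulf_neq0 // -?absz_eq0 ?s1 -lt0n.
Qed.

Lemma hh_neq0 g e : (g %| l)%N -> (e %| w)%N -> hh s l w g e != 0.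
Proof.
move=> gl ew; have g0 := dvdn_gt0 l0 gl; have e0 := dvdn_gt0 w0 ew.
have lg : (0 < l %/ g)%N by rewrite divn_gt0 dvdn_leq.
have we : (0 < w %/ e)%N by rewrite divn_gt0 dvdn_leq.
by rewrite -absz_eq0 /hh /nu1 !abszM s1 !muln_eq0 negb_or -!lt0n lg.
Qed.

(** The block sum for (g, e) extends to l floor(X / (g e)), whence the factor l / (g e). *)
Definition lead_const (L : nat -> nat -> R[i]) : R[i] := \sum_(g <- divisors l | odd g) \sum_(e <- divisors w | odd e) coef R g e * (jacobi (- s) g)%:~R * ((l%:R / (g * e)%:R)%:C * L g e).

Lemma salie_asym (L : nat -> nat -> R[i]) : (forall g e, (g %| l)%N -> odd g -> (e %| w)%N -> odd e -> coef R g e != 0 -> (forall d1, (0 < d1)%N -> d = (d1 ^ 2)%N ->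
    tends (msum (mpair g q (phi D f chi s l g e) (hh s l w g e) d1)) (L g e)) /\
  ((forall d1, (0 < d1)%N -> d != (d1 ^ 2)%N) -> L g e = 0)) ->
 forall e : R, 0 < e -> asym (3 / 4 + e) (salie_sum D chi m (s * l * w%:Z ^+ 2)) (lead_const L).
Proof.
move=> HL eps eps0; set r := 3 / 4 + eps; have r0 : 0 <= r by rewrite /r; lra.
have [K hK] : asym r (fun X => \sum_(g <- divisors l | odd g) \sum_(e <- divisors w | odd e)
  coef R g e * (jacobi (- s) g)%:~R * blocksum d g (phi D f chi s l g e) (hh s l w g e) 0 (l * (Num.truncn X %/ (g * e)))) (lead_const L).
 apply: asym_sum => g; rewrite -dvdn_divisors // => gl og; apply: asym_sum => e; rewrite -dvdn_divisors // => ew oe. case: (eqVneq (coef R g e) 0) => [->|cne0].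
  by exists 0 => X; rewrite ?mul0r mulr0 subr0 normc0.
 apply: asym_scale; have g0 := dvdn_gt0 l0 gl; have e0 := dvdn_gt0 w0 ew. have ge0 : (0 < g * e)%N by rewrite muln_gt0 g0. have [H1 H2] := HL _ _ gl og ew oe cne0.
 have gd : (g %| d)%Z by rewrite /d -mulrA dvdz_mull // dvdz_mulr. have q0 : (0 < q)%N by rewrite /q muln_gt0 l0 q0_gt0. have gq : (g %| q)%N by rewrite /q dvdn_mulr.
 have [K hK] := block_limit og (sqf_dvd gl sl) gd q0 gq (phi_per D f chi s l0 g e) (phi_le1 D s l f0 chid g e) (@phi_supp R D f chi s l g e ^~ gl) d_neq0 (hh_neq0 gl ew) H1 H2 eps0.
 have {}hK : exists2 K, 0 <= K & forall X, (0 < X)%N -> normc (blocksum d g (phi D f chi s l g e) (hh s l w g e) 0 X - X%:R * L g e) <= K * X%:R `^ r.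
  exists `|K| => // X X0; apply: le_trans (hK _ X0) _; apply: ler_wpM2r; rewrite ?powR_ge0 ?ler_norm //.
 have {K} [K K0 {}hK] := hK. exists (K * l%:R `^ r + 2 * l%:R * normc (L g e)) => X X1; set Y := (l * _)%N. have X0 : 0 <= X by apply: le_trans. have lr : 0 < l%:R :> R by rewrite ltr0n.
 have ger : 1 <= (g * e)%:R :> R by rewrite ler1n. have [n1 n2] : (Num.truncn X)%:R <= X /\ X < (Num.truncn X).+1%:R by have /andP[] := truncn_itv X0.
 have [Y1 Y2] : Y%:R <= l%:R / (g * e)%:R * X /\ l%:R / (g * e)%:R * X <= Y%:R + 2 * l%:R.
  set n := Num.truncn X in n1 n2 Y *; pose k := (n %/ (g * e))%N. have k1 : (k * (g * e))%:R <= n%:R :> R by rewrite ler_nat leq_divM.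
  have k2 : n%:R + 1 <= (k.+1 * (g * e))%:R :> R by rewrite -natr1 || rewrite natr1 ler_nat ltn_ceil. have ge1 : 0 < (g * e)%:R :> R by rewrite ltr0n.
  rewrite /Y -/k natrM -mulrA; have -> : l%:R * k%:R + 2 * l%:R = l%:R * (k%:R + 2) :> R by ring. rewrite !ler_pM2l // mulrC ler_pdivlMr // ler_pdivrMr //.
  move: k1 k2 n1 n2; rewrite natrM (natrM R k.+1) -natr1 -natr1 mulrDl mul1r; move: ge1 ger. set b := (g * e)%:R; set a := k%:R => ge1 ger k1 k2 n1 n2. split; first by lra.
  have : 0 <= a * b by rewrite mulr_ge0.  rewrite mulrDl; lra.
 have Xr : 1 <= X `^ r.
  by have := @powR_mono R 1 X r ler01 X1 r0; rewrite powR1.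
 have st : normc (blocksum d g (phi D f chi s l g e) (hh s l w g e) 0 Y - Y%:R * L g e) <= K * l%:R `^ r * X `^ r.
  case: (posnP Y) => [->|Y0].
   rewrite /blocksum big_geq // mul0r subr0 normc0 !mulr_ge0 ?powR_ge0 //.
  apply: le_trans (hK _ Y0) _; rewrite -mulrA -powRM //; apply: ler_wpM2l => //. apply: (powR_mono (ler0n _ _) _ r0).
  apply: le_trans Y1 _; rewrite ler_wpM2r // ler_pdivrMr ?(lt_le_trans ltr01) // ler_peMr // ltW.
 have eL : X%:C * ((l%:R / (g * e)%:R)%:C * L g e) = Y%:R * L g e - (Y%:R - l%:R / (g * e)%:R * X)%:C * L g e.
  have Yc : (Y%:R : R)%:C = Y%:R by exact: rmorph_nat. rewrite rmorphB /= Yc rmorphM; ring.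
 rewrite eL. have -> (a b c : R[i]) : a - (b - c) = (a - b) + c by ring. apply: le_trans (le_normcD _ _) _; rewrite mulrDl; apply: lerD => //.
 rewrite normcM normc_real; apply: le_trans (_ : 2 * l%:R * normc (L g e) * 1 <= _); last first.
  by apply: ler_wpM2l => //; rewrite !mulr_ge0 ?normc_ge0.
 rewrite mulr1; apply: ler_wpM2r; first exact: normc_ge0. by rewrite ler_norml; apply/andP; move: Y1 Y2; lra.
exists K => X X1; rewrite /salie_sum.
have -> := salie_blocks m D0 f0 chid l0 sl w0 s1 (Num.truncn X).
exact: hK.
Qed.
End Assembly.

(** * Evaluation of the densities *)

Section MainTerm.
Variable R : realType.
Local Notation ee := (efrac R).
Variables (D g u e m0 P N : nat) (Psi phi : int -> R[i]) (c0 : R[i]).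
Hypotheses (D0 : (0 < D)%N) (og : odd g) (e0 : (0 < e)%N) (u0 : (0 < u)%N) (P0 : (0 < P)%N) (N0 : (0 < N)%N) (sl : squarefree (g * u)) (uP : (u %| P)%N) (perP : per P Psi) (PsiM : forall x y, Psi (x * y) = Psi x * Psi y) (PsiC : forall x, Psi x != 0 -> coprimez x P).
Hypothesis phiE : forall x : nat, phi x%:Z = if (g * u %| x)%N && (D %| g * (e * (x %/ (g * u))))%N
  then c0 * Psi (e * (x %/ (g * u)))%N%:Z else 0.
Let q := (u * (N * (P * (D * g))))%N.
Let d1 := (g * u * m0)%N.
(** For C = u C1 and g | v, the value 2 d1 v x + C v^2 is g u v times this number. *)
Definition gam v (C1 x : int) : int := 2 * m0%:Z * x + C1 * (v %/ g)%N%:Z.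
Definition wgt v (C1 x : int) : R[i] := if (D%:Z %| (g * e * v)%N%:Z * gam v C1 x)%Z then (jacobi C1 g)%:~R else 0.
Lemma g_gt0 : (0 < g)%N. Proof. by case: g og. Qed.
Lemma sg : squarefree g. Proof. by apply: sqf_dvd sl; rewrite dvdn_mulr. Qed.

(** l = g u divides C v^2. The symbol modulo g forces g | v. A prime dividing u and v would divide
    k, the value over l, against Psi(e k) <> 0, as u divides the period P; so u | C. Finally v
    divides k, hence v is prime to P. *)
Lemma mterm_cases v C i : (0 < v)%N -> phi (2 * d1 * v * i + C * v ^ 2)%N * (jacobi C g)%:~R != 0 -> [/\ (g %| v)%N, coprime (e * v) P & (u %| C)%N].
Proof.
move=> v0; rewrite mulf_eq0 negb_or intr_eq0 phiE; have g0 := g_gt0.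
case: ifP => [/andP[lx _]|_]; last by rewrite eqxx.
rewrite mulf_eq0 negb_or => /andP[/andP[_ Pn] Jn].
set k := (_ %/ _)%N in Pn; have cp : coprime (e * k) P by have := PsiC Pn; rewrite copz_nat.
have cC : coprime C g.
 by apply: contraNT Jn => nc; rewrite jacobi_0.
have xk : (2 * d1 * v * i + C * v ^ 2 = k * (g * u))%N by rewrite divnK.
have lCv : (g * u %| C * v ^ 2)%N.
 by move: lx; rewrite dvdn_addr /d1 -!mulnA || (rewrite dvdn_addr // /d1; apply/dvdnP; exists (2 * m0 * v * i); ring).
have gv : (g %| v)%N.
 have h : (g %| v ^ 2)%N by rewrite -(@Gauss_dvdr _ C) 1?coprime_sym //; apply: dvdn_trans lCv; rewrite dvdn_mulr. by have := @sqf_dvd_sq g g0 sg v; rewrite !dvdzE; apply.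
have ku : coprime k u by apply: coprime_dvdr uP _; move: cp; rewrite coprimeMl => /andP[].
have cuv : coprime u v.
 rewrite /coprime; apply/negPn/negP => h.
 have [p pp pd] : exists2 p, prime p & (p %| gcdn u v)%N by exists (pdiv (gcdn u v)); [apply: pdiv_prime; move: h; have := gcdn_gt0 u v; rewrite u0; case: gcdn => [|[|]] | exact: pdiv_dvd].
 have pu : (p %| u)%N := dvdn_trans pd (dvdn_gcdl _ _). have pv : (p %| v)%N := dvdn_trans pd (dvdn_gcdr _ _).
 have [z ez] := dvdnP lCv; have [u' eu] := dvdnP pu; have [v' ev] := dvdnP pv; have p0 := prime_gt0 pp. have npg : ~~ (p %| g * u')%N.
  apply/negP => h1; have : (p ^ 2 %| g * u)%N by rewrite eu mulnA dvdn_pmul2r. by move/sl => p1; rewrite p1 in pp.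
 have pz : (p %| z)%N.
  have : (z * (g * u') = C * p * v' ^ 2)%N.
   apply/eqP; rewrite -(eqn_pmul2r p0); apply/eqP; move: ez; rewrite ev eu expnMn => ez. transitivity (z * (g * (u' * p)))%N; first by ring. by rewrite -ez; ring.
  move=> h1; have : (p %| z * (g * u'))%N by rewrite h1 mulnAC dvdn_mull. by rewrite Euclid_dvdM // (negbTE npg) orbF.
 have ek : (k = 2 * m0 * v * i + z)%N.
  apply/eqP; rewrite -(@eqn_pmul2r (g * u)) ?muln_gt0 ?g0 // -xk ez /d1; apply/eqP; ring.
 have pk : (p %| k)%N by rewrite ek dvdn_add // dvdn_mulr // dvdn_mull. have : (p %| gcdn k u)%N by rewrite dvdn_gcd pk. by rewrite (eqP ku) dvdn1 => /eqP p1; rewrite p1 in pp.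
have uC : (u %| C)%N.
 by rewrite -(@Gauss_dvdl _ _ (v ^ 2)) ?coprimeXr //; apply: dvdn_trans lCv; rewrite dvdn_mull.
split => //.
have vk : (v %| k)%N.
 have [C1 eC] := dvdnP uC; have [v1 ev] := dvdnP gv. apply/dvdnP; exists (2 * m0 * i + C1 * v1)%N; apply/eqP. have e2 : (v ^ 2 = v * (v1 * g))%N by rewrite -ev.
 by rewrite -(@eqn_pmul2r (g * u)) ?muln_gt0 ?g0 // -xk /d1 e2 eC; apply/eqP; ring.
by apply: coprime_dvdl cp; rewrite dvdn_mul.
Qed.

Lemma mterm_omega v C1 i : (0 < v)%N -> (g %| v)%N ->  phi (2 * d1 * v * i + (u * C1) * v ^ 2)%N * (jacobi (u * C1)%N g)%:~R = c0 * Psi (e * v)%N * (jacobi u g)%:~R * (Psi (gam v C1 i) * wgt v C1 i).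
Proof.
move=> v0 gv; have g0 := g_gt0; have gu0 : (0 < g * u)%N by rewrite muln_gt0 g0.
pose k := (2 * m0 * i + C1 * (v %/ g))%N.
have ek : (2 * d1 * v * i + u * C1 * v ^ 2 = (v * k) * (g * u))%N.
 have e2 : (v ^ 2 = v * (v %/ g * g))%N by rewrite divnK. by rewrite /d1 /k e2; ring.
have gk : gam v C1 i = k by [].
rewrite phiE ek dvdn_mull // mulnK //= /wgt gk -PoszM dvdzE /=.
have -> : (g * (e * (v * k)) = g * e * v * k)%N by ring.
case: ifP => _; last by rewrite !mulr0 mul0r.
by rewrite mulnA PoszM PsiM (PoszM u) jacobiMl //; ring.
Qed.

Lemma sum_period_mul a k (F : int -> R[i]) : per a F -> \sum_(x < a * k) F x = k%:R * \sum_(x < a) F x.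
Proof.
move=> pF; rewrite sum_split mulr_sumr; apply: eq_bigr => y _.
by rewrite (eq_bigr (fun=> F y)) => [|j _]; rewrite // sumr_const card_ord mulr_natl.
Qed.

Definition wsum v (x : int) : R[i] := \sum_(y < D * g) wgt v y%:Z x.
Lemma wgt_per v x : (g %| v)%N -> per (D * g) (wgt v ^~ x).
Proof.
move=> gv C1 k; rewrite /wgt (@jacobi_eqm (C1 + _) C1); last first.
 by rewrite addrC addKr PoszM mulrAC dvdz_mull.
have -> : (g * e * v)%N%:Z * gam v (C1 + (D * g)%N%:Z * k) x = (g * e * v)%N%:Z * gam v C1 x + D%:Z * ((g * e * v)%N%:Z * (g%:Z * k * (v %/ g)%N)).
 by rewrite /gam; ring.
by rewrite rpredDr // dvdz_mulr.
Qed.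

Lemma sum_affine (F : int -> R[i]) a b : per P F -> coprimez a P -> \sum_(x < P) F (b + a * x) = \sum_(x < P) F x.
Proof.
move=> pF ca; rewrite -(sum_shift b P0 pF) -(@sum_scale R P (fun x => F (x + b)) a) //.
 by apply: eq_bigr => x; rewrite addrC.
by move=> x k; rewrite addrAC.
Qed.

(** C1 modulo P and C1 modulo D g are independent: the first yields the full sum of Psi, the second
    [wsum]. If P and D have a common prime, divisibility by D contradicts the nonvanishing of
    Psi. *)
Lemma inner_eval v x : (0 < v)%N -> (g %| v)%N -> coprime (e * v) P -> \sum_(C1 < N * (P * (D * g))) Psi (gam v C1 x) * wgt v C1 x = if coprime P D then N%:R * (\sum_(y < P) Psi y) * wsum v x else 0.
Proof.
move=> v0 gv cev; have g0 := g_gt0; have Dg : (0 < D * g)%N by rewrite muln_gt0 D0.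
have [ce cv] : coprime e P /\ coprime v P by move: cev; rewrite coprimeMl => /andP.
have cg : coprime g P := coprime_dvdl gv cv.
have cv1 : coprime (v %/ g) P := coprime_dvdl (dvdn_div gv) cv.
have pG : per P (fun C1 => Psi (gam v C1 x)).
 move=> C1 k; have -> : gam v (C1 + P%:Z * k) x = gam v C1 x + P%:Z * (k * (v %/ g)%N) by rewrite /gam; ring. by rewrite perP.
case: ifP => cPD; last first.
 apply: big1 => C1 _; rewrite /wgt; case: ifP => h; rewrite ?mulr0 //. case: (eqVneq (Psi (gam v C1 x)) 0) => [->|/PsiC cp]; rewrite ?mul0r //.
 have h1 : coprimez ((g * e * v)%N%:Z * gam v C1 x) P by rewrite coprimezMl copz_nat !coprimeMl cg ce cv. case/negP: (negbT cPD); rewrite coprime_sym; move: h; rewrite dvdzE /= => h.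
 exact: coprime_dvdl h h1.
have cPDg : coprime P (D * g) by rewrite coprimeMr cPD coprime_sym.
pose G C1 := Psi (gam v C1 x) * wgt v C1 x.
have perG : per (P * (D * g)) G.
 move=> C1 k; congr (_ * _); first by rewrite PoszM -mulrA. by rewrite mulnC PoszM -mulrA wgt_per.
rewrite mulnC (@sum_period_mul _ _ G perG) sum_crt // -mulrA; congr (_ * _); rewrite /G.
under eq_bigr => a _ do under eq_bigr => b _ do rewrite pG addrC wgt_per //.
under eq_bigr => a _ do rewrite -mulr_sumr.
rewrite -mulr_suml; congr (_ * _).
 rewrite -(@sum_affine Psi ((D * g)%N%:Z * (v %/ g)%N) (2 * m0%:Z * x)) //.
  by apply: eq_bigr => a _; rewrite /gam; congr Psi; ring.
 by rewrite copz_nat !coprimeMl cg coprime_sym cPD.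
by rewrite (@sum_scale R _ (wgt v ^~ x)) //; exact: wgt_per.
Qed.

Lemma mterm_eval h v : (0 < v)%N -> mterm d1 g q phi h v = if [&& (g %| v)%N, coprime (e * v) P & coprime P D] then (q%:R)^-1 * (c0 * Psi (e * v)%N * (jacobi u g)%:~R * (N%:R * (\sum_(y < P) Psi y))) *
   \sum_(i < v | coprime i v) ee v (- h * iv v i) * wsum v i
 else 0.
Proof.
move=> v0; pose Om C i := phi (2 * d1 * v * i + C * v ^ 2)%N * (jacobi C g)%:~R.
have omE C i : omega d1 g phi h v C%:Z i%:Z = Om C i * ee v (- h * iv v i).
 rewrite /omega /Om; congr (phi _ * _ * _); rewrite PoszD !PoszM; ring.
rewrite /mterm; under eq_bigr => C _ do under eq_bigr => i _ do rewrite omE.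
case: (boolP ((g %| v)%N && coprime (e * v) P)) => [/andP[gv cev]|h1]; last first.
 rewrite andbA (negbTE h1) /= big1 ?mulr0 // => C _; apply: big1 => i _. case: (eqVneq (Om C i) 0) => [->|/(mterm_cases v0)[gv cev _]]; rewrite ?mul0r //. by rewrite gv cev in h1.
rewrite gv cev /=.
have -> : \sum_(C < q) \sum_(i < v | coprime i v) Om C i * ee v (- h * iv v i) = \sum_(C1 < N * (P * (D * g))) \sum_(i < v | coprime i v) Om (u * C1)%N i * ee v (- h * iv v i).
 pose F C := \sum_(i < v | coprime i v) Om `|C|%N i * ee v (- h * iv v i). transitivity (\sum_(C < q | (u %| C)%N) F C).
  rewrite [RHS]big_mkcond; apply: eq_bigr => C _; case: ifP => // uC. by apply: big1 => i; case: (eqVneq (Om C i) 0) => [->|/(mterm_cases v0)[_ _]]; rewrite ?mul0r ?uC.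
 by rewrite sum_multiples.
rewrite exchange_big /=.
have st i : \sum_(C1 < N * (P * (D * g))) Om (u * C1)%N i * ee v (- h * iv v i) =
 c0 * Psi (e * v)%N * (jacobi u g)%:~R * (if coprime P D then N%:R * (\sum_(y < P) Psi y) * wsum v i else 0) * ee v (- h * iv v i).
 rewrite -(inner_eval i v0 gv cev) -mulr_suml; congr (_ * _); rewrite mulr_sumr. by apply: eq_bigr => C1; rewrite /Om mterm_omega.
under eq_bigr => i _ do rewrite st.
case: ifP => _; last by rewrite big1 ?mulr0 // => i; rewrite mul0r.
move: (\sum_(y < P) Psi y) => S.
rewrite !mulr_sumr; apply: eq_bigr => i _; ring.
Qed.

Lemma wgt_opp v C1 x : wgt v (- C1) (- x) = (jacobi (-1) g)%:~R * wgt v C1 x.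
Proof.
rewrite /wgt; have -> : gam v (- C1) (- x) = - gam v C1 x by rewrite /gam; ring.
rewrite mulrN rpredN; case: ifP => _; last by rewrite mulr0.
by rewrite -[- C1]mulN1r jacobiMl // rmorphM.
Qed.

Lemma wsum_opp v x : (g %| v)%N -> wsum v (- x) = (jacobi (-1) g)%:~R * wsum v x.
Proof.
move=> gv; rewrite /wsum -(sum_opp _ (wgt_per (- x) gv)) ?muln_gt0 ?D0 ?g_gt0 // mulr_sumr.
by apply: eq_bigr => y; rewrite wgt_opp.
Qed.

Lemma wsum_per v : (g %| v)%N -> per v (wsum v).
Proof.
move=> gv x k; have Dg : (0 < D * g)%N by rewrite muln_gt0 D0 g_gt0.
rewrite /wsum -(@sum_shift R _ (wgt v ^~ (x + v%:Z * k)) (- 2 * m0%:Z * g * k)) //; last exact: wgt_per.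
apply: eq_bigr => y _; rewrite /wgt.
have -> : gam v (y%:Z + - 2 * m0%:Z * g * k) (x + v%:Z * k) = gam v y x.
 by rewrite /gam -{1}(divnK gv); ring.
by rewrite (@jacobi_eqm (y%:Z + _) y) // addrC addKr mulrAC dvdz_mull.
Qed.

(** The substitution x -> - x, C1 -> - C1 reverses h in the phase and multiplies the symbol by (-1 /
    g). *)
Lemma mterm_parity h v : (0 < v)%N -> mterm d1 g q phi (- h) v = (jacobi (-1) g)%:~R * mterm d1 g q phi h v.
Proof.
move=> v0; rewrite !mterm_eval //; case: ifP => [/andP[gv _]|_]; last by rewrite mulr0.
rewrite [RHS]mulrCA; congr (_ * _).
pose F x := if coprimez x v then ee v (- - h * iv v x) * wsum v x else 0.
have pF : per v F.
 move=> x k; rewrite /F copz_per wsum_per //; case: ifP => // cx; congr (_ * _). apply: ee_eqm => //; rewrite -mulrBr dvdz_mull //; apply: iv_eqm; first by rewrite copz_per.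
 by rewrite addrC addKr dvdz_mulr.
rewrite [LHS](_ : _ = \sum_(x < v) F x); last by rewrite big_mkcond; apply: eq_bigr => x; rewrite /F.
rewrite -(sum_opp v0 pF) mulr_sumr [RHS]big_mkcond; apply: eq_bigr => x _; rewrite /F.
have cN : coprimez (- x%:Z) v = coprime x v by rewrite coprimezE abszN.
rewrite cN; case: ifP => // cx; rewrite wsum_opp // mulrCA; congr (_ * (_ * _)).
apply: ee_eqm => //; have -> : - - h * iv v (- x%:Z) - - h * iv v x = h * (iv v (- x%:Z) + iv v x) by ring.
rewrite dvdz_mull // -[_ + _]subr0 -(subrr (- iv v x)) opprK.
have -> : iv v (- x%:Z) + iv v x - (- iv v x + iv v x) = iv v (- x%:Z) - - iv v x by ring.
apply: (@iv_uniq v (- x%:Z)); rewrite ?cN //; first by apply: iv_mul; rewrite cN.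
by rewrite mulrNN; apply: iv_mul; rewrite copz_nat.
Qed.

Lemma mterm_zero h v : (0 < v)%N -> \sum_(y < P) Psi y = 0 -> mterm d1 g q phi h v = 0.
Proof. by move=> v0 S0; rewrite mterm_eval // S0 !mulr0 mul0r if_same. Qed.
End MainTerm.

(** * Which characters admit a main term *)

Section Dichotomy.
Variable R : realType.

Lemma jacobi_pm1 a c : odd c -> coprimez a c -> jacobi a c = 1 \/ jacobi a c = -1.
Proof.
move=> oc cp; have c0 : (0 < c)%N by case: c oc cp.
have /eqP := jacobi_sq c0 oc cp; rewrite sqrf_eq1 => /orP[] /eqP ->; by [left | right].
Qed.

Lemma jacobi_recip1 b c : odd b -> odd c -> coprime b c -> (c %% 4 == 1)%N -> jacobi b c = jacobi c b.
Proof.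
move=> ob oc cp c4; have := jacobi_recip R ob oc cp; rewrite c4 orbT.
have cz : coprimez b c by [].
have [->|->] := jacobi_pm1 oc cz; rewrite ?mul1r ?mulN1r; first by [].
by lia.
Qed.

Lemma odd_part2 u : squarefree u -> exists u' (b : bool), odd u' /\ u = (2 ^ b * u')%N.
Proof.
move=> su; case: (boolP (odd u)) => ou; first by exists u, false; rewrite mul1n.
exists u./2, true; have eu : u = (2 * u./2)%N by lia.
split => //; apply/negPn/negP => nu.
have : (2 ^ 2 %| u)%N by lia.
by move/su.
Qed.

(** For u > 0 the symbol (u / k) is an even character of k modulo 8 u; this is its value at - 1. *)
Lemma jacobi_minus1_mod u k : squarefree u -> odd k -> (0 < u)%N -> (k.+1 %% (8 * u) = 0)%N -> jacobi u k = 1.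
Proof.
move=> su ok u0 hk; have dk : (8 * u %| k.+1)%N by lia.
have [u' [b [ou eu]]] := odd_part2 su.
have k8 : (k %% 8 = 7)%N.
 have : (8 %| k.+1)%N by apply: dvdn_trans dk; rewrite dvdn_mulr. by lia.
have k4 : (k %% 4 == 1)%N = false by apply/negbTE; move: k8; clear; lia.
have u'k : (u' %| k.+1)%N by apply: dvdn_trans dk; rewrite eu mulnA dvdn_mull.
have cp : coprime u' k.
 by rewrite coprime_sym /coprime -dvdn1 -(@dvdn_addr k) ?dvdn_gcdl // addn1 (dvdn_trans _ u'k) // dvdn_gcdr.
have J' : jacobi u' k = 1.
 have := jacobi_recip R ou ok cp; rewrite k4 orbF. have -> : jacobi k u' = jacobi (-1) u'.
  by apply: jacobi_eqm; rewrite -PoszD addn1.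
 rewrite jacobi_m1 //; case: ifP => _; first by lra. by lra.
rewrite eu PoszM jacobiMl // J' mulr1; case: (b); last by rewrite jacobi_1l.
by rewrite jacobi_2 // k8.
Qed.

Lemma jacobi_mod1 (a : int) k : a != 0 -> odd k -> k = 1 %[mod 8 * `|a|] -> jacobi a k = 1.
Proof.
move=> a0 ok h; rewrite (@jacobi_per R a k 1) ?jacobi1 //.
by rewrite -eqz_mod_dvd !modz_nat h.
Qed.

Lemma jacobi_sum0 g : odd g -> squarefree g -> (1 < g)%N -> \sum_(r < g) (jacobi r g)%:~R = 0 :> R[i].
Proof.
move=> og sg g1; have := jsumE R 0 og sg; rewrite jacobi_0 ?mul0r; last 2 first.
- by lia.
- by rewrite /coprime; case: (g) g1 => [|[]].
by rewrite /jsum => h; rewrite -[RHS]h; apply: eq_bigr => r; rewrite ee0 mulr1.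
Qed.

(** Otherwise all symbols are nonnegative and (1 / p) = 1, while their sum is 0. *)
Lemma exists_nonres p : prime p -> odd p -> exists2 a, coprime a p & jacobi a p = -1.
Proof.
move=> pp op; have p0 := prime_gt0 pp; have p1 := prime_gt1 pp.
case: (boolP [exists a : 'I_p, jacobi a p == -1]) => [/existsP[a /eqP ha]|/existsPn h].
 exists a => //; rewrite -copz_nat; apply/negPn/negP => nc. by move: ha; rewrite jacobi_0.
have sp : squarefree p.
 move=> d dp; have d0 : (0 < d)%N by case: d dp => //; rewrite dvd0n => /eqP p00; rewrite p00 in p0. have dd : (d %| p)%N by apply: dvdn_trans dp; rewrite dvdn_exp.
 move: dp; case/primeP: pp => _ /(_ _ dd) /orP[/eqP -> //|/eqP ->] /dvdn_leq; move: p0 p1; clear; nia.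
have := jacobi_sum0 op sp p1 => /eqP; rewrite -rmorph_sum intr_eq0 => /eqP s0; exfalso.
have nn (a : 'I_p) : 0 <= jacobi a p.
 case: (boolP (coprimez a p)) => ca; last by rewrite jacobi_0. by case: (jacobi_pm1 op ca) (h a) => ->.
have : \sum_(r < p) jacobi r p >= 1.
 rewrite (bigD1 (Ordinal p1)) //= jacobi_1l // lerDl; exact: sumr_ge0.
by lra.
Qed.

Variables (f : nat) (chi : int -> R[i]).
Hypotheses (f0 : (0 < f)%N) (fodd : odd f) (cprim : primitive_character f chi) (ceven : even_character chi).

Let chid := proj1 cprim.
Lemma chi_eqm a b : (f %| a - b)%Z -> chi a = chi b.
Proof. exact: per_eqm (chi_per chid). Qed.

(** Each conclusion is tested at a suitable k. For s: k = - 1 modulo 8 f u. For f | u: k = 1 modulo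
    8 u and k = a modulo f, with primitivity. For u = f: k = 1 modulo u / p and k a nonresidue
    modulo p, or k = 5 modulo 8 if p = 2. For f modulo 4: k = 3 modulo 4 and k = 1 modulo f. *)
Lemma real_character s u : `|s|%N = 1%N -> (0 < u)%N -> squarefree u -> (forall k, odd k -> coprime k (f * u) -> chi k = (jacobi (s * u) k)%:~R) -> [/\ s = 1, u = f & (f %% 4 == 1)%N].
Proof.
move=> s1 u0 su H.
have es : s = 1.
 case: (eqVneq s 1) => // ns; have sm : s = -1 by move: s1 ns; clear; lia. have fu0 : (0 < f * u)%N by rewrite muln_gt0 f0.
 pose k := (8 * (f * u)).-1; have ek : k.+1 = (8 * (f * u))%N by rewrite prednK // muln_gt0. have ok : odd k by have := congr1 odd ek; rewrite !oddM => /negbFE. have ck : coprime k (f * u).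
  rewrite /coprime -dvdn1 -(@dvdn_addr k) ?dvdn_gcdl // addn1 ek dvdn_mull // dvdn_gcdr //.
 have := H k ok ck; rewrite (@chi_eqm k (-1)); last by rewrite -PoszD addn1 ek mulnCA PoszM dvdz_mulr. rewrite ceven sm jacobiMl // jacobi_m1 // jacobi_minus1_mod //; last by rewrite ek mulnCA modnMl.
 have -> : (k %% 4 == 1)%N = false by apply/negbTE; move: ek; clear; move: (f * u) => x; lia. by rewrite mulr1 => /(congr1 (@complex.Re R)) /= e1; exfalso; move: e1; lra.
rewrite es mul1r in H.
have fu : (f %| u)%N.
 have <- : gcdn f u = f; last exact: dvdn_gcdr. case: cprim => _; apply; first exact: dvdn_gcdl. move=> a ca a1; set G := gcdn f u in a1 *. have [p [r eb]] := Bezoutz (8 * u)%N f.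
 have eG : gcdz (8 * u)%N f = G.
  rewrite /gcdz gcdnC Gauss_gcdr //; by rewrite (@coprimeXr 3 f 2) // coprimen2.
 have /dvdzP[z ez] : (G %| a - 1)%Z by rewrite -eqz_mod_dvd; apply/eqP. have [x [y [_ exy]]] := int_ediv (p * z) f0. pose k := (1 + 8 * u * x)%N. have ok : odd k by rewrite /k oddD !oddM.
 have ka : (f %| k%:Z - a)%Z.
  apply/dvdzP; exists (- (8 * u)%N%:Z * y - z * r). have -> : a = 1 + z * (p * (8 * u)%N + r * f) by rewrite eb eG -ez; ring. have -> : k%:Z = 1 + (8 * u)%N%:Z * x by [].
  have -> : z * (p * (8 * u) + r * f) = (p * z) * (8 * u)%N + z * r * f by ring. by rewrite exy; ring.
 rewrite -(chi_eqm ka) H //.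
  by rewrite jacobi_mod1 -?lt0n //= /k -modnDmr -mulnA mulnA modnMr.
 rewrite coprimeMr; apply/andP; split.
  have -> : coprime k f = coprimez k f by []. have /dvdzP[j ej] := ka; rewrite -(subrK a k) ej addrC mulrC copz_per //.
 by rewrite /k -coprime_modl -modnDmr mulnAC modnMl coprime_modl coprime1n.
have ef : u = f.
 have [r er] := dvdnP fu; have r0 : (0 < r)%N by move: u0; rewrite er; case: (r). case: (boolP (r == 1)%N) => [/eqP r1|nr1]; first by rewrite er r1 mul1n.
 pose p := pdiv r; have pp : prime p by apply: pdiv_prime; move: nr1 r0; case: (r) => [|[]]. have pr : (p %| r)%N := pdiv_dvd _; have [r' er'] := dvdnP pr; have p0 := prime_gt0 pp.
 pose u' := (r' * f)%N; have eu : u = (p * u')%N by rewrite er er' /u'; ring. have u'0 : (0 < u')%N by move: u0; rewrite eu muln_gt0 => /andP[].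
 have su' : squarefree u' by apply: sqf_dvd su; rewrite eu dvdn_mull. have cpu : coprime p u' by apply: sqf_coprime; rewrite -eu.
 have fin k : odd k -> coprime k p -> (k = 1 %[mod u']) -> jacobi u' k = 1 -> jacobi p k = -1 -> False.
  move=> ok ckp k1 j1 j2; have : chi k = 1.
   rewrite -(chi_1 chid); apply: chi_eqm; rewrite -eqz_mod_dvd !modz_nat. by have -> : (k = 1 %[mod f]) by rewrite -(modn_dvdm k (dvdn_mull r' (dvdnn f))) k1 modn_dvdm // dvdn_mull.
  rewrite H //; first by rewrite eu PoszM jacobiMl // j1 j2 => /(congr1 (@complex.Re R)) /=; lra. have cku : coprime k u' by rewrite -coprime_modl k1 coprime_modl coprime1n.
  by rewrite coprimeMr eu coprimeMr ckp cku !andbT; apply: coprime_dvdr cku; rewrite dvdn_mull.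
 exfalso; case: (boolP (odd p)) => op.
  have [a ca ja] := exists_nonres pp op. have cp8 : coprime (8 * u') p.
   rewrite coprimeMl [coprime u' p]coprime_sym cpu andbT coprime_sym (@coprimeXr 3 p 2) // coprimen2 //.
  pose k := chinese (8 * u') p 1 a. have k1 : (k = 1 %[mod 8 * u']) by exact: chinese_modl. have k2 : (k = a %[mod p]) by exact: chinese_modr.
  have k8 : (k %% 8 = 1)%N by rewrite -(modn_dvdm k (dvdn_mulr u' (dvdnn 8))) k1 modn_dvdm // dvdn_mulr. have ok : odd k by move: k8; clear; lia. have k4 : (k %% 4 == 1)%N by move: k8; clear; lia.
  have ckp : coprime k p by rewrite -coprime_modl k2 coprime_modl. apply: (fin k) => //.
  + by rewrite -(modn_dvdm k (dvdn_mull 8 (dvdnn u'))) k1 modn_dvdm // dvdn_mull.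
  + by rewrite jacobi_mod1 // -lt0n.
  rewrite jacobi_recip1 1?coprime_sym // -ja; apply: jacobi_eqm. by rewrite -eqz_mod_dvd !modz_nat k2.
 have p2 : p = 2%N by case: (even_prime pp) op => ->. have ou' : odd u' by move: cpu; rewrite p2 coprime2n. have c8 : coprime 8 u' by rewrite (@coprimeXl 3 2) // coprime2n. pose k := chinese 8 u' 5 1.
 have k8 : (k %% 8 = 5)%N by exact: chinese_modl. have k2 : (k = 1 %[mod u']) by exact: chinese_modr. have ok : odd k by move: k8; clear; lia. have k4 : (k %% 4 == 1)%N by move: k8; clear; lia.
 apply: (fin k); rewrite ?p2 ?coprimen2 //.
  have cku : coprime u' k by rewrite coprime_sym -coprime_modl k2 coprime_modl coprime1n. rewrite jacobi_recip1 // -(jacobi_1l R ou'); apply: jacobi_eqm. by rewrite -eqz_mod_dvd !modz_nat k2.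
 by rewrite jacobi_2 // k8.
split => //; rewrite ef in H; case: (odd_mod4 fodd) => [//|[f3 _]]; exfalso.
have c4 : coprime 4 f by rewrite (@coprimeXl 2 2) // coprime2n.
pose k := chinese 4 f 3 1.
have k4 : (k %% 4 = 3)%N by exact: chinese_modl.
have k2 : (k = 1 %[mod f]) by exact: chinese_modr.
have ok : odd k by move: k4; clear; lia.
have ckf : coprime k f by rewrite -coprime_modl k2 coprime_modl coprime1n.
have kf : (f %| k%:Z - 1)%Z by rewrite -eqz_mod_dvd !modz_nat k2.
have := H k ok; rewrite coprimeMr ckf => /(_ isT); rewrite (chi_eqm kf) (chi_1 chid).
have := jacobi_recip R fodd ok; rewrite coprime_sym => /(_ ckf); rewrite (eqP f3) k4 /= (jacobi_eqm kf) jacobi_1l // mulr1 => ->.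
by move=> /(congr1 (@complex.Re R)) /=; lra.
Qed.

Lemma kronecker_odd a k : odd k -> kronecker a k = jacobi a k.
Proof.
move=> ok; rewrite /kronecker; case: ifP => [/eqP k0|_]; first by rewrite k0 in ok.
rewrite /jacobi big_seq big_seq; apply: eq_bigr => -[p j] /mem_prime_decomp[pp j0 h].
rewrite /kronecker_prime /=; case: eqP => // p2.
have : odd p by apply: dvdn_odd ok; apply: dvdn_trans h; rewrite -[p]expn1 dvdn_exp2l.
by rewrite p2.
Qed.

Lemma kroneckerE a n : (0 < n)%N -> kronecker a n = \prod_(p <- primes n) kronecker_prime a p ^+ logn p n.
Proof.
move=> n0; rewrite /kronecker eqn0Ngt n0 prime_decompE big_map; apply: eq_bigr => p _ //.
Qed.

Lemma squarefree_part_gt0 n : (0 < squarefree_part n)%N.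
Proof.
rewrite /squarefree_part big_seq_cond; apply: prodn_cond_gt0 => p /andP[].
by rewrite mem_primes => /and3P[/prime_gt0].
Qed.

Lemma squarefree_partE n : (0 < n)%N -> squarefree n -> squarefree_part n = n.
Proof.
move=> n0 sn; rewrite /squarefree_part; apply/eqP; rewrite eqn_dvd; apply/andP; split; apply: dvdn_logn => //; try exact: squarefree_part_gt0.
 move=> p pp; rewrite -big_filter logn_prod_primes ?filter_uniq ?primes_uniq //; last first.
  by apply/allP => r; rewrite mem_filter mem_primes => /andP[_ /and3P[]].
 rewrite mem_filter; case: (boolP (odd _)) => //= ol; rewrite mem_primes pp n0 /=. by case: (boolP (p %| n)%N) => // pn; rewrite logn_gt0 mem_primes pp n0.
move=> p pp; rewrite -big_filter logn_prod_primes ?filter_uniq ?primes_uniq //; last first.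
 by apply/allP => r; rewrite mem_filter mem_primes => /andP[_ /and3P[]].
rewrite mem_filter; have := sqf_logn n0 pp sn; case e : logn => [|[|]] //= _.
have l0 : (0 < logn p n)%N by rewrite e.
by rewrite logn_gt0 in l0; rewrite l0.
Qed.

Lemma squarefree_part_sq n : (0 < n)%N -> squarefree (squarefree_part n) /\ (0 < squarefree_part n)%N.
Proof.
move=> n0; have s0 := squarefree_part_gt0 n.
split => // d dn; apply/eqP; rewrite -dvdn1; have d0 : (0 < d)%N by case: d dn s0 => //; rewrite dvd0n => /eqP ->.
apply: dvdn_logn => // p pp; rewrite logn1.
have := dvdn_leq_log p s0 dn; rewrite lognX [X in (_ <= logn p X)%N]/squarefree_part -big_filter logn_prod_primes ?filter_uniq ?primes_uniq //; last first.
 by apply/allP => r; rewrite mem_filter mem_primes => /andP[_ /and3P[]].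
by case: (_ \in _); clear; lia.
Qed.

(** Evenness reduces to positive arguments. The value at 2 is reached through the odd number f + 2:
    (f / (f + 2)) = ((f + 2) / f) = (2 / f). *)
Lemma quad_char_of_jacobi : (f %% 4 == 1)%N -> squarefree f -> (forall k, odd k -> coprime k f -> chi k = (jacobi f k)%:~R) -> chi =1 quad_char R f.
Proof.
move=> f4 sf H a; rewrite /quad_char /quad_disc (squarefree_partE f0 sf) f4.
have [_ chiM chinz] := chid.
have cabs : chi a = chi `|a|%N.
 case: (ger0P a) => ha; first by rewrite gez0_abs. by rewrite -[LHS]mul1r -ceven -chiM mulN1r ltz0_abs.
rewrite cabs; move: (`|a|%N) => {a cabs} n.
case: (boolP (coprime n f)) => cp; last first.
 have -> : chi n = 0 by apply/eqP; apply: contraNT cp; rewrite chinz. case: (posnP n) => [n0|n0].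
  move: cp; rewrite n0 /coprime gcd0n /kronecker => /negbTE ->; by [].
 rewrite kroneckerE //; symmetry; apply/eqP; rewrite intr_eq0. have [p pp pd] : exists2 p, prime p & (p %| gcdn n f)%N.
  exists (pdiv (gcdn n f)); [apply: pdiv_prime; move: cp; rewrite /coprime; have := gcdn_gt0 n f; rewrite n0; case: gcdn => [|[|]] // | exact: pdiv_dvd].
 have pn := dvdn_trans pd (dvdn_gcdl _ _); have pf := dvdn_trans pd (dvdn_gcdr _ _). have pin : p \in primes n by rewrite mem_primes pp n0.
 rewrite (bigD1_seq p) ?primes_uniq //= mulf_eq0 expf_eq0 logn_gt0 pin /=. have p2 : p != 2%N by apply: contraTneq fodd => p2; move: pf; rewrite p2 dvdn2.
 by rewrite /kronecker_prime (negbTE p2) /legendre dvdzE pf.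
case: (posnP n) => [n0|n0].
 move: cp; rewrite n0 /coprime gcd0n => /eqP f1; rewrite f1 /kronecker /=. by rewrite -(chi_1 chid); apply: chi_eqm; rewrite f1.
have [j [b [ob en]]] : exists j b, odd b /\ n = (2 ^ j * b)%N.
 exists (logn 2 n), (n`_2^')%N; rewrite odd_2'nat part_pnat; split => //. by rewrite -p_part partnC.
have b0 := odd_gt0 ob.
have cb : coprime b f by apply: coprime_dvdl cp; rewrite en dvdn_mull.
have kM : kronecker f n = kronecker_prime f 2 ^+ j * kronecker f b.
 rewrite en; elim: (j) => [|j' IH]; first by rewrite mul1n mul1r. rewrite expnS -mulnA; set n' := (2 ^ j' * b)%N in IH *; have n'0 : (0 < n')%N by rewrite muln_gt0 expn_gt0.
 have tot N M : (0 < N)%N -> (N < M)%N -> kronecker f N = \prod_(0 <= p < M | prime p) kronecker_prime f p ^+ logn p N.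
  move=> N0 NM; rewrite kroneckerE //. rewrite -big_filter [RHS](bigID (fun p => p \in primes N)) /= [X in _ = _ * X]big1 ?mulr1; last first.
   by move=> p /andP[pp]; rewrite -logn_gt0 -eqn0Ngt => /eqP ->.
  rewrite -[RHS]big_filter -big_filter; apply: perm_big; apply: uniq_perm; rewrite ?filter_uniq ?primes_uniq ?iota_uniq //.
  move=> p; rewrite !mem_filter mem_index_iota mem_primes; case: (boolP (prime p)) => //= pp. by rewrite N0; case: (boolP (p %| N)%N) => // pN; rewrite (leq_ltn_trans (dvdn_leq N0 pN)).
 have n20 : (0 < 2 * n')%N by rewrite muln_gt0. rewrite (tot _ _ n20 (ltnSn _)) exprS -mulrA -IH (tot n' (2 * n').+1 n'0); last by rewrite ltnS leq_pmull.
 rewrite big_mkcond (bigD1_seq 2%N) ?iota_uniq //=; last by rewrite mem_index_iota ltnS leq_pmulr. rewrite [in RHS]big_mkcond (bigD1_seq 2%N) ?iota_uniq //=; last by rewrite mem_index_iota ltnS leq_pmulr.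
 rewrite lognM // (pfactorK 1) // exprS !mulrA; congr (_ * _); apply: eq_bigr => p p2; case: ifP => // pp. by rewrite lognM // logn_prime // (negbTE p2).
have e2 : (2 ^ j)%N = 2 ^+ j :> int by rewrite -natz natrX.
rewrite kM rmorphM rmorphXn /= (kronecker_odd _ ob) -(H b ob cb) en PoszM chiM e2 (chi_X chid).
congr (_ ^+ _ * _).
have of2 : odd (f + 2) by rewrite oddD fodd.
have cf2 : coprime (f + 2) f by rewrite coprimeDl || rewrite -coprime_modl modnDl coprime_modl coprime2n.
have -> : chi 2 = chi (f + 2)%N by apply: chi_eqm; rewrite subrr || (apply/dvdzP; exists (-1); rewrite PoszD; ring).
rewrite H //; congr (_%:~R).
have -> : jacobi f (f + 2) = jacobi (f + 2)%N f.
 by symmetry; apply: jacobi_recip1.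
have -> : jacobi (f + 2) f = jacobi 2 f by apply: jacobi_eqm; apply/dvdzP; exists 1; rewrite PoszD; ring.
rewrite jacobi_2 // /kronecker_prime dvdzE dvdn2 fodd modz_nat !inE !eqz_nat //.
Qed.

(** The discriminant may contain a factor 4, which odd k do not see; [real_character] shows that f
    is its own square-free part and is 1 modulo 4. *)
Lemma quad_char_jacobi : chi =1 quad_char R f -> [/\ squarefree f, (f %% 4 == 1)%N & forall k, odd k -> coprime k f -> chi k = (jacobi f k)%:~R].
Proof.
move=> H; have [ss s0] := squarefree_part_sq f0.
have H' k : odd k -> coprime k f -> chi k = (jacobi (squarefree_part f) k)%:~R.
 move=> ok ck; rewrite H /quad_char absz_nat kronecker_odd //; congr (_%:~R); rewrite /quad_disc; case: ifP => // _. by rewrite PoszM (_ : 4%N%:Z = 2 ^+ 2) // mulrC jacobi_sqr_mul // copz_nat coprime2n.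
have [] := @real_character 1 (squarefree_part f) erefl s0 ss.
 by move=> k ok; rewrite coprimeMr mul1r => /andP[ck _]; exact: H'.
move=> _ e f4.
by split => //; [rewrite -e | move=> k; rewrite -[in X in _ -> _ -> _ = X]e; exact: H'].
Qed.
End Dichotomy.

(** * The character that governs the density *)

Section Instance.
Variable R : realType.
Local Notation ee := (efrac R).
Local Notation eps := (eps_odd R).

(** The eps factors see b and g modulo 4 only, and combine into symbols modulo b with numerators - 1
    and (-1 / g). *)
Lemma eps_triple b g : odd b -> odd g -> conjc (eps b) * eps g * conjc (eps (g * b)) = (jacobi (-1) b * jacobi (jacobi (-1) g) b)%:~R.
Proof.
move=> ob og; have i2 : 'i * 'i = -1 :> R[i] by rewrite -expr2 sqr_i.
have ci : conjc 'i = - 'i :> R[i] by rewrite /=; apply/eqP; rewrite eq_complex /= oppr0 !eqxx.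
have c1 : conjc 1 = 1 :> R[i] by rewrite /=; apply/eqP; rewrite oppr0.
have E1 c : (c %% 4 = 1)%N -> eps c = 1 by rewrite /eps_odd => ->.
have E3 c : (c %% 4 = 3)%N -> eps c = 'i by rewrite /eps_odd => ->.
have J1 c : odd c -> (c %% 4 = 1)%N -> jacobi (-1) c = 1 by move=> oc c4; rewrite (jacobi_m1 R oc) c4.
have J3 c : odd c -> (c %% 4 = 3)%N -> jacobi (-1) c = -1 by move=> oc c4; rewrite (jacobi_m1 R oc) c4.
have gb4 : ((g * b) %% 4 = ((g %% 4) * (b %% 4)) %% 4)%N by rewrite modnMm.
have J11 := jacobi_1l R ob.
case: (odd_mod4 ob) => [/eqP b4|[/eqP b4 _]]; case: (odd_mod4 og) => [/eqP g4|[/eqP g4 _]]; rewrite b4 g4 in gb4.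
- by rewrite (E1 _ b4) (E1 _ g4) (E1 _ gb4) (J1 _ ob b4) (J1 _ og g4) J11 c1 !mulr1.
- by rewrite (E1 _ b4) (E3 _ g4) (E3 _ gb4) (J3 _ og g4) (J1 _ ob b4) ci c1 mul1r mulrN i2 opprK.
- by rewrite (E3 _ b4) (E1 _ g4) (E3 _ gb4) (J1 _ og g4) (J3 _ ob b4) J11 ci !mulr1 mulNr mulrN opprK.
by rewrite (E3 _ b4) (E3 _ g4) (E1 _ gb4) (J3 _ og g4) (J3 _ ob b4) ci c1 mulr1 mulNr i2 opprK.
Qed.

Variables (D f : nat) (chi : int -> R[i]) (s : int) (g u e : nat).
Hypotheses (D0 : (0 < D)%N) (f0 : (0 < f)%N) (fodd : odd f) (cprim : primitive_character f chi) (ceven : even_character chi) (og : odd g) (u0 : (0 < u)%N) (oe : odd e) (sl : squarefree (g * u)) (s1 : `|s|%N = 1%N).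
Let l := (g * u)%N.
Let nu : int := s * jacobi (-1) g.
Let chid := proj1 cprim.
Let g0 := odd_gt0 og.
Let e0 := odd_gt0 oe.
Let l0 : (0 < l)%N. Proof. by rewrite muln_gt0 g0. Qed.
Lemma nu_abs : `|nu|%N = 1%N.
Proof. by rewrite /nu abszM s1 (jacobi_m1 R og); case: ifP. Qed.
Definition per8 := (8 * (f * u))%N.
Lemma per8_gt0 : (0 < per8)%N. Proof. by rewrite !muln_gt0 f0. Qed.
Lemma u_per8 : (u %| per8)%N. Proof. by rewrite /per8 mulnA dvdn_mull. Qed.
(** chi times a real character: the dependence of [kappa] on k apart from divisibility by D. *)
Definition qchi (k : nat) : R[i] := if odd k then (jacobi (nu * u%:Z) k)%:~R * chi k%:Z else 0.
Definition Psi (x : int) : R[i] := qchi (absz (modz x per8%:Z)).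
Lemma psi_mod k k' : (k = k' %[mod per8]) -> qchi k = qchi k'.
Proof.
move=> kk; have kd r : (r %| per8)%N -> (k = k' %[mod r]).
 by move=> rq; rewrite -(modn_dvdm k rq) kk modn_dvdm.
have od : odd k = odd k'.
 have : (k = k' %[mod 2]) by apply: kd; rewrite /per8 dvdn_mulr. by rewrite !modn2 => /eqP; case: odd; case: odd.
rewrite /qchi od; case: ifP => // ok'; congr (_%:~R * _).
 apply: jacobi_per; rewrite ?od //.
  by rewrite -absz_eq0 abszM nu_abs mul1n -lt0n.
 rewrite abszM nu_abs mul1n -eqz_mod_dvd !modz_nat eqz_nat. by apply/eqP; apply: kd; rewrite /per8 dvdn_mul // dvdn_mull.
apply: (chi_eqm cprim); rewrite -eqz_mod_dvd !modz_nat eqz_nat; apply/eqP; apply: kd.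
by rewrite /per8 dvdn_mull // dvdn_mulr.
Qed.

Lemma Psi_nat (k : nat) : Psi k = qchi k.
Proof. by rewrite /Psi modz_nat; apply: psi_mod; rewrite modn_mod. Qed.
Lemma Psi_per : per per8 Psi.
Proof. by move=> x k; rewrite /Psi addrC mulrC modzMDl. Qed.
Lemma psiM a b : qchi (a * b) = qchi a * qchi b.
Proof.
rewrite /qchi oddM; case: (boolP (odd a)) => oa /=; last by rewrite mul0r.
case: (boolP (odd b)) => ob; last by rewrite mulr0.
have [_ M _] := chid.
rewrite PoszM M jacobiMr; [rewrite rmorphM; ring | by case: a oa | by case: b ob].
Qed.

Lemma Psi_rep (x : int) : exists k, (per8 %| x - k%:Z)%Z.
Proof.
have [r [z [_ ->]]] := int_ediv x per8_gt0; exists r.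
by rewrite addrC addKr dvdz_mulr.
Qed.

Lemma PsiM x y : Psi (x * y) = Psi x * Psi y.
Proof.
have [a ha] := Psi_rep x; have [b hb] := Psi_rep y.
rewrite (per_eqm Psi_per ha) (per_eqm Psi_per hb) !Psi_nat -psiM -Psi_nat; apply: (per_eqm Psi_per).
have -> : x * y - (a * b)%N%:Z = (x - a%:Z) * y + a%:Z * (y - b%:Z) by rewrite PoszM; ring.
by apply: rpredD; [exact: dvdz_mulr | exact: dvdz_mull].
Qed.

Lemma psiC k : qchi k != 0 -> coprime k per8.
Proof.
rewrite /qchi; case: ifP => [ok|_]; last by rewrite eqxx.
have k0 := odd_gt0 ok.
have [_ _ nz] := chid; rewrite mulf_eq0 negb_or nz copz_nat => /andP[J cf].
rewrite coprimeMr coprimeMr cf (@coprimeXr 3 k 2) ?coprimen2 //= .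
move: J; rewrite intr_eq0; apply: contraNT => nc; rewrite jacobi_0 // coprimezE abszM nu_abs mul1n /=.
by rewrite coprime_sym.
Qed.

Lemma PsiC x : Psi x != 0 -> coprimez x per8.
Proof.
have [k hk] := Psi_rep x; rewrite (per_eqm Psi_per hk) Psi_nat => /psiC ck.
by have /dvdzP[j ej] := hk; rewrite -(subrK k%:Z x) ej addrC mulrC copz_per.
Qed.

Lemma kap_psi k : kappa D chi s l g e k = if (D %| g * (e * k))%N then chi g * qchi (e * k) else 0.
Proof.
rewrite /kappa /qchi oddM oe; case: (boolP (odd k)) => ok /=; last by rewrite mulr0 if_same.
case: ifP => // _; have [_ M _] := chid; set b := (e * k)%N.
have ob : odd b by rewrite oddM oe.
rewrite PoszM M.
transitivity ((jacobi (- nu1 s l g) b)%:~R * (conjc (eps b) * eps g * conjc (eps (g * b))) * (chi g * chi b)); first by ring.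
rewrite eps_triple // -rmorphM.
have -> : jacobi (- nu1 s l g) b * (jacobi (-1) b * jacobi (jacobi (-1) g) b) = jacobi (nu * u) b.
 by rewrite -!jacobiMl //; congr jacobi; rewrite /nu1 /nu /l mulKn //; ring.
by rewrite mulrCA.
Qed.

Lemma phi_Psi (x : nat) : phi D f chi s l g e x = if (g * u %| x)%N && (D %| g * (e * (x %/ (g * u))))%N then chi g * Psi (e * (x %/ (g * u)))%N else 0.
Proof.
case: (boolP (g * u %| x)%N) => lx /=; last by rewrite /phi dvdzE (negbTE lx).
have ex : x = (l * (x %/ (g * u)))%N by rewrite mulnC divnK.
have gl : (g %| l)%N by rewrite /l dvdn_mulr.
by rewrite [in LHS]ex (phi_mul D chid l0 s1 _ gl oe) kap_psi Psi_nat.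
Qed.

Let q := (l * q0 D f l)%N.
(** Matches the period with the general evaluation, whose free factor N is taken to be g. *)
Lemma q_eq : q = (u * (g * (per8 * (D * g))))%N.
Proof. by rewrite /q /q0 /per8 /l; ring. Qed.

Lemma mpair_eval h m0 v : (0 < v)%N -> mpair g q (phi D f chi s l g e) h (l * m0) v = (1 + (jacobi (-1) g)%:~R) * mterm (l * m0) g q (phi D f chi s l g e) h v.
Proof.
move=> v0; rewrite /mpair q_eq (mterm_parity m0 g D0 og u0 per8_gt0 sl u_per8 Psi_per PsiM PsiC phi_Psi) //.
by rewrite mulrDl mul1r.
Qed.

(** Multiplication by a unit k permutes the residues and multiplies the sum by the value at k. *)
Lemma Psi_sum_trivial : \sum_(y < per8) Psi y != 0 -> forall k, coprime k per8 -> qchi k = 1.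
Proof.
move=> S0 k ck; apply: (mulIf S0); rewrite mul1r -[RHS](@sum_scale R per8 Psi k) ?per8_gt0 //; last exact: Psi_per.
by rewrite mulr_sumr; under [RHS]eq_bigr => y _ do rewrite PsiM Psi_nat.
Qed.

(** If (-1 / g) = - 1 the two densities cancel. If the sum of Psi over a period is not 0, then chi
    agrees with a real character at the odd k prime to f u, and [real_character] identifies it. *)
Lemma mpair_dichotomy h m0 : (forall v, (0 < v)%N -> mpair g q (phi D f chi s l g e) h (l * m0) v = 0) \/ [/\ s = 1, jacobi (-1) g = 1, u = f, (f %% 4 == 1)%N & chi =1 quad_char R f].
Proof.
case: (eqVneq (\sum_(y < per8) Psi y) 0) => [S0|S0].
 left=> v v0; rewrite mpair_eval // q_eq (mterm_zero m0 g D0 og u0 per8_gt0 sl u_per8 Psi_per PsiM PsiC phi_Psi) ?mulr0 //.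
case: (eqVneq (jacobi (-1) g) 1) => [J1|J1]; last first.
 left=> v v0; rewrite mpair_eval //. have -> : jacobi (-1) g = -1 by move: J1; rewrite (jacobi_m1 R og); case: ifP => //; rewrite eqxx. by rewrite subrr mul0r.
right; have tr := Psi_sum_trivial S0.
have su : squarefree u by apply: sqf_dvd sl; rewrite dvdn_mull.
have H k : odd k -> coprime k (f * u) -> chi k = (jacobi (nu * u) k)%:~R.
 move=> ok ck; have k0 := odd_gt0 ok. have cu : coprimez (nu * u) k.
  by rewrite coprimezE abszM nu_abs mul1n coprime_sym; move: ck; rewrite coprimeMr => /andP[].
 have := tr k; rewrite /qchi ok coprimeMr ck (@coprimeXr 3 k 2) ?coprimen2 // => /(_ isT) h1. case: (jacobi_pm1 ok cu) h1 => ->; first by rewrite mul1r. by rewrite rmorphN1 mulN1r => <-; rewrite opprK.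
have [n1 uf f4] := real_character f0 fodd cprim ceven nu_abs u0 su H.
split => //; first by move: n1; rewrite /nu J1 mulr1.
have sf : squarefree f by rewrite -uf.
apply: (quad_char_of_jacobi f0 fodd cprim ceven f4 sf) => k ok ck; rewrite H ?uf ?coprimeMr ?ck //.
by rewrite n1 mul1r.
Qed.
End Instance.

(** * The densities when chi = chi_f *)

Section JacobiClass.
Variable R : realType.

Lemma jacobi_int_per t : per t (fun y => (jacobi y t)%:~R : R[i]).
Proof. by move=> y k; congr (_%:~R); apply: jacobi_eqm; rewrite addrC addKr dvdz_mulr. Qed.

(** If t does not divide r, some factor t2 > 1 of t is prime to r; y is then free modulo t2, and the
    symbol modulo t2 sums to 0. *)
Lemma jacobi_class_sum t r N (a : int) : odd t -> squarefree t -> (0 < r)%N -> (r %| N)%N -> (t %| N)%N -> (0 < N)%N -> \sum_(y < N) (if (r %| y%:Z - a)%Z then (jacobi y t)%:~R else 0) =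
 if (t %| r)%N then (N %/ r)%:R * (jacobi a t)%:~R else 0 :> R[i].
Proof.
move=> ot st r0 rN tN N0; have t0 := odd_gt0 ot.
case: ifP => tr.
 pose A (y : int) : R[i] := if (r %| y - a)%Z then 1 else 0. have pA : per r A by move=> y k; rewrite /A addrAC rpredDr // dvdz_mulr. transitivity (\sum_(y < r * (N %/ r)) (jacobi a t)%:~R * A y).
  rewrite mulnC divnK //; apply: eq_bigr => y _; rewrite /A; case: ifP => h; rewrite ?mulr0 ?mulr1 //. by congr (_%:~R); apply: jacobi_eqm; apply: dvdz_trans h; rewrite dvdzE.
 rewrite -mulr_sumr (sum_period_mul _ pA) mulrC -mulrA; congr (_ * _). have -> : \sum_(y < r) A y = 1; last by rewrite mul1r. rewrite -(sum_shift a r0 pA) (bigD1 (Ordinal r0)) //= big1 ?addr0 /A.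
  by rewrite add0r subrr dvdz0.
 move=> y y0; rewrite addrK; case: ifP => // h; case/eqP: y0; apply: val_inj => /=. by move/dvdz_small: h => ->.
pose t1 := gcdn t r; pose t2 := (t %/ t1)%N.
have t10 : (0 < t1)%N by rewrite gcdn_gt0 t0.
have et : t = (t1 * t2)%N by rewrite mulnC divnK // dvdn_gcdl.
have ot1 : odd t1 by apply: dvdn_odd ot; rewrite dvdn_gcdl.
have ot2 : odd t2 by apply: dvdn_odd ot; rewrite et dvdn_mull.
have t20 := odd_gt0 ot2.
have st2 : squarefree t2 by apply: sqf_dvd st; rewrite et dvdn_mull.
have t21 : (1 < t2)%N.
 case: (ltngtP t2 1) => //; first by rewrite ltnS leqn0 => /eqP h; rewrite h in t20. by move=> h; move: tr; rewrite et h muln1 dvdn_gcdr.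
have c12 : coprime t1 t2 by apply: sqf_coprime; rewrite -et.
have crt : coprime r t2.
 rewrite coprime_sym /coprime; have : (gcdn t2 r %| gcdn t2 t1)%N.
  rewrite dvdn_gcd dvdn_gcdl dvdn_gcd dvdn_gcdr (dvdn_trans (dvdn_gcdl _ _)) // et dvdn_mull //.
 by rewrite [gcdn t2 t1]gcdnC (eqP c12) dvdn1.
pose A (y : int) : R[i] := if (r %| y - a)%Z then (jacobi a t1)%:~R else 0.
pose B y : R[i] := (jacobi y t2)%:~R.
have pA : per r A by move=> y k; rewrite /A addrAC rpredDr // dvdz_mulr.
have pB : per t2 B := @jacobi_int_per t2.
have pAB : per (r * t2) (fun y => A y * B y).
 by move=> y k; congr (_ * _); [rewrite PoszM -mulrA | rewrite PoszM mulrAC -mulrA mulrC [k * _]mulrC -mulrA || rewrite pB].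
transitivity (\sum_(y < (r * t2) * (N %/ (r * t2))) A y * B y).
 rewrite mulnC divnK; last first.
  by rewrite Gauss_dvd // rN (dvdn_trans _ tN) // et dvdn_mull.
 apply: eq_bigr => y _; rewrite /A /B; case: ifP => h; rewrite ?mul0r // -rmorphM; congr (_%:~R). rewrite et jacobiMr //; congr (_ * _); apply: jacobi_eqm; apply: dvdz_trans h; by rewrite dvdzE dvdn_gcdr.
rewrite (sum_period_mul (F := fun y => A y * B y) _ pAB) (@sum_crt R r t2 (fun y => A y * B y)) // big1 ?mulr0 // => x _.
transitivity (\sum_(y < t2) A (t2%:Z * x) * B (r%:Z * y)).
 by apply: eq_bigr => y _; congr (_ * _); rewrite // addrC.
by rewrite -mulr_sumr sum_scale // jacobi_sum0 ?mulr0.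
Qed.
End JacobiClass.

Section Special.
Variable R : realType.
Local Notation ee := (efrac R).
Variables (D t e m0 : nat).
Hypotheses (D0 : (0 < D)%N) (Dodd : odd D) (ot : odd t) (st : squarefree t) (e0 : (0 < e)%N).

(** What remains of the condition D | t e v x on x, where v = t v1. *)
Definition Rmod v1 := (D %/ gcdn D (t * e * (t * v1)))%N.
Definition Gpart v1 := gcdn (Rmod v1) v1.
Lemma RR_gt0 v1 : (0 < Rmod v1)%N.
Proof. by rewrite /Rmod divn_gt0 ?gcdn_gt0 dvdn_leq ?dvdn_gcdl. Qed.
Lemma RR_dvd v1 : (Rmod v1 %| D)%N. Proof. by rewrite /Rmod dvdn_div // dvdn_gcdl. Qed.
Lemma GG_gt0 v1 : (0 < Gpart v1)%N. Proof. by rewrite /Gpart gcdn_gt0 RR_gt0. Qed.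
Lemma dvd_RR v1 (x : int) : (D %| (t * e * (t * v1))%N%:Z * x)%Z = ((Rmod v1) %| x)%Z.
Proof.
set A := (t * e * (t * v1))%N; have g0 : (0 < gcdn D A)%N by rewrite gcdn_gt0 D0.
rewrite !dvdzE abszM !absz_nat /Rmod -/A.
have cp : coprime (D %/ gcdn D A) (A %/ gcdn D A) by rewrite /coprime -(eqn_pmul2r g0) mul1n muln_gcdl !divnK ?dvdn_gcdl ?dvdn_gcdr.
move: (divnK (dvdn_gcdl D A)) (divnK (dvdn_gcdr D A)) cp g0.
set g := gcdn D A; set Dq := (D %/ g)%N; set Aq := (A %/ g)%N => eD eA cp g0.
by rewrite -eD -eA mulnAC dvdn_pmul2r // Gauss_dvdr.
Qed.

(** The congruence for y is solvable only if G divides m0, as 2 x is a unit modulo G. It then fixes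
    y modulo R / G, and by [jacobi_class_sum] the symbol survives only if t divides R / G. *)
Lemma wsum_eval v1 x : (0 < v1)%N -> odd v1 -> coprimez x (t * v1)%N -> wsum R D t e m0 (t * v1) x = if (Gpart v1 %| m0)%N && (t %| Rmod v1 %/ Gpart v1)%N then
  (D * t %/ (Rmod v1 %/ Gpart v1))%:R * (jacobi (- 2 * (m0 %/ Gpart v1)%N%:Z * (v1 %/ Gpart v1)%N * x) t)%:~R
 else 0.
Proof.
move=> v10 ov cx; have t0 := odd_gt0 ot.
set G := Gpart v1; set Q := Rmod v1; have G0 := GG_gt0 v1; have Q0 := RR_gt0 v1; rewrite -/G -/Q in G0 Q0.
have GQ : (G %| Q)%N := dvdn_gcdl _ _; have Gv : (G %| v1)%N := dvdn_gcdr _ _.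
have QD : (Q %| D)%N := RR_dvd v1.
have gamE (y : nat) : gam t m0 (t * v1) y x = 2 * m0%:Z * x + y%:Z * v1 by rewrite /gam mulKn.
have wE (y : nat) : wgt R D t e m0 (t * v1) y x = if (Q %| 2 * m0%:Z * x + y%:Z * v1)%Z then (jacobi y t)%:~R else 0 by rewrite /wgt gamE dvd_RR.
rewrite /wsum; under eq_bigr => y _ do rewrite wE.
have cGx : coprimez G x.
 rewrite coprimez_sym; apply: coprimez_dvd cx; by rewrite dvdn_mull.
have oG : odd G := dvdn_odd Gv ov.
case: (boolP (G %| m0)%N) => Gm /=; last first.
 apply: big1 => y; case: ifP => // h; case/negP: Gm. have : (G %| 2 * m0%:Z * x)%Z.
 have e1 : 2 * m0%:Z * x = 2 * m0%:Z * x + y%:Z * v1 - y%:Z * v1 by ring.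
  rewrite {}e1; apply: rpredB; first by apply: dvdz_trans h; rewrite dvdzE. by rewrite dvdz_mull.
 by rewrite Gauss_dvdzl // Gauss_dvdzr // copz_nat coprimen2.
set r := (Q %/ G)%N; set m' := (m0 %/ G)%N; set v' := (v1 %/ G)%N.
have r0 : (0 < r)%N by rewrite divn_gt0 dvdn_leq.
have crv : coprime v' r by rewrite coprime_sym /coprime -(eqn_pmul2r G0) mul1n muln_gcdl !divnK.
pose a := - 2 * m'%:Z * x * iv r v'.
have Gz : G%:Z != 0 by rewrite -lt0n.
have crz : coprimez v' r by [].
have eqv y : (Q %| 2 * m0%:Z * x + y%:Z * v1)%Z = (r %| y%:Z - a)%Z.
 have -> : 2 * m0%:Z * x + y%:Z * v1 = (2 * m'%:Z * x + y%:Z * v') * G.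
  by rewrite -(divnK Gm) -(divnK Gv) -/m' -/v'; ring.
 rewrite -(divnK GQ) -/r PoszM dvdz_mul2r //. have hv := iv_mul crz. have -> : 2 * m'%:Z * x + y * v' = v'%:Z * (y%:Z - a) - 2 * m'%:Z * x * (v'%:Z * iv r v' - 1) by rewrite /a; ring.
 have hY : - (2 * m'%:Z * x * (v'%:Z * iv r v' - 1)) \in dvdz r by rewrite rpredN dvdz_mull. by rewrite (rpredDr _ hY) Gauss_dvdzr // coprimez_sym.
under eq_bigr => y _ do rewrite eqv.
have rDt : (r %| D * t)%N by apply: dvdn_mulr; apply: dvdn_trans QD; exact: dvdn_div.
have Dt0 : (0 < D * t)%N by rewrite muln_gt0 D0.
rewrite (jacobi_class_sum _ _ ot st r0 rDt (dvdn_mull D (dvdnn t)) Dt0).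
case: ifP => // tr; congr (_ * _%:~R); rewrite /a.
have cvt : coprimez v' t by apply: coprimez_dvd tr crz.
have hi : (t %| v'%:Z * iv r v' - 1)%Z by apply: dvdz_trans (iv_mul crz); rewrite dvdzE.
have j1 : jacobi v' t * jacobi (iv r v') t = 1 by rewrite -jacobiMl // (jacobi_eqm hi) jacobi_1l.
have t0' := t0; have j2 : jacobi v' t * jacobi v' t = 1 by rewrite -expr2 jacobi_sq.
rewrite [RHS](_ : _ = jacobi (- 2 * m'%:Z * x * v') t); last by congr jacobi; ring.
rewrite !jacobiMl //; congr (_ * _).
by rewrite -[LHS]mul1r -j2 -mulrA j1 mulr1.
Qed.

(** A unit and its inverse have the same symbol, so inverting the variable gives a twisted Ramanujan
    sum. *)
Lemma vsum_eval v1 (H : int) : (0 < v1)%N -> odd v1 -> \sum_(i < t * v1 | coprime i (t * v1)) ee (t * v1) (H * iv (t * v1) i) * wsum R D t e m0 (t * v1) i =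
 if (Gpart v1 %| m0)%N && (t %| Rmod v1 %/ Gpart v1)%N then
  (D * t %/ (Rmod v1 %/ Gpart v1))%:R * (jacobi (- 2 * (m0 %/ Gpart v1)%N%:Z * (v1 %/ Gpart v1)%N) t)%:~R *
  \sum_(k <- divisors v1) (mu k)%:~R * (jacobi k t)%:~R *
   (if ((v1 %/ k)%N %| H)%Z then (v1 %/ k)%:R * (jacobi (H %/ (v1 %/ k)%N)%Z t)%:~R * gauss R t 1 else 0)
 else 0.
Proof.
move=> v10 ov; have t0 := odd_gt0 ot.
have tv0 : (0 < t * v1)%N by rewrite muln_gt0 t0.
case: ifP => hc; last first.
 by rewrite big1 // => x cx; rewrite wsum_eval // hc mulr0.
rewrite -twisted_ramanujan //; set c := _%:R * _.
pose F x := (jacobi x t)%:~R * ee (t * v1) (H * x).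
have pF : per (t * v1) F.
 move=> x k; rewrite /F (@jacobi_eqm (x + _) x); last by rewrite addrC addKr PoszM -mulrA dvdz_mulr. by congr (_ * _); rewrite mulrDr mulrCA ee_per.
rewrite -(sum_inv tv0 pF) mulr_sumr; apply: eq_bigr => x cx.
have cz : coprimez x (t * v1)%N by [].
rewrite wsum_eval // hc /F.
have ci : jacobi x t = jacobi (iv (t * v1) x) t.
 have cxt : coprimez x t by apply: coprimez_dvd cz; rewrite dvdn_mulr. have hi : (t %| x%:Z * iv (t * v1) x - 1)%Z by apply: dvdz_trans (iv_mul cz); rewrite dvdzE dvdn_mulr.
 have j1 : jacobi x t * jacobi (iv (t * v1) x) t = 1 by rewrite -jacobiMl // (jacobi_eqm hi) jacobi_1l. have j2 : jacobi x t * jacobi x t = 1 by rewrite -expr2 jacobi_sq.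
 by rewrite -[RHS]mul1r -j2 -mulrA j1 mulr1.
by rewrite jacobiMl // ci /c; ring.
Qed.
End Special.

Lemma sum_divisors_rev (T : nmodType) n (F : nat -> T) : (0 < n)%N -> \sum_(k <- divisors n) F k = \sum_(j <- divisors n) F (n %/ j)%N.
Proof.
move=> n0; apply: (@sum_bij _ _ _ _ _ xpredT xpredT (fun k => n %/ k)%N (fun k => n %/ k)%N); rewrite ?divisors_uniq //.
 by move=> k; rewrite -!dvdn_divisors // => kn; split => //; [exact: dvdn_div | rewrite divnA // mulKn].
move=> k; rewrite -!dvdn_divisors // => kn _; split => //; first exact: dvdn_div.
by rewrite divnA // mulKn.
Qed.

Section Special.
Variable R : realType.
Local Notation ee := (efrac R).
Variables (D f t w m0 : nat) (chi : int -> R[i]).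
Hypotheses (D0 : (0 < D)%N) (Dodd : odd D) (f0 : (0 < f)%N) (fodd : odd f) (cDf : coprime D f) (cprim : primitive_character f chi) (ceven : even_character chi) (cquad : chi =1 quad_char R f) (ot : odd t) (t4 : (t %% 4 == 1)%N) (stf : squarefree (t * f)) (w0 : (0 < w)%N) (m00 : (0 < m0)%N).
Let t0 := odd_gt0 ot.
Let P := per8 f f.
Let ctf : coprime t f. Proof. exact: sqf_coprime. Qed.
Let st : squarefree t. Proof. by apply: sqf_dvd stf; rewrite dvdn_mulr. Qed.
Let q := (t * f * q0 D f (t * f))%N.
Definition Jf e v1 j : int := jacobi (f * (m0 %/ Gpart D t e v1) * (v1 %/ Gpart D t e v1) * (v1 %/ j) * (w %/ e %/ j) * e)%N%:Z t.

(** The part of the density at v = t v1 that varies with v1, in real form. In the Ramanujan sum j is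
    the divisor complementary to the Moebius variable. *)
Definition Bcount e v1 : R := if [&& coprime (e * v1) (2 * f), (Gpart D t e v1 %| m0)%N & (t %| Rmod D t e v1 %/ Gpart D t e v1)%N] then ((Rmod D t e v1 %/ Gpart D t e v1)%:R)^-1 *
  \sum_(j <- divisors v1 | (j %| w %/ e)%N) (mu (v1 %/ j))%:~R * j%:R * (Jf e v1 j)%:~R
 else 0.

(** totient P / P is the mean of Psi over its period; sqrt t comes from the Gauss sum modulo t. *)
Definition Kq : R := (totient P)%:R / P%:R / f%:R * Num.sqrt t%:R.
Let absz1 : `|1%Z|%N = 1%N. Proof. by []. Qed.
Lemma coprimeP8 k : coprime k P = coprime k (2 * f).
Proof. by rewrite /P /per8 !coprimeMr andbb -[8%N]/(2 ^ 3)%N coprime_pexpr. Qed.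
(** Here nu = 1 and u = f, so the value at odd k prime to f is (f / k)^2. *)
Lemma psi_special k : qchi chi 1 t f k = if coprime k P then 1 else 0.
Proof.
case: ifP => [ck|/negbT ck]; last by apply: contraNeq ck => /(psiC cprim ot absz1).
have := ck; rewrite coprimeP8 coprimeMr coprimen2 => /andP[ok ckf].
have k0 := odd_gt0 ok.
have [_ _ H] := quad_char_jacobi f0 fodd cprim ceven cquad.
by rewrite /qchi ok H // mul1r (jacobi_m1 R ot) t4 mul1r -rmorphM -expr2 jacobi_sq // copz_nat coprime_sym.
Qed.

Lemma Psi_total : \sum_(y < P) Psi f chi 1 t f y = (totient P)%:R.
Proof.
rewrite totient_count_coprime big_mkord natr_sum; apply: eq_bigr => y _.
rewrite (Psi_nat cprim ot f0 absz1) psi_special coprime_sym; by case: ifP.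
Qed.

Lemma mterm_special e v : (0 < v)%N -> odd e -> (e %| w)%N -> coprime e t -> mterm (t * f * m0) t q (phi D f chi 1 (t * f) t e) (hh 1 (t * f) w t e) v =
 if (t %| v)%N then (Kq * (jacobi e t)%:~R * Bcount e (v %/ t))%:C else 0.
Proof.
move=> v0 oe ew cet; have e0 := odd_gt0 oe.
have s1 : `|1%Z|%N = 1%N by [].
rewrite /q q_eq (mterm_eval m0 t D0 ot f0 (per8_gt0 f0 f0) stf (u_per8 f f) (@Psi_per R f chi 1 t f) (PsiM f0 cprim ot f0 s1) (@PsiC _ _ _ _ _ _ f0 cprim ot f0 s1) (phi_Psi D cprim ot f0 oe s1)) // -/P.
case: (boolP (t %| v)%N) => tv //=; set v1 := (v %/ t)%N.
have ev : v = (t * v1)%N by rewrite mulnC divnK.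
have v10 : (0 < v1)%N by move: v0; rewrite ev muln_gt0 => /andP[].
have cPD : coprime P D by rewrite coprime_sym coprimeP8 coprimeMr coprimen2 Dodd.
have ct2 : coprime t (2 * f) by rewrite coprimeMr coprimen2 ot.
have cev : coprime (e * v) P = coprime (e * v1) (2 * f) by rewrite coprimeP8 ev mulnCA coprimeMl ct2.
rewrite cPD cev /Bcount; case: (boolP (coprime (e * v1) (2 * f))) => cv /=; last by rewrite mulr0.
have [ov1 cvf] : odd v1 /\ coprime v1 f by move: cv; rewrite coprimeMl !coprimeMr !coprimen2 => /andP[_ /andP[]].
have hE : - hh 1 (t * f) w t e = (2 * (f * (w %/ e)))%N.
 by rewrite /hh /nu1 mulKn //; ring.
rewrite hE [in X in _ * X]ev vsum_eval //.
case: ifP => hc; last by rewrite !mulr0.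
rewrite (Psi_nat cprim ot f0 absz1) psi_special cev cv Psi_total.
have [_ _ Hchi] := quad_char_jacobi f0 fodd cprim ceven cquad.
rewrite Hchi // mulr1 -rmorphM.
have -> : jacobi f t * jacobi f t = 1 by rewrite -expr2 jacobi_sq // copz_nat coprime_sym.
rewrite rmorph1 mul1r (gs1 R ot) /eps_odd t4 mul1r sum_divisors_rev //.
set r := (Rmod D t e v1 %/ Gpart D t e v1)%N; set G := Gpart D t e v1.
have r0 : (0 < r)%N by rewrite divn_gt0 ?GG_gt0 // dvdn_leq ?RR_gt0 // dvdn_gcdl.
have rD : (r %| D)%N by apply: dvdn_trans (RR_dvd D t e v1); rewrite dvdn_div // dvdn_gcdl.
have e1 : (D * t %/ r)%:R = D%:R * t%:R / r%:R :> R[i].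
 apply: (mulIf (_ : r%:R != 0)); first by rewrite pnatr_eq0 -lt0n. have rn : (r%:R : R[i]) != 0 by rewrite pnatr_eq0 -lt0n. by rewrite -[LHS]natrM divnK ?dvdn_mulr // mulfVK // natrM.
rewrite e1 [in RHS]big_mkcond.
have nz x : (0 < x)%N -> (x%:R : R[i]) != 0 by move=> x0; rewrite pnatr_eq0 -lt0n.
have P0 : (0 < P)%N := per8_gt0 f0 f0.
have rc x : (x%:R : R)%:C = x%:R by exact: rmorph_nat.
have ic x : (x%:~R : R)%:C = x%:~R by exact: rmorph_int.
rewrite /Kq !(rmorphM (real_complex R)) !fmorphV /= !rc ic rmorph_sum /=.
have J2 : (jacobi 2 t)%:~R * (jacobi 2 t)%:~R = 1 :> R[i] by rewrite -rmorphM -expr2 jacobi_sq // copz_nat coprime2n.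
have Je : (jacobi e t)%:~R * (jacobi e t)%:~R = 1 :> R[i] by rewrite -rmorphM -expr2 jacobi_sq.
set S2 := \sum_(i <- _) _.
have eS : (jacobi (- 2 * (m0 %/ G)%N%:Z * (v1 %/ G)%N) t)%:~R * S2 = (jacobi e t)%:~R * (Num.sqrt t%:R)%:C *
  \sum_(j <- divisors v1) (if (j %| w %/ e)%N then (mu (v1 %/ j))%:~R * j%:R * (Jf e v1 j)%:~R else 0)%:C.
 rewrite /S2 !mulr_sumr; apply: eq_big_seq => j; rewrite -dvdn_divisors // => jv. have j0 := dvdn_gt0 v10 jv; have cj : coprime j (2 * f).
  by apply: coprime_dvdl jv _; move: cv; rewrite coprimeMl => /andP[].
 rewrite divnA // mulKn // dvdzE /=. have -> : (j %| 2 * (f * (w %/ e)))%N = (j %| w %/ e)%N by rewrite mulnA Gauss_dvdr. case: ifP => jw; last by rewrite !mulr0.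
 have -> : ((2 * (f * (w %/ e)))%N %/ j)%Z = 2 * f%:Z * (w %/ e %/ j)%N by rewrite divz_nat mulnA -muln_divA.
 rewrite !rmorphM /= rc !ic /Jf !PoszM !jacobiMl // !rmorphM /= -mulN1r jacobiMl // (jacobi_m1 R ot) t4 mul1r. move: J2 Je; move: (jacobi 2 t)%:~R (jacobi e t)%:~R => a b a2 b2.
 transitivity (a * a * (b * b) * (jacobi (m0 %/ G)%N t)%:~R * (jacobi (v1 %/ G)%N t)%:~R * ((mu (v1 %/ j))%:~R * (jacobi (v1 %/ j)%N t)%:~R * (j%:R * ((jacobi f t)%:~R * (jacobi (w %/ e %/ j)%N t)%:~R) * (Num.sqrt t%:R)%:C))).
  by rewrite b2; ring.
 by rewrite a2; ring.
rewrite -(mulrA (D%:R * t%:R / r%:R)) eS.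
move: (\sum_(i <- _) _) => S3; rewrite !natrM; field.
by rewrite !nz.
Qed.
End Special.

(** * Separation of the primes of t *)

Lemma gcdn_cross a b c d : coprime a b -> coprime a d -> coprime b c -> gcdn (a * b) (c * d) = (gcdn a c * gcdn b d)%N.
Proof.
move=> ab ad bc; apply/eqP; rewrite eqn_dvd; apply/andP; split.
 set G := gcdn (a * b) (c * d). have h : G = (gcdn G a * gcdn G b)%N.
  apply/eqP; rewrite eqn_dvd; apply/andP; split; last first.
   rewrite Gauss_dvd ?dvdn_gcdl //. by apply: coprime_dvdl (dvdn_gcdr _ _) _; apply: coprime_dvdr (dvdn_gcdr _ _) _.
  by rewrite muln_gcdl dvdn_gcd dvdn_mulr //= muln_gcdr dvdn_gcd dvdn_mull //= dvdn_gcdl.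
 rewrite h dvdn_mul //.
  rewrite dvdn_gcd dvdn_gcdr /=; have : (gcdn G a %| c * d)%N by apply: dvdn_trans (dvdn_gcdl _ _) (dvdn_gcdr _ _). by rewrite Gauss_dvdl //; apply: coprime_dvdl (dvdn_gcdr _ _) ad.
 rewrite dvdn_gcd dvdn_gcdr /=; have : (gcdn G b %| c * d)%N by apply: dvdn_trans (dvdn_gcdl _ _) (dvdn_gcdr _ _). by rewrite Gauss_dvdr //; apply: coprime_dvdl (dvdn_gcdr _ _) bc.
by rewrite dvdn_gcd !dvdn_mul ?dvdn_gcdl ?dvdn_gcdr.
Qed.

Lemma divnMM a b c d : (0 < c)%N -> (0 < d)%N -> (c %| a)%N -> (d %| b)%N -> ((a * b) %/ (c * d) = (a %/ c) * (b %/ d))%N.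
Proof.
move=> c0 d0 ca db; by rewrite -{1}(divnK ca) -{1}(divnK db) mulnACA mulnK // muln_gt0 c0.
Qed.

Lemma pi_coprime t a b : (0 < t)%N -> \pi(t).-nat a -> coprime b t -> coprime a b.
Proof.
move=> t0 pa cb; case: (posnP b) => [b0|b0].
 move: cb; rewrite b0 /coprime gcd0n => /eqP t1; move: pa; rewrite t1 => pa. rewrite gcdn0; apply/eqP/(@pnat_1 \pi(1)) => //; apply/pnatP; first by case/andP: pa.
 by move=> p pp pd; exfalso; have := pnatPpi pa; move=> /(_ p); rewrite mem_primes pp pd; case/andP: pa => -> _ /(_ isT).
by apply: pnat_coprime pa _; rewrite -coprime_pi' // coprime_sym.
Qed.

Lemma coprime_part t x : (0 < t)%N -> (0 < x)%N -> coprime x t -> (x`_\pi(t) = 1)%N.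
Proof.
move=> t0 x0 cx; have c1 := pi_coprime t0 (part_pnat \pi(t) x) cx.
by apply/eqP; rewrite -dvdn1 -(eqP c1) dvdn_gcd dvdnn dvdn_part.
Qed.

Lemma logn_pi_part p (pi : nat_pred) n : prime p -> (logn p n`_pi = if p \in pi then logn p n else 0)%N.
Proof.
move=> pp; case: ifP => pin.
 rewrite -logn_part -[RHS]logn_part partn_part // => r; rewrite inE => /eqP ->; exact: pin.
apply/eqP; rewrite -leqn0 leqNgt logn_gt0 mem_primes; apply/negP => /and3P[_ n0 h].
by have := pnatPpi (part_pnat pi n) (_ : (p \in \pi(n`_pi))%N); rewrite mem_primes pp n0 h pin => /(_ isT).
Qed.

Section Form.
Variables (R : realType) (D f t w m0 : nat).
Hypotheses (D0 : (0 < D)%N) (f0 : (0 < f)%N) (ot : odd t) (st : squarefree t) (w0 : (0 < w)%N) (m00 : (0 < m0)%N) (ctf : coprime t f).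
Let t0 := odd_gt0 ot.
Local Notation Bq := (Bcount R D f t w m0).
Local Notation RR := (Rmod D t).
Local Notation GG := (Gpart D t).

Lemma jacobi_nat_ne0 (x : nat) : jacobi x t != 0 -> coprime x t.
Proof. by move=> J; apply: contraNT J => nc; rewrite jacobi_0. Qed.

(** All factors in the numerator of the symbol are prime to t, so the divisibilities j | v1, G | v1,
    j | w / e and G | m0 preserve the part supported by t. *)
Lemma term_parts e v1 j : (0 < v1)%N -> (j %| v1)%N -> (e %| w)%N -> (j %| w %/ e)%N -> (GG e v1 %| m0)%N -> Jf D f t w m0 e v1 j != 0 ->
 [/\ (j`_\pi(t) = v1`_\pi(t))%N, (w`_\pi(t) = v1`_\pi(t))%N, (m0`_\pi(t) = v1`_\pi(t))%N & ((GG e v1)`_\pi(t) = v1`_\pi(t))%N].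
Proof.
move=> v10 jv ew jw Gm /jacobi_nat_ne0; rewrite !coprimeMl => /andP[/andP[/andP[/andP[/andP[_ c1] c2] c3] c4] c5].
have Gv : (GG e v1 %| v1)%N := dvdn_gcdr _ _.
have e0 := dvdn_gt0 w0 ew; have j0 := dvdn_gt0 v10 jv.
have pe a b : (0 < b)%N -> (a %| b)%N -> coprime (b %/ a) t -> (b`_\pi(t) = a`_\pi(t))%N.
 move=> b0 ab cab; have a0 := dvdn_gt0 b0 ab. have q0 : (0 < b %/ a)%N by rewrite divn_gt0 dvdn_leq. by rewrite -(divnK ab) (partnM _ q0 a0) (coprime_part t0 q0 cab) mul1n.
have jE := pe _ _ v10 jv c3; have GE := pe _ _ v10 Gv c2; have mE := pe _ _ m00 Gm c1.
have we0 : (0 < w %/ e)%N by rewrite divn_gt0 dvdn_leq.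
have wE := pe _ _ we0 jw c4.
have wE' : (w`_\pi(t) = (w %/ e)`_\pi(t))%N by rewrite -{1}(divnK ew) (partnM _ we0 e0) (coprime_part t0 e0 c5) muln1.
by rewrite wE' mE -GE; split; rewrite jE.
Qed.

(** At a prime p of t, let a be the exponent of p in v1. From t | R / G follows 1 + a <= ord_p(D) -
    2 - a, which is p by p the divisibility s^2 t^3 | D for s the part of w supported by t. *)
Lemma Bq_ne0 e v1 : (0 < v1)%N -> (e %| w)%N -> Bq e v1 != 0 -> [/\ (v1`_\pi(t) = w`_\pi(t))%N, (m0`_\pi(t) = w`_\pi(t))%N & ((w`_\pi(t)) ^ 2 * t ^ 3 %| D)%N].
Proof.
move=> v10 ew; rewrite /Bcount; case: ifP => [/and3P[_ Gm tr]|_]; last by rewrite eqxx.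
rewrite mulf_eq0 negb_or => /andP[_ S].
have [j [jv jw J]] : exists j, [/\ (j %| v1)%N, (j %| w %/ e)%N & Jf D f t w m0 e v1 j != 0].
 case: (boolP (has (fun j => (j %| w %/ e)%N && (Jf D f t w m0 e v1 j != 0)) (divisors v1))) => [/hasP[j]|/hasPn h].
  by rewrite -dvdn_divisors // => jv /andP[jw J]; exists j.
 move: S; rewrite big_seq_cond big1 ?eqxx // => j /andP[jv jw]; have := h j jv. by rewrite jw negbK => /eqP ->; rewrite mulr0.
have [jE wE mE GE] := term_parts v10 jv ew jw Gm J.
have e0 := dvdn_gt0 w0 ew.
have cet : coprime e t by move/jacobi_nat_ne0: J; rewrite !coprimeMl => /andP[_].
split; rewrite ?wE //.
have G0 : (0 < GG e v1)%N by exact: GG_gt0.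
have R0 : (0 < RR e v1)%N by exact: RR_gt0.
apply: dvdn_logn => // [|p pp]; first by rewrite muln_gt0 !expn_gt0 ?part_gt0 t0.
have wp : (0 < v1`_\pi(t) ^ 2)%N by rewrite expn_gt0 part_gt0.
have t3 : (0 < t ^ 3)%N by rewrite expn_gt0 t0.
rewrite (lognM _ wp t3) !lognX logn_pi_part //.
case: (boolP (p \in \pi(t))) => pt; last first.
 by have -> : logn p t = 0 by apply/eqP; rewrite -leqn0 leqNgt logn_gt0; move: pt; rewrite /= => ->.
have lt1 : logn p t = 1%N.
 by apply/eqP; rewrite eqn_leq (sqf_logn t0 pp st) logn_gt0.
have le0 : logn p e = 0%N.
 apply/eqP; rewrite -leqn0 leqNgt logn_gt0; apply/negP => pe. have : (p %| gcdn e t)%N by rewrite dvdn_gcd; move: pe pt; rewrite !mem_primes => /and3P[_ _ ->] /and3P[_ _ ->].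
 by rewrite (eqP cet) dvdn1 => /eqP p1; rewrite p1 in pp.
have GEp : logn p (GG e v1) = logn p v1.
 by have := congr1 (logn p) GE; rewrite !logn_pi_part // pt.
have h1 : (logn p v1 + 1 <= logn p (RR e v1))%N.
 have := dvdn_leq_log p (_ : 0 < RR e v1 %/ GG e v1)%N tr. rewrite divn_gt0 dvdn_leq ?dvdn_gcdl // => /(_ isT); rewrite logn_div ?dvdn_gcdl // lt1 GEp; clear; lia.
have A0 : (0 < t * e * (t * v1))%N by rewrite !muln_gt0 t0 e0.
have h2 : logn p (RR e v1) = (logn p D - minn (logn p D) (2 + logn p v1))%N.
 rewrite /Rmod logn_div ?dvdn_gcdl // logn_gcd // !lognM ?muln_gt0 ?t0 // lt1 le0; congr (_ - minn _ _)%N; clear; lia.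
move: h1; rewrite h2 lt1; clear; lia.
Qed.

Variables (Dt D' s m' n' : nat).
Hypotheses (eD : D = (Dt * D')%N) (pDt : \pi(t).-nat Dt) (cD' : coprime D' t) (ps : \pi(t).-nat s) (ew : w = (s * n')%N) (em : m0 = (s * m')%N) (cm : coprime m' t) (cn : coprime n' t) (sD : (s ^ 2 * t ^ 3 %| D)%N).

(** With [G0] and [gamq]: the counterparts of [Rmod], [Gpart] and [Bcount] with the primes of t
    removed. *)
Definition R0 e v0 := (D' %/ gcdn D' (e * v0))%N.
Definition G0 e v0 := gcdn (R0 e v0) v0.
Definition gamq e v0 : R := if coprime (e * v0) (2 * f) && (G0 e v0 %| m')%N then ((R0 e v0 %/ G0 e v0)%:R)^-1 * \sum_(j <- divisors v0 | (j %| n' %/ e)%N) (mu (v0 %/ j))%:~R * j%:R else 0.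

Let s0 : (0 < s)%N. Proof. by case/andP: ps. Qed.
Let n'0 : (0 < n')%N. Proof. by move: w0; rewrite ew muln_gt0 => /andP[]. Qed.
Let m'0 : (0 < m')%N. Proof. by move: m00; rewrite em muln_gt0 => /andP[]. Qed.
Let D'0 : (0 < D')%N. Proof. by move: D0; rewrite eD muln_gt0 => /andP[]. Qed.
Let pt : \pi(t).-nat t. Proof. exact: pnat_pi. Qed.
Lemma sDt : (t * t * s * (s * t) %| Dt)%N.
Proof.
have h : (t * t * s * (s * t) %| Dt * D')%N.
 by rewrite -eD; rewrite (_ : t * t * s * (s * t) = s ^ 2 * t ^ 3)%N //; ring.
rewrite Gauss_dvdl // in h; apply: (pi_coprime t0) cD'.
by rewrite !pnatM ps pt.
Qed.

Lemma R0_gt0 e v0 : (0 < R0 e v0)%N.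
Proof. by rewrite /R0 divn_gt0 ?gcdn_gt0 dvdn_leq ?dvdn_gcdl. Qed.
Lemma G0_gt0 e v0 : (0 < G0 e v0)%N. Proof. by rewrite gcdn_gt0 R0_gt0. Qed.
Lemma RR_form e v0 : coprime (e * v0) t -> RR e (s * v0) = (Dt %/ (t * t * s) * R0 e v0)%N.
Proof.
move=> cev; have tts : (t * t * s %| Dt)%N by apply: dvdn_trans sDt; rewrite dvdn_mulr.
have ptts : \pi(t).-nat (t * t * s)%N by rewrite !pnatM pt.
rewrite /Rmod eD (_ : t * e * (t * (s * v0)) = (t * t * s) * (e * v0))%N; last by ring.
rewrite gcdn_cross; last 3 first.
- exact: pi_coprime t0 pDt cD'.
- exact: pi_coprime t0 pDt cev.
- by rewrite coprime_sym; exact: pi_coprime t0 ptts cD'.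
rewrite gcdnC (gcdn_idPl tts) divnMM ?dvdn_gcdl ?gcdn_gt0 ?D'0 //.
by case/andP: ptts.
Qed.

Lemma R0_coprime e v0 : coprime (R0 e v0) t.
Proof. by apply: coprime_dvdl cD'; rewrite dvdn_div // dvdn_gcdl. Qed.
Lemma GG_form e v0 : coprime (e * v0) t -> GG e (s * v0) = (s * G0 e v0)%N.
Proof.
move=> cev; have cv : coprime v0 t by move: cev; rewrite coprimeMl => /andP[].
have tts : (t * t * s %| Dt)%N by apply: dvdn_trans sDt; rewrite dvdn_mulr.
have pq : \pi(t).-nat (Dt %/ (t * t * s))%N by apply: pnat_dvd pDt; exact: dvdn_div.
rewrite /Gpart RR_form // gcdn_cross; last 3 first.
- exact: pi_coprime t0 pq (R0_coprime _ _).
- exact: pi_coprime t0 pq cv.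
- by rewrite coprime_sym; exact: pi_coprime t0 ps (R0_coprime _ _).
rewrite gcdnC (gcdn_idPl _) // dvdn_divRL // mulnC; apply: dvdn_trans sDt.
by rewrite dvdn_mul // dvdn_mulr.
Qed.

(** The parts of R and G supported by t are Dt / (t^2 s) and s. The numerator of the symbol becomes
    f m' n' v0^2 / (G j)^2, so up to squares it is f m' n' for every j. *)
Lemma Bq_form e v0 : (0 < v0)%N -> (e %| n')%N -> coprime v0 t ->  Bq e (s * v0) = (jacobi (f * m' * n')%N t)%:~R * ((t ^ 2 * s ^ 3)%:R / Dt%:R) * gamq e v0.
Proof.
move=> v00 en cv; have e0 := dvdn_gt0 n'0 en.
have cet : coprime e t := coprime_dvdl en cn.
have cev : coprime (e * v0) t by rewrite coprimeMl cet.
have cst : s = 1%N \/ ~~ coprime s (2 * f) \/ coprime s (2 * f) by right; case: coprime; [right | left].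
have cs2 : coprime s (2 * f).
 by apply: (pi_coprime t0 ps); rewrite coprimeMl coprime2n ot coprime_sym.
have ew' : (w %/ e = s * (n' %/ e))%N by rewrite ew muln_divA.
have mE x : (s * x %| m0)%N = (x %| m')%N by rewrite em dvdn_pmul2l.
rewrite /Bcount /gamq GG_form // RR_form // ew' mE.
have -> : coprime (e * (s * v0)) (2 * f) = coprime (e * v0) (2 * f) by rewrite mulnCA coprimeMl cs2.
set G := G0 e v0; set Q := R0 e v0.
have GQ : (G %| Q)%N := dvdn_gcdl _ _; have Gv : (G %| v0)%N := dvdn_gcdr _ _.
have Gp : (0 < G)%N := G0_gt0 e v0; have Qp : (0 < Q)%N := R0_gt0 e v0.
have tts : (t * t * s %| Dt)%N by apply: dvdn_trans sDt; rewrite dvdn_mulr.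
have sq : (s * t %| Dt %/ (t * t * s))%N by rewrite dvdn_divRL // mulnC sDt.
have sq' : (s %| Dt %/ (t * t * s))%N by apply: dvdn_trans sq; rewrite dvdn_mulr.
have rE : (Dt %/ (t * t * s) * Q %/ (s * G) = (Dt %/ (t * t * s) %/ s) * (Q %/ G))%N by rewrite divnMM.
have tr : (t %| (Dt %/ (t * t * s) %/ s) * (Q %/ G))%N by rewrite dvdn_mulr // dvdn_divRL // mulnC.
rewrite rE tr andbT; case: ifP => [/andP[c2f Gm]|_]; last by rewrite !mulr0.
set J := jacobi _ t.
have sv0 : (0 < s * v0)%N by rewrite muln_gt0 s0.
have -> : \sum_(j <- divisors (s * v0) | (j %| s * (n' %/ e))%N) (mu (s * v0 %/ j))%:~R * j%:R * (Jf D f t w m0 e (s * v0) j)%:~R =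
 \sum_(j <- divisors v0 | (j %| n' %/ e)%N) (mu (v0 %/ j))%:~R * (s * j)%:R * J%:~R :> R. rewrite (bigID (fun j => s %| j)%N) /= [X in _ + X]big1_seq ?addr0; last first.
  move=> j /andP[/andP[jn nsj]]; rewrite -dvdn_divisors // => jv. case: (eqVneq (Jf D f t w m0 e (s * v0) j) 0) => [->|/term_parts]; first by rewrite mulr0.
  rewrite -ew' in jn; rewrite GG_form // mE => /(_ sv0 jv (_ : (e %| w)%N) jn Gm) h. have {h}[|jE _ _ _] := h; first by rewrite ew dvdn_mull.
  case/negP: nsj; apply: dvdn_trans (dvdn_part \pi(t) j); rewrite jE partnM // part_pnat_id // dvdn_mulr //.
 transitivity (\sum_(j <- divisors v0 | (j %| n' %/ e)%N) (mu (s * v0 %/ (s * j)))%:~R * (s * j)%:R * (Jf D f t w m0 e (s * v0) (s * j))%:~R : R).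
  apply: (@sum_bij _ _ _ _ _ _ _ (fun j => j %/ s)%N (fun j => s * j)%N (fun j => (mu (s * v0 %/ j))%:~R * j%:R * (Jf D f t w m0 e (s * v0) j)%:~R)); rewrite ?divisors_uniq //; last first.
   by move=> j; rewrite -!dvdn_divisors // => jv jn; rewrite !dvdn_pmul2l // jn dvdn_mulr // mulKn.
  move=> j; rewrite -!dvdn_divisors // => jv /andP[jn sj]; have ej : j = (s * (j %/ s))%N by rewrite mulnC divnK. by rewrite -ej; split => //; rewrite -(dvdn_pmul2l s0) -ej.
 rewrite big_seq_cond [RHS]big_seq_cond; apply: eq_bigr => j /andP[]; rewrite -!dvdn_divisors // => jv jn.
 have jp := dvdn_gt0 v00 jv; rewrite divnMl //; congr (_ * _ * _%:~R); rewrite /Jf GG_form // em ew' !divnMl // -/G /J.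
 have cGj : coprime (G * j) t by rewrite coprimeMl (coprime_dvdl Gv cv) (coprime_dvdl jv cv). rewrite -[RHS](@jacobi_sqr_mul R _ v0) // -(@jacobi_sqr_mul R _ (G * j)%N) //.
 congr jacobi; rewrite !expr2 -!PoszM; congr Posz. have a1 := divnK Gm; have a2 := divnK Gv; have a3 := divnK jv; have a4 := divnK jn; have a5 := divnK en.
 transitivity (f * ((m' %/ G) * G) * ((v0 %/ G) * G) * ((v0 %/ j) * j) * ((n' %/ e %/ j * j) * e))%N; first by ring. by rewrite a1 a2 a3 a4 a5; ring.
have nz x : (0 < x)%N -> (x%:R : R) != 0 by move=> x0; rewrite pnatr_eq0 -lt0n.
have -> : \sum_(j <- divisors v0 | (j %| n' %/ e)%N) (mu (v0 %/ j))%:~R * (s * j)%:R * J%:~R = J%:~R * s%:R * \sum_(j <- divisors v0 | (j %| n' %/ e)%N) (mu (v0 %/ j))%:~R * j%:R :> R.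
 by rewrite mulr_sumr; apply: eq_bigr => j _; rewrite natrM; ring.
move: (\sum_(_ <- _ | _) _) => S; rewrite natrM.
have Dt0 : (0 < Dt)%N by case/andP: pDt.
have dd : (Dt %/ (t * t * s) %/ s)%:R = Dt%:R / (t%:R * t%:R * s%:R * s%:R) :> R.
 apply: (mulIf (_ : (t * t * s * s)%:R != 0)); first by apply: nz; rewrite !muln_gt0 t0 s0. have dv : (t * t * s * s %| Dt)%N by apply: dvdn_trans sDt; rewrite dvdn_mul // dvdn_mulr.
 by rewrite -[LHS]natrM -divnMA divnK // !natrM mulfVK // !mulf_neq0 ?nz.
rewrite dd !natrM; field.
by rewrite !nz //= divn_gt0 dvdn_leq.
Qed.
End Form.

(** * The sum over odd squares and the Moebius series *)

Section TanBound.
Import normed_module.numFieldNormedType.Exports.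
Variable R : realType.

Lemma atan_le (y : R) : 0 <= y -> atan y <= y.
Proof.
move=> y0; have [|x xz e] := @derive.MVT_segment R atan (fun x => (1 + x ^+ 2)^-1) 0 y y0.
 by apply: (@subspace_topology.continuous_subspaceT _ _ _ atan) => x; exact: continuous_atan.
move: e; rewrite atan0 !subr0 => ->; rewrite -[X in _ <= X]mul1r; apply: ler_wpM2r => //.
by rewrite invf_le1 ?lerDl ?sqr_ge0 // ltr_pwDl // sqr_ge0.
Qed.

End TanBound.

Section Basel.
Variable R : realType.

(** From sin x <= x <= tan x and 1 / sin^2 = 1 + 1 / tan^2. *)
Lemma csc2_bounds (x : R) : 0 < x < pi / 2 -> (x ^+ 2)^-1 <= (sin x ^+ 2)^-1 <= (x ^+ 2)^-1 + 1.
Proof.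
move=> /andP[x0 x2]; have s0 : 0 < sin x by apply: sin_gt0_pihalf; rewrite x0.
have c0 : 0 < cos x by apply: cos_gt0_pihalf; rewrite (lt_trans _ x0) // oppr_lt0 divr_gt0 ?pi_gt0.
have sx : sin x <= x.
 have [c _ ->] := sin_mvt (ltW x0); rewrite -[X in _ <= X]mul1r; apply: ler_wpM2r; [exact: ltW | exact: cos_le1].
have t0 : 0 < tan x by rewrite /tan divr_gt0.
have xt : x <= tan x.
 rewrite -{1}(@tanK R x) ?atan_le ?ltW // in_itv /= x2 andbT (lt_trans _ x0) // oppr_lt0 divr_gt0 ?pi_gt0 //.
have sq a b : 0 < a -> a <= b -> (b ^+ 2)^-1 <= (a ^+ 2)^-1 :> R.
 by move=> a0 ab; rewrite lef_pV2 ?posrE ?exprn_gt0 ?(lt_le_trans a0) // ler_pXn2r // nnegrE ltW // (lt_le_trans a0).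
apply/andP; split; first exact: sq.
have -> : (sin x ^+ 2)^-1 = (tan x ^+ 2)^-1 + 1.
 have n1 : sin x != 0 by rewrite gt_eqF. rewrite /tan expr_div_n invf_div; apply: (mulfI (_ : sin x ^+ 2 != 0)); first by rewrite expf_neq0. by rewrite mulrDr mulr1 mulrCA !mulfV ?expf_neq0 // mulr1 cos2Dsin2.
by rewrite lerD2r; apply: sq.
Qed.

Definition cscsum k : R := \sum_(j < 2 ^ k) (sin ((j.*2.+1)%:R * pi / (2 ^ k.+2)%:R) ^+ 2)^-1.
(* Doubling sums the values of sin^-2 at odd multiples of pi / 2^(k+2) in closed form. *)
Lemma csc_double (y : R) : sin y != 0 -> cos y != 0 -> (sin (y *+ 2) ^+ 2)^-1 = 4^-1 * ((sin y ^+ 2)^-1 + (cos y ^+ 2)^-1).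
Proof.
move=> n1 n2; have := cos2Dsin2 y; rewrite sin_mulr2n -mulr_natl; move: (sin y) (cos y) n1 n2 => s c n1 n2 e.
have -> : (s ^+ 2)^-1 + (c ^+ 2)^-1 = (c ^+ 2 + s ^+ 2) / (s ^+ 2 * c ^+ 2) by field; rewrite n2.
by rewrite e; field; rewrite n2.
Qed.

(** Induction on k: the angles pair up as y and pi / 2 - y, and [csc_double] merges each pair into
    four times the term at 2 y. *)
Lemma cscsumE k : cscsum k = 2 * (4 ^ k)%:R.
Proof.
have pi0 := pi_gt0 R.
have ang m K : (0 < m < 2 ^ K.+1)%N -> 0 < m%:R * (pi : R) / (2 ^ K.+2)%:R < pi / 2.
 move=> /andP[m0 mK]; have P : 0 < (2 ^ K.+2)%:R :> R by rewrite ltr0n expn_gt0. have mp : 0 < m%:R * (pi : R) by rewrite mulr_gt0 // ltr0n. apply/andP; split; first by rewrite divr_gt0.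
 by rewrite ltr_pdivrMr // mulrC -mulrA ltr_pM2l // natrM mulrA mulVf ?pnatr_eq0 // mul1r ltr_nat.
elim: k => [|k IH].
 rewrite /cscsum big_ord1 mul1r. have -> : sin (pi / (2 ^ 2)%:R) ^+ 2 = 1 / 2 :> R.
  have h := cosD (pi / 4) (pi / 4 : R); have e : pi / 4 + pi / 4 = pi / 2 :> R by field. rewrite e cos_pihalf in h; have := cos2Dsin2 (pi / 4 : R). have -> : (2 ^ 2)%:R = 4 by [].
  by move: h; rewrite -!expr2; lra.
 by rewrite invf_div divr1 mulr1.
have E : (4 ^ k.+1)%:R = 4 * (4 ^ k)%:R :> R by rewrite expnS natrM.
rewrite E mulrCA -IH /cscsum expnS mul2n -addnn big_split_ord /= [X in _ + X](reindex_inj rev_ord_inj) -big_split /= mulr_sumr; apply: eq_bigr => j _.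
set y := (j.*2.+1)%:R * pi / (2 ^ k.+3)%:R.
have jk := ltn_ord j; have p2 : (2 ^ k.+1 = 2 ^ k + 2 ^ k)%N by rewrite expnS mul2n addnn.
have yr : 0 < y < pi / 2 by apply: ang; rewrite expnS; move: jk p2; clear; lia.
have yy : (j.*2.+1)%:R * pi / (2 ^ k.+2)%:R = y *+ 2.
 have g (a p b : R) : b != 0 -> a * p / b = a * p / (2 * b) * 2 by move=> bn; field. by rewrite /y (expnS 2 k.+2) natrM -[RHS]mulr_natr; apply: g; rewrite pnatr_eq0 expn_eq0.
have sy : sin y != 0 by rewrite gt_eqF // sin_gt0_pihalf.
have cy : cos y != 0.
 move/andP: yr => [y0 y2]; rewrite gt_eqF // cos_gt0_pihalf // y2 andbT (lt_trans _ y0) // oppr_lt0 divr_gt0 //.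
rewrite yy csc_double // mulrA mulfV ?mul1r; last by lra.
congr (_ + (_ ^+ 2)^-1).
have -> : ((2 ^ k + (2 ^ k - j.+1)).*2.+1)%:R * pi / (2 ^ k.+3)%:R = pi / 2 - y.
 have e1 : ((2 ^ k + (2 ^ k - j.+1)).*2.+1)%:R = (2 ^ k.+2)%:R - (j.*2.+1)%:R :> R.
  rewrite -natrB; last by rewrite !expnS; move: (nat_of_ord j) jk; clear; move: (2 ^ k)%N => a b; lia. by congr (_%:R); rewrite !expnS; move: (nat_of_ord j) jk; clear; move: (2 ^ k)%N => a b; lia.
 have g (a p b : R) : b != 0 -> (b - a) * p / (2 * b) = p / 2 - a * p / (2 * b) by move=> bn; field. by rewrite e1 /y (expnS 2 k.+2) natrM; apply: g; rewrite pnatr_eq0 expn_eq0.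
by rewrite -cosBpihalf -cosN; congr cos; ring.
Qed.

Definition oddsum M : R := \sum_(j < M) ((j.*2.+1)%:R ^+ 2)^-1.
(** Summing [csc2_bounds] over the 2^k angles leaves an error of at most 2^k, which the scaling
    divides by a multiple of 4^k. *)
Lemma oddsum_bounds k : pi ^+ 2 / 8 - pi ^+ 2 / (16 * (2 ^ k)%:R) <= oddsum (2 ^ k) <= pi ^+ 2 / 8.
Proof.
have pi0 := pi_gt0 R; have P : 0 < (2 ^ k)%:R :> R by rewrite ltr0n expn_gt0.
pose x j : R := (j.*2.+1)%:R * pi / (2 ^ k.+2)%:R.
have E2 : (2 ^ k.+2)%:R = 4 * (2 ^ k)%:R :> R by rewrite !expnS mulnA natrM.
have E4 : (4 ^ k)%:R = (2 ^ k)%:R ^+ 2 :> R by rewrite -natrX -expnM mulnC expnM.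
have oE : oddsum (2 ^ k) = (pi ^+ 2 / (16 * (2 ^ k)%:R ^+ 2)) * \sum_(j < 2 ^ k) (x j ^+ 2)^-1.
 have g (p a b : R) : p != 0 -> a != 0 -> b != 0 -> (b ^+ 2)^-1 = p ^+ 2 / (16 * a ^+ 2) * ((b * p / (4 * a)) ^+ 2)^-1.
  by move=> pn an bn; field; rewrite pn an.
 by rewrite /oddsum mulr_sumr; apply: eq_bigr => j _; rewrite /x E2; apply: g; rewrite gt_eqF.
have xr (j : 'I_(2 ^ k)) : 0 < x j < pi / 2.
 rewrite /x E2; have jk : (j.*2.+1)%:R < 2 * (2 ^ k)%:R :> R.
  by rewrite -natrM ltr_nat; move: (nat_of_ord j) (ltn_ord j); clear; move: (2 ^ k)%N => a b; lia.
 rewrite divr_gt0 ?mulr_gt0 //= ltr_pdivrMr ?mulr_gt0 //. have g (p a : R) : p / 2 * (4 * a) = p * (2 * a) by field. by rewrite g mulrC ltr_pM2l.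
have c0 : 0 < (pi : R) ^+ 2 / (16 * (2 ^ k)%:R ^+ 2) by rewrite divr_gt0 ?mulr_gt0.
have up : \sum_(j < 2 ^ k) (x j ^+ 2)^-1 <= 2 * (4 ^ k)%:R.
 by rewrite -cscsumE; apply: ler_sum => j; have /andP[] := csc2_bounds (xr j).
have lo : 2 * (4 ^ k)%:R - (2 ^ k)%:R <= \sum_(j < 2 ^ k) (x j ^+ 2)^-1.
 rewrite -cscsumE lerBlDr /cscsum -[X in _ + X%:R]card_ord -sumr_const -big_split /=. by apply: ler_sum => j; have /andP[] := csc2_bounds (xr j).
have Pn : (2 ^ k)%:R != 0 :> R by rewrite gt_eqF.
rewrite oE; apply/andP; split.
 have -> : (pi : R) ^+ 2 / 8 - pi ^+ 2 / (16 * (2 ^ k)%:R) = (pi ^+ 2 / (16 * (2 ^ k)%:R ^+ 2)) * (2 * (4 ^ k)%:R - (2 ^ k)%:R).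
  have g (p a : R) : a != 0 -> p ^+ 2 / 8 - p ^+ 2 / (16 * a) = p ^+ 2 / (16 * a ^+ 2) * (2 * a ^+ 2 - a) by move=> an; field. by rewrite E4; exact: g.
 by rewrite ler_pM2l.
have g (p a : R) : a != 0 -> p ^+ 2 / 8 = p ^+ 2 / (16 * a ^+ 2) * (2 * a ^+ 2) by move=> an; field.
by rewrite (g _ _ Pn) ler_pM2l // -E4.
Qed.

Definition rtends (u : nat -> R) (l : R) : Prop := forall eta : R, 0 < eta -> exists n0, forall n, (n0 <= n)%N -> `|u n - l| <= eta.

Definition zsum (P : pred nat) N : R := \sum_(1 <= n < N.+1 | P n) (n%:R ^+ 2)^-1.
Lemma zsum_mono P M N : (M <= N)%N -> zsum P M <= zsum P N.
Proof.
move=> MN; rewrite /zsum [X in _ <= X](@big_cat_nat _ _ _ M.+1) //= lerDl.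
by apply: sumr_ge0 => n; rewrite invr_ge0 exprn_ge0.
Qed.

Lemma zsum_odd M : zsum odd M.*2 = oddsum M.
Proof.
elim: M => [|M IH]; first by rewrite /zsum /oddsum big_geq // big_ord0.
by rewrite /zsum big_mkcond big_nat_recr //= big_nat_recr //= -big_mkcond -/(zsum odd M.*2) IH odd_double addr0 /oddsum big_ord_recr.
Qed.

Lemma basel_odd : rtends (zsum odd) (pi ^+ 2 / 8).
Proof.
move=> eta e0; have pi0 := pi_gt0 R.
pose k := Num.bound (pi ^+ 2 / (16 * eta)).
have kE : pi ^+ 2 / (16 * eta) <= (2 ^ k)%:R.
 apply: le_trans (_ : k%:R <= _); last by rewrite ler_nat ltnW // ltn_expl. by apply: ltW; apply: archi_boundP; rewrite divr_ge0 ?mulr_ge0 ?ltW.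
have P : 0 < (2 ^ k)%:R :> R by rewrite ltr0n expn_gt0.
have small : pi ^+ 2 / (16 * (2 ^ k)%:R) <= eta.
 rewrite ler_pdivrMr; move: kE; rewrite ler_pdivrMr ?mulr_gt0 // => h. by apply: le_trans h _; rewrite le_eqVlt; apply/orP; left; apply/eqP; ring.
exists (2 ^ k).*2 => n hn; rewrite ler_norml; apply/andP; split.
 have /andP[h _] := oddsum_bounds k; have := zsum_mono odd hn; rewrite zsum_odd; lra.
have /andP[_ h] := oddsum_bounds n; have : zsum odd n <= zsum odd (2 ^ n).*2.
 by apply: zsum_mono; rewrite -addnn; apply: leq_trans (leq_addr _ _); rewrite ltnW // ltn_expl.
rewrite zsum_odd; lra.
Qed.

Lemma rtends_div u l k : (0 < k)%N -> rtends u l -> rtends (fun n => u (n %/ k)%N) l.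
Proof.
move=> k0 h eta /h[n0 H]; exists (n0 * k) => n hn; apply: H; by rewrite leq_divRL.
Qed.

Lemma rtends_ext u v l : u =1 v -> rtends u l -> rtends v l.
Proof. by move=> uv H eta /H[n0 h]; exists n0 => n /h; rewrite uv. Qed.
Lemma rtendsB_scale u l v m a : rtends u l -> rtends v m -> rtends (fun n => u n - a * v n) (l - a * m).
Proof.
move=> hu hv eta e0; have e2 : 0 < eta / 2 by rewrite divr_gt0.
have a1 : 0 < `|a| + 1 by rewrite ltr_wpDl.
have [n1 h1] := hu _ e2; have [n2 h2] := hv _ (divr_gt0 e2 a1); exists (maxn n1 n2) => n; rewrite geq_max => /andP[/h1 c1 /h2 c2].
have -> : u n - a * v n - (l - a * m) = (u n - l) - a * (v n - m) by ring.
apply: le_trans (ler_normB _ _) _; rewrite normrM.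
have : `|a| * `|v n - m| <= eta / 2.
 move: c2; rewrite ler_pdivlMr // => c2; apply: le_trans c2; rewrite mulrC; apply: ler_wpM2l => //; lra.
lra.
Qed.

Definition copP (s : seq nat) n := odd n && all (fun p => ~~ (p %| n)%N) s.

Lemma zsum_prime s p N : prime p -> odd p -> p \notin s -> all prime s -> zsum (copP (p :: s)) N = zsum (copP s) N - (p%:R ^+ 2)^-1 * zsum (copP s) (N %/ p).
Proof.
move=> pp op ps sp; have p0 := prime_gt0 pp; apply/eqP; rewrite -subr_eq opprK addrC eq_sym; apply/eqP.
rewrite /zsum (bigID (fun n => p %| n)%N) /=; congr (_ + _); last first.
 by apply: eq_bigl => n; rewrite /copP -andbA [all _ _ && _]andbC.
rewrite mulr_sumr.
transitivity (\sum_(1 <= k < (N %/ p).+1 | copP s k) ((p * k)%:R ^+ 2)^-1 : R).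
 apply: (@sum_bij _ _ _ _ _ _ _ (fun n => n %/ p)%N (fun k => p * k)%N (fun n => (n%:R ^+ 2)^-1)); rewrite ?iota_uniq //.
  move=> n; rewrite !mem_index_iota !ltnS => /andP[n1 nN] /andP[/andP[on an] pn]. have en : n = (p * (n %/ p))%N by rewrite mulnC divnK. split; rewrite //; first by rewrite divn_gt0 dvdn_leq //= leq_div2r.
  rewrite /copP (dvdn_odd (dvdn_div pn) on); apply/allP => r rs; apply: contra (allP an r rs) => h. by apply: dvdn_trans h _; exact: dvdn_div.
 move=> k; rewrite !mem_index_iota !ltnS => /andP[k1 kN] /andP[ok ak]; rewrite mulKn // dvdn_mulr // andbT; split => //.
  by rewrite muln_gt0 p0 k1 mulnC -leq_divRL.
 rewrite /copP oddM op ok; apply/allP => r rs; have pr := allP sp r rs. rewrite Euclid_dvdM // negb_or (allP ak r rs) andbT dvdn_prime2 //; by apply: contraNneq ps => <-.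
by apply: eq_bigr => k; rewrite natrM exprMn invfM.
Qed.

Lemma zsum_limit s : uniq s -> all prime s -> all odd s -> rtends (zsum (copP s)) (pi ^+ 2 / 8 * \prod_(p <- s) (1 - (p%:R ^+ 2)^-1)).
Proof.
elim: s => [|p s IH] /=.
 move=> _ _ _; rewrite big_nil mulr1; apply: rtends_ext basel_odd => n. by apply: eq_bigl => k; rewrite /copP andbT.
move=> /andP[ps us] /andP[pp sp] /andP[op so]; have H := IH us sp so.
rewrite big_cons; apply: (@rtends_ext (fun N => zsum (copP s) N - (p%:R ^+ 2)^-1 * zsum (copP s) (N %/ p))).
 by move=> N; rewrite zsum_prime.
set Pr := \prod_(_ <- s) _ in H *.
have -> : pi ^+ 2 / 8 * ((1 - (p%:R ^+ 2)^-1) * Pr) = pi ^+ 2 / 8 * Pr - (p%:R ^+ 2)^-1 * (pi ^+ 2 / 8 * Pr) by ring.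
by apply: rtendsB_scale => //; apply: rtends_div => //; exact: prime_gt0.
Qed.

Lemma zsum_tail P M N : (0 < M)%N -> (M <= N)%N -> zsum P N - zsum P M <= M%:R^-1.
Proof.
move=> M0 MN; suff H : zsum P N - zsum P M <= M%:R^-1 - N%:R^-1.
 by apply: le_trans H _; rewrite gerBl invr_ge0.
elim: N MN => [|N IH]; first by rewrite leqn0 => /eqP ->; rewrite subrr subrr.
rewrite leq_eqVlt => /orP[/eqP <-|]; first by rewrite !subrr.
rewrite ltnS => MN; have := IH MN; have N0 : (0 < N)%N by apply: leq_trans MN.
have : zsum P N.+1 <= zsum P N + (N%:R^-1 - N.+1%:R^-1); last first.
 by move: (zsum P N.+1) zsum zsum (M%:R^-1) (N%:R^-1) (N.+1%:R^-1) => a b c x y z h1 h2; lra.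
rewrite /zsum big_mkcond big_nat_recr //= -big_mkcond lerD2l.
have n0 : 0 < N%:R :> R by rewrite ltr0n. have -> : N%:R^-1 - N.+1%:R^-1 = (N%:R * N.+1%:R)^-1 :> R.
 by rewrite -natr1; field; rewrite natr1 !gt_eqF.
case: ifP => _; last by rewrite invr_ge0 mulr_ge0.
by rewrite lef_pV2 ?posrE ?mulr_gt0 // ler_wpM2r // ler_nat.
Qed.

Definition msumP P V : R := \sum_(1 <= v < V.+1 | P v) (mu v)%:~R / v%:R ^+ 2.

(** The indicator of P is completely multiplicative, so the terms with v k = n collect the sum of mu
    over the divisors of n, which leaves n = 1. *)
Lemma msum_zsum (P : pred nat) V : (forall a b, (0 < a)%N -> (0 < b)%N -> P (a * b)%N = P a && P b) -> P 1%N -> (0 < V)%N -> \sum_(1 <= v < V.+1 | P v) (mu v)%:~R / v%:R ^+ 2 * zsum P (V %/ v) = 1.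
Proof.
move=> PM P1 V0.
pose F v k : R := if P (v * k)%N then (mu v)%:~R / (v * k)%:R ^+ 2 else 0.
transitivity (\sum_(1 <= v < V.+1) \sum_(1 <= n < V.+1) if (v %| n)%N then F v (n %/ v)%N else 0).
 rewrite big_mkcond; apply: eq_big_nat => v /andP[v0 vV]; rewrite -big_mkcond /=. have -> : \sum_(1 <= n < V.+1 | (v %| n)%N) F v (n %/ v)%N = \sum_(1 <= k < (V %/ v).+1) F v k.
  transitivity (\sum_(1 <= k < (V %/ v).+1) F v (v * k %/ v)%N); last by apply: eq_bigr => k; rewrite mulKn.
  apply: (@sum_bij _ _ _ _ _ (fun n => v %| n)%N xpredT (fun n => n %/ v)%N (fun k => v * k)%N (fun n => F v (n %/ v)%N)); rewrite ?iota_uniq //.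
   move=> n; rewrite !mem_index_iota !ltnS => /andP[n1 nV] vn; split => //; last by rewrite mulnC divnK. by rewrite divn_gt0 dvdn_leq //= leq_div2r.
  move=> k; rewrite !mem_index_iota !ltnS => /andP[k1 kV] _; rewrite dvdn_mulr // mulKn //; split => //. by rewrite muln_gt0 v0 k1 mulnC -leq_divRL.
 case: ifP => Pv; last first.
  by rewrite big_nat_cond big1 // => k /andP[/andP[k0 _] _]; rewrite /F PM // Pv.
 rewrite /zsum mulr_sumr big_mkcond; apply: eq_big_nat => k /andP[k0 _]; rewrite /F PM // Pv /=. by case: ifP => //; rewrite -mulrA -invfM -exprMn -natrM.
rewrite exchange_big (bigD1_seq 1%N) ?iota_uniq ?mem_index_iota //=.
have inner n : (0 < n < V.+1)%N -> \sum_(1 <= v < V.+1) (if (v %| n)%N then F v (n %/ v)%N else 0) = if P n then (n == 1%N)%:R / n%:R ^+ 2 else 0.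
 move=> /andP[n0 nV]; transitivity (\sum_(v <- divisors n) F v (n %/ v)%N).
  rewrite -big_mkcond -big_filter; apply: perm_big; apply: uniq_perm; rewrite ?filter_uniq ?iota_uniq ?divisors_uniq //.
  move=> v; rewrite mem_filter mem_index_iota -dvdn_divisors; case: (boolP (v %| n)%N) => //= vn. by rewrite (dvdn_gt0 n0 vn) ltnS (leq_trans (dvdn_leq n0 vn)).
 transitivity (\sum_(v <- divisors n) if P n then (mu v)%:~R / n%:R ^+ 2 else 0 : R).
  by apply: eq_big_seq => v; rewrite -dvdn_divisors // => vn; rewrite /F mulnC divnK.
 case: ifP => _; last by rewrite big1. rewrite -mulr_suml; congr (_ / _); rewrite -rmorph_sum /= sum_divisors_mu //. by case: (n == 1).
rewrite inner // P1 eqxx expr1n divr1 big_seq_cond big1 ?addr0 // => n; rewrite mem_index_iota => /andP[nr n1].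
by rewrite inner // (negbTE n1) mul0r if_same.
Qed.

(** In [msum_zsum] each partial sum is replaced by zeta. The tail beyond V / v is at most 2 v / V,
    so the total error is 2 H / V for the harmonic sum H up to V. *)
Lemma mobius_limit (P : pred nat) (zeta : R) : (forall a b, (0 < a)%N -> (0 < b)%N -> P (a * b)%N = P a && P b) -> P 1%N -> 0 < zeta -> rtends (zsum P) zeta -> rtends (msumP P) zeta^-1.
Proof.
move=> PM P1 z0 H eta e0.
have tail M : (0 < M)%N -> `|zeta - zsum P M| <= M%:R^-1.
 move=> M0; apply/ler_addgt0Pl => d d0; have [n0 h] := H _ d0. have := h _ (leq_maxl n0 M); have := zsum_tail P M0 (leq_maxr n0 M); have := zsum_mono P (leq_maxr n0 M).
 rewrite !ler_norml; set Z := zsum P (maxn _ _); set Y := zsum P M => a b /andP[c1 c2]; apply/andP; split; lra.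
have [Hm Hm0 hh] := @harm_pow R (1 / 2) ltac:(lra).
have K0 : 0 < eta * zeta by rewrite mulr_gt0.
pose B := (2 * Hm + 1) / (eta * zeta); have B0 : 0 <= B by rewrite divr_ge0; lra.
exists (Num.bound (B ^+ 2)).+1 => V hV; have V0 : (0 < V)%N by apply: leq_trans hV.
have Vr : 0 < V%:R :> R by rewrite ltr0n.
have e1 : 1 - zeta * msumP P V = \sum_(1 <= v < V.+1 | P v) (mu v)%:~R / v%:R ^+ 2 * (zsum P (V %/ v) - zeta).
 by rewrite -{1}(msum_zsum PM P1 V0) /msumP mulr_sumr -sumrB; apply: eq_bigr => v _; ring.
have e2 : `|1 - zeta * msumP P V| <= 2 * harm_sum R V / V%:R.
 rewrite e1; apply: le_trans (ler_norm_sum _ _ _) _; rewrite big_mkcond /=.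
 rewrite /harm_sum mulr_sumr mulr_suml -(big_mkord xpredT (fun k => 2 * k.+1%:R^-1 / V%:R)) big_add1 /= big_nat_cond [X in _ <= X]big_nat_cond; apply: ler_sum => k /andP[/andP[_ kV] _].
 have k1 : 0 < k.+1%:R :> R by []. have bd0 : 0 <= 2 * k.+1%:R^-1 / V%:R :> R by rewrite !mulr_ge0 ?invr_ge0. case: ifP => // _; rewrite normrM normrM normfV (ger0_norm (exprn_ge0 _ (ltW k1))).
 have Y0 : (0 < V %/ k.+1)%N by rewrite divn_gt0. have m1 : `|(mu k.+1)%:~R| <= 1 :> R by rewrite -intr_norm lerz1 mu_abs. have t1 : `|zsum P (V %/ k.+1) - zeta| <= 2 * k.+1%:R / V%:R.
  rewrite distrC; apply: le_trans (tail _ Y0) _. have Yr : 0 < (V %/ k.+1)%:R :> R by rewrite ltr0n. rewrite ler_pdivlMr // mulrC ler_pdivrMr // -natrM -natrM ler_nat.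
  have := ltn_ceil V (ltn0Sn k); move: Y0; move: (V %/ k.+1)%N => Y; clear; nia.
 apply: le_trans (_ : 1 / k.+1%:R ^+ 2 * (2 * k.+1%:R / V%:R) <= _).
  by apply: ler_pM; rewrite ?mulr_ge0 ?invr_ge0 ?exprn_ge0 // ler_pM2r ?invr_gt0 ?exprn_gt0.
 have g (a b : R) : a != 0 -> b != 0 -> 1 / a ^+ 2 * (2 * a / b) = 2 / a / b by move=> an bn; field; rewrite bn. by rewrite g ?gt_eqF.
have e3 : harm_sum R V <= Hm * V%:R `^ (1 / 2) := hh _ V0.
have sq : V%:R `^ (1 / 2) * V%:R `^ (1 / 2) = V%:R :> R.
 by rewrite -powR_add // (_ : 1 / 2 + 1 / 2 = 1) ?powRr1; lra.
have rt : 0 < V%:R `^ (1 / 2) :> R by rewrite powR_gt0.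
have BV : B <= V%:R `^ (1 / 2).
 have : B ^+ 2 <= (V%:R `^ (1 / 2)) ^+ 2.
  rewrite expr2 expr2 sq -expr2; apply: ltW. apply: lt_le_trans (archi_boundP (exprn_ge0 2 B0)) _; by rewrite ler_nat ltnW.
 by rewrite ler_pXn2r // nnegrE ltW.
have e4 : `|1 - zeta * msumP P V| <= eta * zeta.
 apply: le_trans e2 _; rewrite ler_pdivrMr //. move: BV; rewrite /B ler_pdivrMr // => BV; rewrite -sq mulrA. apply: le_trans (_ : 2 * (Hm * V%:R `^ (1 / 2)) <= _); first by rewrite ler_pM2l.
 rewrite mulrA ler_pM2r; move: BV; rewrite mulrC; lra.
have -> : msumP P V - zeta^-1 = - (1 - zeta * msumP P V) / zeta by field; rewrite gt_eqF.
by rewrite normrM normfV normrN (gtr0_norm z0) ler_pdivrMr.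
Qed.
End Basel.

(** * Local factors at the primes of D' *)

Lemma primes_perm a b : (0 < a)%N -> (0 < b)%N -> coprime a b -> perm_eq (primes (a * b)) (primes a ++ primes b).
Proof.
move=> a0 b0 cab; apply: uniq_perm; rewrite ?primes_uniq //.
 by rewrite cat_uniq !primes_uniq andbT -coprime_has_primes.
by move=> p; rewrite mem_cat primesM.
Qed.

Lemma moebiusM a b : (0 < a)%N -> (0 < b)%N -> coprime a b -> mu (a * b) = mu a * mu b.
Proof.
move=> a0 b0 cab; rewrite /moebius (perm_big _ (primes_perm a0 b0 cab)) big_cat /=.
have h x y p : (0 < x)%N -> (0 < y)%N -> coprime x y -> p \in primes x -> logn p (x * y) = logn p x.
 move=> x0 y0 cxy px; rewrite lognM //; have -> : logn p y = 0%N; last by rewrite addn0. apply/eqP; rewrite -leqn0 leqNgt logn_gt0; apply/negP => py.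
 move: px py; rewrite !mem_primes => /and3P[pp _ px] /and3P[_ _ py]. by have := dvdn_gcd p x y; rewrite px py (eqP cxy) dvdn1 => /eqP p1; rewrite p1 in pp.
congr (_ * _); apply: eq_big_seq => p pin; first by rewrite h.
by rewrite mulnC h // coprime_sym.
Qed.

Lemma moebius1 : mu 1 = 1. Proof. by rewrite /moebius big_nil. Qed.
Lemma moebius_prime p : prime p -> mu p = -1.
Proof. by move=> pp; rewrite -[p]muln1 mu_pM ?moebius1 // dvdn1; apply: contraTneq pp => ->. Qed.
Lemma moebius_pp p k : prime p -> mu (p ^ k.+2) = 0.
Proof. by move=> pp; apply: (@mu_ppM p); rewrite ?expn_gt0 ?prime_gt0 // !expnS mulnA dvdn_mulr. Qed.

Lemma sum_div_coprime (T : nmodType) a b (F : nat -> T) : (0 < a)%N -> (0 < b)%N -> coprime a b -> \sum_(d <- divisors (a * b)) F d = \sum_(x <- divisors a) \sum_(y <- divisors b) F (x * y)%N.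
Proof.
move=> a0 b0 cab; have ab0 : (0 < a * b)%N by rewrite muln_gt0 a0.
have -> : \sum_(x <- divisors a) \sum_(y <- divisors b) F (x * y) = \sum_(z <- [seq (x, y) | x <- divisors a, y <- divisors b]) F (z.1 * z.2)%N by rewrite big_allpairs.
apply: (@sum_bij _ _ _ (divisors (a * b)) _ xpredT xpredT (fun d => (gcdn d a, gcdn d b)) (fun z => z.1 * z.2)%N).
- exact: divisors_uniq.
- by apply: allpairs_uniq; rewrite ?divisors_uniq // => -[x y] [x' y'] _ _ [-> ->].
- move=> d; rewrite -dvdn_divisors // => dab _; split => //.
  by apply/allpairsP; exists (gcdn d a, gcdn d b); rewrite -!dvdn_divisors // !dvdn_gcdr.
 have /= := gcdn_cross cab (coprimen1 a) (_ : coprime b d); move=> _. apply/eqP; rewrite eqn_dvd; apply/andP; split.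
  rewrite Gauss_dvd ?dvdn_gcdl //; by apply: coprime_dvdl (dvdn_gcdr _ _) _; apply: coprime_dvdr (dvdn_gcdr _ _) _.
 by rewrite muln_gcdl dvdn_gcd dvdn_mulr //= muln_gcdr dvdn_gcd dvdn_mull.
move=> z /allpairsP[[x y] /= [xa yb ->]] _ /=; rewrite -!dvdn_divisors // in xa yb *; split => //.
 by rewrite dvdn_mul.
have cxb : coprime x b := coprime_dvdl xa cab; have cya : coprime a y := coprime_dvdr yb cab.
congr (_, _); rewrite gcdnC.
 by rewrite Gauss_gcdl //; apply/gcdn_idPr.
by rewrite Gauss_gcdr 1?coprime_sym //; apply/gcdn_idPr.
Qed.

Section Local.
Variable R : realType.

Definition Rq D x := (D %/ gcdn D x)%N.
(** The factor (R / G)^-1 of [gamq], at the argument j v. *)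
Definition phq m D e j v : R := if (gcdn (Rq D (e * j * v)) (j * v) %| m)%N then (gcdn (Rq D (e * j * v)) (j * v))%:R / (Rq D (e * j * v))%:R else 0.
Definition sterm m D e j v : R := (mu e)%:~R * (mu v)%:~R / (e * j * v ^ 2)%:R * phq m D e j v.
(** The finite part of the series, over the primes of D. For fixed m it is multiplicative in the
    pair (D, n), hence an Euler product. *)
Definition Ssum m D n : R := \sum_(e <- divisors n) \sum_(j <- divisors (n %/ e)) \sum_(v <- divisors D) sterm m D e j v.

Lemma RqM a b x y : (0 < a)%N -> (0 < b)%N -> coprime a b -> coprime a y -> coprime b x -> Rq (a * b) (x * y) = (Rq a x * Rq b y)%N.
Proof. by move=> a0 b0 ab ay bx; rewrite /Rq gcdn_cross // divnMM ?dvdn_gcdl ?gcdn_gt0 ?a0 ?b0. Qed.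

Lemma stermM m a b e1 e2 j1 j2 v1 v2 A B : (0 < a)%N -> (0 < b)%N -> (a %| A)%N -> (b %| B)%N -> coprime A B -> (e1 * j1 %| A)%N -> (e2 * j2 %| B)%N -> (v1 %| a)%N -> (v2 %| b)%N -> (0 < A)%N -> (0 < B)%N ->
 sterm m (a * b) (e1 * e2) (j1 * j2) (v1 * v2) = sterm m a e1 j1 v1 * sterm m b e2 j2 v2.
Proof.
move=> a0 b0 aA bB cAB ejA ejB va vb A0 B0.
have [e10 j10] : (0 < e1)%N /\ (0 < j1)%N by have := dvdn_gt0 A0 ejA; rewrite muln_gt0 => /andP.
have [e20 j20] : (0 < e2)%N /\ (0 < j2)%N by have := dvdn_gt0 B0 ejB; rewrite muln_gt0 => /andP.
have v10 := dvdn_gt0 a0 va; have v20 := dvdn_gt0 b0 vb.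
have cAx x y : (forall p, prime p -> (p %| x)%N -> (p %| A)%N) -> (forall p, prime p -> (p %| y)%N -> (p %| B)%N) -> (0 < x)%N -> coprime x y.
 move=> hx hy x0; rewrite /coprime; apply/negPn/negP => h. have [p pp pd] : exists2 p, prime p & (p %| gcdn x y)%N.
  exists (pdiv (gcdn x y)); [apply: pdiv_prime; move: h; have := gcdn_gt0 x y; rewrite x0; case: gcdn => [|[|]] // | exact: pdiv_dvd].
 have h1 := hx p pp (dvdn_trans pd (dvdn_gcdl _ _)); have h2 := hy p pp (dvdn_trans pd (dvdn_gcdr _ _)). by have := dvdn_gcd p A B; rewrite h1 h2 (eqP cAB) dvdn1 => /eqP p1; rewrite p1 in pp.
have dA d : (d %| A)%N -> forall p, prime p -> (p %| d)%N -> (p %| A)%N by move=> dA' p _ pd; apply: dvdn_trans dA'.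
have dB d : (d %| B)%N -> forall p, prime p -> (p %| d)%N -> (p %| B)%N by move=> dA' p _ pd; apply: dvdn_trans dA'.
have eA : (e1 %| A)%N by apply: dvdn_trans ejA; rewrite dvdn_mulr.
have eB : (e2 %| B)%N by apply: dvdn_trans ejB; rewrite dvdn_mulr.
have jA : (j1 %| A)%N by apply: dvdn_trans ejA; rewrite dvdn_mull.
have jB : (j2 %| B)%N by apply: dvdn_trans ejB; rewrite dvdn_mull.
have vA : (v1 %| A)%N := dvdn_trans va aA; have vB : (v2 %| B)%N := dvdn_trans vb bB.
have pM x y N : (forall p, prime p -> (p %| x)%N -> (p %| N)%N) -> (forall p, prime p -> (p %| y)%N -> (p %| N)%N) -> forall p, prime p -> (p %| x * y)%N -> (p %| N)%N.
 by move=> hx hy p pp; rewrite Euclid_dvdM // => /orP[/(hx _ pp)|/(hy _ pp)].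
set x1 := (e1 * j1 * v1)%N; set x2 := (e2 * j2 * v2)%N; set y1 := (j1 * v1)%N; set y2 := (j2 * v2)%N.
have hx1 : forall p, prime p -> (p %| x1)%N -> (p %| A)%N by apply: pM; [apply: dA | apply: dA].
have hx2 : forall p, prime p -> (p %| x2)%N -> (p %| B)%N by apply: pM; [apply: dB | apply: dB].
have hy1 : forall p, prime p -> (p %| y1)%N -> (p %| A)%N by apply: pM; apply: dA.
have hy2 : forall p, prime p -> (p %| y2)%N -> (p %| B)%N by apply: pM; apply: dB.
have cab : coprime a b by apply: cAx => //; [apply: dA | apply: dB].
have cax2 : coprime a x2 by apply: cAx => //; apply: dA.
have cbx1 : coprime b x1 by rewrite coprime_sym; apply: cAx => //; [apply: dB | rewrite !muln_gt0 e10 j10].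
have Re : Rq (a * b) (e1 * e2 * (j1 * j2) * (v1 * v2)) = (Rq a x1 * Rq b x2)%N.
 rewrite -RqM //; congr Rq; rewrite /x1 /x2; ring.
have Ra : (Rq a x1 %| A)%N by apply: dvdn_trans aA; rewrite /Rq dvdn_div // dvdn_gcdl.
have Rb : (Rq b x2 %| B)%N by apply: dvdn_trans bB; rewrite /Rq dvdn_div // dvdn_gcdl.
have R10 : (0 < Rq a x1)%N := dvdn_gt0 A0 Ra; have R20 : (0 < Rq b x2)%N := dvdn_gt0 B0 Rb.
have Ge : gcdn (Rq a x1 * Rq b x2) (j1 * j2 * (v1 * v2)) = (gcdn (Rq a x1) y1 * gcdn (Rq b x2) y2)%N.
 rewrite -gcdn_cross; first by congr gcdn; rewrite /y1 /y2; ring.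
 - by apply: cAx => //; [apply: dA | apply: dB].
 - by apply: cAx => //; apply: dA.
 by rewrite coprime_sym; apply: cAx => //; [apply: dB | rewrite muln_gt0 j10].
have me : mu (e1 * e2) = mu e1 * mu e2.
 by apply: moebiusM => //; apply: cAx => //; [apply: dA | apply: dB].
have mv : mu (v1 * v2) = mu v1 * mu v2.
 by apply: moebiusM => //; apply: cAx => //; [apply: dA | apply: dB].
have nz x : (0 < x)%N -> (x%:R : R) != 0 by move=> h; rewrite pnatr_eq0 -lt0n.
rewrite /sterm /phq Re Ge me mv -/x1 -/x2 -/y1 -/y2 Gauss_dvd; last first.
 apply: cAx; rewrite ?gcdn_gt0 ?R10 //.
  by apply: dA; apply: dvdn_trans Ra; exact: dvdn_gcdl.
 by apply: dB; apply: dvdn_trans Rb; exact: dvdn_gcdl.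
case: (gcdn (Rq a x1) y1 %| m)%N => /=; last by rewrite !(mulr0, mul0r).
case: (gcdn (Rq b x2) y2 %| m)%N => /=; last by rewrite !(mulr0, mul0r).
move: (gcdn _ y1) (gcdn _ y2) => g1 g2; move: (Rq a x1) (Rq b x2) R10 R20 => r1 r2 R10 R20.
rewrite !intrM !natrM; field.
by rewrite !nz.
Qed.

Lemma SsumM m a b c d : (0 < a)%N -> (0 < b)%N -> (0 < c)%N -> (0 < d)%N -> coprime (a * c) (b * d) -> Ssum m (a * b) (c * d) = Ssum m a c * Ssum m b d.
Proof.
move=> a0 b0 c0 d0 cc.
have ac0 : (0 < a * c)%N by rewrite muln_gt0 a0. have bd0 : (0 < b * d)%N by rewrite muln_gt0 b0.
have cab : coprime a b by apply: coprime_dvdl (dvdn_mulr c (dvdnn a)) _; apply: coprime_dvdr (dvdn_mulr d (dvdnn b)) _.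
have ccd : coprime c d by apply: coprime_dvdl (dvdn_mull a (dvdnn c)) _; apply: coprime_dvdr (dvdn_mull b (dvdnn d)) _.
rewrite /Ssum sum_div_coprime // mulr_suml; apply: eq_big_seq => e1; rewrite -dvdn_divisors // => e1c.
rewrite mulr_sumr; apply: eq_big_seq => e2; rewrite -dvdn_divisors // => e2d.
have e10 := dvdn_gt0 c0 e1c; have e20 := dvdn_gt0 d0 e2d.
rewrite divnMM //.
have ce0 : (0 < c %/ e1)%N by rewrite divn_gt0 dvdn_leq.
have de0 : (0 < d %/ e2)%N by rewrite divn_gt0 dvdn_leq.
rewrite sum_div_coprime //; last first.
 by apply: coprime_dvdl (dvdn_div e1c) _; apply: coprime_dvdr (dvdn_div e2d) _.
rewrite mulr_suml; apply: eq_big_seq => j1; rewrite -dvdn_divisors // => j1c.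
rewrite mulr_sumr; apply: eq_big_seq => j2; rewrite -dvdn_divisors // => j2d.
rewrite sum_div_coprime // mulr_suml; apply: eq_big_seq => v1; rewrite -dvdn_divisors // => v1a.
rewrite mulr_sumr; apply: eq_big_seq => v2; rewrite -dvdn_divisors // => v2b.
have h1 : (e1 * j1 %| a * c)%N by apply: dvdn_mull; rewrite -(divnK e1c) mulnC dvdn_mul.
have h2 : (e2 * j2 %| b * d)%N by apply: dvdn_mull; rewrite -(divnK e2d) mulnC dvdn_mul.
by apply: (@stermM m a b e1 e2 j1 j2 v1 v2 (a * c) (b * d)) => //; exact: dvdn_mulr.
Qed.

Lemma sum_divisors_pX (T : nmodType) p b (F : nat -> T) : prime p -> \sum_(d <- divisors (p ^ b)) F d = \sum_(k < b.+1) F (p ^ k)%N.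
Proof.
move=> pp; rewrite -(big_mkord xpredT (fun k => F (p ^ k)%N)).
have p0 := prime_gt0 pp; have pb : (0 < p ^ b)%N by rewrite expn_gt0 p0.
apply: (@sum_bij _ _ _ _ _ xpredT xpredT (logn p) (fun k => p ^ k)%N); rewrite ?divisors_uniq ?iota_uniq //.
 move=> d; rewrite -dvdn_divisors // => /(dvdn_pfactor _ _ pp)[k kb ->] _. by rewrite pfactorK // mem_index_iota.
by move=> k; rewrite mem_index_iota -dvdn_divisors // => kb; rewrite dvdn_exp2l // pfactorK.
Qed.

Section Prime.
Variables (p dl a' : nat) (m : nat).
Hypotheses (pp : prime p) (dl0 : (0 < dl)%N).
Let q : R := p%:R.
Let fq x : R := if (p ^ x %| m)%N then q ^+ x else 0.
Let p0 : (0 < p)%N. Proof. exact: prime_gt0. Qed.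
Let qn : q != 0. Proof. by rewrite /q pnatr_eq0 -lt0n. Qed.
Let d1 := dl./2.
Let Tq k0 k v : R := fq (minn (dl - (k0 + k + v)) (k + v)) / (q ^+ (k0 + k + v.*2 + (dl - (k0 + k + v)))).
Lemma sterm_p k0 k v : sterm m (p ^ dl) (p ^ k0) (p ^ k) (p ^ v) = (mu (p ^ k0))%:~R * (mu (p ^ v))%:~R * Tq k0 k v.
Proof.
have gX x y : gcdn (p ^ x) (p ^ y) = (p ^ minn x y)%N.
 case: leqP => xy; first by apply/gcdn_idPl; rewrite dvdn_exp2l. by rewrite gcdnC; apply/gcdn_idPl; rewrite dvdn_exp2l // ltnW.
have RX x : Rq (p ^ dl) (p ^ x) = (p ^ (dl - x))%N.
 by rewrite /Rq gX -expnB ?geq_minl //; congr _; rewrite minnE subKn // leq_subr.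
rewrite /sterm /phq -!expnD RX gX /Tq /fq; case: ifP => _; last by rewrite !(mulr0, mul0r).
rewrite -expnM -expnD !natrX -/q -mulrA -mulrA -mulrA; congr (_ * (_ * _)).
rewrite mulrCA; congr (_ * _); rewrite -invfM -exprD; congr ((_ ^+ _)^-1).
by rewrite muln2.
Qed.

Let Av v b : R := \sum_(k < b.+1) Tq 0 k v - \sum_(k < b) Tq 1 k v.
(** The Moebius variable has exponent 0 or 1. [Tq 0 k.+1 v] and [Tq 1 k v] share their denominator;
    their numerators differ, and the sum telescopes, until k + 1 + v passes dl / 2, after which they
    agree. *)
Lemma Av_eval v b : (v <= 1)%N -> Av v b = q ^- (dl + v) * fq (minn (b + v) d1).
Proof.
move=> v1; have dE : (dl = odd dl + d1.*2)%N by rewrite odd_double_half.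
have [dlo dhi] : (d1.*2 <= dl)%N /\ (dl <= d1.*2.+1)%N by move: dE; case: odd; clear; lia.
elim: b => [|b IH].
 rewrite /Av big_ord0 subr0 big_ord1 /Tq !add0n mulrC; congr (_ ^-1 * fq _).
  by congr (_ ^+ _); move: v1 dl0; clear; lia.
 by move: v1 dl0 dlo dhi; clear; lia.
rewrite /Av big_ord_recr [X in _ - X]big_ord_recr /=.
have -> (x y z w : R) : x + y - (z + w) = (x - z) + (y - w) by ring.
rewrite -/(Av v b) IH /Tq !add0n add1n.
case: (leqP (b.+1 + v) dl) => hb; last first.
 have -> : minn (dl - (b.+1 + v)) (b.+1 + v) = 0 by move: hb; clear; lia. have -> : minn (dl - (b.+1 + v)) (b + v) = 0 by move: hb; clear; lia.
 have -> : minn (b.+1 + v) d1 = minn (b + v) d1 by move: hb dlo dl0; clear; lia. by rewrite subrr addr0.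
have eE : (b.+1 + v.*2 + (dl - (b.+1 + v)) = dl + v)%N by move: hb; clear; lia.
rewrite eE -mulrBl [(_ - _) * _]mulrC -mulrDr; congr (_ * _).
case: (leqP (b.+1 + v) d1) => hd.
 have -> : minn (dl - (b.+1 + v)) (b.+1 + v) = (b.+1 + v)%N by move: hb hd dlo; clear; lia. have -> : minn (dl - (b.+1 + v)) (b + v) = (b + v)%N by move: hb hd dlo; clear; lia.
 have -> : minn (b + v) d1 = (b + v)%N by move: hd; clear; lia. by rewrite addrCA subrr addr0.
have -> : minn (dl - (b.+1 + v)) (b.+1 + v) = minn (dl - (b.+1 + v)) (b + v) by move: hb hd dhi; clear; lia.
have -> : minn (b + v) d1 = d1 by move: hd; clear; lia.
by rewrite subrr addr0.
Qed.

Lemma mu_sum2 n (F : nat -> R) : \sum_(k < n.+1) (mu (p ^ k))%:~R * F k = F 0%N - (if (0 < n)%N then F 1%N else 0).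
Proof.
case: n => [|n]; first by rewrite big_ord1 moebius1 mul1r subr0.
rewrite !big_ord_recl /= moebius1 mul1r expn1 moebius_prime // rmorphN1 mulN1r big1 ?addr0 // => k _.
by rewrite moebius_pp // mul0r.
Qed.

Lemma Ssum_prime b : Ssum m (p ^ dl) (p ^ b) = q ^- dl * (fq (minn b d1) - q^-1 * fq (minn b.+1 d1)).
Proof.
transitivity (\sum_(i < b.+1) (mu (p ^ i))%:~R * \sum_(k < (b - i).+1) (Tq i k 0 - Tq i k 1)).
 rewrite /Ssum (sum_divisors_pX _ _ pp); apply: eq_bigr => i _. have ib : (i <= b)%N by rewrite -ltnS. rewrite -(expnB p0 ib) (sum_divisors_pX _ _ pp) mulr_sumr.
 apply: eq_bigr => k _; rewrite (sum_divisors_pX _ _ pp). under eq_bigr => v _ do rewrite sterm_p mulrAC mulrC. by rewrite (mu_sum2 dl (fun v => (mu (p ^ i))%:~R * Tq i k v)) dl0 -mulrBr.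
rewrite (mu_sum2 b (fun i => \sum_(k < (b - i).+1) (Tq i k 0 - Tq i k 1))) subn0.
have -> : (if (0 < b)%N then \sum_(k < (b - 1).+1) (Tq 1 k 0 - Tq 1 k 1) else 0) = \sum_(k < b) (Tq 1 k 0 - Tq 1 k 1).
 by case: b => [|b']; rewrite ?big_ord0 subn1.
rewrite !sumrB; have -> (x y z w : R) : x - y - (z - w) = (x - z) - (y - w) by ring.
rewrite -/(Av 0 b) -/(Av 1 b) !Av_eval // !addn0 !addn1 exprS invfM mulrBr; congr (_ - _).
by rewrite mulrCA mulrA.
Qed.
End Prime.

(** The terms with e j = d collect the sum of mu over the divisors of d, which leaves d = 1. *)
Lemma Ssum1 m n : (0 < n)%N -> Ssum m 1 n = 1.
Proof.
move=> n0; have R1 x : Rq 1 x = 1%N by rewrite /Rq gcd1n.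
pose G d : R := (d%:R)^-1.
transitivity (\sum_(e <- divisors n) \sum_(d <- divisors n) if (e %| d)%N then (mu e)%:~R * G d else 0).
 rewrite /Ssum; apply: eq_big_seq => e; rewrite -dvdn_divisors // => en; have e0 := dvdn_gt0 n0 en. rewrite -big_mkcond /=; symmetry. have ne0 : (0 < n %/ e)%N by rewrite divn_gt0 dvdn_leq.
 transitivity (\sum_(j <- divisors (n %/ e)) (mu e)%:~R * G (e * j)%N).
  apply: (@sum_bij _ _ _ _ _ (fun d => e %| d)%N xpredT (fun d => d %/ e)%N (fun j => e * j)%N (fun d => (mu e)%:~R * G d)); rewrite ?divisors_uniq //.
   move=> d; rewrite -!dvdn_divisors // => dn ed; split => //; last by rewrite mulnC divnK. by rewrite dvdn_divRL // divnK.
  move=> j; rewrite -!dvdn_divisors // => jn _; rewrite dvdn_mulr // mulKn //; split => //. by rewrite mulnC -dvdn_divRL.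
 apply: eq_bigr => j; rewrite (_ : divisors 1 = [:: 1%N]) // big_seq1 /sterm /phq R1 gcd1n dvd1n divr1 mulr1 moebius1 mulr1 exp1n muln1 //.
rewrite exchange_big /= (eq_big_seq (fun d => (d == 1%N)%:R * G d)); last first.
 move=> d; rewrite -dvdn_divisors // => dn; have d0 := dvdn_gt0 n0 dn. rewrite -big_mkcond -mulr_suml -rmorph_sum /=; congr (_ * _).
 have <- : \sum_(e <- divisors d) mu e = \sum_(e <- divisors n | (e %| d)%N) mu e.
  rewrite -[RHS]big_filter; apply: perm_big; apply: uniq_perm; rewrite ?filter_uniq ?divisors_uniq //. move=> e; rewrite mem_filter -!dvdn_divisors; case: (boolP (e %| d)%N) => //= ed.
  by rewrite (dvdn_trans ed dn).
 by rewrite sum_divisors_mu; case: (d == 1).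
rewrite (bigD1_seq 1%N) ?divisors_uniq -?dvdn_divisors //= mul1r /G invr1 big1 ?addr0 // => d d1.
by rewrite (negbTE d1) mul0r.
Qed.

Lemma Ssum_prod m D n : (0 < D)%N -> (0 < n)%N -> Ssum m D n = \prod_(p <- primes D) Ssum m (p ^ logn p D) (p ^ logn p n).
Proof.
elim/ltn_ind: D n => D IH n D0 n0; case: (ltnP 1 D) => D1; last first.
 have -> : D = 1 by move: D0 D1; clear; lia. by rewrite Ssum1 // big_nil.
pose p := pdiv D; have pp : prime p := pdiv_prime D1; have pD : (p %| D)%N := pdiv_dvd D.
have pin : p \in primes D by rewrite mem_primes pp D0.
set D' := (D`_p^')%N; set n1 := (n`_p^')%N.
have eD : D = (p ^ logn p D * D')%N by rewrite -p_part partnC.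
have en : n = (p ^ logn p n * n1)%N by rewrite -p_part partnC.
have D'0 : (0 < D')%N := part_gt0 _ _; have n10 : (0 < n1)%N := part_gt0 _ _.
have D'D : (D' < D)%N.
 by rewrite eD ltn_Pmull // -(exp1n (logn p D)) ltn_exp2r ?prime_gt1 // logn_gt0.
have cp x k : coprime (p ^ k) (x`_p^').
 by apply: coprimeXl; apply: pnat_coprime; [exact: pnat_id | exact: part_pnat].
have pX k : (0 < p ^ k)%N by rewrite expn_gt0 prime_gt0.
have cpp : coprime (p ^ logn p D * p ^ logn p n) (D' * n1) by rewrite !coprimeMl !coprimeMr !cp.
rewrite [in LHS]eD [in LHS]en (SsumM m (pX _) D'0 (pX _) n10 cpp) (IH D' D'D) // [in RHS](bigD1_seq p) ?primes_uniq //=; congr (_ * _).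
rewrite -[RHS]big_filter [RHS](perm_big (primes D')) /=; last first.
 apply: uniq_perm; rewrite ?filter_uniq ?primes_uniq // => r. by rewrite /D' primes_part.
apply: eq_big_seq => r; rewrite primes_part mem_filter inE => /andP[rp rin].
have lr x : (0 < x)%N -> logn r (x`_p^') = logn r x.
 move=> x0; rewrite logn_pi_part; last by move: rin; rewrite mem_primes => /andP[]. by rewrite !inE rp.
by rewrite !lr.
Qed.
End Local.

Section RealLimits.
Variable R : realType.

Lemma rtends_tends (u : nat -> R) l : rtends u l <-> tends (fun n => (u n)%:C) l%:C.
Proof.
have e n : normc ((u n)%:C - l%:C) = `|u n - l| by rewrite -rmorphB normc_real.
by split=> h eta /h[n0 H]; exists n0 => n /H; rewrite e.
Qed.

Lemma rtendsZ (a : R) u l : rtends u l -> rtends (fun n => a * u n) (a * l).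
Proof.
move=> /rtends_tends/(tendsZ a%:C) h; apply/rtends_tends; rewrite rmorphM /=.
by apply: tends_ext h => n; rewrite rmorphM.
Qed.

Lemma rtends_sum (I : eqType) (r : seq I) (P : pred I) (u : I -> nat -> R) (L : I -> R) :
 (forall x, x \in r -> P x -> rtends (u x) (L x)) -> rtends (fun n => \sum_(x <- r | P x) u x n) (\sum_(x <- r | P x) L x).
Proof.
move=> H; apply/rtends_tends; rewrite (rmorph_sum (real_complex R)).
apply: (@tends_ext R (fun n => \sum_(x <- r | P x) (u x n)%:C)).
 by move=> n; rewrite rmorph_sum.
by apply: tends_sum => x xr px; apply/rtends_tends/H.
Qed.

End RealLimits.

(** * Summation of the series *)

Section Weighted.
Variables (R : realType) (f t D' m' n' e : nat).
Hypotheses (D'0 : (0 < D')%N) (n'0 : (0 < n')%N) (en : (e %| n')%N).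
Let Q := (2 * f * t)%N.

(** The term at v = j u of the series, without its Moebius factor, whose variable is u. *)
Definition gw j u : R := if coprime (e * (j * u)) (2 * f) && coprime (j * u) t then j%:R / (j * u)%:R ^+ 2 * phq R m' D' e j u else 0.

Lemma phq_mulr j v x : (0 < x)%N -> coprime x D' -> phq R m' D' e j (v * x) = phq R m' D' e j v.
Proof.
move=> x0 cx; have RE : Rq D' (e * j * (v * x)) = Rq D' (e * j * v).
 by rewrite /Rq mulnA Gauss_gcdl // coprime_sym.
rewrite /phq RE mulnA.
have cr : coprime (Rq D' (e * j * v)) x by rewrite coprime_sym; apply: coprime_dvdr cx; rewrite /Rq dvdn_div // dvdn_gcdl.
by rewrite Gauss_gcdl.
Qed.

Lemma gw_mulr j v x : (0 < x)%N -> coprime x (Q * D') -> gw j (v * x) = gw j v / x%:R ^+ 2.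
Proof.
move=> x0; rewrite coprimeMr => /andP[cQ cD]; rewrite /gw phq_mulr //.
move: cQ; rewrite /Q coprimeMr => /andP[c2f ct].
have -> : coprime (e * (j * (v * x))) (2 * f) = coprime (e * (j * v)) (2 * f) by rewrite !mulnA coprimeMl c2f andbT.
have -> : coprime (j * (v * x)) t = coprime (j * v) t by rewrite mulnA coprimeMl ct andbT.
case: ifP => _; last by rewrite mul0r.
rewrite mulnA (natrM _ (j * v)) exprMn invfM; ring.
Qed.

Lemma gw_supp j u : gw j u != 0 -> coprime u Q.
Proof.
rewrite /gw; case: ifP => [/andP[]|_]; last by rewrite eqxx.
by rewrite /Q !coprimeMl => /and3P[_ _ c1] /andP[_ c2]; rewrite coprimeMr c1.
Qed.

(** u = v x with v = gcd(u, D'). A common prime of x and D' would divide u twice and make mu u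
    vanish; the x that remain are prime to Q D' and form a Moebius series independent of v. *)
Lemma inner_split j Y : \sum_(1 <= u < Y.+1) (mu u)%:~R * gw j u = \sum_(v <- divisors D') (mu v)%:~R * gw j v * msumP R (fun x => coprime x (Q * D')) (Y %/ v).
Proof.
transitivity (\sum_(v <- divisors D') \sum_(1 <= u < Y.+1 | gcdn u D' == v) (mu u)%:~R * gw j u).
 rewrite (exchange_big_dep xpredT) //=; apply: eq_big_nat => u _.
 rewrite big_mkcond (bigD1_seq (gcdn u D')) ?divisors_uniq -?dvdn_divisors ?dvdn_gcdr //= eqxx big1 ?addr0 // => v nv. by rewrite eq_sym (negbTE nv).
apply: eq_big_seq => v; rewrite -dvdn_divisors // => vD; have v0 := dvdn_gt0 D'0 vD.
transitivity (\sum_(1 <= u < Y.+1 | (gcdn u D' == v) && coprime (u %/ v) (Q * D')) (mu u)%:~R * gw j u).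
 rewrite big_nat_cond [RHS]big_nat_cond (bigID (fun u => coprime (u %/ v) (Q * D'))) /= [X in _ + X]big1 ?addr0.
  by apply: eq_bigl => u; rewrite andbA.
 move=> u /andP[/andP[/andP[u0 _] /eqP gv] nc]; have vu : (v %| u)%N by rewrite -gv dvdn_gcdl. have eu : u = (u %/ v * v)%N by rewrite divnK. have uv0 : (0 < u %/ v)%N by rewrite divn_gt0 dvdn_leq.
 move: nc; rewrite coprimeMr negb_and => /orP[nc|nc].
  case: (eqVneq (gw j u) 0) => [->|/gw_supp cu]; rewrite ?mulr0 //. by case/negP: nc; apply: coprime_dvdl cu; exact: dvdn_div.
 have [p pp pd] : exists2 p, prime p & (p %| gcdn (u %/ v) D')%N.
  exists (pdiv (gcdn (u %/ v) D')); last exact: pdiv_dvd. by apply: pdiv_prime; move: nc; rewrite /coprime; have := gcdn_gt0 (u %/ v) D'; rewrite uv0; case: (gcdn (u %/ v) D') => [|[|]].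
 have pu := dvdn_trans pd (dvdn_gcdl _ _); have pD := dvdn_trans pd (dvdn_gcdr _ _). have pv : (p %| v)%N by rewrite -gv dvdn_gcd eu dvdn_mulr. by rewrite (@mu_ppM p) ?mul0r // eu dvdn_mul.
rewrite /msumP mulr_sumr.
transitivity (\sum_(1 <= x < (Y %/ v).+1 | coprime x (Q * D')) (mu (v * x))%:~R * gw j (v * x)).
 apply: (@sum_bij _ _ _ _ _ _ _ (fun u => u %/ v)%N (fun x => v * x)%N (fun u => (mu u)%:~R * gw j u)); rewrite ?iota_uniq //.
  move=> u; rewrite !mem_index_iota !ltnS => /andP[u1 uY] /andP[/eqP gv cu]. have vu : (v %| u)%N by rewrite -gv dvdn_gcdl. split => //; last by rewrite mulnC divnK.
  by rewrite divn_gt0 dvdn_leq //= leq_div2r.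
 move=> x; rewrite !mem_index_iota !ltnS => /andP[x1 xY] cx; rewrite mulKn // cx andbT; split => //.
  by rewrite muln_gt0 v0 x1 mulnC -leq_divRL.
 have cxD : coprime D' x by rewrite coprime_sym; move: cx; rewrite coprimeMr => /andP[]. by rewrite gcdnC Gauss_gcdl // gcdnC; apply/eqP/gcdn_idPl.
rewrite big_nat_cond [RHS]big_nat_cond; apply: eq_bigr => x /andP[/andP[x0 _] cx].
have cvx : coprime v x.
 by rewrite coprime_sym; move: cx; rewrite coprimeMr => /andP[_]; exact: coprime_dvdr.
by rewrite moebiusM // gw_mulr //; ring.
Qed.

Lemma weighted_split V : \sum_(1 <= v < V.+1 | coprime v t) (v%:R ^+ 2)^-1 * gamq R f D' m' n' e v = \sum_(j <- divisors (n' %/ e)) \sum_(1 <= u < (V %/ j).+1) (mu u)%:~R * gw j u.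
Proof.
have e0 := dvdn_gt0 n'0 en; have ne0 : (0 < n' %/ e)%N by rewrite divn_gt0 dvdn_leq.
pose F j v : R := if (j %| v)%N then (mu (v %/ j))%:~R * gw j (v %/ j) else 0.
transitivity (\sum_(1 <= v < V.+1) \sum_(j <- divisors (n' %/ e)) F j v).
 rewrite big_mkcond; apply: eq_big_nat => v /andP[v0 _]. have gE j : (j %| v)%N -> gw j (v %/ j) = if coprime (e * v) (2 * f) && coprime v t then
   j%:R / v%:R ^+ 2 * (if (G0 D' e v %| m')%N then ((R0 D' e v %/ G0 D' e v)%:R)^-1 else 0) else 0.
  move=> jv; have ev : (j * (v %/ j) = v)%N by rewrite mulnC divnK. rewrite /gw /phq -mulnA ev -/(R0 D' e v) -/(G0 D' e v); case: ifP => // _; congr (_ * _); case: ifP => // _.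
  have GR : (G0 D' e v %| R0 D' e v)%N := dvdn_gcdl _ _. have R0' : (0 < R0 D' e v)%N by rewrite divn_gt0 ?gcdn_gt0 dvdn_leq ?dvdn_gcdl. have Gp : (0 < G0 D' e v)%N by rewrite gcdn_gt0 R0'.
  rewrite -[Rq _ _]/(R0 D' e v) -{1}(divnK GR) natrM invfM mulrCA divff ?mulr1 // pnatr_eq0 -lt0n //.
 case: ifP => ct; last first.
  symmetry; apply: big1 => j; rewrite /F; case: ifP => // jv; rewrite gE // ct andbF mulr0 //.
 rewrite /gamq; case: (boolP (coprime (e * v) (2 * f))) => c2f /=; last first.
  rewrite mulr0; symmetry; apply: big1 => j; rewrite /F; case: ifP => // jv; rewrite gE // (negbTE c2f) mulr0 //.
 case: (boolP (G0 D' e v %| m')%N) => Gm; last first.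
  rewrite mulr0; symmetry; apply: big1 => j; rewrite /F; case: ifP => // jv; rewrite gE // c2f ct (negbTE Gm) !mulr0 //.
 rewrite mulrA mulr_sumr -big_mkcond /= -big_filter -[RHS]big_filter (perm_big [seq j <- divisors (n' %/ e) | (j %| v)%N]) /=; last first.
  apply: uniq_perm; rewrite ?filter_uniq ?divisors_uniq // => j. by rewrite !mem_filter -!dvdn_divisors // andbC.
 apply: eq_big_seq => j; rewrite mem_filter => /andP[jv _]; rewrite gE // c2f ct Gm /=; ring.
rewrite exchange_big /=; apply: eq_big_seq => j; rewrite -dvdn_divisors // => jn; have j0 := dvdn_gt0 ne0 jn.
rewrite -big_mkcond /=.
transitivity (\sum_(1 <= u < (V %/ j).+1) (mu (j * u %/ j))%:~R * gw j (j * u %/ j)); last first.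
 by apply: eq_bigr => u; rewrite mulKn.
apply: (@sum_bij _ _ _ _ _ (fun v => j %| v)%N xpredT (fun v => v %/ j)%N (fun u => j * u)%N (fun v => (mu (v %/ j))%:~R * gw j (v %/ j))); rewrite ?iota_uniq //.
 move=> v; rewrite !mem_index_iota !ltnS => /andP[v1 vV] jv; split => //; last by rewrite mulnC divnK. by rewrite divn_gt0 dvdn_leq //= leq_div2r.
move=> u; rewrite !mem_index_iota !ltnS => /andP[u1 uV] _; rewrite dvdn_mulr // mulKn //; split => //.
by rewrite muln_gt0 j0 u1 mulnC -leq_divRL.
Qed.

Lemma weighted_limit Z : rtends (msumP R (fun x => coprime x (Q * D'))) Z -> rtends (fun V => \sum_(1 <= v < V.+1 | coprime v t) (v%:R ^+ 2)^-1 * gamq R f D' m' n' e v)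
  (Z * \sum_(j <- divisors (n' %/ e)) \sum_(v <- divisors D') (mu v)%:~R * gw j v).
Proof.
move=> HZ; have e0 := dvdn_gt0 n'0 en; have ne0 : (0 < n' %/ e)%N by rewrite divn_gt0 dvdn_leq.
apply: (@rtends_ext R (fun V => \sum_(j <- divisors (n' %/ e)) \sum_(v <- divisors D') (mu v)%:~R * gw j v * msumP R (fun x => coprime x (Q * D')) (V %/ j %/ v))).
 by move=> V; rewrite weighted_split; apply: eq_bigr => j; rewrite inner_split.
rewrite mulr_sumr; apply: rtends_sum => j; rewrite -dvdn_divisors // => jn _; have j0 := dvdn_gt0 ne0 jn.
rewrite mulr_sumr; apply: rtends_sum => v; rewrite -dvdn_divisors // => vD _; have v0 := dvdn_gt0 D'0 vD.
rewrite [Z * _]mulrC; apply: rtendsZ.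
apply: (rtends_div j0 (u := fun Y => msumP R (fun x => coprime x (Q * D')) (Y %/ v))).
exact: rtends_div.
Qed.
End Weighted.

Section Asymptotics.
Variables (R : realType) (D f : nat) (chi : int -> R[i]).
Hypotheses (D0 : (0 < D)%N) (Dodd : odd D) (f0 : (0 < f)%N) (fodd : odd f) (cDf : coprime D f) (cprim : primitive_character f chi) (ceven : even_character chi).

Let chid := proj1 cprim.

Lemma sq_root_multiple l d1 (s m : int) : (0 < l)%N -> squarefree l -> (0 < d1)%N -> s * l * m = (d1 ^ 2)%N -> exists2 m0, (0 < m0)%N & d1 = (l * m0)%N.
Proof.
move=> l0 sl d10 e; have : (l %| d1%:Z)%Z.
 apply: sqf_dvd_sq => //; rewrite -[_ ^+ 2]/(d1%:Z * d1) -PoszM mulnn -e mulrAC dvdz_mull //.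
rewrite dvdzE /= => /dvdnP[m0 em]; exists m0; last by rewrite mulnC.
by move: d10; rewrite em muln_gt0 => /andP[].
Qed.

(** The hypothesis excludes the second case of [mpair_dichotomy], so every density is 0. *)
Lemma asym_zero (s m : int) l w : (0 < l)%N -> squarefree l -> (0 < w)%N -> `|s|%N = 1%N -> m != 0 -> (forall g m0, odd g -> (0 < m0)%N -> s * l * m = ((l * m0) ^ 2)%N ->
  ~ [/\ s = 1, jacobi (-1) g = 1, l = (g * f)%N, (f %% 4 == 1)%N & chi =1 quad_char R f]) ->
 forall eps : R, 0 < eps -> asym (3 / 4 + eps) (salie_sum D chi m (s * l * w%:Z ^+ 2)) 0.
Proof.
move=> l0 sl w0 s1 m0 H eps e0.
have -> : 0 = lead_const s l w (fun _ _ => 0 : R[i]).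
 by rewrite /lead_const big1 // => g; rewrite big1 // => e; rewrite !mulr0.
apply: (salie_asym D0 f0 chid l0 sl w0 s1 m0 _ e0) => g e gl og ew oe _; split => // d1 d10 ed.
have [mm mm0 ed1] := sq_root_multiple l0 sl d10 ed.
apply: tends_const => V; rewrite /msum big1_seq // => v; rewrite mem_index_iota => /andP[_ /andP[v0 _]].
have g0 := dvdn_gt0 l0 gl; have el : l = (g * (l %/ g))%N by rewrite mulnC divnK.
have lg0 : (0 < l %/ g)%N by rewrite divn_gt0 dvdn_leq.
have slg : squarefree (g * (l %/ g)) by rewrite -el.
have := mpair_dichotomy D0 f0 fodd cprim ceven og lg0 oe slg s1 (hh s l w g e) mm.
rewrite -el -ed1 => -[Z|[h1 h2 h3 h4 h5]]; first by rewrite Z // mulr0.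
exfalso; apply: (H g mm og mm0); first by rewrite ed ed1.
by split => //; rewrite -h3.
Qed.

(** Only g = t contributes, since a nonzero density requires l / g = f; and only the v divisible by
    t, whence the factor t^-2. *)
Lemma asym_special t w m0 (beta : nat -> R) : odd t -> (t %% 4 == 1)%N -> squarefree (t * f) -> (0 < w)%N -> (0 < m0)%N -> chi =1 quad_char R f -> (forall e, odd e -> (e %| w)%N -> coprime e t ->
  rtends (fun Y => \sum_(1 <= v < Y.+1) (v%:R ^+ 2)^-1 * Bcount R D f t w m0 e v) (beta e)) ->
 forall eps : R, 0 < eps -> asym (3 / 4 + eps) (salie_sum D chi (t * f * m0 ^ 2)%N (1 * (t * f)%N%:Z * w%:Z ^+ 2))
  (2 * f%:R * Kq R f t / t%:R ^+ 2 * \sum_(e <- divisors w | odd e && coprime e t) (mu e)%:~R / e%:R * beta e)%:C.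
Proof.
move=> ot t4 stf w0 m00 cquad Hb eps eps0.
have t0 := odd_gt0 ot.
have l0 : (0 < t * f)%N by rewrite muln_gt0 t0.
have s1 : `|1%Z|%N = 1%N by [].
have mz : (t * f * m0 ^ 2)%N%:Z != 0 by rewrite -lt0n muln_gt0 l0 expn_gt0 m00.
have dE : 1 * (t * f)%N%:Z * (t * f * m0 ^ 2)%N = ((t * f * m0) ^ 2)%N.
 by rewrite mul1r; congr Posz; rewrite !expnMn; ring.
pose L g e : R[i] := if (g == t) then (2 * Kq R f t * (jacobi e%:Z t)%:~R / t%:R ^+ 2 * beta e)%:C else 0.
have rc x : (x%:R : R)%:C = x%:R by exact: rmorph_nat.
have ic x : (x%:~R : R)%:C = x%:~R by exact: rmorph_int.
have J1 : jacobi (-1) t = 1 by rewrite (jacobi_m1 R ot) t4.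
have copJ e : (0 < e)%N -> coef R t e != 0 -> coprime e t.
 move=> e0; rewrite /coef mulf_eq0 negb_or intr_eq0 => /andP[_]; rewrite intr_eq0. by apply: contraNT => nc; rewrite jacobi_0.
have -> : (2 * f%:R * Kq R f t / t%:R ^+ 2 * \sum_(e <- divisors w | odd e && coprime e t) (mu e)%:~R / e%:R * beta e)%:C = lead_const 1 (t * f) w L.
 rewrite /lead_const [RHS]big_mkcond (bigD1_seq t) ?divisors_uniq -?dvdn_divisors ?dvdn_mulr //= ot [X in _ = _ + X]big1 ?addr0; last first.
  by move=> g gt; case: ifP => // _; apply: big1 => e; rewrite /L (negbTE gt) !mulr0.
 rewrite mulr_sumr (rmorph_sum (real_complex R)) big_mkcond [RHS]big_mkcond; apply: eq_big_seq => e. rewrite -dvdn_divisors // => ew; have e0 := dvdn_gt0 w0 ew; case: odd => //=. rewrite /L eqxx J1 mulr1.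
 case: ifP => cet; last by rewrite /coef jacobi_0 ?copz_nat ?cet // !(mulr0, mul0r). have Je : (jacobi e t)%:~R * (jacobi e t)%:~R = 1 :> R by rewrite -rmorphM -expr2 jacobi_sq.
 have nz x : (0 < x)%N -> (x%:R : R) != 0 by move=> x0; rewrite pnatr_eq0 -lt0n. rewrite /coef -!ic -!(rmorphM (real_complex R)); congr (_%:C). move: Je; move: ((jacobi e t)%:~R : R) => J Je; rewrite !natrM.
 transitivity ((J * J) * (2 * f%:R * Kq R f t / t%:R ^+ 2 * ((mu e)%:~R / e%:R * beta e))); first by rewrite Je mul1r. by field; rewrite !nz.
apply: (salie_asym D0 f0 chid l0 stf w0 s1 mz _ eps0) => g e gl og ew oe cne; split; last first.
 by move=> h; have := h (t * f * m0); rewrite dE eqxx muln_gt0 l0 m00 => /(_ isT).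
move=> d1 d10 ed.
have {}ed : d1 = (t * f * m0)%N.
 by move: ed; rewrite dE => -[] /eqP; rewrite eqn_exp2r // => /eqP ->.
rewrite {d10}ed; have e0 := dvdn_gt0 w0 ew.
case: (eqVneq g t) cne => [->|gt] cne; last first.
 rewrite /L (negbTE gt); apply: tends_const => V; rewrite /msum big1_seq // => v; rewrite mem_index_iota => /andP[_ /andP[v0 _]].
 have g0 := dvdn_gt0 l0 gl; have el : (t * f = g * (t * f %/ g))%N by rewrite [RHS]mulnC divnK. have lg0 : (0 < t * f %/ g)%N by rewrite divn_gt0 dvdn_leq.
 have slg : squarefree (g * (t * f %/ g)) by rewrite -el. have := mpair_dichotomy D0 f0 fodd cprim ceven og lg0 oe slg s1 (hh 1 (t * f) w g e) m0. rewrite -el => -[Z|[_ _ h3 _ _]]; first by rewrite Z // mulr0.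
 by case/eqP: gt; apply/eqP; rewrite -(eqn_pmul2r f0) el h3.
rewrite /L eqxx; have cet := copJ e e0 cne.
have Hl := Hb e oe ew cet.
set c : R := 2 * Kq R f t * (jacobi e t)%:~R / t%:R ^+ 2.
have /rtends_tends h := rtendsZ c (rtends_div t0 Hl).
apply: tends_ext h => V; rewrite /msum.
have tf0 : t%:R != 0 :> R by rewrite pnatr_eq0 -lt0n.
transitivity (\sum_(1 <= v < V.+1 | (t %| v)%N) ((v%:R ^+ 2)^-1 * (2 * (Kq R f t * (jacobi e t)%:~R * Bcount R D f t w m0 e (v %/ t))))%:C); last first.
 rewrite big_mkcond; apply: eq_big_nat => v /andP[v0 _]. rewrite mpair_eval // J1 mterm_special //. case: ifP => _; last by rewrite !mulr0. by rewrite !rmorphM /= rc.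
rewrite mulr_sumr rmorph_sum /=.
transitivity (\sum_(1 <= v < (V %/ t).+1) (((t * v)%:R ^+ 2)^-1 * (2 * (Kq R f t * (jacobi e t)%:~R * Bcount R D f t w m0 e (t * v %/ t))))%:C).
 apply: eq_big_nat => v /andP[v0 _]; congr (_%:C); rewrite mulKn // /c natrM. have v0' : (v%:R : R) != 0 by rewrite pnatr_eq0 -lt0n. by move: Kq Bcount => K B; field; rewrite v0'.
symmetry; apply: (@sum_bij _ _ _ _ _ (fun v => t %| v)%N xpredT (fun v => v %/ t)%N (fun u => t * u)%N
 (fun v => ((v%:R ^+ 2)^-1 * (2 * (Kq R f t * (jacobi e t)%:~R * Bcount R D f t w m0 e (v %/ t))))%:C)); rewrite ?iota_uniq //.
 move=> v; rewrite !mem_index_iota !ltnS => /andP[v1 vV] jv; split => //; last by rewrite mulnC divnK. by rewrite divn_gt0 dvdn_leq //= leq_div2r.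
move=> u; rewrite !mem_index_iota !ltnS => /andP[u1 uV] _; rewrite dvdn_mulr // mulKn //; split => //.
by rewrite muln_gt0 t0 u1 mulnC -leq_divRL.
Qed.
End Asymptotics.

Section Beta.
Variables (R : realType) (D f t w m0 : nat).
Hypotheses (D0 : (0 < D)%N) (Dodd : odd D) (f0 : (0 < f)%N) (fodd : odd f) (ot : odd t) (st : squarefree t) (w0 : (0 < w)%N) (m00 : (0 < m0)%N) (ctf : coprime t f) (cDf : coprime D f).
Let t0 := odd_gt0 ot.

Lemma beta_zero e : ~ ((m0`_\pi(t) = w`_\pi(t))%N /\ ((w`_\pi(t)) ^ 2 * t ^ 3 %| D)%N) -> (e %| w)%N -> rtends (fun Y => \sum_(1 <= v < Y.+1) (v%:R ^+ 2)^-1 * Bcount R D f t w m0 e v) 0.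
Proof.
move=> H ew eta eta0; exists 0 => V; rewrite big1_seq ?subrr ?normr0 ?ltW // => v.
rewrite mem_index_iota => /andP[_ /andP[v0 _]].
case: (eqVneq (Bcount R D f t w m0 e v) 0) => [->|nz]; first by rewrite mulr0.
by have [_ h1 h2] := Bq_ne0 D0 ot st w0 m00 v0 ew nz; case: H.
Qed.

Lemma zeta_limit E : (0 < E)%N -> odd E -> rtends (msumP R (fun x => coprime x (2 * E))) (pi ^+ 2 / 8 * \prod_(p <- primes E) (1 - (p%:R ^+ 2)^-1))^-1.
Proof.
move=> E0 oE; have pi0 := pi_gt0 R.
apply: mobius_limit.
- by move=> a b; rewrite coprimeMl.
- by rewrite coprime1n.
- apply: mulr_gt0; first by rewrite divr_gt0 ?exprn_gt0. rewrite big_seq; apply: prodr_gt0 => p; rewrite mem_primes => /and3P[pp _ _].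
 by rewrite subr_gt0 invf_lt1 ?exprn_gt0 ?ltr0n ?prime_gt0 // exprn_egt1 // ltr1n prime_gt1.
apply: (@rtends_ext R (zsum R (copP (primes E)))).
 move=> N; rewrite /zsum big_nat_cond [RHS]big_nat_cond; apply: eq_bigl => x. case: (boolP (0 < x < N.+1)%N) => //= /andP[x0 _].
 rewrite /copP coprimeMr coprimen2; congr (_ && _); rewrite coprime_has_primes // -all_predC. apply/allP/allP => h p; rewrite mem_primes => /and3P[pp _ pd].
  have := h p; rewrite mem_primes pp E0 pd => /(_ isT); by rewrite /= mem_primes pp x0.
 have := h p; rewrite mem_primes pp E0 pd => /(_ isT); by rewrite /= mem_primes pp x0.
apply: zsum_limit; rewrite ?primes_uniq //; apply/allP => p; rewrite mem_primes => /and3P[pp _ pE] //.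
exact: dvdn_odd pE oE.
Qed.

Lemma totient_ratio n : (0 < n)%N -> (totient n)%:R = n%:R * \prod_(p <- primes n) (1 - p%:R^-1) :> R.
Proof.
move=> n0.
have en : n%:R = \prod_(p <- primes n) (p ^ logn p n)%:R :> R by rewrite {1}(prod_prime_decomp n0) prime_decompE big_map natr_prod.
rewrite totientE // natr_prod en -big_split /=.
apply: eq_big_seq => p; rewrite mem_primes => /and3P[pp _ pn].
have l0 : (0 < logn p n)%N by rewrite logn_gt0 mem_primes pp n0.
have pr : p%:R != 0 :> R by rewrite pnatr_eq0 -lt0n prime_gt0.
rewrite natrM natrX -{2}(prednK l0) expnS natrM natrX -subn1 natrB ?prime_gt0 //.
by field.
Qed.

Variables (Dt D' s m' n' : nat).
Hypotheses (eD : D = (Dt * D')%N) (pDt : \pi(t).-nat Dt) (cD' : coprime D' t) (ps : \pi(t).-nat s) (ew : w = (s * n')%N) (em : m0 = (s * m')%N) (cm : coprime m' t) (cn : coprime n' t) (sD : (s ^ 2 * t ^ 3 %| D)%N).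
Let s0 : (0 < s)%N. Proof. by case/andP: ps. Qed.
Let n'0 : (0 < n')%N. Proof. by move: w0; rewrite ew muln_gt0 => /andP[]. Qed.
Let m'0 : (0 < m')%N. Proof. by move: m00; rewrite em muln_gt0 => /andP[]. Qed.
Let D'0 : (0 < D')%N. Proof. by move: D0; rewrite eD muln_gt0 => /andP[]. Qed.
Let J : R := (jacobi (f * m' * n')%N%:Z t)%:~R.
Let Z : R := (pi ^+ 2 / 8 * \prod_(p <- primes (f * t * D')) (1 - (p%:R ^+ 2)^-1))^-1.
Let oD' : odd D'. Proof. by apply: dvdn_odd Dodd; rewrite eD dvdn_mull. Qed.
Lemma coprime_dvd_n' e : (e %| w)%N -> coprime e t -> (e %| n')%N.
Proof.
move=> efrac cet; move: efrac; rewrite ew Gauss_dvdr //; rewrite coprime_sym.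
exact: pi_coprime t0 ps cet.
Qed.

(** By [Bq_ne0] only v = s x with x prime to t contribute. *)
Lemma beta_form e : (e %| w)%N -> coprime e t -> rtends (fun Y => \sum_(1 <= v < Y.+1) (v%:R ^+ 2)^-1 * Bcount R D f t w m0 e v)
  (J * ((t ^ 2 * s)%:R / Dt%:R) * (Z * \sum_(j <- divisors (n' %/ e)) \sum_(v <- divisors D') (mu v)%:~R * gw R f t D' m' e j v)).
Proof.
move=> efrac cet; have en := coprime_dvd_n' efrac cet.
have Dt0 : (0 < Dt)%N by case/andP: pDt.
have HZ : rtends (msumP R (fun x => coprime x (2 * f * t * D'))) Z.
 have := @zeta_limit (f * t * D'); rewrite !muln_gt0 f0 t0 D'0 !oddM fodd ot oD' => /(_ isT isT). by rewrite !mulnA.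
have h := rtendsZ (J * ((t ^ 2 * s)%:R / Dt%:R)) (rtends_div s0 (@weighted_limit R f t D' m' n' e D'0 n'0 en Z HZ)).
apply: rtends_ext h => V; rewrite mulr_sumr.
have ws : (w`_\pi(t) = s)%N by rewrite ew partnM // part_pnat_id // (coprime_part t0 n'0 cn) muln1.
transitivity (\sum_(1 <= v < V.+1 | (s %| v)%N && coprime (v %/ s) t) (v%:R ^+ 2)^-1 * Bcount R D f t w m0 e v); last first.
 rewrite big_mkcond; apply: eq_big_nat => v /andP[v0 _]; case: ifP => // nc. case: (eqVneq (Bcount R D f t w m0 e v) 0) => [->|nz]; first by rewrite mulr0. have [h1 _ _] := Bq_ne0 D0 ot st w0 m00 v0 efrac nz.
 have sv : (s %| v)%N by rewrite -ws -h1 dvdn_part. case/negP: (negbT nc); rewrite sv /= coprime_sym. have -> : (v %/ s = v`_\pi(t)^')%N by rewrite -ws -h1 -{1}(partnC \pi(t) v0) mulKn.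
 by rewrite coprime_pi' ?part_pnat.
transitivity (\sum_(1 <= x < (V %/ s).+1 | coprime x t) ((s * x)%:R ^+ 2)^-1 * Bcount R D f t w m0 e (s * x)).
 rewrite big_nat_cond [RHS]big_nat_cond; apply: eq_bigr => x /andP[/andP[x0 _] cx]. rewrite (Bq_form R D0 ot w0 m00 ctf eD pDt cD' ps ew em cn sD x0 en cx) -/J.
 have nz y : (0 < y)%N -> (y%:R : R) != 0 by move=> h; rewrite pnatr_eq0 -lt0n. move: (gamq R f D' m' n' e x) => G; rewrite !natrM; field. by rewrite !nz.
symmetry; apply: (@sum_bij _ _ _ _ _ _ _ (fun v => v %/ s)%N (fun u => s * u)%N (fun v => (v%:R ^+ 2)^-1 * Bcount R D f t w m0 e v)); rewrite ?iota_uniq //.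
 move=> v; rewrite !mem_index_iota !ltnS => /andP[v1 vV] /andP[sv cv]; split => //; last by rewrite mulnC divnK. by rewrite divn_gt0 dvdn_leq //= leq_div2r.
move=> u; rewrite !mem_index_iota !ltnS => /andP[u1 uV] cu; rewrite dvdn_mulr // mulKn //; split => //.
by rewrite muln_gt0 s0 u1 mulnC -leq_divRL.
Qed.

(** The terms with e j not prime to 2 f vanish, so n' may be replaced by its part prime to 2 f. *)
Definition n2 := (n'`_(\pi(2 * f)^'))%N.
Lemma dvdn_n2 k : (k %| n2)%N = (k %| n')%N && coprime k (2 * f).
Proof.
have f20 : (0 < 2 * f)%N by rewrite muln_gt0.
apply/idP/andP => [h|[kn ck]].
 split; first by apply: dvdn_trans h _; exact: dvdn_part. apply: coprime_dvdl h _; rewrite coprime_sym. by rewrite coprime_pi' ?part_pnat // part_gt0.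
move: kn; rewrite -(partnC \pi(2 * f) n'0) Gauss_dvdr // coprime_sym.
exact: pi_coprime f20 (part_pnat _ _) ck.
Qed.

Lemma beta_total : \sum_(e <- divisors w | odd e && coprime e t) (mu e)%:~R / e%:R *
  (J * ((t ^ 2 * s)%:R / Dt%:R) * (Z * \sum_(j <- divisors (n' %/ e)) \sum_(v <- divisors D') (mu v)%:~R * gw R f t D' m' e j v)) =
 J * ((t ^ 2 * s)%:R / Dt%:R) * Z * Ssum R m' D' n2.
Proof.
have n20 : (0 < n2)%N := part_gt0 _ _.
have cD2 v : (v %| D')%N -> coprime v (2 * f) && coprime v t.
 move=> vD; rewrite coprimeMr coprimen2 (dvdn_odd vD oD') /= (coprime_dvdl vD cD') andbT. by apply: coprime_dvdl vD _; apply: coprime_dvdl cDf; rewrite eD dvdn_mull.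
have gwE e j v : (0 < e)%N -> (0 < j)%N -> (e * j %| n')%N -> (v %| D')%N -> (mu e)%:~R / e%:R * ((mu v)%:~R * gw R f t D' m' e j v) = if coprime (e * j) (2 * f) then sterm R m' D' e j v else 0.
 move=> e0 j0 ejn vD; have /andP[c1 c2] := cD2 v vD; have v0 := dvdn_gt0 D'0 vD. have cjt : coprime j t by apply: coprime_dvdl cn; apply: dvdn_trans ejn; rewrite dvdn_mull.
 rewrite /gw mulnA coprimeMl c1 andbT [coprime (j * v) t]coprimeMl cjt c2 !andbT. case: ifP => _; last by rewrite !mulr0. have nz y : (0 < y)%N -> (y%:R : R) != 0 by move=> h; rewrite pnatr_eq0 -lt0n.
 rewrite /sterm !natrM; move: (phq _ _ _ _ _ _) => p; field. by rewrite !nz.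
transitivity (J * ((t ^ 2 * s)%:R / Dt%:R) * Z * \sum_(e <- divisors n') \sum_(j <- divisors (n' %/ e)) \sum_(v <- divisors D') (if coprime (e * j) (2 * f) then sterm R m' D' e j v else 0)).
 rewrite mulr_sumr.
 transitivity (\sum_(e <- divisors n' | odd e) (mu e)%:~R / e%:R * (J * ((t ^ 2 * s)%:R / Dt%:R) * (Z * \sum_(j <- divisors (n' %/ e)) \sum_(v <- divisors D') (mu v)%:~R * gw R f t D' m' e j v))).
  rewrite -big_filter -[RHS]big_filter; apply: perm_big; apply: uniq_perm; rewrite ?filter_uniq ?divisors_uniq // => e. rewrite !mem_filter -!dvdn_divisors; case: odd => //=.
  apply/andP/idP => [[cet efrac]|en]; first exact: coprime_dvd_n'. by rewrite (coprime_dvdl en cn) ew dvdn_mull.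
 rewrite big_mkcond; apply: eq_big_seq => e; rewrite -dvdn_divisors // => en; have e0 := dvdn_gt0 n'0 en. have ne0 : (0 < n' %/ e)%N by rewrite divn_gt0 dvdn_leq.
 have ejn j : (j %| n' %/ e)%N -> (e * j %| n')%N by move=> jn; rewrite -(divnK en) mulnC dvdn_mul. case: (boolP (odd e)) => oe; last first.
  rewrite big1_seq ?mulr0 // => j; rewrite big1_seq // => v _. by rewrite coprimeMl coprimeMr coprimen2 (negbTE oe).
 transitivity (J * ((t ^ 2 * s)%:R / Dt%:R) * Z * ((mu e)%:~R / e%:R * \sum_(j <- divisors (n' %/ e)) \sum_(v <- divisors D') (mu v)%:~R * gw R f t D' m' e j v)).
  by ring.
 rewrite -!mulrA; do !congr (_ * _). rewrite mulrA mulr_sumr; apply: eq_big_seq => j; rewrite -dvdn_divisors // => jn; have j0 := dvdn_gt0 ne0 jn.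
 rewrite mulr_sumr; apply: eq_big_seq => v; rewrite -dvdn_divisors // => vD. by rewrite gwE // ejn.
congr (_ * _); rewrite /Ssum.
transitivity (\sum_(e <- divisors n' | coprime e (2 * f)) \sum_(j <- divisors (n' %/ e) | coprime j (2 * f)) \sum_(v <- divisors D') sterm R m' D' e j v).
 rewrite [RHS]big_mkcond; apply: eq_bigr => e _; rewrite [X in if _ then X else _]big_mkcond. case: ifP => ce; last by rewrite big1 // => j; rewrite big1 // => v; rewrite coprimeMl ce.
 by apply: eq_bigr => j; rewrite coprimeMl ce; case: ifP => //; rewrite big1.
rewrite -big_filter (perm_big (divisors n2)) /=; last first.
 apply: uniq_perm; rewrite ?filter_uniq ?divisors_uniq // => e. by rewrite mem_filter -!dvdn_divisors // dvdn_n2 andbC.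
apply: eq_big_seq => e; rewrite -dvdn_divisors // => en2; have e0 := dvdn_gt0 n20 en2.
have := en2; rewrite dvdn_n2 => /andP[en ce].
have ne0 : (0 < n' %/ e)%N by rewrite divn_gt0 dvdn_leq.
have n2e0 : (0 < n2 %/ e)%N by rewrite divn_gt0 dvdn_leq.
rewrite -big_filter (perm_big (divisors (n2 %/ e))) //=.
apply: uniq_perm; rewrite ?filter_uniq ?divisors_uniq // => j.
rewrite mem_filter -!dvdn_divisors // !dvdn_divRL // dvdn_n2 coprimeMl ce andbT andbC //.
Qed.
End Beta.

(** * The value of the constant *)

Section MainConstant.
Variable R : realType.

(** The origin of the condition (m', D1) = (n', D1): in [Ssum_prime], if the exponents of p in m and
    n, cut at dl / 2, differ, the two terms vanish when the one of m is smaller and cancel when it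
    is larger. *)
Lemma Ssum_local p dl a b : prime p -> (0 < dl)%N -> forall m n, (0 < m)%N -> logn p m = a -> logn p n = b -> Ssum R m (p ^ dl) (p ^ logn p n) =
 (p%:R ^+ dl)^-1 * (if minn a dl./2 == minn b dl./2 then p%:R ^+ minn a dl./2 * (if (a < dl./2)%N then 1 else 1 - p%:R^-1) else 0).
Proof.
move=> pp d0 m n m0 ea eb; rewrite Ssum_prime // eb !pfactor_dvdn // ea; congr (_ * _).
have pr : p%:R != 0 :> R by rewrite pnatr_eq0 -lt0n prime_gt0.
move: dl./2 => d; case: leqP => da; case: (leqP d b) => db.
- by rewrite (minn_idPr (leqW db)) da eqxx mulrBr mulr1 mulrC.
- rewrite (minn_idPl db) (ltnW (leq_trans db da)) (leq_trans db da) ifF; last by apply/eqP => h; rewrite h ltnn in db. by rewrite exprS mulKf // subrr.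
- rewrite (minn_idPr (leqW db)) leqNgt da mulr0 subr0 ifF //; apply/eqP => h; by rewrite h ltnn in da.
rewrite (minn_idPl db); case: ltngtP => ab; rewrite ?mulr0 ?subr0 ?mulr1 //.
 by rewrite exprS mulKf // subrr.
by rewrite ab.
Qed.

Lemma Ssum_eq m D n D1 : (0 < m)%N -> (0 < D)%N -> (0 < n)%N -> (0 < D1)%N -> (D1 %| D)%N ->
 (forall p, p \in primes D -> logn p D1 = (logn p D)./2 /\ minn (logn p m) (logn p D1) = minn (logn p n) (logn p D1)) ->
 Ssum R m D n = D%:R^-1 * (gcdn m D1)%:R * \prod_(p <- primes D) (if (p %| D1 %/ gcdn m D1)%N then 1 else 1 - p%:R^-1).
Proof.
move=> m0 D0 n0 D10 dD H; have g0 : (0 < gcdn m D1)%N by rewrite gcdn_gt0 m0.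
have q0 : (0 < D1 %/ gcdn m D1)%N by rewrite divn_gt0 dvdn_leq // dvdn_gcdr.
have prodE k : (0 < k)%N -> (k %| D)%N -> k%:R = \prod_(p <- primes D) (p%:R ^+ logn p k) :> R.
 move=> k0 kD; rewrite {1}(prod_prime_decomp k0) prime_decompE big_map natr_prod /=. under eq_bigr do rewrite natrX. rewrite [RHS](bigID [pred p | p %| k]%N predT) /= [X in _ * X]big1 ?mulr1; last first.
  by move=> p np; rewrite lognE (negbTE np) andbF andbF.
 rewrite -[RHS]big_filter; apply: perm_big; apply: uniq_perm; rewrite ?filter_uniq ?primes_uniq // => p. rewrite mem_filter !mem_primes k0 D0; case: (boolP (p %| k)%N) => pk; rewrite ?andbF //=.
 by rewrite (dvdn_trans pk kD).
rewrite Ssum_prod // prodE // prodE //; last exact: dvdn_trans (dvdn_gcdr _ _) dD.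
rewrite -prodfV -!big_split /=; apply: eq_big_seq => p pD; have [e1 e2] := H p pD.
have /and3P[pp _ pdD] : [&& prime p, (0 < D)%N & (p %| D)%N] by rewrite -mem_primes.
have d0 : (0 < logn p D)%N by rewrite logn_gt0.
rewrite (Ssum_local pp d0 m0 erefl erefl) -e1 e2 eqxx -e2 -mulrA logn_gcd //; congr (_ * (_ * _)).
by rewrite -(expn1 p) pfactor_dvdn // logn_div ?dvdn_gcdr // logn_gcd // subn_gt0 gtn_min ltnn orbF.
Qed.

Lemma Ssum_eq0 (m D n p : nat) : (0 < m)%N -> (0 < D)%N -> (0 < n)%N -> p \in primes D -> minn (logn p m) (logn p D)./2 <> minn (logn p n) (logn p D)./2 -> Ssum R m D n = 0.
Proof.
move=> m0 D0 n0 pD ne; rewrite Ssum_prod // (big_rem p) //=.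
have /and3P[pp _ pdD] : [&& prime p, (0 < D)%N & (p %| D)%N] by rewrite -mem_primes.
have d0 : (0 < logn p D)%N by rewrite logn_gt0.
rewrite (Ssum_local pp d0 m0 erefl erefl); case: eqP => //; by rewrite mulr0 mul0r.
Qed.

(** The primes of D f are those of f, of t and of D'. On each of the three sets the factors combine
    through 1 - p^-2 = (1 - p^-1) (1 + p^-1). *)
Lemma constant_match D f t s m' n' n2 Dt D' D1 : (0 < f)%N -> odd f -> (0 < t)%N -> (0 < m')%N -> (0 < D1)%N ->
 (0 < Dt)%N -> (0 < D')%N -> D = (Dt * D')%N -> coprime D f -> coprime D' t -> \pi(t).-nat Dt -> (t %| Dt)%N -> (D1 %| D')%N ->
 Ssum R m' D' n2 = D'%:R^-1 * (gcdn m' D1)%:R * \prod_(p <- primes D') (if (p %| D1 %/ gcdn m' D1)%N then 1 else 1 - p%:R^-1) ->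
 2 * f%:R * Kq R f t / t%:R ^+ 2 * ((jacobi (f * m' * n')%N t)%:~R * ((t ^ 2 * s)%:R / Dt%:R) *
  (pi ^+ 2 / 8 * \prod_(p <- primes (f * t * D')) (1 - (p%:R ^+ 2)^-1))^-1 * Ssum R m' D' n2) = main_term_const R D f t s m' n' D1.
Proof.
move=> f0 fodd t0 m'0 D10 Dt0 D'0 eD cDf cD't pDt tDt dD1 ->.
have g0 : (0 < gcdn m' D1)%N by rewrite gcdn_gt0 m'0.
have q0 : (0 < D1 %/ gcdn m' D1)%N by rewrite divn_gt0 dvdn_leq // dvdn_gcdr.
have cDtf : coprime Dt f by apply: coprime_dvdl cDf; rewrite eD dvdn_mulr.
have cD'f : coprime D' f by apply: coprime_dvdl cDf; rewrite eD dvdn_mull.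
have ctf : coprime t f := coprime_dvdl tDt cDtf.
have cDtD' : coprime Dt D' by exact: pi_coprime t0 pDt cD't.
have pt : primes Dt = primes t.
 apply: (irr_sorted_eq ltn_trans ltnn (sorted_primes _) (sorted_primes _)) => p. apply/idP/idP => [|pt]; last first.
  by move: pt; rewrite !mem_primes Dt0 => /and3P[-> _ pt]; rewrite (dvdn_trans pt tDt).
 by rewrite mem_primes => /and3P[pp _ pd]; move/pnatP: pDt => /(_ Dt0 p pp pd).
have P1 : perm_eq (primes (f * t * D')) (primes f ++ primes t ++ primes D').
 apply: perm_trans (primes_perm _ _ _) _; rewrite ?muln_gt0 ?f0 //.
  by rewrite coprimeMl coprime_sym cD'f coprime_sym.
 by rewrite catA perm_cat2r; apply: primes_perm; rewrite // coprime_sym.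
have P2 : perm_eq (primes (D * f)) (primes f ++ primes t ++ primes D').
 apply: perm_trans (primes_perm _ _ _) _; rewrite ?eD ?muln_gt0 ?Dt0 -?eD //. rewrite eD perm_catC perm_cat2l -pt; exact: primes_perm.
have P3 : perm_eq (primes (D1 %/ gcdn m' D1)) [seq p <- primes D' | (p %| D1 %/ gcdn m' D1)%N].
 apply: uniq_perm; rewrite ?filter_uniq ?primes_uniq // => p; rewrite mem_filter !mem_primes q0 D'0 /=. case: (boolP (p %| _)%N) => pd; rewrite ?andbF // !andbT; case: prime => //=.
 apply/esym; apply: dvdn_trans dD1; apply: dvdn_trans pd _; apply/dvdnP; exists (gcdn m' D1). by rewrite mulnC divnK // dvdn_gcdr.
have P4 : perm_eq (primes (8 * (f * f))) (2%N :: primes f).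
 apply: uniq_perm; rewrite /= ?primes_uniq ?mem_primes ?dvdn2 ?fodd ?andbF // => p. rewrite inE primesM ?muln_gt0 ?f0 // primesM // orbb; congr (_ || _). by have -> : primes 8 = [:: 2%N] by []; rewrite inE.
rewrite /main_term_const (perm_big _ P1) (perm_big _ P2) (perm_big _ P3) !big_cat /=.
(* P = 8 f^2, so the mean of Psi has a factor 1 / 2 at the prime 2, which cancels the 2 from the
   pair of densities. *)
have KE : 2 * f%:R * Kq R f t = \prod_(p <- primes f) (1 - p%:R^-1) * Num.sqrt t%:R.
 rewrite /Kq /per8 totient_ratio ?muln_gt0 ?f0 // (perm_big _ P4) /= big_cons natrM natrM. move: (Num.sqrt _) (\prod_(i <- _) _) => u v. have f'0 : f%:R != 0 :> R by rewrite pnatr_eq0 -lt0n. by field.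
have ne p : p \in primes f ++ primes t ++ primes D' -> [/\ (p%:R : R) != 0, 1 - (p%:R : R)^-1 != 0 & 1 + (p%:R : R)^-1 != 0].
 move=> pin; have p2 : (1 < p)%N.
  by apply: prime_gt1; move: pin; rewrite !mem_cat !mem_primes => /or3P[] /and3P[].
 have p0 : 0 < (p%:R : R) by rewrite ltr0n (ltn_trans _ p2). split; first by rewrite gt_eqF.
  by rewrite gt_eqF // subr_gt0 invf_lt1 // ltr1n.
 by rewrite gt_eqF // ltr_wpDr ?invr_ge0.
have loc p : p \in primes f ++ primes t ++ primes D' -> 1 - ((p%:R : R) ^+ 2)^-1 = (1 - p%:R^-1) * (1 + p%:R^-1).
 by move=> /ne[a b c]; field.
have F1 : \prod_(p <- primes f) (1 - p%:R^-1) * (\prod_(p <- primes f) (1 - (p%:R ^+ 2)^-1))^-1 = \prod_(p <- primes f) (1 + p%:R^-1)^-1 :> R.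
 rewrite -prodfV -big_split /=; apply: eq_big_seq => p pin. have pin' : p \in primes f ++ primes t ++ primes D' by rewrite mem_cat pin. by have [_ b c] := ne p pin'; rewrite loc // invfM mulrA mulfV // mul1r.
have F2 : (\prod_(p <- primes t) (1 - (p%:R ^+ 2)^-1))^-1 = \prod_(p <- primes t) (1 + p%:R^-1)^-1 * \prod_(p <- primes t) (1 - p%:R^-1)^-1 :> R.
 rewrite -prodfV -big_split /=; apply: eq_big_seq => p pin. have pin' : p \in primes f ++ primes t ++ primes D' by rewrite !mem_cat pin orbT. by rewrite loc // invfM mulrC.
have F3 : \prod_(p <- primes D') (if (p %| D1 %/ gcdn m' D1)%N then 1 else 1 - p%:R^-1) * (\prod_(p <- primes D') (1 - (p%:R ^+ 2)^-1))^-1 =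
  \prod_(p <- primes D') (1 + p%:R^-1)^-1 * \prod_(p <- [seq p <- primes D' | (p %| D1 %/ gcdn m' D1)%N]) (1 - p%:R^-1)^-1 :> R.
 rewrite -prodfV big_filter [X in _ = _ * X]big_mkcond -!big_split /=; apply: eq_big_seq => p pin. have pin' : p \in primes f ++ primes t ++ primes D' by rewrite !mem_cat pin !orbT.
 rewrite loc // invfM; have [_ b c] := ne p pin'; case: ifP => _; rewrite ?mul1r ?mulr1; first by rewrite mulrC. by rewrite mulrA mulfV // mul1r.
have e1 : (t ^ 2 * s)%:R = t%:R ^+ 2 * s%:R :> R by rewrite -natrX -natrM.
have e2 : D%:R = Dt%:R * D'%:R :> R by rewrite eD -natrM.
rewrite KE e1 e2.
have h0 x : (0 < x)%N -> (x%:R : R) != 0 by move=> ?; rewrite pnatr_eq0 -lt0n.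
have := h0 _ t0; have := h0 _ Dt0; have := h0 _ D'0.
have pi0 : (pi : R) != 0 by rewrite gt_eqF // pi_gt0.
have alg (A B A' Bt T1 T2 E BD U V T dt d' P S g j q : R) : A / B = A' -> Bt^-1 = T1 * T2 -> E / BD = U * V -> d' != 0 -> dt != 0 -> T != 0 -> P != 0 ->
  A * q / T ^+ 2 * (j * (T ^+ 2 * S / dt) / (P ^+ 2 / 8 * (B * (Bt * BD))) * (d'^-1 * g * E)) = 8 / P ^+ 2 * (S * q / (dt * d')) * j * g * (A' * (T1 * U)) * T2 * V.
 move=> h1 h2 h3 n1 n2' n3 n4. have -> : 8 / P ^+ 2 * (S * q / (dt * d')) * j * g * (A' * (T1 * U)) * T2 * V = 8 / P ^+ 2 * (S * q / (dt * d')) * j * g * (A' * (T1 * T2) * (U * V)) by ring.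
 rewrite -h1 -h2 -h3 !invfM; move: (B^-1) (Bt^-1) (BD^-1) => b bt bd; field. by rewrite n1 n2' n4.
by move=> h1 h2 h3; exact: alg.
Qed.
End MainConstant.

(** * Uniqueness of the parameters, and the theorem *)

Lemma sqfM a b : coprime a b -> squarefree a -> squarefree b -> squarefree (a * b).
Proof.
move=> cab sa sb d; case: (eqVneq d 1%N) => // d1 dd.
case: (posnP d) => [d0|d0].
 by move: dd; rewrite d0 dvd0n muln_eq0 => /orP[] /eqP e0; [have := sa 0 | have := sb 0%N]; rewrite e0 => /(_ isT).
have d2 : (1 < d)%N by case: (d) d1 d0 => [|[|]].
have pp := pdiv_prime d2; set p := pdiv d in pp.
have pd : (p ^ 2 %| a * b)%N by apply: dvdn_trans dd; rewrite dvdn_exp2r // pdiv_dvd.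
have ap : (p %| a)%N || (p %| b)%N by rewrite -Euclid_dvdM // (dvdn_trans _ pd) // dvdn_exp.
have p1 : p <> 1%N by move=> e1; rewrite e1 in pp.
case: (boolP (p %| a)%N) ap => [pa _|pa pb].
 have cpb : coprime (p ^ 2) b by rewrite coprime_pexpl //; apply: coprime_dvdl pa _. by rewrite Gauss_dvdl // in pd; case: p1; exact: sa.
have cpa : coprime (p ^ 2) a by rewrite coprime_pexpl // prime_coprime.
by rewrite Gauss_dvdr // in pd; case: p1; exact: sb.
Qed.

(** The parities of the exponents determine the square-free factor. *)
Lemma square_class_unique l l' w w' : (0 < l)%N -> (0 < l')%N -> (0 < w)%N -> (0 < w')%N -> squarefree l -> squarefree l' -> (l * w ^ 2 = l' * w' ^ 2)%N -> l = l' /\ w = w'.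
Proof.
move=> l0 l0' w0 w0' sl sl' e.
have ll : l = l'.
 apply: (eqn_from_log l0 l0') => p; case: (boolP (prime p)) => pp; last by rewrite lognE (negbTE pp) /= lognE (negbTE pp).
 have h k v : (0 < k)%N -> (0 < v)%N -> squarefree k -> logn p k = odd (logn p (k * v ^ 2)).
  move=> k0 v0 sk; rewrite lognM ?expn_gt0 ?v0 // lognX oddD oddM addbF. by have := sqf_logn k0 pp sk; case: logn => [|[|]].
 by rewrite (h _ _ l0 w0 sl) e -h.
split; move: e; rewrite -ll => /eqP; by rewrite eqn_pmul2l // eqn_exp2r // => /eqP.
Qed.

Section Final.
Variable R : realType.

Lemma modn_odd4 g : (g %% 4 == 1)%N -> odd g.
Proof. by move=> /eqP h; rewrite (divn_eq g 4) h oddD oddM andbF. Qed.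
Lemma odd_jacobi_m1 g : odd g -> jacobi (-1) g = 1 -> (g %% 4 == 1)%N.
Proof. by move=> og; rewrite (jacobi_m1 R og); case: ifP. Qed.
Lemma jacobi_m1_mod4 g : (g %% 4 == 1)%N -> jacobi (-1) g = 1.
Proof. by move=> g4; rewrite (jacobi_m1 R (modn_odd4 g4)) g4. Qed.

Lemma asym_bound s (F : R -> R[i]) (C : R) : asym s F C%:C -> exists K : R, forall X : R, 1 <= X -> `|F X - (C * X)%:C| <= (K * X `^ s)%:C.
Proof.
move=> [K h]; exists K => X X1; apply: normc_le_bound; rewrite mulrC rmorphM; exact: h.
Qed.

(** For D = 1 the condition s^2 t^3 | 1 forces t = 1, and the symbol, the only factor of variable
    sign, is 1. *)
Lemma main_term_const_ge0 f m n t s m' n' D0 D1 : main_term_form 1 f m n t s m' n' D0 D1 -> 0 <= main_term_const R 1 f t s m' n' D1.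
Proof.
case=> _ [[_ _ _ d1] _ _].
have t1 : t = 1%N.
 apply/eqP; rewrite -dvdn1 (dvdn_trans _ d1) // (dvdn_trans _ (dvdn_mull _ (dvdnn _))) // dvdn_exp //.
have jE a : jacobi a t = 1 by rewrite t1 /jacobi big_nil.
have q k : (0 : R) <= \prod_(p <- primes k) (1 - p%:R^-1)^-1.
 rewrite big_seq; apply: prodr_ge0 => p; rewrite mem_primes => /andP[pp _]. by rewrite invr_ge0 subr_ge0 invf_le1 ?ler1n ?ltr0n ?prime_gt0.
have q' k : (0 : R) <= \prod_(p <- primes k) (1 + p%:R^-1)^-1.
 by apply: prodr_ge0 => p; rewrite invr_ge0 addr_ge0 ?invr_ge0.
rewrite /main_term_const jE mulr1; do !(apply: mulr_ge0 => //).
- by rewrite invr_ge0 exprn_ge0 // pi_ge0.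
- exact: sqrtr_ge0.
- by rewrite invr1.
Qed.

Section Form.
Variables (D f : nat).
Hypotheses (D0 : (0 < D)%N) (f0 : (0 < f)%N) (sf : squarefree f) (cDf : coprime D f).

Lemma form_params m n t s m' n' D0' D1 : main_term_form D f m n t s m' n' D0' D1 -> squarefree (t * f) /\ (0 < t)%N.
Proof.
case=> [[[t0 _] _ _ _] [[st _ _ d1] _ _]]; split=> //; apply: sqfM => //.
by apply: coprime_dvdl cDf; apply: dvdn_trans d1; rewrite dvdn_mull // dvdn_exp.
Qed.

Lemma form_unique l w m0 t s m' n' D0' D1 : (0 < l)%N -> squarefree l -> (0 < w)%N -> (0 < m0)%N ->
 main_term_form D f (l * m0 ^ 2)%N (l * w ^ 2)%N t s m' n' D0' D1 -> [/\ l = (t * f)%N, w = (s * n')%N & m0 = (s * m')%N].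
Proof.
move=> l0 sl w0 m00 Hf; have [stf t0] := form_params Hf; have tf0 : (0 < t * f)%N by rewrite muln_gt0 t0.
case: Hf => [[[_ s0] [m'0 n'0] [em] [en]] _].
rewrite -mulnA -expnMn in em; rewrite -mulnA -expnMn in en.
have sn0 : (0 < s * n')%N by rewrite muln_gt0 s0.
have sm0 : (0 < s * m')%N by rewrite muln_gt0 s0.
have [e1 e2] := square_class_unique l0 tf0 w0 sn0 sl stf en.
by have [_ e3] := square_class_unique l0 tf0 m00 sm0 sl stf em.
Qed.
End Form.

Section Special.
Variables (D f : nat) (chi : int -> R[i]).
Hypotheses (D0 : (0 < D)%N) (Dodd : odd D) (f0 : (0 < f)%N) (fodd : odd f) (cDf : coprime D f) (cprim : primitive_character f chi) (ceven : even_character chi) (cq : chi =1 quad_char R f).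
Variables (t w m0 : nat).
Hypotheses (ot : odd t) (t4 : (t %% 4 == 1)%N) (stf : squarefree (t * f)) (w0 : (0 < w)%N) (m00 : (0 < m0)%N).
Let t0 := odd_gt0 ot.
Let st : squarefree t. Proof. by move=> d dd; apply: stf; rewrite dvdn_mulr. Qed.
Let sf : squarefree f. Proof. by move=> d dd; apply: stf; rewrite dvdn_mull. Qed.
Let tf0 : (0 < t * f)%N. Proof. by rewrite muln_gt0 t0. Qed.
Local Notation M := (t * f * m0 ^ 2)%N%:Z.
Local Notation N := (t * f * w ^ 2)%N%:Z.
Let NE : N = 1 * (t * f)%N%:Z * w%:Z ^+ 2. Proof. by rewrite mul1r || (rewrite mul1r; congr (_ * _)). Qed.

Lemma special_form t1 s m' n' D0' D1 : main_term_form D f M N t1 s m' n' D0' D1 -> [/\ t1 = t, w = (s * n')%N, m0 = (s * m')%N, s = (w`_\pi(t))%N & s = (m0`_\pi(t))%N].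
Proof.
move=> Hf; have [e1 e2 e3] := form_unique f0 sf cDf tf0 stf w0 m00 Hf.
have e4 : t1 = t by apply/eqP; rewrite -(eqn_pmul2r f0) -e1.
case: Hf => [[[_ s0] [m'0 n'0] _ _] [[_ _ ps _] [cm cn] _]]; rewrite e4 in ps cm cn.
by split; rewrite // ?e2 ?e3 partnM // part_pnat_id // coprime_part // muln1.
Qed.

Lemma special_zero : ~ ((m0`_\pi(t) = w`_\pi(t))%N /\ ((w`_\pi(t)) ^ 2 * t ^ 3 %| D)%N) -> forall eps : R, 0 < eps -> asym (3 / 4 + eps) (salie_sum D chi M N) 0.
Proof.
move=> H eps e0; rewrite NE.
have := asym_special D0 Dodd f0 fodd cDf cprim ceven ot t4 stf w0 m00 cq (fun e _ ew _ => @beta_zero R D f t w m0 D0 ot st w0 m00 e H ew) e0.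
by rewrite big1 ?mulr0 // => e; rewrite mulr0.
Qed.

(** The exponent of p in the square-free factor is 0 or 1, the parity of the exponent in [Da]. *)
Lemma form_sqrt_log Da D0' D1 p : (0 < D0')%N -> (0 < D1)%N -> squarefree D0' -> Da = (D0' * D1 ^ 2)%N -> prime p -> logn p D1 = (logn p Da)./2.
Proof.
move=> h0 h1 sD -> pp; rewrite lognM ?expn_gt0 ?h1 // lognX mul2n.
by have := sqf_logn h0 pp sD; case: logn => [|[|]]; rewrite /= ?uphalf_double ?doubleK.
Qed.

(** C is defined from the parts of w, m0 and D at the primes of t, through [Ssum], so that it makes
    sense before any parameters of the required form are known to exist. *)
Lemma special_coefficient : exists C : R, [/\ forall eps : R, 0 < eps -> asym (3 / 4 + eps) (salie_sum D chi M N) C%:C,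
   forall t1 s m' n' D0' D1, main_term_form D f M N t1 s m' n' D0' D1 -> C = main_term_const R D f t1 s m' n' D1
  & ~ (exists t s m' n' D0' D1, main_term_form D f M N t s m' n' D0' D1) -> C = 0].
Proof.
case: (boolp.pselect ((m0`_\pi(t) = w`_\pi(t))%N /\ ((w`_\pi(t)) ^ 2 * t ^ 3 %| D)%N)) => [[Hs sD]|nH]; last first.
 exists 0; split => //; first exact: special_zero. move=> t1 s m' n' D0' D1 Hf; have [e1 e2 e3 e4 e5] := special_form Hf. case: nH; split; first by rewrite -e4.
 by case: Hf => _ [[_ _ _ d1] _ _]; rewrite -e4 -e1.
pose s := (w`_\pi(t))%N; pose n' := (w`_\pi(t)^')%N; pose m' := (m0`_\pi(t)^')%N.
pose Dt := (D`_\pi(t))%N; pose D' := (D`_\pi(t)^')%N.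
have cpi k : coprime (k`_\pi(t)^') t by rewrite coprime_sym coprime_pi' ?part_pnat.
have eD : D = (Dt * D')%N by rewrite partnC.
have ew : w = (s * n')%N by rewrite partnC.
have em : m0 = (s * m')%N by rewrite /s -Hs partnC.
have ps : \pi(t).-nat s := part_pnat _ _.
have pDt : \pi(t).-nat Dt := part_pnat _ _.
have s0 : (0 < s)%N := part_gt0 _ _; have n'0 : (0 < n')%N := part_gt0 _ _.
have m'0 : (0 < m')%N := part_gt0 _ _; have Dt0 : (0 < Dt)%N := part_gt0 _ _.
have D'0 : (0 < D')%N := part_gt0 _ _.
have tD : (t ^ 3 %| D)%N by apply: dvdn_trans sD; rewrite dvdn_mull.
have ctf : coprime t f by apply: coprime_dvdl cDf; apply: dvdn_trans tD; rewrite dvdn_exp.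
have tDt : (t %| Dt)%N.
 rewrite -(part_pnat_id (pnat_pi t0)) partn_dvd //; by apply: dvdn_trans tD; rewrite dvdn_exp.
pose C : R := 2 * f%:R * Kq R f t / t%:R ^+ 2 * ((jacobi (f * m' * n')%N t)%:~R * ((t ^ 2 * s)%:R / Dt%:R) * (pi ^+ 2 / 8 * \prod_(p <- primes (f * t * D')) (1 - (p%:R ^+ 2)^-1))^-1 * Ssum R m' D' (n2 f n')).
have n20 : (0 < n2 f n')%N := part_gt0 _ _.
have n2l p : p \in primes D' -> logn p (n2 f n') = logn p n'.
 rewrite mem_primes => /and3P[pp _ pD]; rewrite logn_pi_part //. have pD2 : (p %| D)%N by rewrite eD dvdn_mull. rewrite ifT // inE mem_primes muln_gt0 f0 Euclid_dvdM // pp negb_or.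
 have op := dvdn_odd pD2 Dodd; rewrite dvdn_prime2 //; apply/andP; split.
  by apply/eqP => p2; rewrite p2 in op.
 by rewrite -prime_coprime //; apply: coprime_dvdl cDf.
exists C; split.
- move=> eps e0; rewrite NE. have := asym_special D0 Dodd f0 fodd cDf cprim ceven ot t4 stf w0 m00 cq
  (fun e _ efrac ce => @beta_form R D f t w m0 D0 Dodd f0 fodd ot st w0 m00 ctf Dt D' s m' n' eD pDt (cpi D) ps ew em (cpi w) sD e efrac ce) e0.
 by rewrite (beta_total R D0 Dodd f0 ot w0 cDf m' eD (cpi D) ps ew (cpi w)).
- move=> t1 s1 m1 n1 D0' D1 Hf; have [e1 e2 e3 e4 e5] := special_form Hf. case: Hf => [[_ [m10 n10] _ _] [_ _ [eDD sD0 gg]]]. have e4' : s1 = s by [].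
 have en1 : n1 = n' by apply/eqP; rewrite -(eqn_pmul2l s0) -ew e2 e4'. have em1 : m1 = m' by apply/eqP; rewrite -(eqn_pmul2l s0) -em e3 e4'. rewrite e1 en1 em1 e4'; rewrite e1 in eDD; rewrite en1 em1 in gg.
 have eD' : D' = (D0' * D1 ^ 2)%N by apply/eqP; rewrite -(eqn_pmul2l Dt0) -eD mulnA; apply/eqP. have D0'0 : (0 < D0')%N by move: D'0; rewrite eD' muln_gt0 => /andP[].
 have D10 : (0 < D1)%N by move: D'0; rewrite eD' muln_gt0 expn_gt0 orbF => /andP[]. have dD1 : (D1 %| D')%N by rewrite eD' dvdn_mull // dvdn_exp.
 have cm := @constant_match R D f t s m' n' (n2 f n') Dt D' D1 f0 fodd t0 m'0 D10 Dt0 D'0 eD cDf (cpi D) pDt tDt dD1. rewrite /C cm //.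
 apply: Ssum_eq => // p pD; have pp : prime p by move: pD; rewrite mem_primes => /andP[]. split; first exact: form_sqrt_log eD' pp. by rewrite n2l // -!logn_gcd // gg.
move=> nf; apply: boolp.contrapT => C0.
have S0 : Ssum R m' D' (n2 f n') != 0 by apply/eqP => S0; case: C0; rewrite /C S0 !mulr0.
(* If C <> 0, this decomposition supplies D1 = a and D0 = l, and the nonvanishing of each local
   factor gives the equality of the gcds. *)
have [a [l [a0 l0 eal sl]]] := sq_decomp D'0.
have eD' : D' = (l * a ^ 2)%N by rewrite mulnC.
case: nf; exists t, s, m', n', l, a; split; split => //.
- by rewrite em expnMn mulnA.
- by rewrite ew expnMn mulnA.
- by split => //; rewrite (eqP t4).
- split; exact: cpi.
split => //; first by rewrite -mulnA -eD'.
apply: eqn_from_log; rewrite ?gcdn_gt0 ?m'0 ?n'0 // => p; rewrite !logn_gcd //.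
case: (boolP (p \in primes D')) => pD; last first.
 suff -> : logn p a = 0%N by []. move: pD; rewrite mem_primes D'0 lognE a0 /= => pD; case: ifP => // /andP[pp pa]. by case/negP: pD; rewrite pp eD' dvdn_mull // dvdn_mulr.
have pp : prime p by move: pD; rewrite mem_primes => /andP[].
apply: boolp.contrapT => ne; case/eqP: S0; apply: (Ssum_eq0 R m'0 D'0 n20 pD).
by rewrite -(form_sqrt_log l0 a0 sl eD' pp) n2l.
Qed.
End Special.
End Final.

Theorem theorem1p1 (R : realType) (D f : nat) (chi : int -> R[i]) (m n : int)
    (D_odd : odd D) (f_odd : odd f) (coDf : coprime D f)
    (chi_prim : primitive_character f chi) (chi_even : even_character chi)
    (m_neq0 : m != 0) (n_neq0 : n != 0) :
  (~ (chi =1 quad_char R f) \/ m < 0 \/ n < 0 ->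
    forall eps : R, 0 < eps ->
    exists K : R, forall X : R, 1 <= X ->
      `|salie_sum D chi m n X| <= (K * X `^ (3 / 4 + eps))%:C)
  /\
  (chi =1 quad_char R f -> 0 < m -> 0 < n ->
    exists C : R,
      [/\ forall eps : R, 0 < eps ->
            exists K : R, forall X : R, 1 <= X ->
              `|salie_sum D chi m n X - (C * X)%:C|
                <= (K * X `^ (3 / 4 + eps))%:C,
          forall t s m' n' D0 D1 : nat,
            main_term_form D f m n t s m' n' D0 D1 ->
            C = main_term_const R D f t s m' n' D1,
          ~ (exists t s m' n' D0 D1 : nat,
               main_term_form D f m n t s m' n' D0 D1) -> C = 0
        & D = 1%N -> 0 <= C]).
Proof.
have D0 : (0 < D)%N by case: (D) D_odd.
have f0 : (0 < f)%N by case: (f) f_odd.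
have an0 : (0 < `|n|)%N by rewrite absz_gt0.
have [w [l [w0 l0 en sl]]] := sq_decomp an0.
have nE : n = sgz n * l * w%:Z ^+ 2 by rewrite {1}[n]intEsg en -mulrA -[w%:Z ^+ 2]/(w%:Z * w) mulnC.
have s1 : `|sgz n|%N = 1%N by case: sgzP n_neq0.
split.
 move=> H eps e0; rewrite nE. have := asym_bound (F := salie_sum D chi m (sgz n * l * w%:Z ^+ 2)) (C := 0) (s := 3 / 4 + eps). case.
  (* A main term would need s = 1, so n > 0, and l m a positive square, so m > 0. *)
  rewrite rmorph0; apply: (asym_zero D0 f0 f_odd chi_prim chi_even l0 sl w0 s1 m_neq0 _ e0) => g m0 og m00 e [s1' _ _ _ cq]. have n0 : 0 < n by rewrite -sgz_gt0 s1'.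
  case: H => [//|[mn|nn]]; last by rewrite ltNge ltW in nn. have : 0 < sgz n * l * m by rewrite e ltz_nat expn_gt0 muln_gt0 l0 m00. by rewrite s1' mul1r pmulr_rgt0 // ltNge ltW.
 by move=> K hK; exists K => X X1; have := hK X X1; rewrite mul0r subr0.
move=> cq m0 n0.
have s1' : sgz n = 1 by rewrite gtr0_sgz.
have [sf f4 _] := quad_char_jacobi f0 f_odd chi_prim chi_even cq.
have nl : n = (l * w ^ 2)%N by rewrite nE s1' mul1r.
(* A main term needs m and n to have the same square-free part l = g f with g = 1 modulo 4; this g
   is the parameter t. *)
case: (boolp.pselect (exists g m1 : nat, [/\ odd g, (0 < m1)%N, m = (l * m1 ^ 2)%N, jacobi (-1) g = 1 & l = (g * f)%N])).
 move=> [g [m1 [og m10 em j1 el]]]; rewrite el in em nl sl; rewrite em nl. have [C [h1 h2 h3]] := special_coefficient D0 D_odd f0 f_odd coDf chi_prim chi_even cq og (odd_jacobi_m1 R og j1) sl w0 m10.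
 exists C; split => //; first by move=> eps e0; apply: asym_bound; exact: h1.
 move=> D1; case: (boolp.pselect (exists t s m' n' D0 D1 : nat, main_term_form D f (g * f * m1 ^ 2)%N (g * f * w ^ 2)%N t s m' n' D0 D1)) => [|/h3 -> //].
 by move=> [t [s [m' [n' [D0' [D1' Hf]]]]]]; rewrite (h2 _ _ _ _ _ _ Hf); move: Hf; rewrite D1; exact: main_term_const_ge0.
move=> nS; exists 0; split => //.
 move=> eps e0; apply: asym_bound; rewrite nE s1'. rewrite rmorph0; apply: (asym_zero D0 f0) => // g m1 og m10 e [_ j1 el _ _]; case: nS; exists g, m1; split => //. have lz : l%:Z != 0 by rewrite -lt0n.
 by apply: (mulfI lz); rewrite -[l%:Z * m]mul1r mulrA e -PoszM expnMn mulnA.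
move=> t s m' n' D0' D1 Hf; exfalso.
have [stf t0] := form_params sf coDf Hf.
case: (Hf) => [[[_ s0] [m'0 n'0] em en'] [[st t4 ps _] _ _]].
have [e1 e2] : l = (t * f)%N /\ w = (s * n')%N.
 apply: square_class_unique; rewrite ?muln_gt0 ?t0 ?s0 //. by move: en'; rewrite nl => -[->]; rewrite expnMn mulnA.
have t4' : (t %% 4 == 1)%N by rewrite t4.
case: nS; exists t, (s * m')%N; split; rewrite ?muln_gt0 ?s0 //.
- exact: modn_odd4.
- by rewrite e1 expnMn mulnA.
- exact: jacobi_m1_mod4.
Qed.
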